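(* Let $S=\{x_1,x_2,y_1,y_2\}$ and let $r:S\times S\to[0,\infty)$ be the transition rates of an irreducible continuous-time random walk on $S$ with $r(x,x)=0$, reversible with respect to a probability measure $m$ on $S$ (i.e. $m(x)r(x,y)=m(y)r(y,x)$ for all $x,y$). Assume $r(y_p,x_i)>r(x_i,y_p)>0$ for all $1\le i,p\le 2$, $r(x_1,x_2)=r(x_2,x_1)=0$, and $m(x_1)=m(x_2)$ (so that $S_\star=\{x_1,x_2\}$). Let $(d_N)_{N\ge1}$ be positive reals with $d_N\to0$, $\lim_{N\to\infty}d_N\log N=0$, which decay subexponentially (i.e. $\lim_{N\to\infty}d_Ne^{\epsilon N}=\infty$ for every $\epsilon>0$), and such that $\lim_{N\to\infty}d_NN^2(\log N)^2=0$. Set $\theta_{N,2}=N/d_N^2$ and $$\mathfrak{R}=\int_0^1\frac{dt}{\sum_{p=1}^{2}\frac{1}{(1-m_\star(y_p))\left(\frac{1-t}{r(x_1,y_p)}+\frac{t}{r(x_2,y_p)}\right)}}.$$ Fix $i_0\in\{1,2\}$. Then the law of the rescaled process $\{Y_N^{\mathrm{spl}}(\theta_{N,2}t)\}_{t\ge0}$ started at $i_0$ (i.e. with the inclusion process started at $\xi_N^{x_{i_0}}$) converges, with respect to the Skorokhod topology on $D([0,\infty);\{1,2\})$, to the law of the Markov process on $\{1,2\}$ started at $i_0$ that jumps back and forth between $1$ and $2$ at rate $1/\mathfrak{R}$.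
   Context: $M_\star=\max_{x\in S}m(x)$, $S_\star=\{x:m(x)=M_\star\}$, $m_\star(x)=m(x)/M_\star$. $\mathcal{H}_N=\{\eta\in\mathbb{N}^S:\sum_x\eta_x=N\}$. The inclusion process $\{\eta_N(t)\}_{t\ge0}$ is the continuous-time Markov chain on $\mathcal{H}_N$ with generator $(\mathcal{L}_Nf)(\eta)=\sum_{x,y\in S}\eta_x(d_N+\eta_y)r(x,y)\{f(\sigma^{x,y}\eta)-f(\eta)\}$, where $\sigma^{x,y}\eta$ is obtained from $\eta$ by moving one particle from $x$ to $y$ if $\eta_x\ge1$ (and $\sigma^{x,y}\eta=\eta$ if $\eta_x=0$). $\xi_N^x$ denotes the configuration with all $N$ particles at $x$. For a nonempty $\mathcal{G}\subseteq\mathcal{H}_N$, the trace process on $\mathcal{G}$ is $\eta_N^{\mathcal{G}}(t)=\eta_N(S^{\mathcal{G}}(t))$, where $T^{\mathcal{G}}(t)=\int_0^t\mathbf{1}\{\eta_N(s)\in\mathcal{G}\}ds$ and $S^{\mathcal{G}}(t)=\sup\{s\ge0:T^{\mathcal{G}}(s)\le t\}$. Let $\eta_N^\star$ be the trace process on $\{\xi_N^{x_1},\xi_N^{x_2}\}$, and $Y_N^{\mathrm{spl}}(t)=i$ if $\eta_N^\star(t)=\xi_N^{x_i}$. *)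

(* Defs.v *)
From HB Require Import structures.
From mathcomp Require Import all_boot all_order all_algebra.
From mathcomp Require Import all_classical all_reals all_analysis.
Set Implicit Arguments. Unset Strict Implicit. Unset Printing Implicit Defensive.
Import Order.TTheory GRing.Theory Num.Theory.
Import numFieldNormedType.Exports.
Local Open Scope classical_set_scope.
Local Open Scope ring_scope.

Section Defs.
Variable R : realType.

Section CTMC.
Variable St : finType.
Variable q : St -> St -> R.

Definition Qgen (i j : St) : R :=
  if i == j then - \sum_(k | k != i) q i k else q i j.

Fixpoint Qpow (k : nat) (i j : St) : R :=
  match k with
  | 0 => (i == j)%:R
  | k'.+1 => \sum_l Qpow k' i l * Qgen l j
  end.

Definition Ptrans (t : R) (i j : St) : R :=
  limn (fun n => \sum_(0 <= k < n) (t ^+ k / k`!%:R * Qpow k i j)).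

Fixpoint fdd (prev : St) (tprev : R) (l : seq (R * St)) : R :=
  match l with
  | [::] => 1
  | (t, a) :: l' => Ptrans (t - tprev) prev a * fdd a t l'
  end.
End CTMC.

(* cadlag path on [0, oo) with values in a discrete space *)
Definition cadlag (E : Type) (f : R -> E) : Prop :=
  (forall t, 0 <= t -> exists2 e : R, 0 < e & forall s, t <= s < t + e -> f s = f t)
  /\ (forall t, 0 < t -> exists a, exists2 e : R, 0 < e &
        forall s, t - e < s < t -> f s = a).

Definition is_ctmc (d : measure_display) (Om : measurableType d)
  (P : probability Om R) (St : finType) (X : Om -> R -> St)
  (q : St -> St -> R) (i0 : St) : Prop :=
  [/\ forall w, cadlag (X w),
      forall t a, measurable [set w | X w t = a] &
      forall l : seq (R * St), path <=%R 0 (map fst l) ->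
        P [set w | all (fun p => X w p.1 == p.2) l] = (fdd q i0 0 l)%:E].

Section Inclusion.
Variable T : finType.

Definition config (N : nat) :=
  {eta : {ffun T -> 'I_N.+1} | (\sum_z nat_of_ord (eta z))%N == N}.

Definition moven (e : T -> nat) (x y z : T) : nat :=
  if e x == 0%N then e z else (e z - (z == x) + (z == y))%N.

Definition incl_rate (r : T -> T -> R) (dN : R) (N : nat)
    (eta zeta : config N) : R :=
  if zeta == eta then 0 else
  \sum_x \sum_y
    (if [forall z, (val zeta z : nat) == moven (fun w => val eta w : nat) x y z]
     then (val eta x : nat)%:R * (dN + (val eta y : nat)%:R) * r x y else 0).

Definition xi_fun (N : nat) (x : T) : {ffun T -> 'I_N.+1} :=
  [ffun z => if z == x then ord_max else ord0].

Lemma xi_fun_sum N x : (\sum_z nat_of_ord (xi_fun N x z))%N == N.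
Proof.
rewrite (bigD1 x) //= ffunE eqxx big1 /=; first by rewrite addn0.
by move=> z /negbTE zx; rewrite ffunE zx.
Qed.

Definition xi (N : nat) (x : T) : config N := exist _ (xi_fun N x) (xi_fun_sum N x).

Definition occupation (Om : Type) (St : eqType) (X : Om -> R -> St)
    (G : pred St) (w : Om) (t : R) : R :=
  Rintegral (@lebesgue_measure R) `[0, t] (fun s => (X w s \in G)%:R).

Definition trace_time (Om : Type) (St : eqType) (X : Om -> R -> St)
    (G : pred St) (w : Om) (t : R) : R :=
  sup [set s | 0 <= s /\ occupation X G w s <= t].

Definition trace_proc (Om : Type) (St : eqType) (X : Om -> R -> St)
    (G : pred St) (w : Om) (t : R) : St :=
  X w (trace_time X G w t).

(* Y^spl, with {1,2} encoded as 'I_2 (label i <-> i+1) *)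
Definition Yspl (N : nat) (x : 'I_2 -> T) (Om : Type) (X : Om -> R -> config N)
    (w : Om) (t : R) : 'I_2 :=
  let G : pred (config N) := [pred eta | (eta == xi N (x ord0)) || (eta == xi N (x ord_max))] in
  if trace_proc X G w t == xi N (x ord0) then ord0 else ord_max.

Definition Mstar (m : T -> R) : R := \big[Num.max/0]_z m z.
Definition mstar (m : T -> R) (z : T) : R := m z / Mstar m.

Definition irreducible (r : T -> T -> R) : Prop :=
  forall a b : T, connect [rel u v | 0 < r u v] a b.
End Inclusion.

Section Skorokhod.
Variable E : eqType.

Definition time_changes : set (R -> R) :=
  [set lam | [/\ lam 0 = 0,
     (forall s t, 0 <= t < s -> lam t < lam s),
     (forall u, 0 <= u -> exists t, 0 <= t /\ lam t = u) &
     exists K : R, forall s t, 0 <= t < s ->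
       `|ln ((lam s - lam t) / (s - t))| <= K]].

Definition gamma_tc (lam : R -> R) : R :=
  sup [set g | exists s t, 0 <= t < s /\ g = `|ln ((lam s - lam t) / (s - t))|].

Definition sk_du (x y : R -> E) (lam : R -> R) (u : R) : R :=
  sup [set g | exists t, 0 <= t /\ g = (x (Num.min t u) != y (Num.min (lam t) u))%:R].

Definition sk_dist (x y : R -> E) : R :=
  inf [set g | exists2 lam, time_changes lam &
     g = Num.max (gamma_tc lam)
       (Rintegral (@lebesgue_measure R) `[0, +oo[
          (fun u => expR (- u) * sk_du x y lam u))].

Definition sk_continuous (F : (R -> E) -> R) : Prop :=
  forall x, cadlag x -> forall e : R, 0 < e -> exists2 del : R, 0 < del &
    forall y, cadlag y -> sk_dist x y < del -> `|F x - F y| < e.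
End Skorokhod.

End Defs.

(* Main.v *)
(* By reversibility, the chain obtained by watching the inclusion process at the
   times in h N and keeping only its visits to the two configurations xi^{x_1},
   xi^{x_2} is a symmetric two-state chain; its flip probability is the minimum of
   the Dirichlet form of the h-skeleton over f(xi^{x_1}) = 1, f(xi^{x_2}) = 0,
   divided by 2 mu(xi). A skeleton of the limit chain with a suitable time step has
   the same flip probability, hence the same law. As h -> 0 the discretized trace
   is a small time change of the trace process, hence close to it in the Skorokhod
   topology. With mu(xi) ~ d_N / N, all that remains is the capacity asymptotics
   N^2 cap_N / d_N^3 -> 1 / R, R being the integral of the statement.
   Lower bound: drop the edges y_1 y_2 and the configurations charging both y_p. For
   each p, a bounded number of particles at y_p already gives conductors in series
   and in parallel whose total resistance per level k (particles at x_1) involves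
   the factor 1 - m_star(y_p). Cauchy-Schwarz along k bounds the energy below by the
   inverse of the sum over k of the resistances of the two y_p in parallel; the
   values of f on the two branches differ little, and a summation by parts absorbs
   the difference.
   Upper bound: take f with increments in k proportional to the parallel resistance
   at k/N, cut off near k = 0 and k = N, and with a correction linear in the numbers
   of particles at y_1 and y_2 that balances the currents entering and leaving y_p.
   Both bounds produce Riemann sums of the integrand of R. *)

Require Import Defs.
From HB Require Import structures.
From mathcomp Require Import all_boot all_order all_algebra.
From mathcomp Require Import all_classical all_reals all_analysis.
From mathcomp Require Import measurable_realfun.
From mathcomp Require Import zify ring lra.
Import Order.TTheory GRing.Theory Num.Theory.
Import numFieldNormedType.Exports.
Local Open Scope classical_set_scope.
Local Open Scope ring_scope.
Set Implicit Arguments.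
Unset Strict Implicit.
Unset Printing Implicit Defensive.

(** * The transition semigroup of a finite chain *)

(** The functional [F] of the trace is not known to be measurable, and the processes live on a
    different space for each [N]. Skeletons on a finite horizon avoid both difficulties: they take
    finitely many values, their expectations are finite sums, and the trace is reached as an almost
    sure limit. The equality of laws of two skeletons replaces any argument by tightness or by
    generators. Two limits are nested: the mesh [theta / k.+1] is chosen after [N], and [N] then
    enters only through [p * k.+1], with [p] the flip probability, so the last passage needs an
    estimate uniform in the mesh and in the sampling step. Existence of the trace for all times
    comes from a Lyapunov function built on a combinatorial score. In the capacity, [d_N log N -> 0]
    makes every factor [ip_u] equivalent to [d_N]. Configurations charging both sites [y_p] cost a
    fraction of order [d_N N] of the main term [d_N^3 / N^2]. The subexponential decay of [d_N]
    beats those where [x_2] is empty: away from the cut-off ends they carry a number of particles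
    proportional to [N] on the [y_p], hence an exponentially small weight. *)

Section MatrixExponential.
Variables (R : realType) (St : finType) (q : St -> St -> R).

Local Notation Q := (Qgen q).
Local Notation Qp := (Qpow q).

(** A bound on the column sums of [|Q|]: it gives [|Q^k| <= B^k] entrywise and reduces the estimates
    on the semigroup to scalar exponential series. *)
Let B : R := \sum_i \sum_j `|Q i j|.

Let B_ge0 : 0 <= B.
Proof. by apply: sumr_ge0 => i _; apply: sumr_ge0. Qed.

Lemma Qgen_row_sum i : \sum_j Q i j = 0.
Proof.
rewrite (bigD1 i)//= {1}/Qgen eqxx addrC; apply/eqP; rewrite subr_eq0; apply/eqP.
by apply: eq_bigr => j ji; rewrite /Qgen eq_sym (negbTE ji).
Qed.

Let Qcol_le j : \sum_l `|Q l j| <= B.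
Proof.
apply: ler_sum => l _; rewrite (bigD1 j)//= lerDl; exact: sumr_ge0.
Qed.

Let Qpow_le k i j : `|Qp k i j| <= B ^+ k.
Proof.
elim: k j => [|k IH] j /=.
  by rewrite expr0; case: (i == j); rewrite ?normr1 ?normr0.
apply: (le_trans (ler_norm_sum _ _ _)).
apply: (@le_trans _ _ (\sum_l B ^+ k * `|Q l j|)).
  by apply: ler_sum => l _; rewrite normrM ler_wpM2r.
by rewrite -mulr_sumr exprSr ler_wpM2l// exprn_ge0.
Qed.

Local Notation tm t i j := (fun k : nat => t ^+ k / k`!%:R * Qp k i j).

Let tm_le t i j k : `|tm t i j k| <= exp_coeff (`|t| * B) k.
Proof.
rewrite /exp_coeff /= exprMn !normrM normrX mulrAC normfV.
rewrite [`|_%:R|]ger0_norm// ler_wpM2r// ?invr_ge0//.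
by rewrite ler_wpM2l// exprn_ge0.
Qed.

Lemma is_cvg_Ptrans t i j : cvgn (series (tm t i j)).
Proof.
apply: normed_cvg; apply: (@series_le_cvg _ _ (exp_coeff (`|t| * B))) => //.
- by move=> n; rewrite normr_ge0.
- by move=> n; apply: exp_coeff_ge0; rewrite mulr_ge0.
- by move=> n; exact: tm_le.
- exact: is_cvg_series_exp_coeff.
Qed.

Lemma Ptrans_cvg t i j : series (tm t i j) @ \oo --> Ptrans q t i j.
Proof. exact: is_cvg_Ptrans. Qed.

Lemma Ptrans0 i j : Ptrans q 0 i j = (i == j)%:R.
Proof.
suff K : series (tm 0 i j) @ \oo --> ((i == j)%:R : R).
  exact: cvg_unique (Ptrans_cvg (t:=0) (i:=i) (j:=j)) K.
rewrite -(cvg_shiftS (series _)) /=.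
rewrite (_ : (fun n => _) = fun=> (i == j)%:R); first exact: cvg_cst.
apply/funext => n; rewrite /series /= big_nat_recl// expr0 fact0 divr1 mul1r.
by rewrite big1 ?addr0// => k _; rewrite expr0n /= !mul0r.
Qed.

Lemma Ptrans_row_sum t i : \sum_j Ptrans q t i j = 1.
Proof.
have H : (fun n => \sum_j series (tm t i j) n) @ \oo --> \sum_j Ptrans q t i j.
  by apply: cvg_big => [|j _]; [exact: add_continuous|exact: Ptrans_cvg].
suff K : (fun n => \sum_j series (tm t i j) n) @ \oo --> (1 : R).
  exact: cvg_unique H K.
rewrite -(cvg_shiftS (fun n => \sum_j _)) /=.
rewrite (_ : (fun n => _) = fun=> 1); first exact: cvg_cst.
apply/funext => n; rewrite /series /= exchange_big /= big_nat_recl//.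
rewrite [X in _ + X]big1 => [|k _].
  rewrite addr0 (bigD1 i)//= eqxx big1 => [|j ji].
    by rewrite addr0 expr0 fact0 divr1 mulr1.
  by rewrite eq_sym (negbTE ji) mulr0.
rewrite -mulr_sumr exchange_big /= big1 ?mulr0// => l _.
by rewrite -mulr_sumr Qgen_row_sum mulr0.
Qed.

(** [Qpow] multiplies on the right; reversing a path in [Ptrans_rev] puts the new factor on the
    left. *)
Lemma QpowSl k i j : Qp k.+1 i j = \sum_l Q i l * Qp k l j.
Proof.
elim: k i j => [|k IH] i j.
  rewrite /= (bigD1 i)//= eqxx mul1r big1 ?addr0 => [|l li].
    rewrite (bigD1 j)//= eqxx mulr1 big1 ?addr0// => l lj.
    by rewrite (negbTE lj) mulr0.
  by rewrite eq_sym (negbTE li) mul0r.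
rewrite [LHS]/=.
under eq_bigr => l _ do rewrite -/(Qpow q k.+1 i l) IH mulr_suml.
rewrite exchange_big /=; apply: eq_bigr => l _.
by rewrite mulr_sumr; apply: eq_bigr => m _; rewrite mulrA.
Qed.

Lemma Ptrans_rev (mu : St -> R) t :
  (forall i j, mu i * q i j = mu j * q j i) ->
  forall i j, mu i * Ptrans q t i j = mu j * Ptrans q t j i.
Proof.
move=> rev i j.
have revQ a b : mu a * Q a b = mu b * Q b a.
  by rewrite /Qgen eq_sym; case: eqP => [->//|_]; exact: rev.
have revp k a b : mu a * Qp k a b = mu b * Qp k b a.
  elim: k a b => [|k IH] a b.
    by rewrite /= eq_sym; case: eqP => [->//|]; rewrite !mulr0.
  rewrite [in RHS]QpowSl /= !mulr_sumr; apply: eq_bigr => l _.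
  by rewrite mulrA IH mulrAC revQ -mulrA; congr (_ * _); rewrite mulrC.
have H1 : (fun n => mu i * series (tm t i j) n) @ \oo --> mu i * Ptrans q t i j.
  by apply: cvgMr; exact: Ptrans_cvg.
have H2 : (fun n => mu j * series (tm t j i) n) @ \oo --> mu j * Ptrans q t j i.
  by apply: cvgMr; exact: Ptrans_cvg.
apply: cvg_unique H1 _ => //; apply: cvg_trans H2; apply: near_eq_cvg.
near=> n; rewrite /series /= !mulr_sumr; apply: eq_bigr => k _.
by rewrite mulrCA revp mulrCA.
Unshelve. all: by end_near.
Qed.

(** The remainder is the series from degree 2 on, where [h ^+ k <= h ^+ 2] because [h <= 1]; the
    other factors sum to at most [expR B]. *)
Lemma Ptrans_first_order : exists2 C : R, 0 <= C & forall h i j, 0 <= h <= 1 ->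
  `|Ptrans q h i j - (i == j)%:R - h * Q i j| <= C * h ^+ 2.
Proof.
exists (expR B); first exact: expR_ge0.
move=> h i j /andP[h0 h1].
have H : (fun n => `|series (tm h i j) n - (i == j)%:R - h * Q i j|) @ \oo -->
    `|Ptrans q h i j - (i == j)%:R - h * Q i j|.
  by apply: cvg_norm; apply: cvgB; [apply: cvgB => //; [exact: Ptrans_cvg|exact: cvg_cst]|exact: cvg_cst].
rewrite -(cvg_lim _ H)//; apply: limr_le; first by apply/cvg_ex; eexists; exact: H.
near=> n.
have n2 : (2 <= n)%N by near: n; exact: nbhs_infty_ge.
rewrite -(subnKC n2) /series /= addSn addSn !big_nat_recl// add0n.
have Q1 : \sum_l (i == l)%:R * Q l j = Q i j.
  rewrite (bigD1 i)//= eqxx mul1r big1 ?addr0// => l li.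
  by rewrite eq_sym (negbTE li) mul0r.
rewrite expr0 fact0 divr1 mul1r expr1 divr1 /= Q1.
rewrite (_ : _ + _ - _ - _ = \sum_(0 <= k < n - 2) h ^+ k.+2 / (k.+2)`!%:R * Qp k.+2 i j); last by ring.
apply: (le_trans (ler_norm_sum _ _ _)).
apply: (@le_trans _ _ (\sum_(0 <= k < n - 2) (h ^+ 2 * exp_coeff B k.+2))).
  apply: ler_sum => k _.
  have hk : `|h ^+ k.+2| <= h ^+ 2.
    by rewrite normrX (ger0_norm h0) -addn2 exprD ler_piMl ?exprn_ge0// exprn_ile1.
  rewrite normrM normrM normfV [`|_%:R|]ger0_norm// mulrAC mulrA.
  by rewrite ler_wpM2r ?invr_ge0// ler_pM// Qpow_le.
rewrite -mulr_sumr mulrC ler_wpM2r ?exprn_ge0//.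
apply: (@le_trans _ _ (series (exp_coeff B) (n - 2).+2)).
  rewrite /series /= !big_nat_recl// addrA lerDr.
  by rewrite addr_ge0// exp_coeff_ge0.
apply: nondecreasing_cvgn_le; last exact: is_cvg_series_exp_coeff.
apply: (@nondecreasing_series _ (exp_coeff B) predT) => k _ _; exact: exp_coeff_ge0.
Unshelve. all: by end_near.
Qed.

(* The binomial expansion of the entry [i, j] of [(1 + s Q)^n]. *)
Let Ap s n i j := \sum_(k < n.+1) 'C(n, k)%:R * s ^+ k * Qp k i j.

Let ApS s n i j : Ap s n.+1 i j = \sum_l Ap s n i l * ((l == j)%:R + s * Q l j).
Proof.
rewrite /Ap; under [RHS]eq_bigr do rewrite mulrDr.
rewrite big_split /= (bigD1 j)//= eqxx mulr1 [X in _ + X + _]big1 ?addr0; last first.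
  by move=> l /negbTE ->; rewrite mulr0.
have -> : \sum_l (\sum_(k < n.+1) 'C(n, k)%:R * s ^+ k * Qp k i l) * (s * Q l j) =
   \sum_(k < n.+1) 'C(n, k)%:R * s ^+ k.+1 * Qp k.+1 i j.
  under eq_bigr => l _ do rewrite mulr_suml.
  rewrite exchange_big /=; apply: eq_bigr => k _.
  rewrite mulr_sumr; apply: eq_bigr => l _; rewrite exprSr; ring.
rewrite big_ord_recl /= bin0.
rewrite [in RHS]big_ord_recl /= bin0 -addrA; congr (_ + _).
under eq_bigr => k _ do rewrite /bump /= add1n binS natrD 2!mulrDl.
rewrite big_split /= big_ord_recr /= bin_small// !mul0r addr0; congr (_ + _).
Qed.

Let Ap_ge0 s n i j : (forall a b, 0 <= (a == b)%:R + s * Q a b) -> 0 <= Ap s n i j.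
Proof.
move=> H; elim: n j => [|n IH] j.
  by rewrite /Ap big_ord_recl big_ord0 addr0 bin0 expr0 mul1r mul1r.
by rewrite ApS; apply: sumr_ge0 => l _; rewrite mulr_ge0.
Qed.

Lemma ffact_le_expn n k : (n ^_ k <= n ^ k)%N.
Proof.
elim: k => [//|k IH].
by rewrite ffactnSr expnSr leq_mul// leq_subr.
Qed.

(** Each coefficient of [(1 + x / n)^n] is below that of [exp x]. This sign lets a matrix difference
    be dominated by the scalar one in [Ptrans_ge0]. *)
Lemma bin_fact_le n k : 'C(n, k)%:R / n%:R ^+ k <= (k`!%:R)^-1 :> R.
Proof.
case: n => [|n].
  case: k => [|k]; first by rewrite bin0 expr0 fact0 divr1 invr1.
  by rewrite bin0n /= mul0r invr_ge0.
rewrite ler_pdivrMr ?exprn_gt0// -(@ler_pM2l _ k`!%:R) ?ltr0n ?fact_gt0//.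
rewrite mulrA divff ?mul1r; last by rewrite pnatr_eq0 -lt0n fact_gt0.
by rewrite -natrX -natrM ler_nat mulnC bin_ffact ffact_le_expn.
Qed.

(** With [y = x / n.+1], this is a power of [exp (y / (1 + y)) <= 1 + y], which is
    [1 - z <= exp (- z)] at [z = y / (1 + y)] after inversion. *)
Lemma expR_le_onedivn (x : R) n : 0 <= x -> expR (x / (1 + x / n.+1%:R)) <= (1 + x / n.+1%:R) ^+ n.+1.
Proof.
move=> x0; set y := x / n.+1%:R.
have y0 : 0 <= y by rewrite divr_ge0.
have y1 : 0 < 1 + y by lra.
have -> : x / (1 + y) = n.+1%:R * (y / (1 + y)).
  rewrite /y; field; rewrite -/y gt_eqF//=.
  by rewrite addrC gt_eqF// ltr_wpDl// ler0n.
rewrite expRM_natl// lerXn2r ?nnegrE ?expR_ge0//; first exact: ltW.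
rewrite -[leLHS]invrK -expRN -[leRHS]invrK lef_pV2 ?posrE ?expR_gt0 ?invr_gt0//.
apply: le_trans (expR_ge1Dx _).
rewrite le_eqVlt; apply/orP; left; apply/eqP; field; lra.
Qed.

Lemma cvg_expR_euler (x : R) : 0 <= x -> (fun n => (1 + x / n.+1%:R) ^+ n.+1) @ \oo --> expR x.
Proof.
move=> x0.
have inv0 : (fun n => x / n.+1%:R) @ \oo --> (0 : R).
  rewrite -(mulr0 x); apply: cvgMr; exact: cvg_harmonic.
apply: (@squeeze_cvgr _ _ _ _ (fun n => expR (x / (1 + x / n.+1%:R))) (cst (expR x))).
- near=> n; apply/andP; split; first exact: expR_le_onedivn.
  rewrite /= (_ : expR x = expR (n.+1%:R * (x / n.+1%:R))); last by congr expR; field.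
  rewrite expRM_natl// lerXn2r ?nnegrE ?expR_ge0//.
    by rewrite addr_ge0// divr_ge0.
  exact: expR_ge1Dx.
- have : (fun n => x / (1 + x / n.+1%:R)) @ \oo --> x.
    rewrite -[X in _ --> X]divr1 -[X in _ / X]addr0; apply: cvgM; first exact: cvg_cst.
    apply: cvgV; first by rewrite addr0 oner_neq0.
    by apply: cvgD => //; exact: cvg_cst.
  by move=> H; apply: continuous_cvg H; exact: continuous_expR.
- exact: cvg_cst.
Unshelve. all: by end_near.
Qed.

(** The terms of the exponential series have no sign, but the Euler products [(1 + t Q / n)^n] have
    nonnegative entries as soon as [t * B <= n]. Their entrywise distance to the truncated series is
    at most the same distance for the scalar [exp (t B)], which vanishes. *)
Lemma Ptrans_ge0 t i j : (forall a b, a != b -> 0 <= q a b) -> 0 <= t -> 0 <= Ptrans q t i j.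
Proof.
move=> q0 t0.
have Qge a b : a != b -> 0 <= Q a b by move=> ab; rewrite /Qgen (negbTE ab); exact: q0.
have Apn n : t * B <= n.+1%:R -> 0 <= Ap (t / n.+1%:R) n.+1 i j.
  move=> tB; apply: Ap_ge0 => a b; case: (altP (a =P b)) => [->|ab]; last first.
    by rewrite add0r mulr_ge0 ?Qge// divr_ge0.
  rewrite mulrAC -[X in X + _](@divff _ n.+1%:R)// -mulrDl divr_ge0//.
  have : `|t * Q b b| <= n.+1%:R.
    rewrite normrM ger0_norm//; apply: le_trans tB; rewrite ler_wpM2l//.
    by apply: le_trans (Qcol_le b); rewrite (bigD1 b)//= lerDl sumr_ge0.
  by rewrite ler_norml => /andP[]; lra.
set x := t * B.
have x0 : 0 <= x by rewrite mulr_ge0.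
(* With [n.+2] terms both sums stop at degree [n.+1] and can be compared coefficient by
   coefficient. *)
have K n : `|series (tm t i j) n.+2 - Ap (t / n.+1%:R) n.+1 i j| <=
   series (exp_coeff x) n.+2 - (1 + x / n.+1%:R) ^+ n.+1.
  rewrite /series /= !big_mkord /Ap -sumrB.
  rewrite exprDn.
  under [X in _ <= _ - X]eq_bigr => k _ do rewrite expr1n mul1r.
  rewrite -sumrB; apply: (le_trans (ler_norm_sum _ _ _)); apply: ler_sum => k _.
  have -> : t ^+ k / (k`!)%:R * Qp k i j - 'C(n.+1, k)%:R * (t / n.+1%:R) ^+ k * Qp k i j =
     (k`!%:R^-1 - 'C(n.+1, k)%:R / n.+1%:R ^+ k) * t ^+ k * Qp k i j.
    rewrite expr_div_n; ring.
  have -> : exp_coeff x k - (x / n.+1%:R) ^+ k *+ 'C(n.+1, k) =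
     (k`!%:R^-1 - 'C(n.+1, k)%:R / n.+1%:R ^+ k) * t ^+ k * B ^+ k.
    rewrite /exp_coeff /= expr_div_n -mulr_natr /x exprMn; ring.
  rewrite 2!normrM ler_pM ?mulr_ge0//.
  by rewrite ger0_norm ?subr_ge0 ?bin_fact_le// ger0_norm ?exprn_ge0.
have L1 : (fun n => series (tm t i j) n.+2) @ \oo --> Ptrans q t i j.
  by move: (@Ptrans_cvg t i j); rewrite -(cvg_shiftS (series _)) -(cvg_shiftS (fun n => series _ n.+1)).
have L2 : (fun n => series (exp_coeff x) n.+2 - (1 + x / n.+1%:R) ^+ n.+1) @ \oo --> (0 : R).
  rewrite -(subrr (expR x)); apply: cvgB; last exact: cvg_expR_euler.
  have : series (exp_coeff x) @ \oo --> expR x by exact: is_cvg_series_exp_coeff.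
  by rewrite -(cvg_shiftS (series _)) -(cvg_shiftS (fun n => series _ n.+1)).
have L3 : (fun n => series (tm t i j) n.+2 +
    (series (exp_coeff x) n.+2 - (1 + x / n.+1%:R) ^+ n.+1)) @ \oo --> Ptrans q t i j.
  by rewrite -[X in _ --> X]addr0; exact: cvgD.
rewrite -(cvg_lim _ L3)//; apply: limr_ge; first by apply/cvg_ex; eexists; exact: L3.
near=> n.
have An : 0 <= Ap (t / n.+1%:R) n.+1 i j.
  apply: Apn; near: n.
  exists (Num.bound x) => // n /= mn.
  apply: ltW; apply: lt_le_trans (archi_boundP x0) _.
  by rewrite ler_nat; apply: leq_trans mn _.
have := K n; rewrite ler_norml => /andP[]; lra.
Unshelve. all: by end_near.
Qed.

End MatrixExponential.

(** Here [Q^2 = - 2 rho Q], so all powers of [Q] are multiples of [Q] and the series is a scalar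
    exponential. *)
Lemma Ptrans_two_state (R : realType) (rho t : R) (i j : 'I_2) :
  Ptrans (fun i j : 'I_2 => if i != j then rho else 0) t i j =
  (1 + (-1) ^+ (i != j) * expR (- 2 * rho * t)) / 2.
Proof.
set q := fun i j : 'I_2 => _.
have Q2 (a b : 'I_2) : Qgen q a b = - (-1) ^+ (a != b) * rho.
  rewrite /Qgen /q; case: (altP (a =P b)) => [_|_] /=; last by rewrite expr1; ring.
  have -> : \sum_(k < 2 | k != a) (if a != k then rho else 0) = rho.
    rewrite big_mkcond /= !big_ord_recl big_ord0 /=.
    by case: a => -[|[|//]] ? /=; rewrite ?addr0 ?add0r.
  by rewrite expr0; ring.
have Qp2 k (a b : 'I_2) : Qpow q k.+1 a b = (-1) ^+ (a != b) * (- 2 * rho) ^+ k.+1 / 2.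
  elim: k b => [|k IH] b.
    rewrite /= (bigD1 a)//= eqxx mul1r big1 ?addr0 => [|l la]; last first.
      by rewrite eq_sym (negbTE la) mul0r.
    by rewrite Q2 expr1; field.
  rewrite [LHS]/=.
  under eq_bigr => l _ do rewrite -/(Qpow q k.+1 a l) IH Q2.
  rewrite !big_ord_recl big_ord0 [in RHS]exprSr.
  move: ((- 2 * rho) ^+ k.+1) => z.
  by case: a {IH} => -[|[|//]] ?; case: b => -[|[|//]] ? /=; field.
suff K : series (fun k => t ^+ k / k`!%:R * Qpow q k i j) @ \oo -->
    (1 + (-1) ^+ (i != j) * expR (- 2 * rho * t)) / 2.
  exact: cvg_unique (Ptrans_cvg (t:=t) (i:=i) (j:=j)) K.
have E : (fun n => series (exp_coeff (- 2 * rho * t)) n.+1) @ \oo --> expR (- 2 * rho * t).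
  by rewrite (cvg_shiftS (series _)); exact: is_cvg_series_exp_coeff.
have : (fun n => (1 + (-1) ^+ (i != j) * series (exp_coeff (- 2 * rho * t)) n.+1) / 2) @ \oo -->
   (1 + (-1) ^+ (i != j) * expR (- 2 * rho * t)) / 2.
  by apply: cvgMl; apply: cvgD; [exact: cvg_cst|apply: cvgMr].
rewrite -(cvg_shiftS (series (fun k => _ * Qpow _ _ _ _))).
apply: cvg_trans; apply: near_eq_cvg; near=> n.
rewrite /series /= !big_nat_recl// /exp_coeff /= !expr0 fact0 divr1 mul1r.
under [in RHS]eq_bigr => k _ do rewrite -/(Qpow q k.+1 i j) Qp2.
have -> : (i == j)%:R = (1 + (-1) ^+ (i != j)) / 2 :> R.
  by case: eqP => _ /=; rewrite ?expr0 ?expr1; field.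
rewrite mulrDr addrA mulrDl mulr1; congr (_ + _).
rewrite mulr_sumr mulr_suml; apply: eq_bigr => k _.
by rewrite exprMn; ring.
Unshelve. all: by end_near.
Qed.

(** * Finite chains watched on a subset *)

Section Contraction.
Variable R : realType.

Lemma contraction_cvg0 (eps : R) (a del : nat -> R) : 0 < eps <= 1 ->
  (forall n, 0 <= a n) -> (forall n, a n.+1 <= (1 - eps) * a n + del n) ->
  del @ \oo --> 0 -> a @ \oo --> 0.
Proof.
move=> /andP[e0 e1] a0 aS dl; apply/cvgrPdist_le => e egt0.
have /cvgrPdist_le/(_ (eps * (e / 2))) := dl.
rewrite mulr_gt0 ?divr_gt0// => /(_ isT) [N _ HN].
have bnd k : a (N + k)%N <= (1 - eps) ^+ k * a N + e / 2.
  elim: k => [|k IH]; first by rewrite addn0 expr0 mul1r lerDl divr_ge0// ltW.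
  rewrite addnS (le_trans (aS _))// exprS.
  have : `|0 - del (N + k)%N| <= eps * (e / 2) by apply: HN => /=; rewrite leq_addr.
  rewrite sub0r normrN => /(le_trans (ler_norm _)) d1.
  have : (1 - eps) * a (N + k)%N <= (1 - eps) * ((1 - eps) ^+ k * a N + e / 2).
    by rewrite ler_wpM2l// subr_ge0.
  rewrite mulrDr mulrA; lra.
have : (fun k => (1 - eps) ^+ k * a N) @ \oo --> (0 : R).
  rewrite -[X in _ --> X](mul0r (a N)); apply: cvgMl.
  apply: cvg_expr; rewrite ger0_norm ?subr_ge0//; lra.
move=> /cvgrPdist_le/(_ (e / 2)); rewrite divr_gt0// => /(_ isT)[M _ HM].
exists (N + M)%N => // n /= Hn.
rewrite sub0r normrN ger0_norm//.
have -> : n = (N + (n - N))%N by lia.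
have := HM (n - N)%N; rewrite /= leq_subRL; last by lia.
move=> /(_ Hn); rewrite sub0r normrN => /(le_trans (ler_norm _)).
by have := bnd (n - N)%N; lra.
Qed.

End Contraction.

(** * Path expectations and first visits of discrete-time chains *)

Section PathExpectation.
Variables (R : realType) (St : finType) (P : St -> St -> R).

(* Expectation of [Phi (X_1, ..., X_n)] for the chain started at [i]. *)
Fixpoint Epath (n : nat) (i : St) (Phi : seq St -> R) : R :=
  match n with
  | 0 => Phi [::]
  | n'.+1 => \sum_j P i j * Epath n' j (fun s => Phi (j :: s))
  end.

Lemma eq_Epath n i Phi Psi : (forall s, size s = n -> Phi s = Psi s) ->
  Epath n i Phi = Epath n i Psi.
Proof.
elim: n i Phi Psi => [|n IH] i Phi Psi H /=; first exact: H.
by apply: eq_bigr => j _; congr (_ * _); apply: IH => s ss; rewrite H//= ss.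
Qed.

Lemma Epath_tuple n i Phi : Epath n i Phi =
  \sum_(s : n.-tuple St) (\prod_(p <- zip (i :: s) s) P p.1 p.2) * Phi s.
Proof.
elim: n i Phi => [|n IH] i Phi /=.
  rewrite (bigD1 [tuple])//= big_nil mul1r big1 ?addr0// => s.
  by rewrite tuple0.
rewrite (reindex (fun p : St * n.-tuple St => [tuple of p.1 :: p.2])) /=; last first.
  exists (fun s : n.+1.-tuple St => (thead s, [tuple of behead s])) => [[j s] _|s _] /=.
    by congr pair; apply/val_inj.
  by rewrite [RHS]tuple_eta; apply/val_inj.
rewrite -(pair_bigA _ (fun j (s : n.-tuple St) =>
  (\prod_(p <- (i, j) :: zip (j :: s) s) P p.1 p.2) * Phi (j :: s))) /=.
apply: eq_bigr => j _; rewrite IH mulr_sumr; apply: eq_bigr => s _.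
by rewrite big_cons /= mulrA.
Qed.

Hypothesis P_sum : forall i, \sum_j P i j = 1.

Lemma Epath_cst n i c : Epath n i (fun=> c) = c.
Proof.
elim: n i => [//|n IH] i /=.
by under eq_bigr do rewrite IH; rewrite -mulr_suml P_sum mul1r.
Qed.

Lemma EpathZ n i Phi c : Epath n i (fun s => c * Phi s) = c * Epath n i Phi.
Proof.
elim: n i Phi => [//|n IH] i Phi /=.
by rewrite mulr_sumr; apply: eq_bigr => j _; rewrite IH mulrCA.
Qed.

End PathExpectation.

(** Serves to read the trace kernel on configurations, which only reaches two of them, as a kernel
    on ['I_2]. *)
Lemma Epath_embed (R : realType) (St St' : finType) (K : St -> St -> R) (K' : St' -> St' -> R)
    (g : St' -> St) : injective g ->
  (forall i j, (forall b, j != g b) -> K i j = 0) ->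
  (forall a b, K (g a) (g b) = K' a b) ->
  forall n a Phi, Epath K n (g a) Phi = Epath K' n a (fun s => Phi (map g s)).
Proof.
move=> gI K0 KK'; elim=> [//|n IH] a Phi /=.
rewrite (bigID (fun j => j \in codom g)) /= [X in _ + X]big1 ?addr0; last first.
  move=> j jg; rewrite K0 ?mul0r// => b; apply: contra jg => /eqP->.
  exact: codom_f.
rewrite (reindex_onto g (fun j => if [pick b | g b == j] is Some b then b else a)) /=; last first.
  move=> j /codomP[b ->]; case: pickP => [c /eqP//|/(_ b)].
  by rewrite eqxx.
apply: eq_big => [b|b _]; last by rewrite KK' IH.
rewrite codom_f /=; case: pickP => [c /eqP/gI->|/(_ b)]; by rewrite eqxx.
Qed.

Section HittingKernel.
Variables (R : realType) (St : finType) (P : St -> St -> R) (G : pred St).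
Hypothesis P_ge0 : forall i j, 0 <= P i j.
Hypothesis P_sum : forall i, \sum_j P i j = 1.

(** First-step recursion for a visit to [G] within [n] steps. Whether the starting state lies in [G]
    is not looked at, so only positive times count. *)
Fixpoint hitn (n : nat) (g i : St) : R :=
  match n with
  | 0 => 0
  | n'.+1 => P i g + \sum_(j | ~~ G j) P i j * hitn n' g j
  end.

(* For [g] in [G], the probability that the first visit to [G] at a positive
   time of the chain started at [i] takes place at [g]. *)
Definition hit (g i : St) : R := limn (fun n => hitn n g i).

Lemma hitn_ge0 n g i : 0 <= hitn n g i.
Proof.
elim: n i => [//|n IH] i /=.
by rewrite addr_ge0// sumr_ge0// => j _; rewrite mulr_ge0.
Qed.

Lemma hitn_le1 n g i : G g -> hitn n g i <= 1.
Proof.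
move=> Gg; elim: n i => [|n IH] i /=; first exact: ler01.
rewrite -(P_sum i) [leRHS](bigID (fun j => ~~ G j)) /= addrC lerD//.
  by rewrite (bigD1 g) ?negbK//= lerDl sumr_ge0.
by apply: ler_sum => j _; rewrite ler_piMr.
Qed.

Lemma hitn_cvg g i : G g -> (fun n => hitn n g i) @ \oo --> hit g i.
Proof.
move=> Gg; apply: nondecreasing_is_cvgn.
  apply/nondecreasing_seqP => n; elim: n i => [|n IH] i; first exact: hitn_ge0.
  by rewrite /= lerD2l; apply: ler_sum => j _; rewrite ler_wpM2l.
by exists 1 => _ [n _ <-]; exact: hitn_le1.
Qed.

Lemma hitE g i : G g -> hit g i = P i g + \sum_(j | ~~ G j) P i j * hit g j.
Proof.
move=> Gg.
have H : (fun n => hitn n.+1 g i) @ \oo --> P i g + \sum_(j | ~~ G j) P i j * hit g j.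
  rewrite /=; apply: cvgD; first exact: cvg_cst.
  apply: cvg_big => [|j _]; first exact: add_continuous.
  by apply: cvgMr; exact: hitn_cvg.
have H2 := @hitn_cvg g i Gg; rewrite -(cvg_shiftS (fun n => hitn n g i)) in H2.
exact: cvg_unique H2 H.
Qed.

Variables (psi : St -> R) (eps : R).
Hypothesis eps01 : 0 < eps <= 1.
Hypothesis psi_ge1 : forall i, 1 <= psi i.
Hypothesis psi_contr : forall i, \sum_(j | ~~ G j) P i j * psi j <= (1 - eps) * psi i.

(** The kernel killed on [G] contracts the norm [sup (w / psi)] by [1 - eps], and [psi >= 1] lets
    the source [del] be measured in that norm. *)
Lemma killed_cvg0 (w : nat -> St -> R) (del : nat -> R) :
  (forall n i, 0 <= w n i) -> del @ \oo --> 0 -> (forall n, 0 <= del n) ->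
  (forall n i, w n.+1 i <= \sum_(j | ~~ G j) P i j * w n j + del n) ->
  forall i, (fun n => w n i) @ \oo --> 0.
Proof.
move=> w0 del0 del_ge0 wS i.
pose a := fix a n := if n is n'.+1 then (1 - eps) * a n' + del n' else \sum_j w 0%N j.
have e0 : 0 <= 1 - eps by have /andP[_] := eps01; rewrite subr_ge0.
have wa n j : w n j <= a n * psi j /\ 0 <= a n.
  elim: n j => [|n IH] j /=.
    split; last exact: sumr_ge0.
    apply: (@le_trans _ _ (\sum_j w 0%N j)); last by rewrite ler_peMr// sumr_ge0.
    by rewrite (bigD1 j)//= lerDl sumr_ge0.
  have an : 0 <= a n by case: (IH j).
  split; last by rewrite addr_ge0// mulr_ge0.
  apply: (le_trans (wS _ _)); rewrite mulrDl lerD//; last by rewrite ler_peMr.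
  apply: (@le_trans _ _ (a n * \sum_(j' | ~~ G j') P j j' * psi j')).
    rewrite mulr_sumr; apply: ler_sum => l _; rewrite mulrCA ler_wpM2l//.
    by case: (IH l).
  by rewrite mulrAC [leRHS]mulrC ler_wpM2l.
have acvg : a @ \oo --> 0.
  apply: (@contraction_cvg0 _ eps a del) => // n.
  by case: (wa n i).
apply: (@squeeze_cvgr _ _ _ _ (fun=> 0) (fun n => a n * psi i)).
- by near=> n; rewrite w0 /=; case: (wa n i).
- exact: cvg_cst.
- by rewrite -[X in _ --> X](mul0r (psi i)); apply: cvgMl.
Unshelve. all: by end_near.
Qed.

Lemma killed_eq0 (w : St -> R) : (forall i, 0 <= w i) ->
  (forall i, w i <= \sum_(j | ~~ G j) P i j * w j) -> forall i, w i = 0.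
Proof.
move=> w0 wS i.
have H : (fun n : nat => w i) @ \oo --> (0 : R).
  apply: (@killed_cvg0 (fun=> w) (fun=> 0)) => //; first exact: cvg_cst.
  by move=> _ j; rewrite addr0.
by apply: (cvg_unique _ _ H) => //; exact: cvg_cst.
Qed.

(** The defect of the sum from 1 solves the homogeneous equation of the killed kernel, whose only
    solution is 0. *)
Lemma hit_sum i : \sum_(g | G g) hit g i = 1.
Proof.
apply/eqP; rewrite -subr_eq0 -normr_eq0; apply/eqP; move: i.
apply: killed_eq0 => [i|i]; first exact: normr_ge0.
have -> : \sum_(g | G g) hit g i - 1 =
    \sum_(j | ~~ G j) P i j * (\sum_(g | G g) hit g j - 1).
  under eq_bigr => g Gg do rewrite hitE//.
  rewrite big_split /= exchange_big /=.
  under [X in _ + X - _]eq_bigr do rewrite -mulr_sumr.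
  under [RHS]eq_bigr do rewrite mulrBr mulr1.
  rewrite sumrB -(P_sum i) [X in _ - X = _](bigID G) /=; ring.
apply: (le_trans (ler_norm_sum _ _ _)).
by apply: ler_sum => j _; rewrite normrM ger0_norm.
Qed.

Definition trace_kernel (i j : St) : R := if G j then hit j i else 0.

(** Induction on [k]: the finite-horizon expectation and its limit satisfy the same first-step
    equation up to a source that converges by induction, and the killed kernel contracts their
    difference. Paths with fewer than [k] visits give shorter lists; their weight disappears in the
    limit. *)
Lemma trace_law k i (Psi : seq St -> R) :
  (fun n => Epath P n i (fun s => Psi (take k (seq.filter G s)))) @ \oo -->
  Epath trace_kernel k i Psi.
Proof.
elim: k i Psi => [|k IH] i Psi.
  have -> : (fun n => Epath P n i (fun s => Psi (take 0 (seq.filter G s)))) = fun=> Psi [::].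
    apply/funext => n; rewrite -[RHS](@Epath_cst _ _ P P_sum n i).
    by apply: eq_Epath => s _; rewrite take0.
  exact: cvg_cst.
pose e n j := Epath P n j (fun s => Psi (j :: take k (seq.filter G s))).
pose el j := Epath trace_kernel k j (fun s => Psi (j :: s)).
pose v n j := Epath P n j (fun s => Psi (take k.+1 (seq.filter G s))).
pose vl j := Epath trace_kernel k.+1 j Psi.
have ecvg j : (fun n => e n j) @ \oo --> el j by exact: (IH j (fun s => Psi (j :: s))).
have vS n j : v n.+1 j = \sum_(l | ~~ G l) P j l * v n l + \sum_(l | G l) P j l * e n l.
  rewrite {1}/v /= (bigID (fun l => ~~ G l)) /=; congr (_ + _).
    apply: eq_bigr => l Gl; congr (_ * _); apply: eq_Epath => s _ /=.
    by rewrite (negbTE Gl).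
  rewrite (eq_bigl G) => [|l]; last by rewrite negbK.
  by apply: eq_bigr => l Gl; congr (_ * _); apply: eq_Epath => s _ /=; rewrite Gl.
have vlE j : vl j = \sum_(l | ~~ G l) P j l * vl l + \sum_(l | G l) P j l * el l.
  have vle l : vl l = \sum_(g | G g) hit g l * el g.
    rewrite /vl /= [RHS]big_mkcond /=; apply: eq_bigr => g _.
    by rewrite /trace_kernel; case: (G g); rewrite ?mul0r.
  rewrite vle; under eq_bigr => g Gg do rewrite hitE// mulrDl.
  rewrite big_split /= addrC; congr (_ + _).
  under [RHS]eq_bigr do rewrite vle mulr_sumr.
  rewrite [RHS]exchange_big /=; apply: eq_bigr => g Gg.
  by rewrite mulr_suml; apply: eq_bigr => l _; rewrite mulrA.
have w0 : (fun n => `|v n i - vl i|) @ \oo --> 0.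
  apply: (@killed_cvg0 (fun n j => `|v n j - vl j|) (fun n => \sum_(l | G l) `|e n l - el l|)).
  - by move=> n j; exact: normr_ge0.
  - have Z : \sum_(l | G l) (0 : R) = 0 by rewrite big1.
    rewrite -{2}Z; apply: (@cvg_big _ _ _ _ _ _ _ _ _ (fun l n => `|e n l - el l|)) => [|l _].
      exact: add_continuous.
    rewrite -(normr0 R); apply: cvg_norm; rewrite -(subrr (el l)).
    by apply: cvgB => //; exact: cvg_cst.
  - by move=> n; exact: sumr_ge0.
  move=> n j; rewrite vS vlE.
  rewrite (_ : _ - _ = \sum_(l | ~~ G l) P j l * (v n l - vl l) +
      \sum_(l | G l) P j l * (e n l - el l)); last first.
    under [X in _ = X + _]eq_bigr do rewrite mulrBr.
    under [X in _ = _ + X]eq_bigr do rewrite mulrBr.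
    rewrite !sumrB; ring.
  apply: (le_trans (ler_normD _ _)); apply: lerD; apply: (le_trans (ler_norm_sum _ _ _)).
    by apply: ler_sum => l _; rewrite normrM ger0_norm.
  apply: ler_sum => l _; rewrite normrM ger0_norm// ler_piMl//.
  rewrite -(P_sum j) (bigD1 l)//= lerDl; exact: sumr_ge0.
apply/cvgrPdist_le => eta eta0.
have /cvgrPdist_le/(_ eta eta0)[N _ HN] := w0.
exists N => // n /= /HN; rewrite sub0r normrN normr_id distrC.
exact.
Qed.

End HittingKernel.

Definition dirichlet (R : realType) (St : finType) (K : St -> St -> R) (mu f : St -> R) : R :=
  \sum_i \sum_j mu i * K i j * (f j - f i) ^+ 2.

(** * The Dirichlet principle for a trace on two states *)

Section TwoPointTrace.
Variables (R : realType) (St : finType) (P : St -> St -> R) (g1 g2 : St).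
Let G : pred St := [pred i | (i == g1) || (i == g2)].
Hypothesis g12 : g1 != g2.
Hypothesis P_ge0 : forall i j, 0 <= P i j.
Hypothesis P_sum : forall i, \sum_j P i j = 1.
Variable mu : St -> R.
Hypothesis mu_gt0 : forall i, 0 < mu i.
Hypothesis P_rev : forall i j, mu i * P i j = mu j * P j i.
Hypothesis P_hit : forall i, hit P G g1 i + hit P G g2 i = 1.

Let Gg1 : G g1. Proof. by rewrite /G /= eqxx. Qed.
Let Gg2 : G g2. Proof. by rewrite /G /= eqxx orbT. Qed.

(** The equilibrium potential. Its boundary values are imposed by hand because [hit] only counts
    positive times. *)
Let h i : R := if i == g1 then 1 else if i == g2 then 0 else hit P G g1 i.

Let Ph i : \sum_j P i j * h j = hit P G g1 i.
Proof.
rewrite hitE// (bigD1 g1)//= {1}/h eqxx mulr1; congr (_ + _).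
rewrite (bigD1 g2)//=; last by rewrite eq_sym.
rewrite {1}/h eq_sym (negbTE g12) eqxx mulr0 add0r.
apply: eq_big => j; first by rewrite negb_or.
by rewrite /h => /andP[/negbTE-> /negbTE->].
Qed.

(** Summation by parts: [h] is harmonic off [g1] and [g2], so pairing with it only sees the values
    of [f] at these two points, weighted by escape probabilities. The factor 2 appears because
    [dirichlet] runs over ordered pairs. *)
Let form f : \sum_i \sum_j mu i * P i j * ((f j - f i) * (h j - h i)) =
  2 * (mu g1 * hit P G g2 g1 * f g1 - mu g2 * hit P G g1 g2 * f g2).
Proof.
have sym : \sum_i \sum_j mu i * P i j * (f j * (h j - h i)) =
    \sum_i \sum_j mu i * P i j * (f i * (h i - h j)).
  rewrite exchange_big /=; apply: eq_bigr => i _; apply: eq_bigr => j _.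
  by rewrite P_rev.
have -> : \sum_i \sum_j mu i * P i j * ((f j - f i) * (h j - h i)) =
    2 * \sum_i \sum_j mu i * P i j * (f i * (h i - h j)).
  rewrite mulr_natl mulr2n -{1}sym -big_split /=; apply: eq_bigr => i _.
  by rewrite -big_split /=; apply: eq_bigr => j _; ring.
congr (_ * _).
have row i : \sum_j mu i * P i j * (f i * (h i - h j)) = mu i * f i * (h i - hit P G g1 i).
  rewrite -Ph.
  have -> : h i - \sum_j P i j * h j = \sum_j P i j * (h i - h j).
    under [RHS]eq_bigr do rewrite mulrBr.
    by rewrite sumrB -mulr_suml P_sum mul1r.
  by rewrite mulr_sumr; apply: eq_bigr => j _; ring.
under eq_bigr do rewrite row.
rewrite (bigD1 g1)//= (bigD1 g2)/=; last by rewrite eq_sym.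
rewrite big1 ?addr0; last first.
  by move=> i /andP[/negbTE i1 /negbTE i2]; rewrite /h i1 i2 subrr mulr0.
rewrite /h !eqxx [g2 == g1]eq_sym (negbTE g12) sub0r.
have -> : 1 - hit P G g1 g1 = hit P G g2 g1 by rewrite -(P_hit g1); ring.
ring.
Qed.

(** A constant [f] in [form]: the total current of the equilibrium potential is zero. *)
Lemma trace_rate_sym : mu g1 * hit P G g2 g1 = mu g2 * hit P G g1 g2.
Proof.
have := form (fun=> 1); rewrite big1 => [|i _]; last first.
  by rewrite big1// => j _; rewrite subrr mul0r mulr0.
lra.
Qed.

Lemma trace_rate_attained : exists f, [/\ f g1 = 1, f g2 = 0 &
  dirichlet P mu f = 2 * (mu g1 * hit P G g2 g1)].
Proof.
exists h; rewrite /h !eqxx [g2 == g1]eq_sym (negbTE g12); split => //.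
have := form h; rewrite {5 6}/h !eqxx [g2 == g1]eq_sym (negbTE g12) mulr0 subr0 mulr1 => <-.
by apply: eq_bigr => i _; apply: eq_bigr => j _; rewrite expr2.
Qed.

(** Expanding the nonnegative energy of [f - h]: by [form], pairing [h] with [f] or with itself
    gives the same value, as both have the same boundary values. *)
Lemma trace_rate_le (f : St -> R) : f g1 = 1 -> f g2 = 0 ->
  2 * (mu g1 * hit P G g2 g1) <= dirichlet P mu f.
Proof.
move=> f1 f2.
have := form h; rewrite {5 6}/h !eqxx [g2 == g1]eq_sym (negbTE g12) mulr0 subr0 mulr1 => Eh.
have := form f; rewrite f1 f2 mulr0 subr0 mulr1 => Ef.
have : 0 <= \sum_i \sum_j mu i * P i j * ((f j - f i) - (h j - h i)) ^+ 2.
  apply: sumr_ge0 => i _; apply: sumr_ge0 => j _.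
  by rewrite mulr_ge0 ?sqr_ge0// mulr_ge0// ltW.
have -> : \sum_i \sum_j mu i * P i j * ((f j - f i) - (h j - h i)) ^+ 2 =
   dirichlet P mu f - 2 * \sum_i \sum_j mu i * P i j * ((f j - f i) * (h j - h i)) +
   \sum_i \sum_j mu i * P i j * ((h j - h i) * (h j - h i)).
  rewrite /dirichlet mulr_sumr -sumrB -big_split /=; apply: eq_bigr => i _.
  rewrite mulr_sumr -sumrB -big_split /=; apply: eq_bigr => j _; ring.
rewrite Eh Ef; lra.
Qed.

End TwoPointTrace.

(** * Time changes and the Skorokhod distance *)

Section IntegralMonotone.
Context d (T : measurableType d) (R : realType) (mu : {measure set T -> \bar R}).

(* The integral of a non-measurable nonnegative function is the lower integral, hence monotone. *)
Lemma le_integral_nonmeas (D : set T) (f g : T -> \bar R) :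
  (forall x, D x -> (0 <= f x)%E) -> (forall x, D x -> (f x <= g x)%E) ->
  (\int[mu]_(x in D) f x <= \int[mu]_(x in D) g x)%E.
Proof.
move=> f0 fg.
have g0 x : D x -> (0 <= g x)%E by move=> Dx; apply: le_trans (f0 x Dx) (fg x Dx).
rewrite (ge0_integralE _ f0) (ge0_integralE _ g0); apply: ereal_sup_le.
move=> _ [h hf <-]; exists h => // x; apply: (le_trans (hf x)).
by rewrite /patch; case: ifPn => //; rewrite inE; exact: fg.
Qed.

End IntegralMonotone.

Section Jumps.
Variable R : realType.

(** Compactness of intervals as an induction principle: the supremum of the endpoints reached from
    [a] cannot stop before [b]. *)
Lemma interval_ind (Pr : R -> R -> Prop) :
  (forall a b c, a <= b <= c -> Pr a b -> Pr b c -> Pr a c) ->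
  (forall t, 0 <= t -> exists2 e, 0 < e &
     forall a b, 0 <= a -> t - e < a <= t -> t <= b < t + e -> Pr a b) ->
  forall a b, 0 <= a <= b -> Pr a b.
Proof.
move=> cat loc a b /andP[a0 ab].
pose S := [set s | a <= s <= b /\ Pr a s].
have Sa : S a.
  split; first by rewrite lexx.
  by have [e e0] := loc a a0; apply => //; lra.
have ubS : ubound S b by move=> s [/andP[]].
have hS : has_sup S by split; [exists a|exists b].
have at_ : a <= sup S by apply: ub_le_sup => //; exists b.
have tb : sup S <= b by apply: ge_sup => //; exists a.
have [e e0 He] := loc (sup S) (le_trans a0 at_).
have [s Ss es] := sup_adherent e0 hS.
have st : s <= sup S by apply: ub_le_sup => //; exists b.
case: Ss => /andP[as_ sb] Pas.
have Pat c : sup S <= c < sup S + e -> Pr a c.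
  move=> sc; apply: (cat _ s) => //; first by apply/andP; split; lra.
  by apply: He => //; [lra|apply/andP; split].
have [bt|bt] := ltP b (sup S + e); first by apply: Pat; rewrite tb.
suff : sup S + e / 2 <= sup S by lra.
apply: ub_le_sup; first by exists b.
split; first by apply/andP; split; lra.
by apply: Pat; apply/andP; split; lra.
Qed.

Variable E : eqType.

(* [s] contains all the jump times of [x] in [(a, b]]. *)
Definition jumps_on (x : R -> E) (a b : R) (s : seq R) : Prop :=
  forall u v, a <= u -> u <= v -> v <= b ->
    (forall c, c \in s -> ~~ (u < c <= v)) -> x u = x v.

Lemma cadlag_jumps (x : R -> E) (b : R) : cadlag x -> 0 <= b -> exists s, jumps_on x 0 b s.
Proof.
move=> [rc ll] b0.
apply: (@interval_ind (fun a b => exists s, jumps_on x a b s)); last by rewrite lexx.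
  move=> a1 b1 c1 /andP[ab bc] [s1 H1] [s2 H2]; exists (s1 ++ s2) => u v au uv vc Hs.
  have Hs1 u' v' : u <= u' -> v' <= v -> forall c, c \in s1 -> ~~ (u' < c <= v').
    move=> uu vv c cs; have := Hs c; rewrite mem_cat cs => /(_ isT).
    by apply: contra => /andP[??]; apply/andP; split; lra.
  have Hs2 u' v' : u <= u' -> v' <= v -> forall c, c \in s2 -> ~~ (u' < c <= v').
    move=> uu vv c cs; have := Hs c; rewrite mem_cat cs orbT => /(_ isT).
    by apply: contra => /andP[??]; apply/andP; split; lra.
  have [vb|bv] := leP v b1; first by apply: H1 => //; exact: Hs1.
  have [bu|ub] := leP b1 u; first by apply: H2 => //; exact: Hs2.
  by rewrite (H1 u b1) ?(H2 b1 v)//; do ?[exact: ltW|apply: Hs1|apply: Hs2] => //; exact: ltW.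
move=> t t0; have [e1 e10 H1] := rc t t0.
(* At time 0 there is no left limit to invoke, and none is needed since the left endpoint is then
   0. *)
have [t_0|t_neq0] := eqVneq t 0.
  exists e1 => // a1 b1 a0 /andP[_ at_] /andP[tb bt]; exists [::] => u v au uv vb _.
  by rewrite (H1 u) ?(H1 v)//; clear -t_0 a0 au uv vb at_ tb bt; apply/andP; split; lra.
have [z [e2 e20 H2]] := ll t ltac:(by rewrite lt_neqAle eq_sym t_neq0).
exists (Num.min e1 e2); first by rewrite lt_min e10.
move=> a1 b1 a0 /andP[ta at_] /andP[tb bt]; exists [:: t] => u v au uv vb Hs.
have m1 : Num.min e1 e2 <= e1 by rewrite ge_min lexx.
have m2 : Num.min e1 e2 <= e2 by rewrite ge_min lexx orbT.
have := Hs t; rewrite mem_seq1 eqxx => /(_ isT); rewrite negb_and -leNgt -ltNge.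
case/orP => h.
  by rewrite (H1 u) ?(H1 v)//; clear -h au uv vb ta m1 tb bt; apply/andP; split; lra.
by rewrite (H2 u) ?(H2 v)//; clear -h au uv vb ta at_ m2 bt tb; apply/andP; split; lra.
Qed.

End Jumps.

Section SkorokhodDistance.
Variables (R : realType) (E : eqType).
Implicit Types x y : R -> E.

Lemma sk_du_ge0_le1 x y lam u : 0 <= sk_du x y lam u <= 1.
Proof.
rewrite /sk_du; set S := [set _ | _].
have S0 : S (x (Num.min 0 u) != y (Num.min (lam 0) u))%:R by exists 0.
have ubS : ubound S 1 by move=> _ [t [_ ->]]; case: (_ != _).
apply/andP; split; last by apply: ge_sup => //; eexists; exact: S0.
by apply: le_trans (ub_le_sup _ S0); [case: (_ != _)|exists 1].
Qed.

Lemma sk_du_eq0 x y lam u :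
  (forall t, 0 <= t -> x (Num.min t u) = y (Num.min (lam t) u)) -> sk_du x y lam u = 0.
Proof.
move=> H; rewrite /sk_du (_ : [set _ | _] = [set 0]) ?sup1//.
apply/seteqP; split => [g [t [t0 ->]]|g ->] /=; first by rewrite H// eqxx.
by exists 0; split; rewrite // H// eqxx.
Qed.

Lemma sk_dist_le x y lam (b : R) : time_changes lam -> gamma_tc lam <= b ->
  Rintegral (@lebesgue_measure R) `[0, +oo[ (fun u => expR (- u) * sk_du x y lam u) <= b ->
  sk_dist x y <= b.
Proof.
move=> tl gb ib.
apply: (@le_trans _ _ (Num.max (gamma_tc lam) (Rintegral (@lebesgue_measure R) `[0, +oo[
  (fun u => expR (- u) * sk_du x y lam u)))); last by rewrite ge_max gb.
apply: ge_inf; last by exists lam.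
exists 0 => _ [l _ ->]; rewrite le_max; apply/orP; right.
apply: Rintegral_ge0 => u _; rewrite mulr_ge0 ?expR_ge0//.
by have /andP[] := sk_du_ge0_le1 x y l u.
Qed.

(** The integrand is at most 1 near the points of [s], and beyond [U] it is below
    [exp (- U / 2) * exp (- u / 2)], a multiple of the exponential density of rate 1/2.
    Measurability of [sk_du] is not established, so the comparison goes through the lower
    integral. *)
Lemma integral_sk_du_le x y lam (s : seq R) (eta U : R) : 0 <= eta -> 0 <= U ->
  (forall u, 0 <= u <= U -> (forall c, c \in s -> eta < `|u - c|) -> sk_du x y lam u = 0) ->
  Rintegral (@lebesgue_measure R) `[0, +oo[ (fun u => expR (- u) * sk_du x y lam u) <=
  (size s)%:R * (2 * eta) + 2 * expR (- (U / 2)).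
Proof.
move=> eta0 U0 H.
pose f c : R -> \bar R := fun u => (\1_(`[c - eta, c + eta]%classic : set R) u)%:E.
pose g : R -> \bar R := fun u => (2 * expR (- (U / 2)) * exponential_pdf (1/2) u)%:E.
have g0 u : (0 <= g u)%E.
  by rewrite lee_fin mulr_ge0 ?exponential_pdf_ge0 ?mulr_ge0 ?expR_ge0//; lra.
have f0 c u : (0 <= f c u)%E by rewrite lee_fin.
have mf c : measurable_fun [set: R] (f c).
  by apply/measurable_EFinP; apply: measurable_indic.
have mg : measurable_fun [set: R] g.
  apply/measurable_EFinP; apply: measurable_funM => //.
  exact: measurable_exponential_pdf.
have If c : (\int[@lebesgue_measure R]_u f c u = (2 * eta)%:E)%E.
  transitivity (lebesgue_measure (`[c - eta, c + eta]%classic : set R)).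
    by rewrite /f integral_indic// setIT.
  rewrite lebesgue_measure_itv/= lte_fin.
  case: ifPn => [_|]; first by rewrite -EFinB; congr EFin; ring.
  rewrite -leNgt => h; have -> : eta = 0 by lra.
  by rewrite mulr0.
have Ig : (\int[@lebesgue_measure R]_u g u = (2 * expR (- (U / 2)))%:E)%E.
  rewrite /g; under eq_integral do rewrite EFinM.
  rewrite ge0_integralZl//; first by rewrite integral_exponential_pdf ?mule1//; lra.
  - by apply/measurable_EFinP; exact: measurable_exponential_pdf.
  - by move=> u _; rewrite lee_fin exponential_pdf_ge0//; lra.
have I : (\int[@lebesgue_measure R]_(u in `[0%R, +oo[) (expR (- u) * sk_du x y lam u)%:E <=
    ((size s)%:R * (2 * eta) + 2 * expR (- (U / 2)))%:E)%E.
  rewrite integral_mkcond.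
  apply: (@le_trans _ _ (\int[@lebesgue_measure R]_u ((\sum_(c <- s) f c u) + g u))%E).
    have du_ge0 u : 0 <= expR (- u) * sk_du x y lam u.
      by rewrite mulr_ge0 ?expR_ge0//; case/andP: (sk_du_ge0_le1 x y lam u).
    apply: le_integral_nonmeas => u _.
      by rewrite /patch; case: ifP => // _; rewrite lee_fin.
    have sum0 : (0 <= \sum_(c <- s) f c u)%E by apply: sume_ge0.
    rewrite /patch; case: ifPn => [|_]; last by rewrite adde_ge0.
    rewrite inE /= in_itv /= andbT => u0.
    have /andP[d0 d1] := sk_du_ge0_le1 x y lam u.
    have [/hasP[c cs uc]|/hasPn nh] := boolP (has (fun c => `|u - c| <= eta) s).
      apply: (@le_trans _ _ 1%E).
        rewrite lee_fin -[leRHS]mulr1 ler_pM ?expR_ge0//.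
        by rewrite -expR0 ler_expR lerNl oppr0.
      apply: (@le_trans _ _ (\sum_(c <- s) f c u)%E); last by rewrite leeDl.
      apply: (@le_trans _ _ (f c u)).
        rewrite lee_fin indicE mem_set//= in_itv/=.
        by move: uc; rewrite ler_norml => /andP[? ?]; apply/andP; split; lra.
      by rewrite (big_rem c)//= leeDl// sume_ge0.
    have [uU|Uu] := leP u U.
      rewrite H ?mulr0 ?adde_ge0//; first by rewrite u0.
      by move=> c cs; rewrite ltNge; exact: nh.
    apply: (@le_trans _ _ (g u)); last by rewrite leeDr.
    rewrite lee_fin exponential_pdfE//.
    apply: (@le_trans _ _ (expR (- u))); first by rewrite ler_piMr ?expR_ge0.
    have -> : - u = - (u / 2) - u / 2 by lra.
    rewrite expRD mulrA.
    have -> : 2 * expR (- (U / 2)) * (1 / 2) = expR (- (U / 2)) by lra.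
    have -> : - (1 / 2) * u = - (u / 2) by lra.
    by rewrite ler_wpM2r ?expR_ge0// ler_expR; lra.
  rewrite ge0_integralD//; last 2 first.
  - by move=> u _; apply: sume_ge0.
  - by apply: emeasurable_sum => c; exact: mf.
  rewrite Ig ge0_integral_sum//.
  under eq_bigr do rewrite If.
  rewrite sumEFin EFinD leeD2r// lee_fin big_const_seq count_predT iter_addr_0.
  by rewrite [leRHS]mulr_natl.
rewrite /Rintegral.
have I0 : (0 <= \int[@lebesgue_measure R]_(u in `[0%R, +oo[) (expR (- u) * sk_du x y lam u)%:E)%E.
  apply: integral_ge0 => u _; rewrite lee_fin mulr_ge0 ?expR_ge0//.
  by case/andP: (sk_du_ge0_le1 x y lam u).
by rewrite -lee_fin fineK// ge0_fin_numE// (le_lt_trans I)// ltry.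
Qed.

(** A hat function which, rescaled by the separation of the jump times, moves one of them while
    fixing 0 and the others. *)
Definition tent (u : R) : R := Num.max 0 (1 - `|u|).

Lemma tent_lip u v : `|tent u - tent v| <= `|u - v|.
Proof.
have H a b : tent a - tent b <= `|a - b|.
  have ab : `|b| <= `|a| + `|a - b|.
    by rewrite -{1}(subKr a b) (le_trans (ler_normB _ _)).
  have : 0 <= `|a - b| by [].
  rewrite /tent !maxEle; case: ifP => ?; case: ifP => ?; lra.
by rewrite ler_norml; have := H v u; have := H u v; rewrite (distrC v u) => ? ?; apply/andP; split; lra.
Qed.

Lemma tent_eq0 u : 1 <= `|u| -> tent u = 0.
Proof. by move=> h; rewrite /tent; apply/max_idPl; lra. Qed.

Lemma tent0 : tent 0 = 1.
Proof. by rewrite /tent normr0 subr0; apply/max_idPr. Qed.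

Lemma tent_ge0_le1 u : 0 <= tent u <= 1.
Proof.
have : 0 <= `|u| by [].
by rewrite /tent maxEle; case: ifP => ? ?; apply/andP; split; lra.
Qed.

Lemma separated_seq (s : seq R) : (forall c, c \in s -> 0 < c) -> exists2 rho : R, 0 < rho &
  forall c, c \in s -> rho <= c /\ (forall b, b \in s -> b != c -> rho <= `|b - c|).
Proof.
elim: s => [|a s IH] pos; first by exists 1.
have [|rho rho0 H] := IH; first by move=> c cs; apply: pos; rewrite inE cs orbT.
have [r1 r10 H1] : exists2 r1 : R, 0 < r1 & forall b, b \in s -> b != a -> r1 <= `|b - a|.
  elim: s {IH pos H} => [|b s [r1 r10 H1]]; first by exists 1.
  have [ba|ba] := eqVneq b a.
    by exists r1 => // c; rewrite inE => /orP[/eqP->|/H1//]; rewrite ba eqxx.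
  exists (Num.min r1 `|b - a|); first by rewrite lt_min r10 normr_gt0 subr_eq0.
  move=> c; rewrite inE => /orP[/eqP-> _|cs ca]; first by rewrite ge_min lexx orbT.
  by rewrite ge_min H1.
have a0 : 0 < a by apply: pos; rewrite inE eqxx.
exists (Num.min (Num.min rho r1) a); first by rewrite !lt_min rho0 r10 a0.
move=> c; rewrite inE => /orP[/eqP->|cs].
  split; first by rewrite ge_min lexx orbT.
  move=> b; rewrite inE => /orP[/eqP->|bs ba]; first by rewrite eqxx.
  by rewrite !ge_min H1// orbT.
split; first by rewrite !ge_min (H c cs).1.
move=> b; rewrite inE => /orP[/eqP-> ac|bs bc].
  by rewrite distrC !ge_min H1 1?eq_sym// orbT.
by rewrite !ge_min (H c cs).2.
Qed.

Lemma norm_ln_le (z eta : R) : 0 <= eta <= 1/2 -> 1 - eta <= z <= 1 + eta -> `|ln z| <= 2 * eta.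
Proof.
move=> /andP[e0 e1] /andP[z1 z2].
have z0 : 0 < z by lra.
rewrite ler_norml; apply/andP; split; last first.
  have := @le_ln1Dx R (z - 1) ltac:(lra).
  have -> : 1 + (z - 1) = z by lra.
  lra.
rewrite lerNl -lnV ?posrE//.
have := @le_ln1Dx R (z^-1 - 1) ltac:(by have := invr_gt0 z; rewrite z0 => ?; lra).
have -> : 1 + (z^-1 - 1) = z^-1 by lra.
move=> /le_trans; apply; rewrite lerBlDl -div1r ler_pdivrMr//.
have : (1 + 2 * eta) * (1 - eta) <= (1 + 2 * eta) * z by rewrite ler_wpM2l; lra.
have : 0 <= eta * (1 - 2 * eta) by rewrite mulr_ge0; lra.
rewrite !mulrDl !mulrDr; lra.
Qed.

(** [k c] is the time at which [phi] crosses the jump time [c], but the value of [phi] exactly at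
    [k c] is unknown. Right continuity of [x] composed with [phi] permits looking at [lam t + e']
    instead, after all crossings up to [lam t] and before the next one. There [phi] and [t] lie on
    the same side of every jump of [x]. *)
Lemma time_warp_match x (phi lam k : R -> R) (s : seq R) (B : R) :
  (forall u v, 0 <= u -> u <= v -> v <= B ->
     (forall c, c \in s -> ~~ (u < c <= v)) -> x u = x v) ->
  cadlag (fun t => x (phi t)) ->
  (forall t u, t < u -> lam t < lam u) -> lam 0 = 0 ->
  (forall c, c \in s -> lam c = k c) ->
  (forall c t, c \in s -> k c < t -> c <= phi t) ->
  (forall c t, 0 <= t -> t < k c -> phi t < c) ->
  (forall t, 0 <= t -> 0 <= phi t) ->
  forall t, 0 <= t -> t <= B -> (forall u, lam t <= u <= lam t + 1 / 4 -> phi u <= B) ->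
  x (phi (lam t)) = x t.
Proof.
move=> Hs [rc _] lam_mono lam0 lam_c after before phi_ge0 t t0 tB phiB.
have lam_le u v : u <= v -> lam u <= lam v.
  by rewrite le_eqVlt => /orP[/eqP->//|/lam_mono/ltW].
have lt0 : 0 <= lam t by rewrite -lam0 lam_le.
have [e e0 He] := rc (lam t) lt0.
have [e' [e'0 e'e e'1 He']] : exists e', [/\ 0 < e', e' < e, e' <= 1/4 &
    forall c, c \in s -> lam t < k c -> lam t + e' < k c].
  clear -e0.
  elim: s => [|c l [e' [e'0 e'e e'1 He']]].
    exists (Num.min (e / 2) (1/4)); split => //.
    - by rewrite lt_min !divr_gt0.
    - by rewrite (@le_lt_trans _ _ (e / 2)) ?ge_min ?lexx//; lra.
    - by rewrite ge_min lexx orbT.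
  have [h|h] := ltP (lam t) (k c); last first.
    exists e'; split => // b; rewrite inE => /orP[/eqP->|bl hb]; first by lra.
    exact: He'.
  have m1 : Num.min e' ((k c - lam t) / 2) <= e' by rewrite ge_min lexx.
  have m2 : Num.min e' ((k c - lam t) / 2) <= (k c - lam t) / 2 by rewrite ge_min lexx orbT.
  exists (Num.min e' ((k c - lam t) / 2)); split; [|lra|lra|].
    by rewrite lt_min e'0 divr_gt0// subr_gt0.
  move=> b; rewrite inE => /orP[/eqP-> _|bl hb]; first by lra.
  by have := He' b bl hb; lra.
rewrite -(He (lam t + e')); last by clear -e'0 e'e; apply/andP; split; lra.
have v0 : 0 <= phi (lam t + e') by apply: phi_ge0; clear -lt0 e'0; lra.
have vB : phi (lam t + e') <= B by apply: phiB; clear -e'0 e'1; apply/andP; split; lra.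
have crossed c : c \in s -> (c <= t) = (c <= phi (lam t + e')).
  move=> cs; apply/idP/idP => ct.
    apply: after => //; have := lam_le _ _ ct; rewrite (lam_c c cs); clear -e'0; lra.
  rewrite leNgt; apply/negP => tc; have := lam_mono _ _ tc; rewrite (lam_c c cs) => h.
  have le0 : 0 <= lam t + e' by clear -lt0 e'0; lra.
  by have := before c _ le0 (He' c cs h); rewrite ltNge ct.
have [tv|vt] := leP t (phi (lam t + e')).
  apply/esym; apply: Hs => // c cs; rewrite -crossed//.
  by apply/negP => /andP[h1 h2]; move: h1; rewrite ltNge h2.
apply: Hs => //; first exact: ltW.
by move=> c cs; rewrite crossed//; apply/negP => /andP[h1 h2]; move: h1; rewrite ltNge h2.
Qed.

(** Stopping at [u] can affect [t] and [lam t] differently, but both times involved are then within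
    [D] of [u], where [x] does not jump. *)
Lemma sk_du_eq0_match x y (lam : R -> R) (U D u : R) :
  0 <= D <= 1 -> (forall t u, t < u -> lam t < lam u) ->
  (forall u, 0 <= u -> exists t, 0 <= t /\ lam t = u) ->
  (forall t, `|lam t - t| <= D) ->
  (forall t, 0 <= t -> t <= U + 2 -> y (lam t) = x t) ->
  0 <= u <= U ->
  (forall a b, 0 <= a -> a <= b -> b <= U + 2 -> u - D <= a -> b <= u + D -> x a = x b) ->
  sk_du x y lam u = 0.
Proof.
move=> /andP[D0 D1] lam_mono surj lam_id key /andP[u0 uU] flat; apply: sk_du_eq0 => t t0.
have := lam_id t; rewrite ler_norml => /andP[lt1 lt2].
have [tu|ut] := leP t u; have [lu|ul] := leP (lam t) u.
- by rewrite key//; lra.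
- have [t' [t'0 t'u]] := surj u u0.
  have := lam_id t'; rewrite ler_norml => /andP[lt'1 lt'2].
  have t't : t' <= t.
    by rewrite leNgt; apply/negP => /lam_mono; clear -t'u ul; lra.
  rewrite -t'u key//; last by clear -t't tu uU; lra.
  by apply/esym; apply: flat => //; clear -t't tu uU D0 D1 t'u lt'1 lt'2; lra.
- rewrite key//; last by clear -lt1 lu uU D1; lra.
  by apply: flat => //; clear -u0 uU lt1 lt2 ut lu D0 D1; lra.
- have [t' [t'0 t'u]] := surj u u0.
  have := lam_id t'; rewrite ler_norml => /andP[lt'1 lt'2].
  rewrite -{2}t'u key//; last by clear -t'u lt'1 uU D1; lra.
  by have [?|/ltW ?] := leP u t'; [|apply/esym]; apply: flat => //; clear -u0 uU lt1 lt2 ut t'u lt'1 lt'2 ul D0 D1; lra.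
Qed.

(* The time change moves every jump time [c] of [x] to the time at which [phi]
   crosses [c]; it differs from the identity by a sum of small tents. *)
Lemma sk_dist_time_warp x (eps : R) : cadlag x -> 0 < eps ->
  exists2 del : R, 0 < del & exists2 V : R, 0 <= V & forall phi : R -> R,
    (forall s t, 0 <= s -> s <= t -> phi s <= phi t) -> (forall t, 0 <= t -> 0 <= phi t) ->
    (forall t, 0 <= t <= V -> `|phi t - t| <= del) -> cadlag (fun t => x (phi t)) ->
    sk_dist x (fun t => x (phi t)) < eps.
Proof.
move=> cx eps0.
have [U U0 HU] : exists2 U : R, 0 <= U & 2 * expR (- (U / 2)) <= eps / 4.
  exists (2 * Num.max 0 (- ln (eps / 8))); first by rewrite mulr_ge0// le_max lexx.
  have -> : 2 * Num.max 0 (- ln (eps / 8)) / 2 = Num.max 0 (- ln (eps / 8)) by field.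
  have : expR (- Num.max 0 (- ln (eps / 8))) <= expR (ln (eps / 8)).
    by rewrite ler_expR lerNl le_max lexx orbT.
  rewrite lnK ?posrE; last by rewrite divr_gt0.
  lra.
(* Margins: for [t <= U + 2], the time [lam t + 1/4] is at most [U + 3 + 1/4], and [phi] adds at
   most 1 more. The extra unit in [U + 6] leaves room to see [phi] cross a jump time at [U + 5]. *)
have [s0 Hs0] := @cadlag_jumps R E x (U + 5) cx ltac:(lra).
pose s := undup [seq c <- s0 | 0 < c <= U + 5].
have us : uniq s by exact: undup_uniq.
have ins c : c \in s = (0 < c <= U + 5) && (c \in s0) by rewrite mem_undup mem_filter.
have Hs u v : 0 <= u -> u <= v -> v <= U + 5 -> (forall c, c \in s -> ~~ (u < c <= v)) -> x u = x v.
  move=> u0 uv vU H; apply: Hs0 => // c cs0; apply/negP => /andP[uc cv].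
  have /negP := H c ltac:(rewrite ins cs0 andbT; apply/andP; split; lra).
  by apply; rewrite uc cv.
have spos c : c \in s -> 0 < c by rewrite ins => /andP[/andP[]].
have sle c : c \in s -> c <= U + 5 by rewrite ins => /andP[/andP[]].
have [rho rho0 Hrho] := separated_seq spos.
pose n : R := (size s)%:R.
have n0 : 0 <= n by rewrite ler0n.
(* The bounds on [n * del] serve in turn to make the slopes of [lam] within [eps / 8] of 1, to keep
   these slopes positive, to make the exceptional set around the jumps small, and to keep
   displacements below 1. *)
pose del : R := Num.min 1 (Num.min (eps * rho / 8) (Num.min (rho / 2) (Num.min (eps / 16 / (n + 1)) 1)) / (n + 1)).
have m0 : 0 < n + 1 by rewrite ltr_wpDl.
have del0 : 0 < del.
  by rewrite /del lt_min ltr01 /= divr_gt0// !lt_min ltr01 !divr_gt0// mulr_gt0.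
have nd : n * del <= Num.min (eps * rho / 8) (Num.min (rho / 2) (Num.min (eps / 16 / (n + 1)) 1)).
  apply: (@le_trans _ _ ((n + 1) * del)); first by rewrite ler_wpM2r ?lerDl// ltW.
  rewrite mulrC -ler_pdivlMr ?ltr_wpDl//.
  by rewrite /del ge_min lexx orbT.
have nd1 : n * del <= eps * rho / 8 by apply: le_trans nd _; rewrite ge_min lexx.
have nd2 : n * del <= rho / 2 by apply: le_trans nd _; rewrite !ge_min lexx orbT.
have nd3 : n * del <= eps / 16 / (n + 1) by apply: le_trans nd _; rewrite !ge_min lexx !orbT.
have nd4 : n * del <= 1 by apply: le_trans nd _; rewrite !ge_min lexx !orbT.
have del1 : del <= 1 by rewrite /del ge_min lexx.
exists del => //; exists (U + 6); first by lra.
move=> phi phi_mono phi_ge0 phi_del cy.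
set y := fun t => x (phi t) in cy *.
(* [phi] may jump over [c] without taking this value, so the crossing time is an infimum. *)
pose C c := [set t | 0 <= t /\ c <= phi t].
pose k c := inf (C c).
have Clb c : has_lbound (C c) by exists 0 => t [].
have Ck c : c \in s -> C c (c + del).
  move=> cs; have c0 := spos c cs; have cU := sle c cs.
  split; first by lra.
  have := phi_del (c + del) ltac:(clear -c0 cU del0 del1; lra); rewrite ler_norml => /andP[+ _]; clear; lra.
have kle c : c \in s -> k c <= c + del by move=> cs; apply: ge_inf => //; exact: Ck.
have kge c : c \in s -> c - del <= k c.
  move=> cs; have c0 := spos c cs; have cU := sle c cs.
  apply: lb_le_inf; first by eexists; exact: Ck.
  move=> t [t0 ct]; rewrite leNgt; apply/negP => h.
  have := phi_del t ltac:(clear -t0 cU h del0; apply/andP; split; lra); rewrite ler_norml => /andP[_]; clear -h ct; lra.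
have kabs c : c \in s -> `|k c - c| <= del.
  by move=> cs; rewrite ler_norml; have := kle c cs; have := kge c cs; clear => ? ?; apply/andP; split; lra.
have after c t : c \in s -> k c < t -> c <= phi t.
  move=> cs kt; have [|t1 [t10 ct1] t1t] := @inf_lt R (C c) t _ kt.
    by eexists; exact: Ck.
  by apply: le_trans ct1 _; apply: phi_mono => //; exact: ltW.
have before c t : 0 <= t -> t < k c -> phi t < c.
  move=> t0 tk; rewrite ltNge; apply/negP => h.
  by have := ge_inf (Clb c) (conj t0 h : C c t); rewrite leNgt tk.
pose pert t := \sum_(c <- s) (k c - c) * tent ((t - c) / rho).
pose lam t := t + pert t.
have sumle (f : R -> R) b : (forall c, c \in s -> `|f c| <= b) -> `|\sum_(c <- s) f c| <= n * b.
  move=> fb; apply: (le_trans (ler_norm_sum _ _ _)).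
  apply: (@le_trans _ _ (\sum_(c <- s) b)).
    by rewrite big_seq [leRHS]big_seq; apply: ler_sum.
  by rewrite big_const_seq count_predT iter_addr_0 mulr_natl.
have pert_abs t : `|pert t| <= n * del.
  apply: sumle => c cs; rewrite normrM -[leRHS]mulr1 ler_pM// ?kabs//.
  by have /andP[? ?] := tent_ge0_le1 ((t - c) / rho); rewrite ger0_norm.
pose eta := n * del / rho.
have eta0 : 0 <= eta by rewrite divr_ge0 ?mulr_ge0// ltW.
have eta1 : eta <= 1/2 by rewrite /eta ler_pdivrMr//; clear -nd2; lra.
have eta2 : eta <= eps / 8 by rewrite /eta ler_pdivrMr//; clear -nd1; lra.
have pert_lip t u : `|pert t - pert u| <= eta * `|t - u|.
  rewrite /pert -sumrB /eta.
  have -> : n * del / rho * `|t - u| = n * (del * (`|t - u| / rho)) by ring.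
  apply: sumle => c cs; rewrite -mulrBr normrM ler_pM ?kabs//.
  apply: (le_trans (tent_lip _ _)); rewrite -mulrBl opprB addrA subrK normrM.
  by rewrite [`|rho^-1|]gtr0_norm ?invr_gt0.
have lam_c c : c \in s -> lam c = k c.
  move=> cs; rewrite /lam /pert (bigD1_seq c)//= subrr mul0r tent0 mulr1.
  rewrite big_seq_cond big1 => [|b /andP[bs bc]]; first by rewrite addr0 addrC subrK.
  rewrite tent_eq0 ?mulr0// normrM [`|rho^-1|]gtr0_norm ?invr_gt0//.
  by rewrite ler_pdivlMr// mul1r distrC (Hrho c cs).2.
have lam0 : lam 0 = 0.
  rewrite /lam /pert big_seq big1 ?addr0// => c cs.
  rewrite tent_eq0 ?mulr0// sub0r normrM normrN [`|rho^-1|]gtr0_norm ?invr_gt0//.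
  by rewrite ler_pdivlMr// mul1r ger0_norm ?(Hrho c cs).1// ltW// spos.
have slope t u : t < u -> (1 - eta) * (u - t) <= lam u - lam t <= (1 + eta) * (u - t).
  move=> tu; have E1 : `|u - t| = u - t by rewrite gtr0_norm// subr_gt0.
  have := pert_lip u t; rewrite E1.
  rewrite ler_norml /lam => /andP[h1 h2].
  by clear -h1 h2; apply/andP; split; rewrite mulrDl mul1r ?mulNr; lra.
have lam_mono t u : t < u -> lam t < lam u.
  move=> tu; have /andP[h _] := slope t u tu.
  by rewrite -subr_gt0 (lt_le_trans _ h)// mulr_gt0 ?subr_gt0//; clear -eta1; lra.
have lam_le t u : t <= u -> lam t <= lam u.
  by rewrite le_eqVlt => /orP[/eqP->//|/lam_mono/ltW].
have lam_id t : `|lam t - t| <= n * del by rewrite /lam addrAC subrr add0r.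
have lam_cont : continuous lam.
  move=> t; apply/cvgrPdist_le => e e0; exists (e / 2) => /=; first by rewrite divr_gt0.
  move=> u /= tu; have : `|lam t - lam u| <= 2 * `|t - u|.
    rewrite /lam opprD addrACA (le_trans (ler_normD _ _))//.
    have := pert_lip t u; have : eta * `|t - u| <= `|t - u| by rewrite ler_piMl//; clear -eta1; lra.
    clear; lra.
  move=> /le_trans; apply; clear -tu; lra.
have surj u : 0 <= u -> exists t, 0 <= t /\ lam t = u.
  move=> u0.
  have hb := lam_id (u + n * del); rewrite ler_norml in hb.
  have nd0 : 0 <= n * del by rewrite mulr_ge0// ltW.
  have [|c] := @IVT R lam 0 (u + n * del) u ltac:(clear -u0 nd0; lra) (continuous_subspaceT lam_cont).
    by rewrite lam0; apply/andP; split; [rewrite ge_min u0|rewrite le_max; apply/orP; right; clear -hb; lra].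
  by rewrite in_itv/= => /andP[c0 _] <-; exists c.
have ln_bound t u : 0 <= t < u -> `|ln ((lam u - lam t) / (u - t))| <= 2 * eta.
  move=> /andP[t0 tu]; have /andP[h1 h2] := slope t u tu.
  have ut : 0 < u - t by rewrite subr_gt0.
  apply: norm_ln_le; first by rewrite eta0.
  by rewrite ler_pdivlMr// h1 ler_pdivrMr.
have tc : time_changes lam.
  split => //; first by move=> u t /andP[_]; exact: lam_mono.
  by exists (2 * eta) => u t; exact: ln_bound.
have gam : gamma_tc lam <= 2 * eta.
  apply: ge_sup; first by exists `|ln ((lam 1 - lam 0) / (1 - 0))|, 1, 0; rewrite lexx ltr01.
  by move=> _ [u [t [tu ->]]]; exact: ln_bound.
have key t : 0 <= t -> t <= U + 2 -> y (lam t) = x t.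
  move=> t0 tU.
  apply: (@time_warp_match x phi lam k s (U + 5)) => //; first by clear -tU; lra.
  move=> u /andP[ltu ulu].
  have := lam_id t; rewrite ler_norml => /andP[l1 l2].
  have lt0 : 0 <= lam t by rewrite -lam0 lam_le.
  have uV : 0 <= u <= U + 6 by clear -lt0 ltu ulu l2 tU nd4; apply/andP; split; lra.
  have := phi_del u uV; rewrite ler_norml => /andP[_].
  clear -ulu l2 tU nd4 del1; lra.
have du0 u : 0 <= u <= U -> (forall c, c \in s -> n * del < `|u - c|) -> sk_du x y lam u = 0.
  move=> uU far; apply: (@sk_du_eq0_match x y lam U (n * del)) => //.
    by rewrite nd4 mulr_ge0// ltW.
  move=> a b a0 ab bU ua bu; apply: Hs => //; first by clear -bU; lra.
  move=> c cs; apply/negP => /andP[ac cb].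
  by have := far c cs; rewrite ltNge => /negP; apply; rewrite ler_norml; clear -ua bu ac cb; apply/andP; split; lra.
apply: (@le_lt_trans _ _ (eps / 2)); last by clear -eps0; lra.
apply: (sk_dist_le tc); first by clear -gam eta2 eps0; lra.
apply: (le_trans (integral_sk_du_le _ U0 du0)); first by rewrite mulr_ge0// ltW.
have : (n + 1) * (n * del) <= eps / 16 by rewrite mulrC -ler_pdivlMr ?ltr_wpDl.
have : 0 <= n * del by rewrite mulr_ge0// ltW.
rewrite -/n mulrDl mul1r; clear -HU eps0; lra.
Qed.

End SkorokhodDistance.

(** * Occupation times and discretized traces *)

Section Occupation.
Variables (R : realType) (Om : Type) (St : eqType) (X : Om -> R -> St) (G : pred St) (w : Om).
Let x := X w.
Hypothesis cx : cadlag x.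
Let mu := @lebesgue_measure R.

Let B (a b : R) : set R := [set s | a <= s <= b /\ x s \in G].

(** Around any time a cadlag path has one value before and one value after, so the set is locally a
    union of two intervals; [interval_ind] pieces these together. *)
Let mB a b : 0 <= a <= b -> measurable (B a b).
Proof.
apply: (@interval_ind R (fun a b => measurable (B a b))) => [a1 b1 c1 /andP[ab bc] m1 m2|t t0].
  have -> : B a1 c1 = B a1 b1 `|` B b1 c1; last exact: measurableU.
  apply/seteqP; split => s.
    move=> [/andP[as_ sc] xs]; have [sb|/ltW bs] := leP s b1; first by left; rewrite /B/= as_.
    by right; rewrite /B/= bs.
  move=> [[/andP[? ?] xs]|[/andP[? ?] xs]]; split => //; apply/andP; split; lra.
clear a b; have [e1 e10 H1] := cx.1 t t0.
have mr b : measurable ([set s | t <= s <= b /\ x t \in G] : set R).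
  have [Gt|Gt] := boolP (x t \in G).
    rewrite (_ : [set _ | _] = `[t, b]%classic); first exact: measurable_itv.
    by apply/seteqP; split => s /=; rewrite in_itv/=; [case|].
  rewrite (_ : [set _ | _] = set0); first exact: measurable0.
  by apply/seteqP; split => s //= [].
have [t_0|t_neq0] := eqVneq t 0.
  exists e1 => // a1 b1 a0 /andP[_ at_] /andP[tb bt].
  rewrite (_ : B a1 b1 = [set s | t <= s <= b1 /\ x t \in G]); first exact: mr.
  have -> : a1 = t by lra.
  by apply/seteqP; split => s [/andP[? ?]]; (rewrite H1 => [|//]; last by apply/andP; split; lra) || (rewrite -(H1 s) => [|//]; last by apply/andP; split; lra) => ?; split => //; apply/andP.
have [z [e2 e20 H2]] := cx.2 t ltac:(by rewrite lt_neqAle eq_sym t_neq0).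
exists (Num.min e1 e2); first by rewrite lt_min e10.
move=> a1 b1 a0 /andP[ta at_] /andP[tb bt].
have m1 : Num.min e1 e2 <= e1 by rewrite ge_min lexx.
have m2 : Num.min e1 e2 <= e2 by rewrite ge_min lexx orbT.
have ml : measurable ([set s | a1 <= s < t /\ z \in G] : set R).
  have [Gt|Gt] := boolP (z \in G).
    rewrite (_ : [set _ | _] = `[a1, t[%classic); first exact: measurable_itv.
    by apply/seteqP; split => s /=; rewrite in_itv/=; [case|].
  rewrite (_ : [set _ | _] = set0); first exact: measurable0.
  by apply/seteqP; split => s //= [].
rewrite (_ : B a1 b1 = [set s | a1 <= s < t /\ z \in G] `|` [set s | t <= s <= b1 /\ x t \in G]).
  exact: measurableU.
apply/seteqP; split => s.
  move=> [/andP[as_ sb] xs]; have [ts|st] := leP t s.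
    right; split; first by rewrite ts.
    by rewrite -(H1 s)//; apply/andP; split; lra.
  left; split; first by rewrite as_.
  by rewrite -(H2 s)//; apply/andP; split; lra.
move=> [[/andP[as_ st] xs]|[/andP[ts sb] xs]].
  split; first by apply/andP; split; lra.
  by rewrite (H2 s)//; apply/andP; split; lra.
split; first by apply/andP; split; lra.
by rewrite (H1 s)//; apply/andP; split; lra.
Qed.

Let o t := occupation X G w t.

Let oE t : 0 <= t -> mu (B 0 t) = (o t)%:E.
Proof.
move=> t0; have mBt : measurable (B 0 t) by apply: mB; rewrite lexx.
rewrite /o /occupation /Rintegral.
have -> : (\int[mu]_(s in `[0%R, t]) ((X w s \in G)%:R)%:E = mu (B 0%R t))%E.
  transitivity (\int[mu]_(s in `[0%R, t]) (\1_(B 0%R t) s)%:E)%E.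
    apply: eq_integral => s; rewrite inE/= in_itv/= => st.
    rewrite indicE; congr ((nat_of_bool _)%:R%:E).
    by apply/idP/idP => [h|]; [apply/mem_set; split|rewrite inE => -[]].
  rewrite integral_indic//.
  congr (mu _); apply/seteqP; split => s; first by case.
  by move=> Bs; split => //=; rewrite in_itv/=; case: Bs.
rewrite fineK// ge0_fin_numE//.
apply: (@le_lt_trans _ _ (mu `[0, t]%classic)).
  apply: le_measure; rewrite ?inE//.
  by move=> s [st _]; rewrite /= in_itv.
by rewrite [mu _]lebesgue_measure_itv/=; case: ifP; rewrite ?ltry// -EFinB ltry.
Qed.

Let itv_len (i : interval R) a b : i.1 = BSide true a \/ i.1 = BSide false a ->
  i.2 = BSide true b \/ i.2 = BSide false b -> a <= b -> mu [set` i] = (b - a)%:E.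
Proof.
move=> i1 i2 ab; rewrite [LHS]lebesgue_measure_itv.
have -> : (i.1 : \bar R) = a%:E by case: i1 => ->.
have -> : (i.2 : \bar R) = b%:E by case: i2 => ->.
rewrite lte_fin; case: ifPn => [_|]; first by rewrite -EFinB.
by rewrite -leNgt => ba; congr EFin; lra.
Qed.

Lemma occupation0 : o 0 = 0.
Proof.
apply/EFin_inj; rewrite -oE//; apply/eqP; rewrite eq_le measure_ge0 andbT.
apply: (@le_trans _ _ (mu [set 0])); last by rewrite [mu _]lebesgue_measure_set1.
apply: le_measure; rewrite ?inE//; first by apply: mB; rewrite lexx.
by move=> s [/andP[? ?] _] /=; lra.
Qed.

Lemma occupation_incr s t : 0 <= s <= t -> 0 <= o t - o s <= t - s.
Proof.
move=> /andP[s0 st]; have t0 : 0 <= t by lra.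
have ms : measurable (B 0 s) by apply: mB; rewrite lexx.
have mt : measurable (B 0 t) by apply: mB; rewrite lexx.
apply/andP; split.
  rewrite subr_ge0 -lee_fin -!oE//; apply: le_measure; rewrite ?inE//.
  by move=> u [/andP[? ?] ?]; split => //; apply/andP; split; lra.
rewrite lerBlDl -lee_fin EFinD -!oE// -(@itv_len `]s, t] s t) /=; [|by right|by right|by []].
apply: (@le_trans _ _ (mu (B 0 s `|` `]s, t]%classic))).
  apply: le_measure; rewrite ?inE//; first by apply: measurableU => //; exact: measurable_itv.
  move=> u [/andP[u0 ut] xu]; have [us|su] := leP u s; first by left; split => //; rewrite u0.
  by right; rewrite /= in_itv/= su.
by apply: measureU2 => //; exact: measurable_itv.
Qed.

Lemma occupation_inside s t : 0 <= s <= t -> (forall u, s <= u < t -> x u \in G) ->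
  o t - o s = t - s.
Proof.
move=> st H; apply/eqP; rewrite eq_le (andP (occupation_incr st)).2 /=.
move: st => /andP[s0 st]; have t0 : 0 <= t by lra.
have ms : measurable (B 0 s) by apply: mB; rewrite lexx.
have mt : measurable (B 0 t) by apply: mB; rewrite lexx.
rewrite lerBrDl -lee_fin EFinD -!oE// -(@itv_len `]s, t[ s t) /=; [|by right|by left|by []].
rewrite -measureU//; last first.
  by apply/seteqP; split => u //= [[/andP[? ?] _]]; rewrite in_itv/= => /andP[? ?]; lra.
apply: le_measure; rewrite ?inE//; first by apply: measurableU => //; exact: measurable_itv.
move=> u [[/andP[? ?] xu]|/=].
  by split => //; apply/andP; split; lra.
rewrite in_itv/= => /andP[? ?]; split; first by apply/andP; split; lra.
by apply: H; apply/andP; split; lra.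
Qed.

Lemma occupation_outside s t : 0 <= s <= t -> (forall u, s <= u < t -> x u \notin G) ->
  o t = o s.
Proof.
move=> st H; apply/eqP; rewrite eq_le andbC -subr_ge0 (andP (occupation_incr st)).1 /=.
move: st => /andP[s0 st]; have t0 : 0 <= t by lra.
have ms : measurable (B 0 s) by apply: mB; rewrite lexx.
have mt : measurable (B 0 t) by apply: mB; rewrite lexx.
(* The path may already be in [G] at time [t] itself; this single point has measure zero. *)
have E : mu (B 0 s `|` [set t]) = mu (B 0 s) by apply: measureU0 => //; exact: lebesgue_measure_set1.
rewrite -lee_fin -!oE// -E.
apply: le_measure; rewrite ?inE//; first exact: measurableU.
move=> u [/andP[u0 ut] xu]; have [us|su] := leP u s; first by left; split => //; rewrite u0.
right => /=; apply/eqP; rewrite eq_le ut leNgt /=; apply/negP => tu.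
by move: xu; apply/negP; apply: H; rewrite tu ltW.
Qed.

End Occupation.

Lemma count_le_split (R : realType) (s : seq R) (a b : R) : a <= b ->
  count (fun c => c <= b) s = (count (fun c => c <= a)%R s + count (fun c => a < c <= b)%R s)%N.
Proof.
move=> ab; elim: s => //= c s ->.
have [ca|ac] := leP c a => /=; first by rewrite (le_trans ca ab) add0n addnA.
by have [cb|bc] := leP c b => /=; lia.
Qed.

(** Turns a rank in the list of visits into a number of visits, which is what the Riemann sum of the
    occupation time measures. *)
Lemma count_nth_filter_iota (p : pred nat) (J k : nat) :
  (k < size (seq.filter p (iota 0 J)))%N ->
  count p (iota 0 (nth 0 (seq.filter p (iota 0 J)) k)) = k.
Proof.
set I := seq.filter p _ => kI.
have uI : uniq I by rewrite filter_uniq// iota_uniq.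
set m := nth 0 I k.
have : m \in I by exact: mem_nth.
rewrite mem_filter mem_iota add0n => /andP[pm /andP[_ mJ]].
have IE : I = seq.filter p (iota 0 m) ++ m :: seq.filter p (iota m.+1 (J - m).-1).
  rewrite /I -{1}(subnKC (ltnW mJ)) iotaD filter_cat add0n; congr (_ ++ _).
  by rewrite -{1}(@prednK (J - m)) ?subn_gt0//= pm.
rewrite -[RHS](index_uniq 0%N kI uI) -/m IE index_cat mem_filter mem_iota add0n ltnn andbF.
by rewrite andbF /= eqxx addn0 size_filter.
Qed.

(** Beyond the end of [s] the last value is kept; this makes the identity with a time-changed trace
    valid at all nonnegative times. *)
Definition step_path (R : realType) (St : Type) (z : St) (s : seq St) (h t : R) : St :=
  nth z s (minn (Num.truncn (t / h)) (size s).-1).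

Lemma cadlag_step (R : realType) (E : Type) (f : nat -> E) (h : R) : 0 < h ->
  cadlag (fun t => f (Num.truncn (t / h))).
Proof.
move=> h0; split => t t0.
  have th : 0 <= t / h by rewrite divr_ge0// ltW.
  have /andP[k1 k2] := truncn_itv th.
  exists ((Num.truncn (t / h)).+1%:R * h - t); first by rewrite subr_gt0 -ltr_pdivrMr.
  move=> s /andP[ts st]; congr f; apply: truncn_def; apply/andP; split.
    by rewrite (le_trans k1)// ler_pM2r ?invr_gt0.
  by rewrite ltr_pdivrMr//; lra.
have th : 0 <= t / h by rewrite divr_ge0// ltW.
have /andP[k1 k2] := truncn_itv th.
have [kt|kt] := eqVneq ((Num.truncn (t / h))%:R : R) (t / h).
  exists (f (Num.truncn (t / h)).-1), h => // s /andP[ts st]; congr f.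
  have k0 : (0 < Num.truncn (t / h))%N by rewrite lt0n -(pnatr_eq0 R) kt mulf_neq0 ?invr_neq0 ?gt_eqF.
  move: kt k0; case: (Num.truncn (t / h)) => // k kt _; apply: truncn_def.
  have tk : t = k%:R * h + h by rewrite -[t](@divfK _ h) ?gt_eqF// -kt -natr1 mulrDl mul1r.
  rewrite ler_pdivlMr// ltr_pdivrMr// -natr1 mulrDl mul1r -tk st andbT /=; lra.
exists (f (Num.truncn (t / h))), (t - (Num.truncn (t / h))%:R * h).
  by rewrite subr_gt0 -ltr_pdivlMr// lt_neqAle kt.
move=> s /andP[ts st]; congr f; apply: truncn_def; apply/andP; split.
  by rewrite ler_pdivlMr//; lra.
by rewrite (le_lt_trans _ k2)// ler_pM2r ?invr_gt0// ltW.
Qed.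

Lemma cadlag_step_path (R : realType) (St : Type) (z : St) (s : seq St) (h : R) : 0 < h ->
  cadlag (step_path z s h).
Proof. exact: (cadlag_step (fun k => nth z s (minn k (size s).-1))). Qed.

Lemma cadlag_comp (R : realType) (E E' : Type) (g : E -> E') (f : R -> E) :
  cadlag f -> cadlag (fun t => g (f t)).
Proof.
move=> [rc ll]; split => t t0.
  by have [e e0 He] := rc t t0; exists e => // s st; rewrite He.
by have [a [e e0 He]] := ll t t0; exists (g a), e => // s st; rewrite He.
Qed.

Lemma cadlag_scale (R : realType) (E : Type) (f : R -> E) (th : R) : 0 < th ->
  cadlag f -> cadlag (fun t => f (th * t)).
Proof.
move=> th0 [rc ll]; split => t t0.
  have [|e e0 He] := rc (th * t); first by rewrite mulr_ge0// ltW.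
  exists (e / th); first by rewrite divr_gt0.
  move=> s /andP[ts st]; apply: He; rewrite ler_pM2l// ts /=.
  move: st; rewrite -(ltr_pM2l th0) mulrDr => /lt_le_trans; apply.
  by rewrite lerD2l mulrC divfK ?gt_eqF.
have [|a [e e0 He]] := ll (th * t); first by rewrite mulr_gt0.
exists a, (e / th); first by rewrite divr_gt0.
move=> s /andP[ts st]; apply: He; rewrite ltr_pM2l// st andbT.
move: ts; rewrite -(ltr_pM2l th0) mulrBr; apply: le_lt_trans.
by rewrite lerD2l lerN2 mulrC divfK ?gt_eqF.
Qed.

(** * Deterministic trace of a cadlag path and of its discretizations *)

Section TracePath.
Variables (R : realType) (St : eqType) (x : R -> St) (G : pred St) (o : R -> R).
Hypothesis cx : cadlag x.
Hypothesis o0 : o 0 = 0.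
Hypothesis oD : forall s t, 0 <= s <= t -> 0 <= o t - o s <= t - s.
Hypothesis oG : forall s t, 0 <= s <= t -> (forall u, s <= u < t -> x u \in G) -> o t - o s = t - s.
Hypothesis oN : forall s t, 0 <= s <= t -> (forall u, s <= u < t -> x u \notin G) -> o t = o s.
Hypothesis oU : forall L, exists2 s, 0 <= s & L < o s.

(** The right-continuous inverse of the occupation time, which jumps over the excursions outside
    [G]. *)
Let S (t : R) : R := sup [set s | 0 <= s /\ o s <= t].
Let Y (t : R) : St := x (S t).

Let o_mono s t : 0 <= s -> s <= t -> o s <= o t.
Proof. by move=> s0 st; have := @oD s t; rewrite s0 st => /(_ isT)/andP[]; rewrite subr_ge0. Qed.

Let S_sup t : 0 <= t -> has_sup [set s | 0 <= s /\ o s <= t].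
Proof.
move=> t0; split; first by exists 0 => /=; rewrite lexx o0.
have [s s0 ts] := oU t; exists s => u [u0 ut]; rewrite leNgt; apply/negP => su.
by have := o_mono s0 (ltW su); lra.
Qed.

Let S_ge0 t : 0 <= t -> 0 <= S t.
Proof.
move=> t0; apply: ub_le_sup; first by have [] := S_sup t0.
by rewrite /= o0 lexx.
Qed.

Let S_ub t s : 0 <= t -> 0 <= s -> o s <= t -> s <= S t.
Proof. by move=> t0 s0 st; apply: ub_le_sup => //; have [] := S_sup t0. Qed.

Let oS t : 0 <= t -> o (S t) = t.
Proof.
move=> t0; have S0 := S_ge0 t0; apply/eqP; rewrite eq_le; apply/andP; split; rewrite leNgt; apply/negP => h.
  have e0 : 0 < o (S t) - t by lra.
  have [s [s0 st] es] := sup_adherent e0 (S_sup t0).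
  have sS := S_ub t0 s0 st.
  have := @oD s (S t); rewrite s0 sS => /(_ isT) /andP[_].
  rewrite -/(S t) in es; lra.
have : S t + (t - o (S t)) <= S t; last by lra.
apply: S_ub => //; first by lra.
have := @oD (S t) (S t + (t - o (S t))) ltac:(apply/andP; split; lra).
by move=> /andP[_]; lra.
Qed.

(** Otherwise the path would stay outside [G] for a while after [S t] with the occupation time
    unchanged, against the choice of the supremum. *)
Let xS t : 0 <= t -> x (S t) \in G.
Proof.
move=> t0; have S0 := S_ge0 t0; apply/negPn/negP => h.
have [e e0 He] := cx.1 (S t) S0.
have : S t + e / 2 <= S t; last by lra.
apply: S_ub => //; first by lra.
rewrite (@oN (S t)) ?oS//; first by apply/andP; split; lra.
by move=> u /andP[? ?]; rewrite He//; apply/andP; split; lra.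
Qed.

Let So s : 0 <= s -> x s \in G -> S (o s) = s.
Proof.
move=> s0 xs; have os0 : 0 <= o s by rewrite -o0 o_mono.
apply/eqP; rewrite eq_le S_ub// andbT leNgt; apply/negP => h.
have [e e0 He] := cx.1 s s0.
pose s' := Num.min (S (o s)) (s + e / 2).
have s's : s < s' by rewrite lt_min h /=; lra.
have s'S : s' <= S (o s) by rewrite ge_min lexx.
have s'e : s' <= s + e / 2 by rewrite ge_min lexx orbT.
have : o s' - o s = s' - s.
  apply: oG; first by rewrite s0 ltW.
  by move=> u /andP[? ?]; rewrite He//; apply/andP; split; lra.
have := @o_mono s' (S (o s)) ltac:(lra) s'S; rewrite oS//; lra.
Qed.

Lemma trace_at s : 0 <= s -> x s \in G -> Y (o s) = x s.
Proof. by move=> s0 xs; rewrite /Y So. Qed.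

(** To the right, [Y] copies [x] from [S t] on for as long as [x] stays put, because [x (S t)] is in
    [G] and the occupation time grows there at unit speed. *)
Lemma cadlag_trace : cadlag Y.
Proof.
split=> t t0.
  have S0 := S_ge0 t0; have [e e0 He] := cx.1 (S t) S0; exists e => // u /andP[tu ut].
  pose s := S t + (u - t).
  have xs : x s = x (S t) by apply: He; rewrite /s; apply/andP; split; lra.
  have -> : u = o s.
    have : o s - o (S t) = s - S t.
      apply: oG; first by rewrite /s; apply/andP; split; lra.
      by move=> v; rewrite /s => /andP[? ?]; rewrite He ?xS//; apply/andP; split; lra.
    by rewrite oS// /s; lra.
  by rewrite trace_at ?xs ?xS// /s; lra.
(* The left limit at [t] is read at the left-continuous inverse of the occupation time, before the
   excursion ending at [S t]. Just before that time the path must be in [G], since the occupation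
   time still increases. *)
pose A := [set s | 0 <= s /\ o s < t].
have hA : has_sup A.
  split; first by exists 0; rewrite /A /= o0.
  have [s s0 ts] := oU t; exists s => u [u0 ut]; rewrite leNgt; apply/negP => su.
  by have := o_mono s0 (ltW su); lra.
pose s' := sup A.
have s'0 : 0 <= s' by apply: ub_le_sup; [case: hA|rewrite /A /= o0].
have below s : 0 <= s -> s < s' -> o s < t.
  move=> s0 ss; have [|u [u0 ut] su] := @sup_gt R A s _ ss; first by case: hA.
  by apply: le_lt_trans ut; exact: o_mono s0 (ltW su).
have os' : o s' = t.
  apply/eqP; rewrite eq_le; apply/andP; split; rewrite leNgt; apply/negP => h.
    have s'pos : 0 < s'.
      rewrite lt_neqAle s'0 andbT; apply/negP => /eqP s0; move: h; rewrite -s0 o0; lra.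
    pose s := Num.max 0 (s' - (o s' - t) / 2).
    have s0 : 0 <= s by rewrite le_max lexx.
    have ss' : s < s' by rewrite gt_max s'pos /=; lra.
    have sle : s' - (o s' - t) / 2 <= s by rewrite le_max lexx orbT.
    have := below s s0 ss'.
    by have := @oD s s' ltac:(apply/andP; split; lra) => /andP[_]; lra.
  have : s' + (t - o s') / 2 <= s'; last by lra.
  apply: ub_le_sup; first by case: hA.
  split; first by lra.
  have := @oD s' (s' + (t - o s') / 2) ltac:(apply/andP; split; lra) => /andP[_]; lra.
have s'pos : 0 < s'.
  by rewrite lt_neqAle s'0 andbT; apply/negP => /eqP s0; move: os'; rewrite -s0 o0; lra.
have [a [e e0 He]] := cx.2 s' s'pos.
pose e' := Num.min e s'.
have e'0 : 0 < e' by rewrite lt_min e0.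
have e'e : e' <= e by rewrite ge_min lexx.
have e's : e' <= s' by rewrite ge_min lexx orbT.
have aG : a \in G.
  apply/negPn/negP => h.
  have : o s' = o (s' - e' / 2).
    apply: oN; first by apply/andP; split; lra.
    by move=> u /andP[? ?]; rewrite He//; apply/andP; split; lra.
  by have := @below (s' - e' / 2) ltac:(lra) ltac:(lra); lra.
exists a, e' => // u /andP[tu ut].
pose s := s' - (t - u).
have xs : x s = a by apply: He; rewrite /s; apply/andP; split; lra.
have -> : u = o s.
  have : o s' - o s = s' - s.
    apply: oG; first by rewrite /s; apply/andP; split; lra.
    by move=> v; rewrite /s => /andP[? ?]; rewrite He//; apply/andP; split; lra.
  by rewrite os' /s; lra.
by rewrite trace_at ?xs// /s; lra.
Qed.

Let p h : pred nat := fun j => x (j%:R * h) \in G.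
Let V h m := count (p h) (iota 0 m).

(** A mesh interval without jump contributes exactly [h] or 0 to both sides; each of the others
    costs at most [h]. *)
Let riemann h m s : 0 < h -> jumps_on x 0 (m%:R * h) s ->
  `|o (m%:R * h) - h * (V h m)%:R| <= h * (size s)%:R.
Proof.
move=> h0; suff H k : (k <= m)%N -> jumps_on x 0 (m%:R * h) s ->
    `|o (k%:R * h) - h * (V h k)%:R| <= h * (count (fun c => c <= k%:R * h) s)%:R.
  move=> js; apply: (le_trans (H m (leqnn m) js)).
  by rewrite ler_pM2l// ler_nat count_size.
elim: k => [|k IH] km js.
  by rewrite /V /= mul0r o0 mulr0 subr0 normr0 mulr_ge0// ltW.
have hk : 0 <= k%:R * h by rewrite mulr_ge0// ltW.
have kS : k.+1%:R * h = k%:R * h + h by rewrite -natr1 mulrDl mul1r.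
have kSm : k.+1%:R * h <= m%:R * h by rewrite ler_pM2r// ler_nat.
have VS : V h k.+1 = (V h k + p h k)%N by rewrite /V -addn1 iotaD count_cat /= add0n addn0.
have cS := count_le_split s (ltac:(lra) : k%:R * h <= k.+1%:R * h).
rewrite VS cS !natrD !mulrDr.
have := IH (ltnW km) js.
set A := o _ - _; move=> HA.
have -> : o (k.+1%:R * h) - (h * (V h k)%:R + h * (p h k)%:R) =
   A + (o (k.+1%:R * h) - o (k%:R * h) - h * (p h k)%:R) by rewrite /A; ring.
apply: (le_trans (ler_normD _ _)); apply: lerD HA _.
have inc := @oD (k%:R * h) (k.+1%:R * h) ltac:(rewrite hk kS; lra).
have [hc|hc] := boolP (has (fun c => k%:R * h < c <= k.+1%:R * h) s).
  have c1 : 1 <= (count (fun c => k%:R * h < c <= k.+1%:R * h) s)%:R :> R by rewrite ler1n -has_count.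
  apply: (@le_trans _ _ h); last by rewrite ler_peMr// ltW.
  have : 0 <= h * (p h k)%:R <= h by case: (p h k); rewrite ?mulr1 ?mulr0; lra.
  by move: inc; rewrite kS ler_norml => /andP[? ?] /andP[? ?]; apply/andP; split; lra.
have flat u : k%:R * h <= u < k.+1%:R * h -> x u = x (k%:R * h).
  move=> /andP[ku uk]; apply/esym; apply: js => //; first by lra.
  move=> c cs; apply/negP => /andP[kc cu]; move/hasPn: hc => /(_ c cs).
  by rewrite kc (le_trans cu (ltW uk)).
suff -> : o (k.+1%:R * h) - o (k%:R * h) - h * (p h k)%:R = 0 by rewrite normr0 mulr_ge0// ltW.
have [pk|pk] := boolP (p h k).
  rewrite (@oG (k%:R * h) (k.+1%:R * h)) ?kS; first by rewrite mulr1; lra.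
    by rewrite hk; lra.
  by rewrite -kS => u uk; rewrite flat.
rewrite (@oN (k%:R * h) (k.+1%:R * h)) ?kS; first by rewrite mulr0; lra.
  by rewrite hk; lra.
by rewrite -kS => u uk; rewrite flat.
Qed.

Lemma riemann_occupation (s0 eps : R) : 0 <= s0 -> 0 < eps ->
  exists2 h0, 0 < h0 & forall h m, 0 < h <= h0 -> m%:R * h <= s0 ->
    `|o (m%:R * h) - h * (count (fun j => x (j%:R * h) \in G) (iota 0 m))%:R| <= eps.
Proof.
move=> s00 e0; have [s js] := @cadlag_jumps R St x s0 cx s00.
have n1 : 0 < (size s)%:R + 1 :> R by rewrite ltr_wpDl.
exists (eps / ((size s)%:R + 1)); first by rewrite divr_gt0.
move=> h m /andP[h0 hh] ms; apply: (@le_trans _ _ (h * (size s)%:R)).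
  by apply: riemann => // u v au uv vm; apply: js => //; apply: le_trans ms.
move: hh; rewrite ler_pdivlMr// mulrDr mulr1; lra.
Qed.

(** [phi t] is the occupation time at the visit of rank [t / h] (rounded down) of the skeleton to
    [G]. The number of visits times [h] is a Riemann sum of the occupation time, hence [phi t] is
    close to [t]. The conditions on [J] and [K] ensure that enough visits are recorded. *)
Lemma discretized_trace (z : St) (del W : R) : 0 < del -> 0 <= W -> x 0 \in G ->
  exists2 h0 : R, 0 < h0 & exists S0 : R, forall h J K, 0 < h <= h0 ->
    S0 <= J%:R * h -> W <= K%:R * h ->
    exists phi : R -> R, [/\ forall s t, 0 <= s -> s <= t -> phi s <= phi t,
      forall t, 0 <= t -> 0 <= phi t,
      forall t, 0 <= t <= W -> `|phi t - t| <= del &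
      forall t, 0 <= t ->
        step_path z (take K.+1 [seq a <- [seq x (j%:R * h) | j <- iota 0 J] | a \in G]) h t = Y (phi t)].
Proof.
move=> del0 W0 x0G.
(* The surplus 2 pays for a Riemann error of at most 1 and for a mesh of at most 1/2. *)
have [s1 s10 Hs1] := oU (W + 2).
have [|h1 h10 Hh1] := @riemann_occupation s1 (Num.min 1 (del / 2)) s10; first by rewrite lt_min ltr01 divr_gt0.
exists (Num.min h1 (Num.min (1/2) (del / 2))); first by rewrite !lt_min h10 !divr_gt0.
exists (s1 + 1) => h J K /andP[h0]; rewrite !le_min => /and3P[hh1 hh2 hdel] sJ WK.
pose I := seq.filter (p h) (iota 0 J).
set s := take _ _.
have sE : s = map (fun j : nat => x (j%:R * h)) (take K.+1 I) by rewrite /s filter_map map_take.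
have J0 : (0 < J)%N by rewrite lt0n; apply/eqP => J_0; move: sJ; rewrite J_0 mul0r; lra.
have I0 : (0 < size I)%N.
  by rewrite size_filter -has_count; apply/hasP; exists 0%N; rewrite ?mem_iota//= /p mul0r.
pose I' := take K.+1 I.
have sI' : size I' = minn K.+1 (size I) by rewrite size_take_min.
pose idx t := minn (Num.truncn (t / h)) (size I').-1.
have idx_lt t : (idx t < size I')%N.
  by rewrite /idx gtn_min prednK ?leqnn ?orbT// sI' leq_min I0.
have idxI t : (idx t < size I)%N by apply: leq_trans (idx_lt t) _; rewrite sI' geq_minr.
have nthI' t : nth 0%N I' (idx t) = nth 0%N I (idx t).
  by rewrite nth_take//; apply: leq_trans (idx_lt t) _; rewrite sI' geq_minl.
have sortI : sorted leq I.
  by apply: sorted_filter; [exact: leq_trans|exact: iota_sorted].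
have t_h_mono t u : t <= u -> t / h <= u / h by move=> tu; rewrite ler_pM2r ?invr_gt0.
have V_mono m n : (m <= n)%N -> (V h m <= V h n)%N.
  by move=> mn; rewrite /V -(subnKC mn) iotaD count_cat leq_addr.
exists (fun t => o ((nth 0%N I (idx t))%:R * h)); split.
- move=> t u t0 tu; apply: o_mono; first by rewrite mulr_ge0// ltW.
  rewrite ler_pM2r// ler_nat.
  apply: (sorted_leq_nth leq_trans leqnn 0%N sortI); rewrite ?inE ?idxI//.
  by rewrite /idx leq_min geq_minr andbT (leq_trans (geq_minl _ _))// le_truncn// t_h_mono.
- by move=> t t0; rewrite -o0; apply: o_mono => //; rewrite mulr_ge0// ltW.
- move=> t /andP[t0 tW].
  have th : 0 <= t / h by rewrite divr_ge0// ltW.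
  have /andP[k1 k2] := truncn_itv th.
  set k := Num.truncn (t / h) in k1 k2.
  have kh : k%:R * h <= t by rewrite -ler_pdivlMr.
  have kh2 : t < k%:R * h + h by move: k2; rewrite ltr_pdivrMr// -natr1 mulrDl mul1r.
  have kK : (k <= K)%N by rewrite -(ler_nat R) -(ler_pM2r h0); lra.
  pose m0 := Num.truncn (s1 / h).
  have s1h : 0 <= s1 / h by rewrite divr_ge0// ltW.
  have /andP[m1 m2] := truncn_itv s1h; rewrite -/m0 in m1 m2.
  have mh : m0%:R * h <= s1 by rewrite -ler_pdivlMr.
  have mh2 : s1 < m0%:R * h + h by move: m2; rewrite ltr_pdivrMr// -natr1 mulrDl mul1r.
  have m0J : (m0 <= J)%N by rewrite -(ler_nat R) -(ler_pM2r h0); lra.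
  have m0h : 0 <= m0%:R * h by rewrite mulr_ge0// ltW.
  have kV : (k < V h m0)%N.
    rewrite -(ltr_nat R) -(ltr_pM2r h0).
    have := Hh1 h m0; rewrite h0 hh1 => /(_ isT mh); rewrite le_min => /andP[+ _].
    rewrite ler_norml -/(V h m0) [h * _%:R]mulrC => /andP[_].
    by have := @oD (m0%:R * h) s1; rewrite m0h mh => /(_ isT) /andP[_]; lra.
  have kI : (k < size I)%N by rewrite size_filter (leq_trans kV)// V_mono.
  have -> : idx t = k.
    by rewrite /idx -/k; apply/minn_idPl; rewrite -ltnS prednK sI' ?leq_min ?I0// ltnS kK kI.
  set kap := nth 0%N I k.
  have Vk : V h kap = k by exact: count_nth_filter_iota.
  have km0 : (kap <= m0)%N by rewrite leqNgt; apply/negP => /ltnW/V_mono; rewrite Vk leqNgt kV.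
  have kaps : kap%:R * h <= s1 by apply: le_trans mh; rewrite ler_pM2r// ler_nat.
  have := Hh1 h kap; rewrite h0 hh1 => /(_ isT kaps); rewrite le_min => /andP[_].
  rewrite -/(V h kap) Vk [h * _%:R]mulrC => H.
  by move: H; rewrite ler_norml => /andP[? ?]; rewrite ler_norml; apply/andP; split; lra.
- move=> t t0; rewrite /step_path sE size_map -/I' -/(idx t) (nth_map 0%N)// nthI'.
  rewrite trace_at//; first by rewrite mulr_ge0// ltW.
  by have := mem_nth 0%N (idxI t); rewrite mem_filter => /andP[].
Qed.

End TracePath.

(** * Skeletons of continuous-time chains *)

Section BoundedConvergence.
Context d (Om : measurableType d) (R : realType) (P : probability Om R).

Lemma bounded_integrable (f : Om -> R) (M : R) : measurable_fun [set: Om] f ->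
  (forall w, `|f w| <= M) -> P.-integrable [set: Om] (EFin \o f).
Proof.
move=> mf fM; apply: measurable_bounded_integrable => //.
  by rewrite [X in (X < _)%E](@probability_setT _ _ _ P) ltry.
exists M; split; first exact: num_real.
by move=> b Mb w _; apply: le_trans (fM w) (ltW Mb).
Qed.

Lemma bounded_integral_fin_num (f : Om -> R) (M : R) : measurable_fun [set: Om] f ->
  (forall w, `|f w| <= M) -> (\int[P]_w (f w)%:E)%E \is a fin_num.
Proof.
by move=> mf fM; apply: integrable_fin_num => //; exact: (bounded_integrable mf fM).
Qed.

(** [h] itself may be non-measurable; it is squeezed between [h] times the indicator of [A] and the
    same plus [M] on the null complement. *)
Lemma integral_mod_null_ge0 (A : set Om) (h : Om -> R) (M : R) : 0 <= M ->
  measurable A -> P (~` A) = 0%E ->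
  (forall w, 0 <= h w <= M) -> measurable_fun [set: Om] (fun w => h w * \1_A w) ->
  (\int[P]_w (h w)%:E = \int[P]_w (h w * \1_A w)%:E)%E.
Proof.
move=> M0 mA PA hM mh.
have h0 w : 0 <= h w by case/andP: (hM w).
have hA w : 0 <= h w * \1_A w by rewrite mulr_ge0.
apply/eqP; rewrite eq_le; apply/andP; split; last first.
  apply: le_integral_nonmeas => w _; rewrite lee_fin//.
  by rewrite ler_piMr// indicE; case: (_ \in _).
apply: (@le_trans _ _ (\int[P]_w ((h w * \1_A w)%:E + M%:E * (\1_(~` A) w)%:E))%E).
  apply: le_integral_nonmeas => w _; first by rewrite lee_fin.
  rewrite -EFinM -EFinD lee_fin !indicE in_setC.
  by case: (w \in A); rewrite /= ?mulr1 ?mulr0 ?addr0 ?add0r//; case/andP: (hM w).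
have mC : measurable (~` A) by exact: measurableC.
have mi : measurable_fun [set: Om] (fun w => (\1_(~` A) w)%:E : \bar R).
  by apply/measurable_EFinP; exact: measurable_indic.
rewrite ge0_integralD//=.
- rewrite ge0_integralZl//.
  have -> : (\int[P]_w (\1_(~` A) w)%:E = 0)%E by rewrite integral_indic// setIT; exact: PA.
  by rewrite mule0 adde0.
- by move=> w _; rewrite lee_fin.
- by apply/measurable_EFinP.
- by move=> w _; rewrite -EFinM lee_fin mulr_ge0.
- by apply: measurable_funeM.
Qed.

Lemma integral_mod_null (A : set Om) (f : Om -> R) (M : R) : 0 <= M ->
  measurable A -> P (~` A) = 0%E ->
  (forall w, `|f w| <= M) -> measurable_fun [set: Om] (fun w => f w * \1_A w) ->
  (\int[P]_w (f w)%:E = \int[P]_w (f w * \1_A w)%:E)%E.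
Proof.
move=> M0 mA PA fM mf.
rewrite integralE [RHS]integralE.
have E1 (g : Om -> R) w : ((fun w => (g w)%:E)^\+ w = (Num.max (g w) 0)%:E)%E.
  by rewrite funeposE EFin_max.
have E2 (g : Om -> R) w : ((fun w => (g w)%:E)^\- w = (Num.max (- g w) 0)%:E)%E.
  by rewrite funenegE EFin_max.
have maxM (a : R) w : Num.max a 0 * \1_A w = Num.max (a * \1_A w) 0.
  by rewrite indicE; case: (w \in A); rewrite ?mulr1 ?mulr0 ?maxxx.
congr (_ - _)%E.
- under eq_integral do rewrite E1.
  under [RHS]eq_integral do rewrite E1 -maxM.
  apply: (integral_mod_null_ge0 M0) => //.
    move=> w; rewrite le_max lexx orbT /= ge_max M0 andbT.
    exact: le_trans (ler_norm _) (fM w).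
  under eq_fun do rewrite maxM.
  by apply: measurable_maxr => //; exact: measurable_cst.
- under eq_integral do rewrite E2.
  under [RHS]eq_integral do rewrite E2 -mulNr -maxM.
  apply: (integral_mod_null_ge0 M0) => //.
    move=> w; rewrite le_max lexx orbT /= ge_max M0 andbT.
    by apply: le_trans (fM w); rewrite -normrN ler_norm.
  under eq_fun do rewrite maxM mulNr.
  by apply: measurable_maxr => //; exact: measurableT_comp.
Qed.

(** The limit is known to be measurable only after restriction to [A], as a pointwise limit. This is
    how the functional of the trace acquires a usable expectation. *)
Lemma Rintegral_cvg_bounded (A : set Om) (fn : nat -> Om -> R) (f : Om -> R) (M : R) :
  measurable A -> P (~` A) = 0%E -> (forall n, measurable_fun [set: Om] (fn n)) ->
  (forall n w, `|fn n w| <= M) -> (forall w, `|f w| <= M) ->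
  (forall w, A w -> (fun n => fn n w) @ \oo --> f w) ->
  (fun n => Rintegral P [set: Om] (fn n)) @ \oo --> Rintegral P [set: Om] f.
Proof.
move=> mA PA mfn fnM fM cv.
have [Ae|/set0P[w0 _]] := eqVneq A set0.
  by move: PA; rewrite Ae setC0 probability_setT => -[/eqP]; rewrite oner_eq0.
have M0 : 0 <= M by apply: le_trans (fM w0).
have mA1 : measurable_fun [set: Om] (\1_A : Om -> R) by exact: measurable_indic.
have mg n : measurable_fun [set: Om] (fun w => fn n w * \1_A w) by exact: measurable_funM.
have cvA w : (fun n => fn n w * \1_A w) @ \oo --> f w * \1_A w.
  rewrite indicE; have [wA|wA] := boolP (w \in A); last first.
    by rewrite mulr0; under eq_fun do rewrite mulr0; exact: cvg_cst.
  by rewrite mulr1; under eq_fun do rewrite mulr1; apply: cv; rewrite inE in wA.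
have mf : measurable_fun [set: Om] (fun w => f w * \1_A w).
  by apply: (@measurable_fun_cvg _ _ _ _ (fun n w => fn n w * \1_A w)) => // w _; exact: cvA.
have bd (g : Om -> R) : (forall w, `|g w| <= M) -> forall w, `|g w * \1_A w| <= M.
  move=> gM w; rewrite indicE; case: (_ \in _); rewrite ?mulr1 ?mulr0 ?normr0//; exact: gM.
have E n : Rintegral P [set: Om] (fn n) = fine (\int[P]_w (fn n w * \1_A w)%:E)%E.
  by rewrite /Rintegral (integral_mod_null M0 mA PA (fnM n)).
rewrite /Rintegral (integral_mod_null M0 mA PA fM mf).
rewrite (_ : (fun n => _) = (fun n => fine (\int[P]_w (fn n w * \1_A w)%:E)%E)); last first.
  by apply/funext => n; exact: E.
apply: fine_cvg; rewrite fineK; last by apply: (@bounded_integral_fin_num _ M) => //; exact: bd.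
apply: (@dominated_cvg _ _ _ P _ _ (fun n w => (fn n w * \1_A w)%:E) _ (fun=> M%:E)) => //.
- by move=> n; apply/measurable_EFinP.
- by move=> w _; apply: cvg_EFin; [near=> n|exact: cvA].
- by apply: (@bounded_integrable (fun=> M) M) => // w; rewrite ger0_norm.
- by move=> n w _; rewrite lee_fin; exact: bd.
Unshelve. all: by end_near.
Qed.

End BoundedConvergence.

Section Skeleton.
Variables (R : realType) (d : measure_display) (Om : measurableType d) (P : probability Om R).
Variables (St : finType) (X : Om -> R -> St) (q : St -> St -> R) (i0 : St).
Hypothesis HX : is_ctmc P X q i0.

Definition skeleton (h : R) (n : nat) (w : Om) : seq St := [seq X w (j%:R * h) | j <- iota 0 n].

Let all_zip (F : R -> St) (ts : seq R) (s : seq St) : size ts = size s ->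
  all (fun p => F p.1 == p.2) (zip ts s) = (map F ts == s).
Proof.
elim: ts s => [|t ts IH] [|a s] //= [sz].
by rewrite IH// eqseq_cons.
Qed.

Let skeletonE h n s : size s = n ->
  [set w | skeleton h n w = s] =
  [set w | all (fun p => X w p.1 == p.2) (zip [seq j%:R * h | j <- iota 0 n] s)].
Proof.
move=> sn; apply/seteqP; split => w /=; rewrite all_zip ?size_map ?size_iota ?sn//.
  by rewrite -map_comp => /eqP.
by move=> /eqP; rewrite -map_comp.
Qed.

Lemma measurable_skeleton_eq h n s : measurable [set w | skeleton h n w = s].
Proof.
have [sn|sn] := eqVneq (size s) n; last first.
  rewrite (_ : [set w | _] = set0); first exact: measurable0.
  apply/seteqP; split => w //= ws; move: sn; rewrite -ws size_map size_iota eqxx//.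
rewrite skeletonE//; elim: (zip _ _) => [|p l IH] /=.
  by rewrite (_ : [set w | _] = setT); [exact: measurableT|apply/seteqP; split].
rewrite (_ : [set w | _] = [set w | X w p.1 = p.2] `&` [set w | all (fun p => X w p.1 == p.2) l]).
  by apply: measurableI => //; case: HX => _ + _; exact.
by apply/seteqP; split => w /=; [move=> /andP[/eqP]|move=> [-> ->]; rewrite eqxx].
Qed.

Let skeleton_sum h n (Phi : seq St -> R) w :
  Phi (skeleton h n w) = \sum_(s : n.-tuple St) Phi s * \1_[set w | skeleton h n w = s] w.
Proof.
have sz : size (skeleton h n w) == n by rewrite size_map size_iota.
rewrite (bigD1 (Tuple sz))//= indicE mem_set//= mulr1 big1 ?addr0// => s sw.
rewrite indicE memNset ?mulr0//= => e; move/negP: sw; apply; apply/eqP/val_inj => /=.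
by rewrite e.
Qed.

Lemma measurable_skeleton h n (Phi : seq St -> R) :
  measurable_fun [set: Om] (fun w => Phi (skeleton h n w)).
Proof.
under eq_fun do rewrite skeleton_sum.
apply: measurable_sum => s; apply: measurable_funM; first exact: measurable_cst.
by apply: measurable_indic; exact: measurable_skeleton_eq.
Qed.

Let fdd_skeleton h k i s :
  fdd q i (k%:R * h) (zip [seq j%:R * h | j <- iota k.+1 (size s)] s) =
  \prod_(p <- zip (i :: s) s) Ptrans q h p.1 p.2.
Proof.
elim: s k i => [|a s IH] k i /=; first by rewrite big_nil.
have -> : k.+1%:R * h - k%:R * h = h by rewrite -natr1; ring.
by rewrite IH big_cons.
Qed.

Let path_times (h t : R) k n : 0 <= h -> t <= k%:R * h -> path <=%R t [seq j%:R * h | j <- iota k n].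
Proof.
move=> h0; elim: n k t => [//|n IH] k t tk /=; rewrite tk /=; apply: IH.
by rewrite ler_wpM2r// ler_nat.
Qed.

(** [n.+1] sampling times make [n] steps: the sample at time 0 equals [i0] with probability one
    because [Ptrans] at time 0 is the identity. *)
Lemma skeleton_expectation h n (Phi : seq St -> R) : 0 <= h ->
  Rintegral P [set: Om] (fun w => Phi (skeleton h n.+1 w)) =
  Epath (Ptrans q h) n i0 (fun s => Phi (i0 :: s)).
Proof.
move=> h0; rewrite /Rintegral.
have -> : (\int[P]_w (Phi (skeleton h n.+1 w))%:E =
   \sum_(s : n.+1.-tuple St) (Phi s)%:E * P [set w | skeleton h n.+1 w = s])%E.
  transitivity (\int[P]_w (\sum_(s : n.+1.-tuple St) (Phi s * \1_[set w | skeleton h n.+1 w = s] w)%:E))%E.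
    by apply: eq_integral => w _; rewrite skeleton_sum sumEFin.
  rewrite integral_sum//; last first.
    move=> s; apply: (@bounded_integrable _ _ _ P _ `|Phi s|).
      apply: measurable_funM; first exact: measurable_cst.
      by apply: measurable_indic; exact: measurable_skeleton_eq.
    by move=> w; rewrite normrM indicE; case: (_ \in _); rewrite ?normr1 ?normr0 ?mulr1 ?mulr0.
  apply: eq_bigr => s _; under eq_integral do rewrite EFinM.
  rewrite integralZl//; last by apply: integrable_indic; exact: measurable_skeleton_eq.
  by rewrite integral_indic ?setIT//; exact: measurable_skeleton_eq.
case: HX => _ _ HP.
have PE (s : n.+1.-tuple St) : P [set w | skeleton h n.+1 w = s] =
    (fdd q i0 0 (zip [seq j%:R * h | j <- iota 0 n.+1] s))%:E.
  rewrite skeletonE ?size_tuple// HP//.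
  rewrite -/(unzip1 _) unzip1_zip ?size_map ?size_iota ?size_tuple//.
  by apply: path_times => //; rewrite mul0r.
under eq_bigr do rewrite PE -EFinM.
rewrite sumEFin /=.
rewrite (reindex (fun p : St * n.-tuple St => [tuple of p.1 :: p.2])) /=; last first.
  exists (fun s : n.+1.-tuple St => (thead s, [tuple of behead s])) => [[j s] _|s _] /=.
    by congr pair; apply/val_inj.
  by rewrite [RHS]tuple_eta; apply/val_inj.
rewrite -(pair_bigA _ (fun j (s : n.-tuple St) =>
  Phi (j :: s) * (Ptrans q (0 * h - 0) i0 j * fdd q j (0 * h) (zip [seq j%:R * h | j <- iota 1 n] s)))) /=.
rewrite (bigD1 i0)//= [X in _ + X]big1 ?addr0 => [|j ji]; last first.
  rewrite big1// => s _; rewrite mul0r subr0 Ptrans0 eq_sym (negbTE ji).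
  by rewrite mul0r mulr0.
rewrite Epath_tuple; apply: eq_bigr => s _.
have := fdd_skeleton h 0 i0 s; rewrite size_tuple => ->.
by rewrite mul0r subr0 Ptrans0 eqxx mul1r mulrC.
Qed.

Lemma start_as : P (~` [set w | X w 0 = i0]) = 0%E.
Proof.
case: HX => _ mX HP.
rewrite probability_setC; last exact: mX.
have := HP [:: (0, i0)] ltac:(by rewrite /= lexx).
rewrite /= subr0 Ptrans0 eqxx !mul1r => E.
rewrite (_ : [set w | X w 0 = i0] = [set w | (X w 0 == i0) && true]) ?E ?subee//.
by apply/seteqP; split => w /=; rewrite andbT => /eqP.
Qed.

End Skeleton.

Lemma small_time_arith (R : realType) (h p k e : R) : e * p <= 1/4 * h * p ->
  0 <= h / 2 * (h * k) -> h * (4 * k) <= h * p -> (1 - h / 2) * (p + h * k) <= (1 - e) * p.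
Proof. by move=> ? ? ?; lra. Qed.

(** * Small time steps: Dirichlet forms and Lyapunov functions *)

Section SmallTime.
Variables (R : realType) (St : finType) (q : St -> St -> R).
Hypothesis q_ge0 : forall i j, 0 <= q i j.

(** The comparison is made edge by edge, so [h0] does not depend on [f]. This matters because the
    minimizer to which it is applied changes with [h]. *)
Lemma dirichlet_Ptrans_ge (mu : St -> R) (eps : R) : (forall i, 0 <= mu i) -> 0 < eps ->
  exists2 h0 : R, 0 < h0 & forall h f, 0 < h <= h0 ->
    (1 - eps) * h * dirichlet q mu f <= dirichlet (Ptrans q h) mu f.
Proof.
move=> mu0 e0; have [C C0 HC] := Ptrans_first_order q.
(* The inverse of 0 is 0, so [s] dominates [1 / q] over the edges of positive rate only. *)
pose s : R := 1 + \sum_i \sum_j (q i j)^-1.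
have qV i j : 0 <= (q i j)^-1 by rewrite invr_ge0.
have s0 : 0 < s by rewrite ltr_wpDr// sumr_ge0// => i _; exact: sumr_ge0.
have qs i j : 0 < q i j -> 1 <= s * q i j.
  move=> qij; rewrite -ler_pdivrMr// div1r /s (bigD1 i)//= (bigD1 j)//=.
  have : 0 <= \sum_(k | k != j) (q i k)^-1 by exact: sumr_ge0.
  have : 0 <= \sum_(k | k != i) \sum_l (q k l)^-1 by apply: sumr_ge0 => k _; exact: sumr_ge0.
  lra.
exists (Num.min 1 (eps / (s * (C + 1)))).
  by rewrite lt_min ltr01 divr_gt0// mulr_gt0// ltr_wpDl.
move=> h f; rewrite le_min => /andP[h0 /andP[h1 he]].
have hs : h * s * (C + 1) <= eps.
  have sC : 0 < s * (C + 1) by rewrite mulr_gt0// ltr_wpDl.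
  by move: he; rewrite ler_pdivlMr// mulrA.
rewrite /dirichlet mulr_sumr; apply: ler_sum => i _.
rewrite mulr_sumr; apply: ler_sum => j _.
have [->|ij] := eqVneq i j; first by rewrite subrr expr0n /= !mulr0.
rewrite mulrA; apply: ler_wpM2r; first exact: sqr_ge0.
rewrite mulrCA; apply: ler_wpM2l => //.
have P0 : 0 <= Ptrans q h i j by apply: Ptrans_ge0; [move=> ? ? _; exact: q_ge0|exact: ltW].
have [qij|qij] := leP (q i j) 0.
  by have -> : q i j = 0 by [apply/eqP; rewrite eq_le qij q_ge0]; rewrite mulr0.
have := HC h i j; rewrite (ltW h0) h1 => /(_ isT).
rewrite (negbTE ij) subr0 /Qgen (negbTE ij) ler_norml => /andP[+ _].
suff : C * h ^+ 2 <= eps * h * q i j by lra.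
have h_ge0 := ltW h0.
have : C * h ^+ 2 <= C * h ^+ 2 * (s * q i j) by rewrite ler_peMr ?mulr_ge0 ?exprn_ge0// qs.
move=> /le_trans; apply.
have -> : C * h ^+ 2 * (s * q i j) = (h * s * C) * (h * q i j) by ring.
rewrite -[eps * h * _]mulrA ler_wpM2r ?mulr_ge0//; apply: le_trans hs.
by rewrite ler_wpM2l ?lerDl// mulr_ge0// ltW.
Qed.

(** The error is additive and depends on [f]: two-step transitions charge pairs that have rate 0
    under [q]. *)
Lemma dirichlet_Ptrans_le (mu f : St -> R) (eps : R) : (forall i, 0 <= mu i) -> 0 < eps ->
  exists2 h0 : R, 0 < h0 & forall h, 0 < h <= h0 ->
    dirichlet (Ptrans q h) mu f <= h * (dirichlet q mu f + eps).
Proof.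
move=> mu0 e0; have [C C0 HC] := Ptrans_first_order q.
pose D := \sum_i \sum_j mu i * C * (f j - f i) ^+ 2.
have D0 : 0 <= D.
  by apply: sumr_ge0 => i _; apply: sumr_ge0 => j _; rewrite mulr_ge0 ?sqr_ge0// mulr_ge0.
exists (Num.min 1 (eps / (D + 1))); first by rewrite lt_min ltr01 divr_gt0// ltr_wpDl.
move=> h; rewrite le_min => /andP[h0 /andP[h1 he]].
have hD : h * D <= eps.
  move: he; rewrite ler_pdivlMr ?ltr_wpDl// mulrDr mulr1; lra.
apply: (@le_trans _ _ (h * (dirichlet q mu f + h * D))); last by rewrite ler_pM2l// lerD2l.
rewrite mulrDr /dirichlet /D !mulr_sumr -big_split /=; apply: ler_sum => i _.
rewrite !mulr_sumr -big_split /=; apply: ler_sum => j _.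
have [->|ij] := eqVneq i j; first by rewrite subrr expr0n /= !mulr0 addr0.
have -> : h * (mu i * q i j * (f j - f i) ^+ 2) + h * (h * (mu i * C * (f j - f i) ^+ 2)) =
  mu i * (h * q i j + C * h ^+ 2) * (f j - f i) ^+ 2 by ring.
apply: ler_wpM2r; first exact: sqr_ge0.
apply: ler_wpM2l => //.
have := HC h i j; rewrite (ltW h0) h1 => /(_ isT).
by rewrite (negbTE ij) subr0 /Qgen (negbTE ij) ler_norml => /andP[_]; lra.
Qed.

Variables (G : pred St) (g : St -> R) (c : R).
Hypothesis g_ge0 : forall i, 0 <= g i.
Hypothesis c_gt0 : 0 < c.
Hypothesis g_drift : forall i, ~~ G i -> \sum_j Qgen q i j * g j <= - c.

(** The first contraction, for the kernel killed on [G], gives the trace of a skeleton. The second,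
    with the weight [expR (- h)] at each visit to [G], bounds the Laplace transform of the
    occupation time. *)
Lemma lyapunov_Ptrans : exists psi : St -> R, (forall i, 1 <= psi i) /\
  exists2 eps : R, 0 < eps & exists2 h0 : R, 0 < h0 & forall h, 0 < h <= h0 ->
  [/\ 0 < eps * h <= 1,
      forall i, \sum_(j | ~~ G j) Ptrans q h i j * psi j <= (1 - eps * h) * psi i &
      forall i, expR (- (h * (G i)%:R)) * \sum_j Ptrans q h i j * psi j <= (1 - eps * h) * psi i].
Proof.
have [C C0 HC] := Ptrans_first_order q.
pose C1 := \sum_i `|\sum_j Qgen q i j * g j|.
have C10 : 0 <= C1 by exact: sumr_ge0.
have C1i i : `|\sum_j Qgen q i j * g j| <= C1 by rewrite /C1 [leRHS](bigD1 i)//= lerDl sumr_ge0.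
(* In [G] one step may increase [psi] by about [h * (C1 + 1)], at most [h / 4] times [psi] by the
   choice of the constant; the weight [expR (- h) <= 1 - h / 2] wins. *)
pose psi i := 4 * (C1 + 1) + g i.
have psi1 i : 4 * (C1 + 1) <= psi i by rewrite lerDl.
have psi_ge1 i : 1 <= psi i by have := psi1 i; lra.
pose Ps := \sum_i psi i.
have psi0 i : 0 <= psi i by exact: le_trans (psi_ge1 i).
have psiP i : psi i <= Ps by rewrite /Ps (bigD1 i)//= lerDl sumr_ge0.
pose C3 := \sum_i \sum_j (C + `|Qgen q i j|) * psi j.
have C3t i j : 0 <= (C + `|Qgen q i j|) * psi j.
  by rewrite mulr_ge0// addr_ge0// ltW.
have C30 : 0 <= C3 by apply: sumr_ge0 => i _; exact: sumr_ge0.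
have C3i i : \sum_j (C + `|Qgen q i j|) * psi j <= C3.
  by rewrite /C3 [leRHS](bigD1 i)//= lerDl sumr_ge0// => k _; exact: sumr_ge0.
pose P1 := 1 + `|Ps|.
have P10 : 0 < P1 by rewrite ltr_pwDl.
have PsP1 : Ps <= P1 by rewrite /P1; have := ler_norm Ps; lra.
pose eps := Num.min (1/4) (c / (2 * P1)).
have eps0 : 0 < eps by rewrite lt_min !divr_gt0// mulr_gt0.
have eps4 : eps <= 1/4 by rewrite ge_min lexx.
have epsc : eps * P1 <= c / 2.
  have : eps <= c / (2 * P1) by rewrite ge_min lexx orbT.
  rewrite ler_pdivlMr ?mulr_gt0//; lra.
pose h0 := Num.min 1 (Num.min (1 / (2 * C3 + 1)) (Num.min 1 (c / 2) / (C * P1 + 1))).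
have CP1 : 0 < C * P1 + 1 by rewrite ltr_wpDl// mulr_ge0// ltW.
have C31 : 0 < 2 * C3 + 1 by rewrite ltr_wpDl// mulr_ge0.
exists psi; split => //; exists eps => //; exists h0.
  by rewrite !lt_min ltr01 !divr_gt0// lt_min ltr01 divr_gt0.
move=> h; rewrite /h0 !le_min => /andP[hp /and3P[h1 hC3 hC]].
have hge := ltW hp.
have hC3' : h * C3 <= 1/2 by move: hC3; rewrite ler_pdivlMr//; lra.
have hCP : h * (C * P1) <= Num.min 1 (c / 2).
  by move: hC; rewrite ler_pdivlMr// mulrDr mulr1; lra.
have hCP1 : h * (C * P1) <= 1 by apply: le_trans hCP _; rewrite ge_min lexx.
have hCPc : h * (C * P1) <= c / 2 by apply: le_trans hCP _; rewrite ge_min lexx orbT.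
have eh : 0 < eps * h by rewrite mulr_gt0.
have eh4 : eps * h <= 1/4 by rewrite -[1/4]mulr1 ler_pM// ltW.
have Pge i j : 0 <= Ptrans q h i j by apply: Ptrans_ge0 => // *; exact: q_ge0.
have bnd i : \sum_j Ptrans q h i j * psi j <= psi i + h * \sum_j Qgen q i j * g j + h * (h * (C * P1)).
  apply: (@le_trans _ _ (\sum_j ((i == j)%:R + h * Qgen q i j + C * h ^+ 2) * psi j)).
    apply: ler_sum => j _; apply: ler_wpM2r => //.
    by have := HC h i j; rewrite hge h1 => /(_ isT); rewrite ler_norml => /andP[_]; lra.
  under eq_bigr do rewrite !mulrDl.
  rewrite !big_split /=.
  have -> : \sum_j (i == j)%:R * psi j = psi i.
    rewrite (bigD1 i)//= eqxx mul1r big1 ?addr0// => j ji.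
    by rewrite eq_sym (negbTE ji) mul0r.
  apply: lerD; first apply: lerD => //.
    under eq_bigr do rewrite -mulrA /psi mulrDr.
    rewrite -mulr_sumr big_split /= -mulr_suml Qgen_row_sum mul0r add0r//.
  rewrite -mulr_sumr -/Ps (_ : h * (h * (C * P1)) = C * h ^+ 2 * P1); last by ring.
  by rewrite ler_wpM2l// mulr_ge0// exprn_ge0.
have epsi i : eps * h * psi i <= h * (c / 2).
  rewrite mulrAC mulrC ler_wpM2l//; apply: le_trans epsc.
  by rewrite ler_pM2l// (le_trans (psiP i)).
have outG i : ~~ G i -> \sum_j Ptrans q h i j * psi j <= (1 - eps * h) * psi i.
  move=> Gi; apply: (le_trans (bnd i)).
  have := epsi i; have : h * \sum_j Qgen q i j * g j <= h * - c by rewrite ler_wpM2l// g_drift.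
  have : h * (h * (C * P1)) <= h * (c / 2) by rewrite ler_wpM2l.
  rewrite mulrBl mul1r mulrN; lra.
split.
- by rewrite eh /=; lra.
- move=> i; have [Gi|Gi] := boolP (G i); last first.
    apply: le_trans (outG i Gi); rewrite [leRHS](bigID (fun j => ~~ G j)) /= lerDl.
    by apply: sumr_ge0 => j _; rewrite mulr_ge0.
  apply: (@le_trans _ _ (h * C3)); last first.
    apply: (le_trans hC3'); rewrite -[1/2]mulr1 ler_pM//; lra.
  apply: (@le_trans _ _ (h * \sum_j (C + `|Qgen q i j|) * psi j)); last by rewrite ler_wpM2l.
  rewrite mulr_sumr [leRHS](bigID (fun j => ~~ G j)) /=.
  apply: ler_wpDr; first by apply: sumr_ge0 => j _; rewrite mulr_ge0.
  apply: ler_sum => j Gj; rewrite mulrA; apply: ler_wpM2r; first exact: psi0.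
  have ij : i != j by apply: contraNneq Gj => <-.
  have := HC h i j; rewrite hge h1 => /(_ isT).
  rewrite (negbTE ij) subr0 ler_norml => /andP[_].
  have : h * Qgen q i j <= h * `|Qgen q i j| by rewrite ler_wpM2l// ler_norm.
  have : C * h ^+ 2 <= h * C by rewrite expr2 mulrC ler_wpM2r// ler_piMl.
  rewrite mulrDr; lra.
- move=> i; have [Gi|Gi] := boolP (G i); last first.
    by rewrite mulr0 oppr0 expR0 mul1r outG.
  rewrite mulr1.
  have eh2 : expR (- h) <= 1 - h / 2.
    rewrite expRN -div1r ler_pdivrMr ?expR_gt0//.
    have : (1 - h / 2) * (1 + h) <= (1 - h / 2) * expR h by rewrite ler_wpM2l ?expR_ge1Dx//; lra.
    have : h ^+ 2 <= h by rewrite expr2 ler_piMl.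
    rewrite mulrDr mulr1 mulrBl mul1r (_ : h / 2 * h = h ^+ 2 / 2); last by rewrite expr2; field.
    lra.
  apply: (@le_trans _ _ ((1 - h / 2) * (psi i + h * (C1 + 1)))).
    apply: ler_pM => //.
      by apply: sumr_ge0 => j _; rewrite mulr_ge0.
    apply: (le_trans (bnd i)).
    have -> : psi i + h * (C1 + 1) = psi i + h * C1 + h by ring.
    apply: lerD; first rewrite lerD2l ler_wpM2l//; last by rewrite ler_piMr.
    exact: le_trans (ler_norm _) (C1i i).
  have : h * (4 * (C1 + 1)) <= h * psi i by rewrite ler_wpM2l.
  have : 0 <= h / 2 * (h * (C1 + 1)) by rewrite !mulr_ge0// ?divr_ge0// addr_ge0.
  have : eps * h * psi i <= 1/4 * h * psi i.
    by rewrite !ler_wpM2r.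
  exact: small_time_arith.
Qed.

End SmallTime.

Section Recurrence.
Variables (R : realType) (d : measure_display) (Om : measurableType d) (P : probability Om R).
Variables (St : finType) (X : Om -> R -> St) (q : St -> St -> R) (i0 : St).
Hypothesis HX : is_ctmc P X q i0.
Hypothesis q_ge0 : forall i j, 0 <= q i j.
Variables (G : pred St) (g : St -> R) (c : R).
Hypothesis g_ge0 : forall i, 0 <= g i.
Hypothesis c_gt0 : 0 < c.
Hypothesis g_drift : forall i, ~~ G i -> \sum_j Qgen q i j * g j <= - c.

Let o := occupation X G.
Let cX w : cadlag (X w). Proof. by case: HX. Qed.

Let hS n : 0 < n.+1%:R^-1 :> R. Proof. by rewrite invr_gt0. Qed.

Let occ_cvg (S : nat) w : (fun n => n.+1%:R^-1 *
    (count G (take (S * n.+1) (skeleton X n.+1%:R^-1 (S * n.+1).+1 w)))%:R) @ \oo --> o w S%:R.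
Proof.
apply/cvgrPdist_le => e e0.
have [h0 h00 H] := riemann_occupation (cX w) (occupation0 G (cX w)) (occupation_incr G (cX w))
  (@occupation_inside _ _ _ X G w (cX w)) (@occupation_outside _ _ _ X G w (cX w)) (ler0n R S) e0.
near=> n.
have nh : n.+1%:R^-1 <= h0.
  near: n; have := @cvg_harmonic R; move=> /cvgrPdist_le/(_ h0 h00); apply: filterS => n.
  by rewrite sub0r normrN => /(le_trans (ler_norm _)).
have := H n.+1%:R^-1 (S * n.+1)%N; rewrite hS nh natrM mulfK ?pnatr_eq0// lexx => /(_ isT isT).
rewrite /skeleton -map_take take_iota (minn_idPl (leqnSn _)) count_map.
exact.
Unshelve. all: by end_near.
Qed.

Let meas_occ (S : nat) : measurable_fun [set: Om] (fun w => o w S%:R).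
Proof.
apply: (@measurable_fun_cvg _ _ _ _ (fun n w => n.+1%:R^-1 *
    (count G (take (S * n.+1) (skeleton X n.+1%:R^-1 (S * n.+1).+1 w)))%:R)) => [n|w _].
  exact: (measurable_skeleton HX _ _ (fun s => n.+1%:R^-1 * (count G (take (S * n.+1) s))%:R)).
exact: occ_cvg.
Qed.

Let exp_occ_le1 (S : nat) w : `|expR (- o w S%:R)| <= 1.
Proof.
rewrite ger0_norm ?expR_ge0//; apply: (@le_trans _ _ (expR 0)); last by rewrite expR0.
rewrite ler_expR oppr_le0.
have := @occupation_incr _ _ _ X G w (cX w) 0 S%:R; rewrite occupation0// subr0.
by rewrite lexx ler0n => /(_ isT)/andP[].
Qed.

(** The weighted contraction is iterated [S * n.+1] times along the skeleton of mesh [1 / n.+1];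
    bounded convergence then replaces the Riemann sum by the occupation time. *)
Let laplace_occ : exists C eps : R, [/\ 0 < C, 0 < eps & forall S : nat,
  Rintegral P [set: Om] (fun w => expR (- o w S%:R)) <= C * expR (- (eps * S%:R))].
Proof.
have [psi [psi1 [eps eps0 [h0 h00 H]]]] := lyapunov_Ptrans q_ge0 g_ge0 c_gt0 g_drift.
exists (psi i0), eps; split => // [|S]; first by apply: lt_le_trans (psi1 i0).
pose h n : R := n.+1%:R^-1.
pose Phi n (s : seq St) := expR (- (h n * (count G (take (S * n.+1) s))%:R)).
have cv : (fun n => Rintegral P [set: Om] (fun w => Phi n (skeleton X (h n) (S * n.+1).+1 w))) @ \oo -->
    Rintegral P [set: Om] (fun w => expR (- o w S%:R)).
  apply: (@Rintegral_cvg_bounded _ _ _ P setT _ _ 1) => //.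
  - by rewrite setCT measure0.
  - by move=> n; exact: (measurable_skeleton HX).
  - move=> n w; rewrite ger0_norm ?expR_ge0// -expR0 ler_expR oppr_le0 mulr_ge0//.
    by rewrite /h invr_ge0.
  - move=> w _; apply: (continuous_cvg _ (@continuous_expR R _)).
    by apply: cvgN; exact: occ_cvg.
rewrite -(cvg_lim _ cv)//; apply: limr_le; first by apply/cvg_ex; eexists; exact: cv.
near=> n.
have nh : h n <= h0.
  near: n; have := @cvg_harmonic R; move=> /cvgrPdist_le/(_ h0 h00); apply: filterS => n.
  by rewrite sub0r normrN => /(le_trans (ler_norm _)).
have hn : 0 < h n by exact: hS.
have [|/andP[eh0 eh1] _ Hb] := H (h n); first by rewrite hn.
have q0' i j : i != j -> 0 <= q i j by move=> _; exact: q_ge0.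
have bound m i : Epath (Ptrans q (h n)) m i (fun s => expR (- (h n * (count G (take m (i :: s)))%:R))) <=
    (1 - eps * h n) ^+ m * psi i.
  elim: m i => [|m IH] i /=; first by rewrite mulr0 oppr0 expR0 mul1r.
  apply: (@le_trans _ _ (expR (- (h n * (G i)%:R)) *
     \sum_j Ptrans q (h n) i j * ((1 - eps * h n) ^+ m * psi j))).
    rewrite mulr_sumr; apply: ler_sum => j _; rewrite mulrCA; apply: ler_wpM2l.
      by apply: Ptrans_ge0 => //; exact: ltW.
    apply: le_trans (_ : expR (- (h n * (G i)%:R)) * _ <= _); last first.
      by apply: ler_wpM2l (IH j); exact: expR_ge0.
    rewrite -EpathZ le_eqVlt; apply/orP; left; apply/eqP; apply: eq_Epath => s _.
    by rewrite -expRD natrD mulrDr opprD.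
  under eq_bigr do rewrite mulrCA.
  rewrite -mulr_sumr mulrCA exprSr -mulrA ler_wpM2l// ?exprn_ge0//; lra.
rewrite (skeleton_expectation HX (S * n.+1)%N (Phi n) (ltW hn)).
apply: (le_trans (bound _ _)); rewrite mulrC ler_wpM2l//; first by apply: le_trans (psi1 i0).
have -> : - (eps * S%:R) = (S * n.+1)%:R * - (eps * h n).
  by rewrite natrM /h; field; rewrite addrC natr1 pnatr_eq0.
rewrite expRM_natl lerXn2r ?nnegrE ?expR_ge0//; first by lra.
exact: expR_ge1Dx.
Unshelve. all: by end_near.
Qed.

(** Exponential Markov inequality: the probability of occupation at most [L] by time [S] is at most
    [expR L] times a Laplace transform that decays exponentially in [S]. *)
Lemma occupation_infinite_as : exists A : set Om, [/\ measurable A, P (~` A) = 0%E &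
  forall w, A w -> X w 0 = i0 /\ forall L, exists2 s, 0 <= s & L < occupation X G w s].
Proof.
have [C [eps [C0 eps0 Hlap]]] := laplace_occ.
pose B (L S : nat) := [set w | o w S%:R <= L%:R].
have mB L S : measurable (B L S).
  rewrite (_ : B L S = [set: Om] `&` (fun w => o w S%:R) @^-1` `]-oo, L%:R]%classic).
    exact: meas_occ.
  by rewrite setTI; apply/seteqP; split => w; rewrite /B /= in_itv.
have PB L : P (\bigcap_S B L S) = 0%E.
  have mbc : measurable (\bigcap_S B L S) by apply: bigcapT_measurable.
  have fP : P (\bigcap_S B L S) \is a fin_num by rewrite fin_num_measure.
  apply/eqP; rewrite eq_le measure_ge0 andbT -(fineK fP) lee_fin.
  have cv : (fun S : nat => expR L%:R * (C * expR (- (eps * S%:R)))) @ \oo --> (0 : R).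
    have -> : (fun S : nat => expR L%:R * (C * expR (- (eps * S%:R)))) =
        (fun S => (expR L%:R * C) * expR (- eps) ^+ S).
      by apply/funext => S; rewrite -expRM_natl mulrA [S%:R * _]mulrC mulNr.
    rewrite -[X in _ --> X](mulr0 (expR L%:R * C)); apply: cvgMr; apply: cvg_expr.
    by rewrite ger0_norm ?expR_ge0// -expR0 ltr_expR oppr_lt0.
  rewrite -(cvg_lim _ cv)//; apply: limr_ge; first by apply/cvg_ex; eexists; exact: cv.
  near=> S.
  have mE : measurable_fun [set: Om] (fun w => expR (- o w S%:R)).
    apply: measurableT_comp; first exact: measurable_expR.
    by apply: measurableT_comp => //; exact: meas_occ.
  have Ele w : `|expR (- o w S%:R)| <= 1 by exact: exp_occ_le1.
  have IE : (\int[P]_w (expR (- o w S%:R))%:E = (Rintegral P [set: Om] (fun w => expR (- o w S%:R)))%:E)%E.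
    by rewrite /Rintegral fineK// (bounded_integral_fin_num P mE Ele).
  rewrite -lee_fin fineK//.
  apply: (@le_trans _ _ (P (B L S))).
    by apply: le_measure; rewrite ?inE// => w; apply.
  apply: (@le_trans _ _ (\int[P]_w ((expR L%:R)%:E * (expR (- o w S%:R))%:E))%E).
    apply: (@le_trans _ _ (\int[P]_w (\1_(B L S) w)%:E)%E).
      by rewrite integral_indic// setIT.
    apply: le_integral_nonmeas => w _; first by rewrite lee_fin.
    rewrite -EFinM lee_fin -expRD indicE; have [|] := boolP (w \in B L S).
      rewrite inE /B /= => h; apply: (@le_trans _ _ (expR 0)); first by rewrite expR0.
      by rewrite ler_expR; lra.
    by rewrite expR_ge0.
  rewrite ge0_integralZl//; last by apply/measurable_EFinP.
  by rewrite IE -EFinM lee_fin ler_wpM2l ?expR_ge0.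
pose N := \bigcup_L \bigcap_S B L S.
have mN : measurable N by apply: bigcupT_measurable => L; exact: bigcapT_measurable.
have PN : P N = 0%E.
  apply/negligibleP => //; apply: negligible_bigcup => L.
  by apply/negligibleP; [exact: bigcapT_measurable|exact: PB].
have m0 : measurable [set w | X w 0 = i0] by case: HX => _ + _; exact.
exists ([set w | X w 0 = i0] `&` ~` N); split.
- by apply: measurableI => //; exact: measurableC.
- rewrite setCI setCK; apply/eqP; rewrite eq_le measure_ge0 andbT.
  have -> : (0 = P (~` [set w | X w 0 = i0]) + P N)%E by rewrite PN adde0 (start_as HX).
  by apply: measureU2 => //; exact: measurableC.
- move=> w [w0 wN]; split => // L.
  apply: contrapT => h; apply: wN; exists (Num.truncn (Num.max 0 L)).+1 => // S _.
  rewrite /B /= leNgt; apply/negP => LS; apply: h; exists S%:R => //.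
  apply: le_lt_trans LS; apply: (@le_trans _ _ (Num.max 0 L)); first by rewrite le_max lexx orbT.
  exact: ltW (truncnS_gt _).
Unshelve. all: by end_near.
Qed.

End Recurrence.

(** * Reduction to the capacity *)

Lemma harmonic_scale_le (R : realType) (th h0 : R) : 0 < h0 ->
  \forall n \near \oo, th / n.+1%:R <= h0.
Proof.
move=> h00.
have : (fun n => th / n.+1%:R) @ \oo --> (0 : R).
  rewrite -(mulr0 th); apply: cvgMr; exact: cvg_harmonic.
move=> /cvgrPdist_le/(_ h0 h00); apply: filterS => n.
by rewrite sub0r normrN => /(le_trans (ler_norm _)).
Qed.

Lemma near_le_nat (R : realType) (c : R) : \forall n \near \oo, c <= n.+1%:R.
Proof.
exists (Num.truncn (Num.max 0 c)) => // n /= hn.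
apply: (@le_trans _ _ (Num.max 0 c)); first by rewrite le_max lexx orbT.
by apply: (le_trans (ltW (truncnS_gt _))); rewrite ler_nat.
Qed.

Section TwoStateWeakLimit.
Variables (R : realType) (d : measure_display) (Om : measurableType d) (P : probability Om R).
Variables (q : 'I_2 -> 'I_2 -> R) (W : Om -> R -> 'I_2) (k0 : 'I_2).
Hypothesis HW : is_ctmc P W q k0.

(** Samples taken every [tau] are displayed on a mesh [1 / n.+1] and frozen from time [n.+1] on, so
    the whole path is a function of a finite skeleton. *)
Definition grid_path (n : nat) (tau : R) (w : Om) (t : R) : 'I_2 :=
  W w ((minn (Num.truncn (t * n.+1%:R)) (n.+1 ^ 2))%:R * tau).

Lemma cadlag_grid_path n tau w : cadlag (grid_path n tau w).
Proof.
rewrite /grid_path.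
have -> : (fun t : R => W w ((minn (Num.truncn (t * n.+1%:R)) (n.+1 ^ 2))%:R * tau)) =
   (fun t : R => W w ((minn (Num.truncn (t / n.+1%:R^-1)) (n.+1 ^ 2))%:R * tau)).
  by apply/funext => t; rewrite invrK.
apply: (@cadlag_step R 'I_2 (fun k => W w ((minn k (n.+1 ^ 2))%:R * tau))).
by rewrite invr_gt0.
Qed.

Lemma grid_path_skeleton n tau w : grid_path n tau w =
  (fun t => nth k0 (skeleton W tau (n.+1 ^ 2).+1 w) (minn (Num.truncn (t * n.+1%:R)) (n.+1 ^ 2))).
Proof.
apply/funext => t; rewrite /grid_path /skeleton (nth_map 0%N) ?size_iota ?ltnS ?geq_minr//.
by rewrite nth_iota ?add0n// ltnS geq_minr.
Qed.

Variables (F : (R -> 'I_2) -> R) (M : R).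
Hypothesis FM : forall w, `|F w| <= M.
Hypothesis Fc : sk_continuous F.

(** The grid path is [W] composed with a monotone step function of time which is close to the
    identity on compact sets when [tau * n.+1] is close to 1. *)
Lemma grid_path_cvg (n : nat -> nat) (tau : nat -> R) :
  (forall N, 0 <= tau N) -> (forall c : R, \forall N \near \oo, c <= (n N).+1%:R) ->
  (fun N => tau N * (n N).+1%:R) @ \oo --> (1 : R) ->
  (fun N => Rintegral P [set: Om] (fun w => F (grid_path (n N) (tau N) w))) @ \oo -->
  Rintegral P [set: Om] (fun w => F (W w)).
Proof.
move=> tau0 noo taun.
apply: (@Rintegral_cvg_bounded _ _ _ P setT _ _ M) => //.
- by rewrite setCT measure0.
- move=> N.
  rewrite (_ : (fun w => _) = (fun w => (fun s => F (fun t : R => nth k0 s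
      (minn (Num.truncn (t * (n N).+1%:R)) ((n N).+1 ^ 2)))) (skeleton W (tau N) ((n N).+1 ^ 2).+1 w))).
    exact: (measurable_skeleton HW _ _ (fun s => F (fun t : R => nth k0 s
      (minn (Num.truncn (t * (n N).+1%:R)) ((n N).+1 ^ 2))))).
  by apply/funext => w; rewrite grid_path_skeleton.
move=> w _; apply/cvgrPdist_lt => e e0.
have cW : cadlag (W w) by case: HW.
have [del del0 Hdel] := Fc cW e0.
have [eta eta0 [V V0 HV]] := sk_dist_time_warp cW del0.
have e1 : 0 < Num.min (eta / (V + 1) / 4) 1 by rewrite lt_min ltr01 !divr_gt0// ltr_wpDl.
near=> N.
apply: Hdel; first exact: cadlag_grid_path.
have mV : V + 1 <= (n N).+1%:R by near: N; exact: noo.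
have m4 : 4 / eta <= (n N).+1%:R by near: N; exact: noo.
have tm : `|1 - tau N * (n N).+1%:R| <= Num.min (eta / (V + 1) / 4) 1.
  by near: N; move/cvgrPdist_le: taun; apply.
set m := (n N).+1%:R : R in mV m4 tm *.
have m0 : 0 < m by rewrite ltr0n.
move: tm; rewrite le_min => /andP[tm1 tm2].
have V1 : 0 < V + 1 by lra.
have tmV : `|1 - tau N * m| * V <= eta / 4.
  apply: (@le_trans _ _ (eta / (V + 1) / 4 * (V + 1))).
    by apply: ler_pM => //; lra.
  by rewrite mulrAC divfK// gt_eqF.
have taum : tau N * m <= 2 by move: tm2; rewrite ler_norml; lra.
have taus : tau N <= eta / 2.
  have : tau N * (4 / eta) <= 2 by apply: le_trans taum; rewrite ler_wpM2l.
  rewrite mulrA ler_pdivrMr//; lra.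
apply: HV => [s t s0 st|t t0|t /andP[t0 tV]|].
- rewrite ler_wpM2r// ler_nat leq_min geq_minr andbT (leq_trans (geq_minl _ _))// le_truncn//.
  by rewrite ler_wpM2r.
- by rewrite mulr_ge0.
- have tm0 : 0 <= t * m by rewrite mulr_ge0// ltW.
  have /andP[k1 k2] := truncn_itv tm0; rewrite -/m.
  set k := Num.truncn (t * m) in k1 k2 *.
  have kK : (k <= (n N).+1 ^ 2)%N.
    rewrite -(ler_nat R) (le_trans k1)// expnS expn1 natrM -/m ler_wpM2r ?ltW//; lra.
  rewrite (minn_idPl kK).
  have h1 : k%:R * tau N <= t * m * tau N by rewrite ler_wpM2r.
  have h2 : t * m * tau N <= k.+1%:R * tau N by rewrite ler_wpM2r// ltW.
  have h3 : `|t * m * tau N - t| <= eta / 4.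
    rewrite (_ : t * m * tau N - t = (tau N * m - 1) * t); last by ring.
    rewrite normrM distrC (ger0_norm t0); apply: le_trans tmV; rewrite ler_wpM2l//.
  move: h2 h3; rewrite -natr1 mulrDl mul1r !ler_norml => h2 /andP[h3 h4].
  by apply/andP; split; lra.
- exact: cadlag_grid_path.
Unshelve. all: by end_near.
Qed.

End TwoStateWeakLimit.

(** * The trace compared with a sampled two-state chain *)

Section TraceApproximation.
Variables (R : realType) (d : measure_display) (Om : measurableType d) (P : probability Om R).
Variables (St : finType) (X : Om -> R -> St) (q : St -> St -> R) (gg : 'I_2 -> St) (k0 : 'I_2).
Let g0 := gg ord0.
Let g1 := gg ord_max.
Hypothesis g01 : g0 != g1.
Hypothesis HX : is_ctmc P X q (gg k0).
Hypothesis q_ge0 : forall i j, 0 <= q i j.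
Let G : pred St := [pred i | (i == g0) || (i == g1)].
Variables (g : St -> R) (c : R).
Hypothesis g_ge0 : forall i, 0 <= g i.
Hypothesis c_gt0 : 0 < c.
Hypothesis g_drift : forall i, ~~ G i -> \sum_j Qgen q i j * g j <= - c.
Variable mu : St -> R.
Hypothesis mu_gt0 : forall i, 0 < mu i.
Hypothesis q_rev : forall i j, mu i * q i j = mu j * q j i.
Hypothesis mu01 : mu g0 = mu g1.
Variables (lab : St -> 'I_2) (th rho : R).
Hypothesis labK : forall k, lab (gg k) = k.
Hypothesis th0 : 0 < th.
Hypothesis rho0 : 0 < rho.
Variables (F : (R -> 'I_2) -> R) (M : R).
Hypothesis FM : forall w, `|F w| <= M.
Hypothesis Fc : sk_continuous F.

Let h n : R := th / n.+1%:R.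
Let h_gt0 n : 0 < h n. Proof. by rewrite divr_gt0. Qed.
Let Pn n := Ptrans q (h n).
Let Pn_ge0 n i j : 0 <= Pn n i j.
Proof. by apply: Ptrans_ge0; [move=> *; exact: q_ge0|exact: ltW]. Qed.
Let Pn_sum n i : \sum_j Pn n i j = 1. Proof. exact: Ptrans_row_sum. Qed.
Let Pn_rev n i j : mu i * Pn n i j = mu j * Pn n j i. Proof. exact: Ptrans_rev. Qed.
Let gg_inj : injective gg.
Proof. by move=> a b ab; rewrite -(labK a) ab labK. Qed.
Let Ggg k : G (gg k).
Proof.
case: k => -[|[|//]] i; rewrite /G /=; apply/orP; [left|right]; apply/eqP; congr gg; exact/val_inj.
Qed.

Definition trace_jump n : R := hit (Ptrans q (th / n.+1%:R)) G g0 g1.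
Local Notation p := trace_jump.

Let hit2 n : (exists psi : St -> R, exists eps : R, [/\ 0 < eps <= 1, forall i, 1 <= psi i &
    forall i, \sum_(j | ~~ G j) Pn n i j * psi j <= (1 - eps) * psi i]) ->
  forall i, hit (Pn n) G g0 i + hit (Pn n) G g1 i = 1.
Proof.
move=> [psi [eps [e01 psi1 Hc]]] i.
rewrite -(hit_sum (Pn_ge0 n) (Pn_sum n) e01 psi1 Hc i).
rewrite (bigD1 g0) /=; last by rewrite /G /= eqxx.
rewrite (bigD1 g1) /=; last by rewrite /G /= eqxx orbT eq_sym.
rewrite big1 ?addr0// => j /andP[/andP[/orP[/eqP->|/eqP->]]]; rewrite ?eqxx ?andbF//.
Qed.

Let contr : exists n0, forall n, (n0 <= n)%N -> exists psi : St -> R, exists eps : R,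
  [/\ 0 < eps <= 1, forall i, 1 <= psi i &
    forall i, \sum_(j | ~~ G j) Pn n i j * psi j <= (1 - eps) * psi i].
Proof.
have [psi [psi1 [eps eps0 [h0 h00 H]]]] := lyapunov_Ptrans q_ge0 g_ge0 c_gt0 g_drift.
have [n0 _ Hn] := harmonic_scale_le th h00.
exists n0 => n n0n; exists psi, (eps * h n).
by have [|? ? _] := H (h n); [rewrite h_gt0 Hn|split].
Qed.

(** The Dirichlet principle is applied to the skeleton, then compared with the generator: at the
    skeleton's own minimizer for the lower bound, at the given [f] for the upper bound. *)
Lemma trace_jump_bounds (mf : R) (f : St -> R) (eps : R) : 0 < eps < 1 ->
  (forall phi, phi g0 = 1 -> phi g1 = 0 -> mf <= dirichlet q mu phi) ->
  f g0 = 1 -> f g1 = 0 ->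
  \forall n \near \oo, (1 - eps) * h n * mf <= 2 * (mu g1 * p n) <= h n * (dirichlet q mu f + eps).
Proof.
move=> /andP[e0 e1] Hmf f0 f1.
have mu0 i : 0 <= mu i by exact: ltW.
have [h1 h10 H1] := dirichlet_Ptrans_ge q_ge0 mu0 e0.
have [h2 h20 H2] := dirichlet_Ptrans_le q f mu0 e0.
have [n0 Hn0] := contr.
near=> n.
have hn1 : 0 < h n <= h1 by rewrite h_gt0; near: n; exact: harmonic_scale_le.
have hn2 : 0 < h n <= h2 by rewrite h_gt0; near: n; exact: harmonic_scale_le.
have nn0 : (n0 <= n)%N by near: n; exact: nbhs_infty_ge.
have Hc := hit2 (Hn0 n nn0).
have sym := trace_rate_sym g01 (Pn_ge0 n) (Pn_sum n) (Pn_rev n) Hc.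
rewrite -/(p n) -/(Pn n) in sym.
have -> : mu g1 * p n = mu g0 * hit (Pn n) G g1 g0 by [].
apply/andP; split.
  have [phi [phi0 phi1 <-]] := trace_rate_attained g01 (Pn_ge0 n) (Pn_sum n) (Pn_rev n) Hc.
  apply: le_trans (H1 _ phi hn1); rewrite ler_wpM2l ?Hmf// mulr_ge0 ?ltW//; lra.
apply: le_trans (H2 _ hn2).
exact: (trace_rate_le g01 (Pn_ge0 n) (Pn_sum n) mu_gt0 (Pn_rev n) Hc f0 f1).
Unshelve. all: by end_near.
Qed.

Variables (dW : measure_display) (OmW : measurableType dW) (PW : probability OmW R).
Variable W : OmW -> R -> 'I_2.
Hypothesis HW : is_ctmc PW W (fun i j : 'I_2 => if i != j then rho else 0) k0.

(** The inverse function of [t |-> (1 - expR (- 2 * rho * t)) / 2], the flip probability of the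
    limit chain after time [t]. *)
Definition flip_time (a : R) : R := - ln (1 - 2 * a) / (2 * rho).
Definition trace_label (w : Om) (t : R) : 'I_2 := lab (trace_proc X G w (th * t)).

(** Equal masses at the two states make the trace kernel symmetric, and a symmetric two-state kernel
    with flip probability below 1/2 belongs to the semigroup of the symmetric flip chain. *)
Let kernel_eq n a b : (forall i, hit (Pn n) G g0 i + hit (Pn n) G g1 i = 1) -> p n < 1/2 ->
  trace_kernel (Pn n) G (gg a) (gg b) =
  Ptrans (fun i j : 'I_2 => if i != j then rho else 0) (flip_time (p n)) a b.
Proof.
move=> Hc p2; rewrite Ptrans_two_state /flip_time.
have -> : - 2 * rho * (- ln (1 - 2 * p n) / (2 * rho)) = ln (1 - 2 * p n).
  by field; rewrite gt_eqF.
rewrite lnK ?posrE; last by lra.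
have sym : hit (Pn n) G g1 g0 = p n.
  have := trace_rate_sym g01 (Pn_ge0 n) (Pn_sum n) (Pn_rev n) Hc.
  rewrite mu01 => /(mulfI _); apply; exact: lt0r_neq0.
have H0 := Hc g0; have H1 := Hc g1; rewrite sym in H0.
have pE : hit (Pn n) G g0 g1 = p n by [].
rewrite pE in H1.
rewrite /trace_kernel Ggg.
have [->|->] : a = ord0 \/ a = ord_max.
  by case: a => -[|[|//]] i; [left|right]; exact/val_inj.
all: have [->|->] : b = ord0 \/ b = ord_max by case: b => -[|[|//]] i; [left|right]; exact/val_inj.
all: rewrite -/g0 -/g1 ?sym ?pE /= ?expr0 ?expr1; lra.
Qed.

Lemma trace_approx (eps : R) : 0 < eps -> \forall n \near \oo, 0 <= p n < 1/2 ->
  `|Rintegral P [set: Om] (fun w => F (trace_label w)) -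
    Rintegral PW [set: OmW] (fun w => F (grid_path W n (flip_time (p n)) w))| <= eps.
Proof.
move=> eps0.
pose K n := (n.+1 ^ 2)%N.
pose Psi n (l : seq St) := F (fun t => lab (step_path (gg k0) l (h n) (th * t))).
have [n0 Hn0] := contr.
(* The horizon [J n] is chosen once the mesh is fixed, so long that truncating the skeleton there
   costs at most [eps / 2]. *)
have exJ n : exists J, (K n <= J)%N /\ ((n0 <= n)%N ->
    `|Epath (Pn n) J (gg k0) (fun s => Psi n (gg k0 :: take (K n) (seq.filter G s))) -
      Epath (trace_kernel (Pn n) G) (K n) (gg k0) (fun s => Psi n (gg k0 :: s))| <= eps / 2).
  have [nn|nn] := leqP n0 n; last by exists (K n); split.
  have [psi [e [e01 psi1 Hc]]] := Hn0 n nn.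
  have := trace_law (Pn_ge0 n) (Pn_sum n) e01 psi1 Hc (k := K n) (i := gg k0)
    (Psi := fun s => Psi n (gg k0 :: s)).
  move=> /cvgrPdist_le/(_ (eps / 2)); rewrite divr_gt0// => /(_ isT)[J0 _ HJ].
  exists (maxn (K n) J0); split; first exact: leq_maxl.
  by move=> _; rewrite distrC; apply: HJ; rewrite /= leq_maxr.
have [J HJ] := choice exJ.
pose fn n w := Psi n (take (K n).+1 (seq.filter G (skeleton X (h n) (J n).+1 w))).
have [A [mA PA HA]] := occupation_infinite_as HX q_ge0 g_ge0 c_gt0 g_drift.
have cv : (fun n => Rintegral P [set: Om] (fn n)) @ \oo -->
    Rintegral P [set: Om] (fun w => F (trace_label w)).
  apply: (@Rintegral_cvg_bounded _ _ _ P A _ _ M) => //.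
  - by move=> n; exact: (measurable_skeleton HX _ _ (fun s => Psi n (take (K n).+1 (seq.filter G s)))).
  - by move=> n w; exact: FM.
  move=> w /HA[w0 wU]; apply/cvgrPdist_lt => e e0.
  have cX : cadlag (X w) by case: HX.
  have oI := @occupation_inside _ _ _ X G w cX.
  have oO := @occupation_outside _ _ _ X G w cX.
  have cT : cadlag (trace_proc X G w).
    exact: (cadlag_trace cX (occupation0 G cX) (occupation_incr G cX) oI oO wU).
  have cY : cadlag (trace_label w) by apply: cadlag_comp; exact: cadlag_scale.
  have [del del0 Hdel] := Fc cY e0.
  have [eta eta0 [V V0 HV]] := sk_dist_time_warp cY del0.
  have w0G : X w 0 \in G by rewrite w0; exact: Ggg.
  have d1 : 0 < th * eta by rewrite mulr_gt0.
  have d2 : 0 <= th * V by rewrite mulr_ge0// ltW.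
  have [h0 h00 [S0 HS0]] := discretized_trace cX (occupation0 G cX) (occupation_incr G cX) oI oO wU
    (gg k0) d1 d2 w0G.
  near=> n.
  have hn0 : 0 < h n <= h0 by rewrite h_gt0; near: n; exact: harmonic_scale_le.
  have nV : V <= n.+1%:R by near: n; exact: near_le_nat.
  have nS : S0 / th <= n.+1%:R by near: n; exact: near_le_nat.
  have Kh : (K n)%:R * h n = th * n.+1%:R.
    by rewrite /K /h expnS expn1 natrM; field; rewrite addrC natr1 pnatr_eq0.
  have SJ : S0 <= (J n).+1%:R * h n.
    apply: (@le_trans _ _ ((K n)%:R * h n)); last first.
      by rewrite ler_pM2r// ler_nat; apply: leqW; case: (HJ n).
    by rewrite Kh mulrC -ler_pdivrMr.
  have VK : th * V <= (K n)%:R * h n by rewrite Kh ler_pM2l.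
  have [phi [phi_mono phi_ge0 phi_close phiE]] := HS0 (h n) (J n).+1 (K n) hn0 SJ VK.
  (* Paths are functions on all of [R] and [F] may see negative times, where the step path keeps its
     value at 0. *)
  pose phi' t := phi (th * Num.max 0 t) / th.
  pose l := take (K n).+1 (seq.filter G (skeleton X (h n) (J n).+1 w)).
  have pathE : (fun t => lab (step_path (gg k0) l (h n) (th * t))) = (fun t => trace_label w (phi' t)).
    apply/funext => t.
    have -> : step_path (gg k0) l (h n) (th * t) = step_path (gg k0) l (h n) (th * Num.max 0 t).
      rewrite /step_path; have [//|t0] := leP 0 t.
      rewrite (_ : Num.truncn (th * t / h n) = 0%N); first by rewrite mulr0 mul0r truncn0.
      apply/truncn0Pn; rewrite -ltNge (@le_lt_trans _ _ 0)//.
      by rewrite pmulr_lle0 ?invr_gt0// pmulr_rle0// ltW.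
    rewrite /trace_label /phi' (mulrC th (_ / th)) divfK ?gt_eqF//.
    have tm0 : 0 <= th * Num.max 0 t by rewrite mulr_ge0 ?(ltW th0)// le_max lexx.
    by have := phiE _ tm0; rewrite /l /skeleton => ->.
  have cl : cadlag (fun t => lab (step_path (gg k0) l (h n) (th * t))).
    by apply: cadlag_comp; apply: cadlag_scale => //; exact: cadlag_step_path.
  have -> : fn n w = F (fun t => trace_label w (phi' t)) by rewrite -pathE.
  apply: Hdel; first by rewrite -pathE.
  have m0 t : 0 <= th * Num.max 0 t by rewrite mulr_ge0 ?(ltW th0)// le_max lexx.
  apply: HV => [s t s0 st|t t0|t /andP[t0 tV]|]; last by rewrite -pathE.
  - rewrite /phi' ler_pM2r ?invr_gt0//; apply: phi_mono => //.
    by rewrite ler_pM2l// ge_max le_max lexx /= le_max st orbT.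
  - by rewrite /phi' divr_ge0 ?phi_ge0// ltW.
  - rewrite /phi' (max_idPr t0).
    have -> : phi (th * t) / th - t = (phi (th * t) - th * t) / th by field; rewrite gt_eqF.
    rewrite normrM [`|th^-1|]gtr0_norm ?invr_gt0// ler_pdivrMr// (mulrC eta).
    by apply: phi_close; rewrite mulr_ge0 ?(ltW th0)//= ler_pM2l.
near=> n; move=> /andP[p0 p2].
have nn0 : (n0 <= n)%N by near: n; exact: nbhs_infty_ge.
have Hc := hit2 (Hn0 n nn0).
have close : `|Rintegral P [set: Om] (fun w => F (trace_label w)) - Rintegral P [set: Om] (fn n)| <= eps / 2.
  by near: n; move/cvgrPdist_le: cv; apply; rewrite divr_gt0.
have fnE : Rintegral P [set: Om] (fn n) =
    Epath (Pn n) (J n) (gg k0) (fun s => Psi n (gg k0 :: take (K n) (seq.filter G s))).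
  rewrite (skeleton_expectation HX (J n) (fun s => Psi n (take (K n).+1 (seq.filter G s))) (ltW (h_gt0 n))).
  by apply: eq_Epath => s _ /=; rewrite Ggg.
have gridE : Rintegral PW [set: OmW] (fun w => F (grid_path W n (flip_time (p n)) w)) =
    Epath (trace_kernel (Pn n) G) (K n) (gg k0) (fun s => Psi n (gg k0 :: s)).
  have tau0 : 0 <= flip_time (p n).
    rewrite /flip_time divr_ge0 ?mulr_ge0 ?(ltW rho0)// oppr_ge0 ln_le0//; lra.
  rewrite (_ : (fun w => F (grid_path W n (flip_time (p n)) w)) =
     (fun w => (fun s => F (fun t : R => nth k0 s (minn (Num.truncn (t * n.+1%:R)) (n.+1 ^ 2))))
       (skeleton W (flip_time (p n)) (n.+1 ^ 2).+1 w))); last first.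
    by apply/funext => w; rewrite (grid_path_skeleton _ k0).
  rewrite (skeleton_expectation HW (n.+1 ^ 2) (fun s => F (fun t : R => nth k0 s (minn (Num.truncn (t * n.+1%:R)) (n.+1 ^ 2)))) tau0).
  rewrite (@Epath_embed _ _ _ (trace_kernel (Pn n) G) _ gg gg_inj _ (fun a b => kernel_eq a b Hc p2)).
    apply: eq_Epath => s ss; rewrite /Psi; congr F; apply/funext => t.
    rewrite /step_path /= size_map ss.
    have -> : th * t / h n = t * n.+1%:R.
      by rewrite /h invf_div; field; rewrite gt_eqF.
    rewrite -[gg k0 :: _]/(map gg (k0 :: s)) (nth_map k0) ?labK//.
    by rewrite /= ss ltnS geq_minr.
  move=> i j nj; rewrite /trace_kernel ifF//; apply/negP => /orP[]/eqP jg.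
    by have := nj ord0; rewrite jg eqxx.
  by have := nj ord_max; rewrite jg eqxx.
have [_ Jc] := HJ n.
rewrite gridE (le_trans (ler_distD (Rintegral P [set: Om] (fn n)) _ _))//.
have := Jc nn0; rewrite -fnE; lra.
Unshelve. all: by end_near.
Qed.

End TraceApproximation.

(** * Reversibility of the inclusion process *)

(** An explicit substitute for hitting times: with [C] large, [C ^+ s i] grows so fast that the one
    move raising the score outweighs the possible loss from all the others. *)
Lemma drift_of_score (R : realType) (St : finType) (q : St -> St -> R) (G : pred St)
    (s : St -> nat) : (forall i j, 0 <= q i j) ->
  (forall i, ~~ G i -> exists j, (s i < s j)%N /\ 0 < q i j) ->
  exists g : St -> R, exists2 c : R, 0 < c &
    (forall i, 0 <= g i) /\ (forall i, ~~ G i -> \sum_j Qgen q i j * g j <= - c).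
Proof.
move=> q0 up.
pose Lam := \sum_i \sum_j q i j.
pose qs := \big[Num.min/1]_(ij : St * St | 0 < q ij.1 ij.2) q ij.1 ij.2.
have qs0 : 0 < qs.
  by rewrite /qs; elim/big_ind: _ => // a b a0 b0; rewrite lt_min a0.
have qsle i j : 0 < q i j -> qs <= q i j.
  by move=> qij; rewrite /qs (bigD1 (i, j))//= ge_min lexx.
have Lam0 : 0 <= Lam by rewrite sumr_ge0// => i _; rewrite sumr_ge0.
have Lamle i : \sum_j q i j <= Lam.
  rewrite /Lam [leRHS](bigD1 i)//= lerDl sumr_ge0// => k _; exact: sumr_ge0.
(* One upward move gains at least [(Lam + 1) * C ^+ s i] in mean, while all others together lose at
   most [Lam * C ^+ s i]; this gives the drift [-1]. *)
pose C := 1 + (Lam + 1) / qs.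
have C1 : 1 <= C by rewrite lerDl divr_ge0 ?addr_ge0// ltW.
have C0 : 0 < C by lra.
pose m := \max_i s i.
have Cs i : C ^+ s i <= C ^+ m by rewrite ler_weXn2l//; exact: leq_bigmax.
exists (fun i => C ^+ m - C ^+ s i), 1 => //; split=> [i|i Gi]; first by rewrite subr_ge0.
have [j0 [sj qj]] := up i Gi.
have j0i : j0 != i by apply/eqP => e; move: sj; rewrite e ltnn.
rewrite (bigD1 i)//= {1}/Qgen eqxx.
rewrite [X in _ + X](eq_bigr (fun j => q i j * (C ^+ m - C ^+ s j))); last first.
  by move=> j ji; rewrite /Qgen eq_sym (negbTE ji).
rewrite mulNr mulr_suml addrC -sumrB (eq_bigr (fun j => q i j * (C ^+ s i - C ^+ s j))); last first.
  by move=> j _; ring.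
rewrite (bigD1 j0)//=.
have Ci0 : 1 <= C ^+ s i by rewrite exprn_ege1.
have h1 : \sum_(j | (j != i) && (j != j0)) q i j * (C ^+ s i - C ^+ s j) <= Lam * C ^+ s i.
  apply: (@le_trans _ _ (\sum_(j | (j != i) && (j != j0)) q i j * C ^+ s i)).
    apply: ler_sum => j _; rewrite ler_wpM2l// gerBl exprn_ge0// ltW//.
  rewrite -mulr_suml ler_wpM2r ?(le_trans ler01)//.
  apply: le_trans (Lamle i); rewrite [leRHS](bigID (fun j => (j != i) && (j != j0)))/= lerDl.
  by rewrite sumr_ge0.
have h2 : q i j0 * (C ^+ s i - C ^+ s j0) <= - (Lam + 1) * C ^+ s i.
  apply: (@le_trans _ _ (q i j0 * (C ^+ s i - C ^+ (s i).+1))).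
    rewrite ler_wpM2l// lerD2l lerN2 ler_weXn2l//.
  rewrite (_ : C ^+ s i - C ^+ (s i).+1 = - ((Lam + 1) / qs * C ^+ s i)); last by rewrite exprS /C; ring.
  rewrite mulrN mulNr lerN2 mulrA ler_wpM2r ?(le_trans ler01)//.
  by rewrite mulrCA ler_peMr ?addr_ge0// ler_pdivlMr ?mul1r ?qsle.
rewrite mulNr mulrDl mul1r in h2; lra.
Qed.

Section Configurations.
Variables (R : realType) (T : finType).
Implicit Types (N n : nat) (z : T).

Lemma config_eqP N (eta zeta : config T N) :
  reflect (forall z, val eta z = val zeta z :> nat) (eta == zeta).
Proof.
apply: (iffP eqP) => [->//|H]; apply/val_inj/ffunP => z; exact: ord_inj.
Qed.

Lemma config_sum N (eta : config T N) : (\sum_z val eta z)%N = N.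
Proof. exact/eqP/(valP eta). Qed.

(** When [e] does not sum to [N] this returns the default [xi N z0]. *)
Definition config_of N (z0 : T) (e : T -> nat) : config T N :=
  insubd (xi N z0) [ffun z => inord (e z)].

Lemma config_ofE N z0 (e : T -> nat) z : (\sum_z e z)%N = N -> val (config_of N z0 e) z = e z :> nat.
Proof.
move=> eN.
have le z' : (e z' < N.+1)%N by rewrite ltnS -eN (bigD1 z')//= leq_addr.
rewrite /config_of val_insubd ifT ?ffunE ?inordK//.
by rewrite (eq_bigr e) ?eN// => z' _; rewrite ffunE inordK.
Qed.

Definition add_particle n (zeta : config T n) z : config T n.+1 :=
  config_of n.+1 z (fun z' => (val zeta z' + (z' == z))%N).

Lemma add_particleE n (zeta : config T n) z z' :
  val (add_particle zeta z) z' = (val zeta z' + (z' == z))%N :> nat.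
Proof.
rewrite config_ofE// big_split/= config_sum (bigD1 z)//= eqxx big1 ?addn0 ?addn1// => i /negbTE->//.
Qed.

Definition remove_particle n (eta : config T n.+1) z : config T n :=
  config_of n z (fun z' => (val eta z' - (z' == z))%N).

Lemma remove_particleE n (eta : config T n.+1) z z' : (0 < val eta z)%N ->
  val (remove_particle eta z) z' = (val eta z' - (z' == z))%N :> nat.
Proof.
move=> z0; rewrite config_ofE//.
have := config_sum eta; rewrite (bigD1 z)//= => eN; rewrite (bigD1 z)//= eqxx.
rewrite (eq_bigr (fun i => val eta i : nat)) => [|i /negbTE->]; last by rewrite subn0.
have [k kE] : exists k, val eta z = k.+1 :> nat by exists (val eta z).-1; rewrite prednK.
by move: eN; rewrite kE subn1 addSn => -[].
Qed.

Lemma add_particle_inj n (a b : config T n) z : add_particle a z = add_particle b z -> a = b.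
Proof.
move=> /eqP/config_eqP ab; apply/eqP/config_eqP => z'.
by have := ab z'; rewrite !add_particleE => /addIn.
Qed.

(** This is [Gamma(d + k) / (k! Gamma(d))], the one-site weight of the reversible measure. The
    companion [ip_u] equals [k.+1] times the next weight and describes a site that gains or loses a
    particle. *)
Definition ip_w (d : R) (k : nat) : R := \prod_(j < k) ((d + j%:R) / j.+1%:R).
Definition ip_u (d : R) (k : nat) : R := (d + k%:R) * ip_w d k.

Lemma ip_w0 d : ip_w d 0 = 1. Proof. by rewrite /ip_w big_ord0. Qed.

Lemma ip_wS d k : ip_w d k.+1 * k.+1%:R = ip_u d k.
Proof. by rewrite /ip_u /ip_w big_ord_recr/= -mulrA divfK ?pnatr_eq0// mulrC. Qed.

Lemma ip_w_gt0 d k : 0 < d -> 0 < ip_w d k.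
Proof. by move=> d0; apply: prodr_gt0 => j _; rewrite divr_gt0// ltr_wpDr. Qed.

Lemma ip_u_gt0 d k : 0 < d -> 0 < ip_u d k.
Proof. by move=> d0; rewrite mulr_gt0 ?ip_w_gt0// ltr_wpDr. Qed.

Variables (ms : T -> R) (r : T -> T -> R) (d : R).
Hypothesis ms_gt0 : forall z, 0 < ms z.
Hypothesis r_ge0 : forall a b, 0 <= r a b.
Hypothesis r_diag : forall a, r a a = 0.
Hypothesis r_rev : forall a b, ms a * r a b = ms b * r b a.
Hypothesis d_gt0 : 0 < d.

Definition ip_weight N (eta : config T N) : R :=
  \prod_z (ip_w d (val eta z) * ms z ^+ val eta z).

Lemma ip_weight_gt0 N (eta : config T N) : 0 < ip_weight eta.
Proof. by apply: prodr_gt0 => z _; rewrite mulr_gt0 ?ip_w_gt0 ?exprn_gt0. Qed.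

(** Conductances are indexed by the [n] particles that do not move: the edge joins [zeta] with one
    more particle at [s] to [zeta] with one more at [t]. Symmetry in [s] and [t] is then visible. *)
Definition edge_weight n (s t : T) (zeta : config T n) : R :=
  \prod_z ((if (z == s) || (z == t) then ip_u d (val zeta z) else ip_w d (val zeta z)) *
           ms z ^+ val zeta z).

Lemma edge_weightC n s t (zeta : config T n) : edge_weight s t zeta = edge_weight t s zeta.
Proof. by apply: eq_bigr => z _; rewrite orbC. Qed.

Lemma edge_weight_gt0 n s t (zeta : config T n) : 0 < edge_weight s t zeta.
Proof. by apply: prodr_gt0 => z _; rewrite mulr_gt0 ?exprn_gt0//; case: ifP; rewrite ?ip_w_gt0 ?ip_u_gt0. Qed.

Lemma ip_weight_add n s t (zeta : config T n) : s != t ->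
  ip_weight (add_particle zeta s) * (val zeta s).+1%:R * (d + (val zeta t)%:R) =
  ms s * edge_weight s t zeta.
Proof.
move=> st; rewrite /ip_weight /edge_weight (bigD1 s)//= [in RHS](bigD1 s)//= eqxx/=.
rewrite (bigD1 t) 1?eq_sym//= [in RHS](bigD1 t) 1?eq_sym//= eqxx orbT.
rewrite !add_particleE eqxx (negbTE (_ : t != s)) 1?eq_sym// addn1 addn0.
rewrite (eq_bigr (fun z => (if (z == s) || (z == t) then ip_u d (val zeta z) else ip_w d (val zeta z)) *
           ms z ^+ val zeta z)); last first.
  by move=> z /andP[/negbTE zs /negbTE zt]; rewrite add_particleE zs zt addn0.
rewrite -ip_wS exprS {2}/ip_u; ring.
Qed.

(** A jump is recorded by its two sites and by the common part [xi]; exchanging the two sites gives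
    detailed balance at once. *)
Lemma incl_rate_weight n (eta zeta : config T n.+1) : zeta != eta ->
  ip_weight eta * incl_rate r d eta zeta =
  \sum_s \sum_t \sum_(xi : config T n | (add_particle xi s == eta) && (add_particle xi t == zeta))
    ms s * r s t * edge_weight s t xi.
Proof.
move=> ze; rewrite /incl_rate (negbTE ze) mulr_sumr; apply: eq_bigr => s _.
rewrite mulr_sumr; apply: eq_bigr => t _.
have [<-|st] := eqVneq s t.
  by rewrite r_diag mulr0 if_same mulr0 big1// => xi _; rewrite !mulr0 mul0r.
case: ifPn => [/forallP cond|cond]; last first.
  rewrite mulr0 big1// => xi /andP[/eqP es /eqP et]; exfalso; move/negP: cond; apply.
  apply/forallP => z; rewrite /moven -es -et !add_particleE eqxx addn1 /=.
  by rewrite addnK.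
have s0 : (0 < val eta s)%N.
  rewrite lt0n; apply/negP => s0; case/negP: ze; apply/config_eqP => z.
  by have /eqP := cond z; rewrite /moven s0.
have E1 : add_particle (remove_particle eta s) s = eta.
  apply/eqP/config_eqP => z; rewrite add_particleE remove_particleE//.
  by have [->|_] := eqVneq z s; rewrite ?subnK// subn0 addn0.
have E2 : add_particle (remove_particle eta s) t = zeta.
  apply/eqP/config_eqP => z; rewrite add_particleE remove_particleE//.
  by have /eqP-> := cond z; rewrite /moven (gtn_eqF s0).
rewrite (big_pred1 (remove_particle eta s)); last first.
  move=> xi /=; apply/andP/eqP => [[/eqP e _]|->]; last by rewrite E1 E2.
  by apply: (@add_particle_inj _ _ _ s); rewrite E1.
have := ip_weight_add (remove_particle eta s) st.
rewrite E1 !remove_particleE// eqxx (negbTE (_ : t != s)) 1?eq_sym// subn0 subn1 prednK// => H.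
by rewrite [RHS]mulrAC -H; ring.
Qed.

Lemma incl_rate_rev n (eta zeta : config T n.+1) :
  ip_weight eta * incl_rate r d eta zeta = ip_weight zeta * incl_rate r d zeta eta.
Proof.
have [->//|ze] := eqVneq zeta eta.
rewrite !incl_rate_weight// 1?eq_sym// exchange_big/=; apply: eq_bigr => s _; apply: eq_bigr => t _.
by apply: eq_big => xi; rewrite 1?andbC// => _; rewrite r_rev edge_weightC.
Qed.

Definition edge_energy n (f : config T n.+1 -> R) (s t : T) : R :=
  \sum_(zeta : config T n) ms s * r s t * edge_weight s t zeta *
    (f (add_particle zeta t) - f (add_particle zeta s)) ^+ 2.

Lemma edge_energyC n (f : config T n.+1 -> R) s t : edge_energy f s t = edge_energy f t s.
Proof. by apply: eq_bigr => z _; rewrite r_rev edge_weightC -sqrrN opprB. Qed.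

Lemma edge_energy_ge0 n (f : config T n.+1 -> R) s t : 0 <= edge_energy f s t.
Proof.
apply: sumr_ge0 => z _; apply: mulr_ge0; last exact: sqr_ge0.
by apply: mulr_ge0; [apply: mulr_ge0; [exact: ltW|]|exact/ltW/edge_weight_gt0].
Qed.

Lemma edge_energy0 n (f : config T n.+1 -> R) s t : r s t = 0 -> edge_energy f s t = 0.
Proof. by move=> rst; apply: big1 => z _; rewrite rst mulr0 !mul0r. Qed.

Lemma dirichlet_incl_rate n (f : config T n.+1 -> R) :
  dirichlet (incl_rate r d (N:=n.+1)) (@ip_weight n.+1) f = \sum_s \sum_t edge_energy f s t.
Proof.
rewrite /dirichlet.
transitivity (\sum_eta \sum_zeta \sum_s \sum_t \sum_(xi : config T n |
     (add_particle xi s == eta) && (add_particle xi t == zeta))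
    ms s * r s t * edge_weight s t xi * (f zeta - f eta) ^+ 2).
  apply: eq_bigr => eta _; apply: eq_bigr => zeta _.
  have [->|ze] := eqVneq zeta eta.
    rewrite subrr expr0n mulr0 big1// => s _; rewrite big1// => t _; rewrite big1// => *; exact: mulr0.
  rewrite incl_rate_weight// mulr_suml; apply: eq_bigr => s _; rewrite mulr_suml.
  by apply: eq_bigr => t _; rewrite mulr_suml.
under eq_bigr do rewrite exchange_big/=.
rewrite exchange_big/=; apply: eq_bigr => s _.
under eq_bigr do rewrite exchange_big/=.
rewrite exchange_big/=; apply: eq_bigr => t _; rewrite /edge_energy.
under eq_bigr do under eq_bigr do rewrite big_mkcond/=.
under eq_bigr do rewrite exchange_big/=.
rewrite exchange_big/=; apply: eq_bigr => xi _.
rewrite (bigD1 (add_particle xi s))//= [X in _ + X]big1 => [|eta /negbTE ne]; last first.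
  by rewrite big1// => zeta _; rewrite eq_sym ne.
rewrite addr0 (bigD1 (add_particle xi t))//= !eqxx/= big1 ?addr0// => zeta /negbTE ne.
by rewrite eq_sym ne.
Qed.
End Configurations.

(** * Coordinates on the configurations over four sites *)

Section FourSites.
Variables (R : realType) (T : finType) (x0 x1 ya yb : T).
Hypothesis sites_uniq : uniq [:: x0; x1; ya; yb].
Hypothesis sites_cover : forall z, z \in [:: x0; x1; ya; yb].

Let sites_neq : [/\ x0 != x1, x0 != ya, x0 != yb & [/\ x1 != ya, x1 != yb & ya != yb]].
Proof. by move: sites_uniq; rewrite /= !inE !negb_or andbT => /and3P[/and3P[-> -> ->] /andP[-> ->] ->]. Qed.

Lemma big_four_sites (S : Type) (idx : S) (op : Monoid.com_law idx) (F : T -> S) :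
  \big[op/idx]_z F z = op (F x0) (op (F x1) (op (F ya) (F yb))).
Proof.
rewrite (perm_big [:: x0; x1; ya; yb]).
  by rewrite !big_cons big_nil Monoid.mulm1.
apply: uniq_perm => //; first exact: index_enum_uniq.
by move=> z; rewrite mem_index_enum sites_cover.
Qed.

(** The remaining particles sit at [x1]; the natural subtraction makes this meaningful only for
    [k + a + b <= N]. The parameters [ya] and [yb] are kept arbitrary so that each lemma serves for
    both orders of the two sites. *)
Definition cfg N (k a b : nat) : config T N :=
  config_of N x0 (fun z => if z == x0 then k else if z == ya then a else if z == yb then b
    else (N - (k + a + b))%N).

Lemma cfgE N k a b : (k + a + b <= N)%N ->
  [/\ val (cfg N k a b) x0 = k :> nat, val (cfg N k a b) x1 = (N - (k + a + b))%N :> nat,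
     val (cfg N k a b) ya = a :> nat & val (cfg N k a b) yb = b :> nat].
Proof.
move=> kab; have [n1 n2 n3 [n4 n5 n6]] := sites_neq.
have H z : val (cfg N k a b) z = (if z == x0 then k else if z == ya then a else if z == yb then b
    else (N - (k + a + b))%N) :> nat.
  apply: config_ofE; rewrite big_four_sites/= eqxx (eq_sym x1) (negbTE n1) (eq_sym ya) (negbTE n2).
  by rewrite (eq_sym yb) (negbTE n3) (negbTE n4) (negbTE n5) (eq_sym yb) (negbTE n6) !eqxx; lia.
rewrite !H eqxx (eq_sym x1) (negbTE n1) (eq_sym ya) (negbTE n2).
by rewrite (eq_sym yb) (negbTE n3) (negbTE n4) (negbTE n5) (eq_sym yb) (negbTE n6) !eqxx.
Qed.

Lemma config_four_eq N (eta zeta : config T N) : val eta x0 = val zeta x0 :> nat ->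
  val eta ya = val zeta ya :> nat -> val eta yb = val zeta yb :> nat -> eta = zeta.
Proof.
move=> e0 ea eb; apply/eqP/config_eqP => z.
have e1 : val eta x1 = val zeta x1 :> nat.
  by have := config_sum eta; have := config_sum zeta; move: e0 ea eb; rewrite !big_four_sites/=; lia.
by have := sites_cover z; rewrite !inE => /or4P[] /eqP->.
Qed.

Lemma config_four_sum N (eta : config T N) :
  (val eta x0 + val eta x1 + val eta ya + val eta yb)%N = N.
Proof. by have := config_sum eta; rewrite big_four_sites/=; lia. Qed.

Lemma cfgK N (eta : config T N) : cfg N (val eta x0) (val eta ya) (val eta yb) = eta.
Proof.
have le : (val eta x0 + val eta ya + val eta yb <= N)%N by have := config_four_sum eta; lia.
by have [e0 e1 ea eb] := cfgE le; apply: config_four_eq.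
Qed.

Lemma sum_cfg N (G : config T N -> R) : \sum_eta G eta =
  \sum_(k < N.+1) \sum_(a < N.+1) \sum_(b < N.+1)
    (if (k + a + b <= N)%N then G (cfg N k a b) else 0).
Proof.
under [RHS]eq_bigr do rewrite pair_big/=.
rewrite pair_big/= -big_mkcond/=.
rewrite (reindex_onto (fun t : 'I_N.+1 * ('I_N.+1 * 'I_N.+1) => cfg N t.1 t.2.1 t.2.2)
  (fun eta => (val eta x0, (val eta ya, val eta yb)))) => [|eta _]; last exact: cfgK.
apply: eq_bigl => -[k [a b]] /=; apply/idP/idP => [/eqP[E0 Ea Eb]|le].
  by have := config_four_sum (cfg N k a b); rewrite /= E0 Ea Eb; lia.
have [e0 e1 ea eb] := cfgE le.
by apply/eqP; congr (_, (_, _)); exact: ord_inj.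
Qed.

Lemma add_particle_cfg N k a b : (k + a + b <= N)%N ->
  [/\ add_particle (cfg N k a b) x0 = cfg N.+1 k.+1 a b,
      add_particle (cfg N k a b) x1 = cfg N.+1 k a b,
      add_particle (cfg N k a b) ya = cfg N.+1 k a.+1 b &
      add_particle (cfg N k a b) yb = cfg N.+1 k a b.+1].
Proof.
move=> le; have [n1 n2 n3 [n4 n5 n6]] := sites_neq.
have [e0 e1 ea eb] := cfgE le.
split; apply: config_four_eq; rewrite add_particleE ?e0 ?ea ?eb;
  rewrite ?eqxx ?(negbTE n1) ?(negbTE n2) ?(negbTE n3) ?(negbTE n4) ?(negbTE n5) ?(negbTE n6)
    ?[ya == x0]eq_sym ?[yb == x0]eq_sym ?[ya == x1]eq_sym ?[yb == x1]eq_sym ?[yb == ya]eq_sym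
    ?(negbTE n1) ?(negbTE n2) ?(negbTE n3) ?(negbTE n4) ?(negbTE n5) ?(negbTE n6) /= ?addn0 ?addn1.
all: match goal with |- context [cfg ?N ?k ?a ?b] =>
   have /cfgE[E0 E1 Ea Eb] : (k + a + b <= N)%N by rewrite ?addnS ?addSn ?ltnS// leqW end.
all: by rewrite ?E0 ?Ea ?Eb.
Qed.

Variables (ms : T -> R) (r : T -> T -> R) (d : R).
Hypothesis ms_x0 : ms x0 = 1.
Hypothesis ms_x1 : ms x1 = 1.

Definition cond_x0_ya n k a b : R :=
  ip_u d k * ip_u d a * ip_w d b * ip_w d (n - (k + a + b)) * (ms ya ^+ a * ms yb ^+ b).
Definition cond_x1_ya n k a b : R :=
  ip_w d k * ip_u d a * ip_w d b * ip_u d (n - (k + a + b)) * (ms ya ^+ a * ms yb ^+ b).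
Definition cond_ya_yb n k a b : R :=
  ip_w d k * ip_u d a * ip_u d b * ip_w d (n - (k + a + b)) * (ms ya ^+ a * ms yb ^+ b).

Let edge_weightE n s t k a b : (k + a + b <= n)%N -> edge_weight ms d s t (cfg n k a b) =
  (if (x0 == s) || (x0 == t) then ip_u d k else ip_w d k) *
  (if (ya == s) || (ya == t) then ip_u d a else ip_w d a) *
  (if (yb == s) || (yb == t) then ip_u d b else ip_w d b) *
  (if (x1 == s) || (x1 == t) then ip_u d (n - (k + a + b)) else ip_w d (n - (k + a + b))) *
  (ms ya ^+ a * ms yb ^+ b).
Proof.
move=> le; have [e0 e1 ea eb] := cfgE le.
by rewrite /edge_weight big_four_sites/= e0 e1 ea eb ms_x0 ms_x1 !expr1n; ring.
Qed.

Lemma edge_energy_x0_ya n (f : config T n.+1 -> R) : edge_energy ms r d f x0 ya =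
  r x0 ya * \sum_(k < n.+1) \sum_(a < n.+1) \sum_(b < n.+1) (if (k + a + b <= n)%N then
    cond_x0_ya n k a b * (f (cfg n.+1 k a.+1 b) - f (cfg n.+1 k.+1 a b)) ^+ 2 else 0).
Proof.
have [n1 n2 n3 [n4 n5 n6]] := sites_neq.
rewrite /edge_energy sum_cfg mulr_sumr; apply: eq_bigr => k _.
rewrite mulr_sumr; apply: eq_bigr => a _; rewrite mulr_sumr; apply: eq_bigr => b _.
case: ifPn => le; last by rewrite mulr0.
have [-> _ -> _] := add_particle_cfg le; rewrite edge_weightE// ms_x0 /cond_x0_ya !eqxx/= orbT.
rewrite [yb == x0]eq_sym (negbTE n3) [yb == ya]eq_sym (negbTE n6) [x1 == x0]eq_sym (negbTE n1) (negbTE n4)/=.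
by rewrite mul1r [RHS]mulrA.
Qed.

Lemma edge_energy_x1_ya n (f : config T n.+1 -> R) : edge_energy ms r d f x1 ya =
  r x1 ya * \sum_(k < n.+1) \sum_(a < n.+1) \sum_(b < n.+1) (if (k + a + b <= n)%N then
    cond_x1_ya n k a b * (f (cfg n.+1 k a.+1 b) - f (cfg n.+1 k a b)) ^+ 2 else 0).
Proof.
have [n1 n2 n3 [n4 n5 n6]] := sites_neq.
rewrite /edge_energy sum_cfg mulr_sumr; apply: eq_bigr => k _.
rewrite mulr_sumr; apply: eq_bigr => a _; rewrite mulr_sumr; apply: eq_bigr => b _.
case: ifPn => le; last by rewrite mulr0.
have [_ -> -> _] := add_particle_cfg le; rewrite edge_weightE// ms_x1 /cond_x1_ya !eqxx/= orbT.
rewrite [yb == x1]eq_sym (negbTE n5) [yb == ya]eq_sym (negbTE n6) (negbTE n1) (negbTE n2)/=.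
by rewrite mul1r [RHS]mulrA.
Qed.

Lemma edge_energy_ya_yb n (f : config T n.+1 -> R) : edge_energy ms r d f ya yb =
  (ms ya * r ya yb) * \sum_(k < n.+1) \sum_(a < n.+1) \sum_(b < n.+1) (if (k + a + b <= n)%N then
    cond_ya_yb n k a b * (f (cfg n.+1 k a b.+1) - f (cfg n.+1 k a.+1 b)) ^+ 2 else 0).
Proof.
have [n1 n2 n3 [n4 n5 n6]] := sites_neq.
rewrite /edge_energy sum_cfg mulr_sumr; apply: eq_bigr => k _.
rewrite mulr_sumr; apply: eq_bigr => a _; rewrite mulr_sumr; apply: eq_bigr => b _.
case: ifPn => le; last by rewrite mulr0.
have [_ _ -> ->] := add_particle_cfg le; rewrite edge_weightE// /cond_ya_yb !eqxx/= orbT.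
by rewrite (negbTE n2) (negbTE n3) (negbTE n4) (negbTE n5)/= [RHS]mulrA.
Qed.

Hypothesis r_diag : forall a, r a a = 0.
Hypothesis r_rev : forall a b, ms a * r a b = ms b * r b a.
Hypothesis r_x01 : r x0 x1 = 0.
Hypothesis r_x10 : r x1 x0 = 0.

Lemma dirichlet_four_sites n (f : config T n.+1 -> R) :
  dirichlet (incl_rate r d (N:=n.+1)) (ip_weight ms d (N:=n.+1)) f =
  2 * ((edge_energy ms r d f x0 ya + edge_energy ms r d f x1 ya) +
       (edge_energy ms r d f x0 yb + edge_energy ms r d f x1 yb) + edge_energy ms r d f ya yb).
Proof.
rewrite dirichlet_incl_rate// !big_four_sites/=.
rewrite !(edge_energy0 _ _ f (r_diag _)) (edge_energy0 _ _ f r_x01) (edge_energy0 _ _ f r_x10).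
rewrite (edge_energyC _ r_rev f ya x0) (edge_energyC _ r_rev f ya x1) (edge_energyC _ r_rev f yb x0).
rewrite (edge_energyC _ r_rev f yb x1) (edge_energyC _ r_rev f yb ya); ring.
Qed.

Lemma ip_weight_xi N : ip_weight ms d (xi N x0) = ip_w d N /\ ip_weight ms d (xi N x1) = ip_w d N.
Proof.
have [n1 n2 n3 [n4 n5 n6]] := sites_neq.
rewrite /ip_weight !big_four_sites/= /xi_fun !ffunE !eqxx (negbTE n1) (eq_sym x1) (negbTE n1).
rewrite (eq_sym ya) (negbTE n2) (eq_sym yb) (negbTE n3) (eq_sym ya) (negbTE n4) (eq_sym yb) (negbTE n5).
by rewrite /= !ip_w0 !expr0 ms_x0 ms_x1 !expr1n; split; ring.
Qed.

Lemma cfg_xi N : cfg N N 0 0 = xi N x0 /\ cfg N 0 0 0 = xi N x1.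
Proof.
have [n1 n2 n3 [n4 n5 n6]] := sites_neq.
have le1 : (N + 0 + 0 <= N)%N by rewrite !addn0.
have le2 : (0 + 0 + 0 <= N)%N by [].
have [e0 e1 ea eb] := cfgE le1; have [f0 f1 fa fb] := cfgE le2.
split; apply: config_four_eq; rewrite ?e0 ?ea ?eb ?f0 ?fa ?fb /= /xi_fun ffunE ?eqxx//.
- by rewrite (eq_sym ya) (negbTE n2).
- by rewrite (eq_sym yb) (negbTE n3).
- by rewrite (negbTE n1).
- by rewrite (eq_sym ya) (negbTE n4).
- by rewrite (eq_sym yb) (negbTE n5).
Qed.

End FourSites.

(** * Sums and inequalities *)

Section HarmonicBounds.
Variable R : realType.
Implicit Types (d : R) (N k : nat).

Definition harm N : R := \sum_(j < N) j.+1%:R^-1.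

Lemma harm_le N : (0 < N)%N -> harm N <= 1 + ln N%:R.
Proof.
case: N => // N _; elim: N => [|N IH]; first by rewrite /harm big_ord1 ln1 invr1 addr0.
rewrite /harm big_ord_recr/= -/(harm N.+1); apply: (le_trans (lerD IH (lexx _))).
rewrite -addrA lerD2l.
have N0 : 0 < N.+1%:R :> R by [].
have M0 : 0 < N.+2%:R :> R by [].
have : ln (N.+1%:R / N.+2%:R) <= - N.+2%:R^-1 :> R.
  apply: (@le_trans _ _ (N.+1%:R / N.+2%:R - 1)); last first.
    by rewrite -[X in _ - X](@divff _ N.+2%:R)// -mulrBl -opprB -natrB// subSnn mulN1r.
  have := @le_ln1Dx R (N.+1%:R / N.+2%:R - 1); rewrite addrCA subrr addr0; apply.
  by rewrite ltrBDl subrr divr_gt0.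
rewrite ln_div ?posrE//; move: (N.+2%:R^-1) (ln N.+1%:R) (ln N.+2%:R) => u v w; lra.
Qed.

(** From this product, [d <= ip_u d k <= d * expR (d * harm N)] is immediate; it is the place where
    [d_N log N -> 0] enters. *)
Lemma ip_u_prod d k : ip_u d k = d * \prod_(j < k) (1 + d / j.+1%:R).
Proof.
elim: k => [|k IH]; first by rewrite /ip_u ip_w0 big_ord0 addr0.
rewrite big_ord_recr/= mulrA -IH -(ip_wS d k) /ip_u.
have -> : 1 + d / k.+1%:R = (d + k.+1%:R) / k.+1%:R by field; rewrite addrC natr1 pnatr_eq0.
set w := ip_w d k.+1; field; by rewrite addrC natr1 pnatr_eq0.
Qed.

Lemma ip_u_ge d k : 0 <= d -> d <= ip_u d k.
Proof.
move=> d0; rewrite ip_u_prod ler_peMr//; elim/big_ind: _ => // [a b a1 b1|j _].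
  exact: mulr_ege1.
by rewrite lerDl divr_ge0.
Qed.

Lemma ip_u_le d k N : 0 <= d -> (k <= N)%N -> ip_u d k <= expR (d * harm N) * d.
Proof.
move=> d0 kN; rewrite ip_u_prod mulrC ler_wpM2r//.
apply: (@le_trans _ _ (\prod_(j < N) (1 + d / j.+1%:R))).
  rewrite -(subnKC kN) big_split_ord/= ler_peMr//.
    by apply: prodr_ge0 => j _; rewrite addr_ge0// divr_ge0.
  elim/big_ind: _ => // [a b a1 b1|j _]; first exact: mulr_ege1.
  by rewrite lerDl divr_ge0.
rewrite /harm mulr_sumr expR_sum; apply: ler_prod => j _.
by rewrite addr_ge0 ?divr_ge0//= expR_ge1Dx.
Qed.

Lemma ip_w_ge d k : 0 < d <= 1 -> d / k.+1%:R <= ip_w d k.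
Proof.
move=> /andP[d0 d1]; case: k => [|k]; first by rewrite ip_w0 divr1.
apply: (@le_trans _ _ (d / k.+1%:R)).
  by rewrite ler_pM2l// lef_pV2 ?posrE// ler_nat.
by rewrite ler_pdivrMr// ip_wS ip_u_ge// ltW.
Qed.

Lemma ip_w_le d k N : 0 <= d -> (k < N)%N -> ip_w d k.+1 <= expR (d * harm N) * d / k.+1%:R.
Proof. by move=> d0 kN; rewrite ler_pdivlMr// ip_wS ip_u_le// ltnW. Qed.

End HarmonicBounds.

Section FiniteSums.
Variable R : realType.

Lemma geom2_sum_le (m : R) n : 0 <= m < 1 ->
  \sum_(a < n) (a.+1 * a.+2)%:R * m ^+ a <= 2 / (1 - m) ^+ 3.
Proof.
move=> /andP[m0 m1]; have c0 : 0 < 1 - m by rewrite subr_gt0.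
pose q (k : nat) : R := 2 / (1 - m) ^+ 3 + 2 * k%:R / (1 - m) ^+ 2 + k%:R * (k%:R + 1) / (1 - m).
have -> : \sum_(a < n) (a.+1 * a.+2)%:R * m ^+ a = 2 / (1 - m) ^+ 3 - m ^+ n * q n.
  elim: n => [|n IH]; first by rewrite big_ord0 /q !(mulr0, mul0r) expr0; ring.
  rewrite big_ord_recr/= IH /q (exprS m n) natrM -!natr1.
  field; by rewrite gt_eqF.
have c0' := ltW c0; rewrite lerBlDr lerDl mulr_ge0 ?exprn_ge0// /q !addr_ge0//.
- by rewrite divr_ge0 ?exprn_ge0.
- by rewrite divr_ge0 ?exprn_ge0 ?mulr_ge0.
- by rewrite divr_ge0// mulr_ge0// addr_ge0.
Qed.

Lemma sum_exp_le (m : R) n : 0 <= m < 1 -> \sum_(a < n) m ^+ a <= (1 - m)^-1.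
Proof.
move=> /andP[m0 m1]; have c0 : 0 < 1 - m by rewrite subr_gt0.
rewrite -[(1 - m)^-1]mul1r ler_pdivlMr// mulrC.
have := subrX1 m n; rewrite -(opprB 1 m) mulNr => /eqP; rewrite -eqr_oppLR opprB => /eqP <-.
by rewrite lerBlDr lerDl exprn_ge0.
Qed.

Lemma titu_sum (I : finType) (P : pred I) (x c : I -> R) : (forall i, P i -> 0 < c i) ->
  (\sum_(i | P i) x i) ^+ 2 <= (\sum_(i | P i) x i ^+ 2 / c i) * (\sum_(i | P i) c i).
Proof.
move=> c0; set X := \sum_(i | P i) x i; set C := \sum_(i | P i) c i.
have [C0|C0] := eqVneq C 0.
  have P0 i : P i -> False.
    move=> Pi; have : c i <= C by rewrite /C (bigD1 i)//= lerDl sumr_ge0// => j /andP[/c0/ltW].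
    by rewrite C0 leNgt c0.
  by rewrite C0 mulr0 /X big1 ?expr0n//= => i /P0.
have Cp : 0 < C by rewrite lt_def C0 sumr_ge0// => j /c0/ltW.
rewrite -ler_pdivrMr//.
suff : 0 <= \sum_(i | P i) x i ^+ 2 / c i - X ^+ 2 / C by rewrite subr_ge0.
have -> : \sum_(i | P i) x i ^+ 2 / c i - X ^+ 2 / C =
    \sum_(i | P i) c i * (x i / c i - X / C) ^+ 2; last first.
  by apply: sumr_ge0 => i /c0 ci; rewrite mulr_ge0 ?sqr_ge0// ltW.
rewrite [RHS](eq_bigr (fun i => x i ^+ 2 / c i - 2 * (X / C) * x i + (X / C) ^+ 2 * c i)).
  rewrite big_split/= sumrB -!mulr_sumr -/X -/C.
  set S := \sum_(i | P i) x i ^+ 2 / c i; move: S => S.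
  by field.
by move=> i /c0 ci; field; rewrite C0 gt_eqF.
Qed.

Lemma abel_sum_le (s E : nat -> R) K (B c : R) :
  (forall k, (k <= K)%N -> `|E k| <= B) -> (forall k, (k <= K)%N -> `|s k| <= 1) ->
  (forall k, (k < K)%N -> `|s k.+1 - s k| <= c) ->
  `|\sum_(k < K) s k * (E k.+1 - E k)| <= B * (2 + K%:R * c).
Proof.
move=> EB s1 sc.
have B0 : 0 <= B by apply: le_trans (EB 0%N _).
have -> : \sum_(k < K) s k * (E k.+1 - E k) =
   s K * E K - s 0%N * E 0%N - \sum_(k < K) (s k.+1 - s k) * E k.+1.
  elim: K {EB s1 sc} => [|K IH]; first by rewrite !big_ord0 subrr subr0.
  by rewrite !big_ord_recr/= IH; ring.
have h x y b b' : `|x| <= b -> `|y| <= b' -> `|x * y| <= b * b'.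
  by move=> ? ?; rewrite normrM ler_pM.
apply: (le_trans (ler_normB _ _)); rewrite mulrDr; apply: lerD.
  apply: (le_trans (ler_normB _ _)); rewrite (_ : B * 2 = 1 * B + 1 * B); last by ring.
  by apply: lerD; apply: h; rewrite ?s1 ?EB.
apply: (le_trans (ler_norm_sum _ _ _)); apply: (@le_trans _ _ (\sum_(k < K) c * B)).
  by apply: ler_sum => k _; apply: h; [exact: sc|exact: EB].
have -> : \sum_(k < K) c * B = B * (K%:R * c) by rewrite sumr_const card_ord -mulr_natl; ring.
exact: lexx.
Qed.

End FiniteSums.

Section ParallelSum.
Variable R : realType.
Implicit Types a b : R.

(** The resistance of two resistors in parallel. *)
Definition par a b : R := (1 / a + 1 / b)^-1.

Lemma parE a b : 0 < a -> 0 < b -> par a b = a * b / (a + b).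
Proof. by move=> a0 b0; rewrite /par; field; rewrite !gt_eqF// addr_gt0. Qed.

Lemma par_gt0 a b : 0 < a -> 0 < b -> 0 < par a b.
Proof. by move=> a0 b0; rewrite invr_gt0 addr_gt0// divr_gt0. Qed.

Lemma par_le a b a' b' : 0 < a <= a' -> 0 < b <= b' -> par a b <= par a' b'.
Proof.
move=> /andP[a0 aa] /andP[b0 bb].
have a0' := lt_le_trans a0 aa; have b0' := lt_le_trans b0 bb.
rewrite /par !div1r lef_pV2 ?posrE ?addr_gt0 ?invr_gt0// lerD// lef_pV2//.
Qed.

Lemma par_scale c a b : 0 < c -> 0 < a -> 0 < b -> par (c * a) (c * b) = c * par a b.
Proof.
by move=> c0 a0 b0; rewrite !parE ?mulr_gt0//; field; rewrite -mulrDr !gt_eqF ?mulr_gt0 ?addr_gt0.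
Qed.

Lemma par_add_le a b s t : 0 < a -> 0 < b -> 0 <= s -> 0 <= t ->
  par (a + s) (b + t) <= par a b + s + t.
Proof.
move=> a0 b0 s0 t0; rewrite !parE ?ltr_pwDl//.
have ab : 0 < a + b by rewrite addr_gt0.
rewrite ler_pdivrMr ?(ltr_pwDl (ltr_pwDl a0 s0)) ?addr_ge0 ?(ltW b0)//.
have -> : a * b / (a + b) + s + t = (a * b + (s + t) * (a + b)) / (a + b) by field; rewrite gt_eqF.
rewrite mulrAC ler_pdivlMr// -subr_ge0.
have -> : (a * b + (s + t) * (a + b)) * (a + s + (b + t)) - (a + s) * (b + t) * (a + b) =
  s * (a * (a + b) + a * b) + t * (b * (a + b) + a * b) + (a + b) * ((s + t) * (s + t) - s * t) by ring.
have st0 : 0 <= (s + t) * (s + t) - s * t by nra.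
have a0' := ltW a0; have b0' := ltW b0.
apply: addr_ge0; last by rewrite mulr_ge0// ltW.
by apply: addr_ge0; rewrite mulr_ge0// addr_ge0// mulr_ge0// ltW.
Qed.

Lemma par_lip a b a' b' : 0 < a -> 0 < b -> 0 < a' -> 0 < b' ->
  `|par a b - par a' b'| <= `|a - a'| + `|b - b'|.
Proof.
move=> a0 b0 a0' b0'.
have H (x y x' y' : R) : 0 < x -> 0 < y -> 0 < x' -> 0 < y' -> par x y <= par x' y' + `|x - x'| + `|y - y'|.
  move=> x0 y0 x0' y0'; apply: le_trans (par_add_le x0' y0' (normr_ge0 _) (normr_ge0 _)).
  apply: par_le; rewrite ?x0 ?y0/= -lerBlDl; exact: ler_norm.
rewrite ler_norml; have := H _ _ _ _ a0 b0 a0' b0'; have := H _ _ _ _ a0' b0' a0 b0.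
rewrite (distrC a') (distrC b'); lra.
Qed.

End ParallelSum.

Section RiemannSum.
Variable R : realType.
Let mu := @lebesgue_measure R.

Let lipschitz_integrable (phi : R -> R) (L a b : R) :
  (forall s t, `|phi s - phi t| <= L * `|s - t|) -> mu.-integrable `[a, b] (EFin \o phi).
Proof.
move=> phiL.
have L0 : 0 <= L by have := phiL 0 1; rewrite sub0r normrN normr1 mulr1 => H; apply: le_trans H.
apply: continuous_compact_integrable; first exact: segment_compact.
apply: continuous_subspaceT => t.
apply/cvgrPdist_le => e e0; near=> s.
have sN : `|t - s| <= e / (L + 1).
  by near: s; apply: (@cvgr_dist_le _ _ _ _ _ _ t (@cvg_id _ _)); rewrite divr_gt0// ltr_wpDl.
apply: le_trans (phiL _ _) _; apply: (@le_trans _ _ ((L + 1) * `|t - s|)).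
  by rewrite ler_wpM2r// lerDl.
by rewrite mulrC -ler_pdivlMr// ltr_wpDl.
Unshelve. all: by end_near.
Qed.

Let riemann_sum_global (phi : R -> R) (L : R) N : (0 < N)%N ->
  (forall s t, `|phi s - phi t| <= L * `|s - t|) ->
  `|\sum_(k < N) phi (k%:R / N%:R) / N%:R - Rintegral mu `[0, 1] phi| <= L / N%:R.
Proof.
move=> N0 phiL.
have L0 : 0 <= L by have := phiL 0 1; rewrite sub0r normrN normr1 mulr1 => H; apply: le_trans H.
have n0 : 0 < N%:R :> R by rewrite ltr0n.
have H k : `|\sum_(j < k) phi (j%:R / N%:R) / N%:R - Rintegral mu `[0, k%:R / N%:R] phi|
    <= k%:R * (L / N%:R ^+ 2).
  elim: k => [|k IH]; first by rewrite big_ord0 !mul0r set_itv1 Rintegral_set1 subrr normr0.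
  have kk : k%:R / N%:R <= k.+1%:R / N%:R :> R by rewrite ler_pM2r ?invr_gt0// ler_nat.
  have k0 : 0 <= k%:R / N%:R :> R by rewrite divr_ge0.
  have E := @Rintegral_itvB R phi (BLeft 0) (BRight (k.+1%:R / N%:R)) (k%:R / N%:R)
    (lipschitz_integrable _ _ phiL).
  rewrite big_ord_recr/=.
  have {}E : Rintegral mu `[0, k.+1%:R / N%:R] phi = Rintegral mu `[0, k%:R / N%:R] phi +
      Rintegral mu `[k%:R / N%:R, k.+1%:R / N%:R] phi.
    rewrite -(@Rintegral_itv_obnd_cbnd _ (k%:R / N%:R)); last first.
      by apply: integrableS (lipschitz_integrable (k%:R / N%:R) (k.+1%:R / N%:R) phiL) => //;
        exact: subset_itv_oc_cc.
    by rewrite -E ?bnd_simp//; rewrite /mu; ring.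
  set a := k%:R / N%:R in kk k0 E *; set b := k.+1%:R / N%:R in kk E *.
  have D : `|Rintegral mu `[a, b] phi - phi a / N%:R| <= L / N%:R ^+ 2.
    have ab1 : b - a = N%:R^-1 by rewrite /a /b -mulrBl -natrB// subSnn div1r.
    have cst c : Rintegral mu `[a, b] (fun=> c) = c / N%:R.
      have mab : mu `[a, b] = (b - a)%:E.
        by rewrite /mu lebesgue_measure_itv/= lte_fin -subr_gt0 ab1 invr_gt0 n0 -ab1.
      have -> : Rintegral mu `[a, b] (fun=> c) = c * fine (mu `[a, b]) by exact: Rintegral_cst.
      by rewrite mab /= ab1.
    have iphi := lipschitz_integrable a b phiL.
    have icst c : mu.-integrable `[a, b] (EFin \o (fun=> c : R)).
      by apply: (@lipschitz_integrable _ 0) => s t; rewrite subrr normr0 mul0r.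
    rewrite -cst -RintegralB//; apply: le_trans (le_normr_Rintegral _ _) _ => //.
      by apply: (@lipschitz_integrable _ L) => s t; rewrite opprB addrA subrK; exact: phiL.
    apply: (@le_trans _ _ (Rintegral mu `[a, b] (fun=> L / N%:R))).
      apply: le_Rintegral => //.
        apply: (@lipschitz_integrable _ L) => s t.
        by apply: le_trans (ler_dist_dist _ _) _; rewrite opprB addrA subrK; exact: phiL.
      move=> t /=; rewrite in_itv/= => /andP[ta tb]; apply: le_trans (phiL _ _) _.
      by rewrite ler_wpM2l// ger0_norm ?subr_ge0// -ab1 lerB.
    by rewrite cst -mulrA -expr2 exprVn.
  rewrite E opprD addrACA -[k.+1%:R]natr1 mulrDl mul1r.
  by apply: le_trans (ler_normD _ _) (lerD IH _); rewrite distrC.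
have := H N; rewrite divff ?gt_eqF// => /le_trans; apply.
by rewrite expr2 invfM !mulrA (mulrC _ L) mulfK ?gt_eqF.
Qed.

(** The integrand is Lipschitz on [[0, 1]] only; composing it with the projection onto this interval
    makes it globally Lipschitz without changing either side. *)
Lemma riemann_sum_lipschitz (phi : R -> R) (L : R) N : (0 < N)%N ->
  (forall s t, 0 <= s <= 1 -> 0 <= t <= 1 -> `|phi s - phi t| <= L * `|s - t|) ->
  `|\sum_(k < N) phi (k%:R / N%:R) / N%:R - Rintegral mu `[0, 1] phi| <= L / N%:R.
Proof.
move=> N0 phiL.
have L0 : 0 <= L by have := phiL 0 1; rewrite !lexx ler01 sub0r normrN normr1 mulr1 => H; apply: le_trans (H _ _).
pose cl (t : R) := Num.min 1 (Num.max 0 t).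
have cl01 t : 0 <= cl t <= 1.
  by rewrite /cl le_min ler01 le_max lexx ge_min lexx.
have clE t : 0 <= t <= 1 -> cl t = t by move=> /andP[t0 t1]; rewrite /cl (max_idPr t0) (min_idPr t1).
have clL s t : `|cl s - cl t| <= `|s - t|.
  have mx (a u v : R) : `|Num.max a u - Num.max a v| <= `|u - v|.
    have := ler_norm (u - v); have := ler_norm (v - u); rewrite (distrC v u) => h1 h2.
    by rewrite ler_norml; have [?|?] := leP a u; have [?|?] := leP a v; lra.
  have mn (a u v : R) : `|Num.min a u - Num.min a v| <= `|u - v|.
    have := ler_norm (u - v); have := ler_norm (v - u); rewrite (distrC v u) => h1 h2.
    by rewrite ler_norml; have [?|?] := leP a u; have [?|?] := leP a v; lra.
  exact: le_trans (mn _ _ _) (mx _ _ _).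
have -> : Rintegral mu `[0, 1] phi = Rintegral mu `[0, 1] (phi \o cl).
  by apply: eq_Rintegral => t; rewrite inE/= in_itv/= => /clE->.
rewrite (eq_bigr (fun k : 'I_N => (phi \o cl) (k%:R / N%:R) / N%:R)); last first.
  move=> k _ /=; rewrite clE// divr_ge0//= ler_pdivrMr ?ltr0n// mul1r ler_nat ltnW//.
apply: riemann_sum_global => // s t /=; apply: le_trans (phiL _ _ (cl01 _) (cl01 _)) _.
by rewrite ler_wpM2l.
Qed.
End RiemannSum.

(** * Lower bound on the capacity *)

Section LowerBound.
Variable R : realType.

Lemma pos_lower_bound (I : finType) (f : I -> R) : (forall i, 0 < f i) ->
  exists2 A, 0 < A <= 1 & forall i, A <= f i.
Proof.
move=> f0; exists (\big[Num.min/1]_i Num.min 1 (f i)).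
  elim/big_ind: _ => [|a b /andP[a0 a1] /andP[b0 b1]|i _]; rewrite ?ltr01 ?lexx//.
    by rewrite lt_min a0 b0 ge_min a1.
  by rewrite lt_min ltr01 f0 ge_min lexx.
by move=> i; rewrite (bigD1 i)//= !ge_min lexx !orbT.
Qed.

Lemma sum_ord_le (f : nat -> R) i j : (i <= j)%N -> (forall k, (k < j)%N -> 0 <= f k) ->
  \sum_(k < i) f k <= \sum_(k < j) f k.
Proof.
move=> ij f0; rewrite -(subnKC ij) in f0 *; rewrite big_split_ord/= lerDl sumr_ge0// => k _.
by rewrite f0// ltn_add2l.
Qed.

Lemma series_law (x y u v : R) : 0 < u -> 0 < v -> (x + y) ^+ 2 / (u + v) <= x ^+ 2 / u + y ^+ 2 / v.
Proof.
move=> u0 v0; rewrite -subr_ge0.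
have -> : x ^+ 2 / u + y ^+ 2 / v - (x + y) ^+ 2 / (u + v) = (x * v - y * u) ^+ 2 / (u * v * (u + v)).
  by field; rewrite !gt_eqF// addr_gt0.
by rewrite divr_ge0 ?sqr_ge0// !mulr_ge0 ?addr_ge0// ltW.
Qed.

Lemma parallel_law (x y a b : R) : 0 < a -> 0 < b ->
  (b / (a + b) * x + a / (a + b) * y) ^+ 2 <= (x ^+ 2 / a + y ^+ 2 / b) * par a b.
Proof.
move=> a0 b0; rewrite parE// -subr_ge0; have ab : 0 < a + b by rewrite addr_gt0.
have -> : (x ^+ 2 / a + y ^+ 2 / b) * (a * b / (a + b)) - (b / (a + b) * x + a / (a + b) * y) ^+ 2 =
   a * b * (x - y) ^+ 2 / (a + b) ^+ 2 by field; rewrite !gt_eqF.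
by apply: divr_ge0; [apply: mulr_ge0; [rewrite ltW// mulr_gt0|exact: sqr_ge0]|rewrite exprn_ge0// ltW].
Qed.

Lemma ratio_lip (u v u' v' c e : R) : 0 <= u -> 0 < v -> 0 < e -> e <= u' + v' -> 0 < u + v ->
  `|u' - u| <= c -> `|v' - v| <= c -> `|u' / (u' + v') - u / (u + v)| <= 3 * c / e.
Proof.
move=> u0 v0 e0 ee uv hu hv; have uv' : 0 < u' + v' by apply: lt_le_trans ee.
have c0 : 0 <= c by apply: le_trans hu.
have -> : u' / (u' + v') - u / (u + v) =
  ((u' - u) - (u / (u + v)) * ((u' - u) + (v' - v))) / (u' + v') by field; rewrite !gt_eqF.
have q1 : 0 <= u / (u + v) <= 1 by apply/andP; split; [rewrite divr_ge0// ltW|rewrite ler_pdivrMr// mul1r lerDl ltW].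
rewrite normrM normfV (gtr0_norm uv') ler_pM ?invr_ge0 ?(ltW uv')//; last by rewrite lef_pV2 ?posrE.
move: hu hv q1; move: (u' - u) (v' - v) (u / (u + v)) => x y q; rewrite !ler_norml => /andP[x1 x2] /andP[y1 y2] /andP[q0 q1].
by apply/andP; split; nra.
Qed.

Variables (al0 al1 m : 'I_2 -> R) (n0 : nat).
Hypothesis al0_gt0 : forall p, 0 < al0 p.
Hypothesis al1_gt0 : forall p, 0 < al1 p.
Hypothesis m_gt0 : forall p, 0 < m p.
Hypothesis m_lt1 : forall p, m p < 1.

(** For [a = 0, ..., n0] the conductors at one level are in parallel with weights [m p ^+ a]; the
    factor tends to [1 - m p] as [n0] grows. *)
Definition level_mass p : R := (\sum_(a < n0.+1) m p ^+ a)^-1.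
Local Notation gam := level_mass.
Definition resist p N (k : nat) : R := (N%:R - k%:R) / al0 p + k.+1%:R / al1 p.

Lemma level_mass_gt0 p : 0 < gam p.
Proof.
rewrite /gam invr_gt0 big_ord_recl expr0 ltr_pwDl// sumr_ge0// => a _.
by rewrite exprn_ge0// ltW.
Qed.

Lemma resist_gt0 p N k : (k <= N)%N -> 0 < resist p N k.
Proof.
by move=> kN; rewrite ltr_pwDr ?divr_gt0// divr_ge0 ?subr_ge0 ?ler_nat// ltW.
Qed.

(** [F p a k] stands for the value with [k] particles at [x_1], [a] at [y_p] and the others at
    [x_2]. The two edges lead from [(a, k)] through [(a.+1, k)] to [(a, k.+1)], in series; the
    conductances are stripped of the common factor [d ^+ 3]. *)
Definition level_energy p N (F : 'I_2 -> nat -> nat -> R) (a k : nat) : R :=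
  m p ^+ a * (al0 p * (F p a.+1 k - F p a k.+1) ^+ 2 / (N - k - a)%:R +
              al1 p * (F p a k - F p a.+1 k) ^+ 2 / k.+1%:R).

Let level_energy_ge0 p N F a k : 0 <= level_energy p N F a k.
Proof.
by rewrite mulr_ge0 ?exprn_ge0 ?(ltW (m_gt0 _))// addr_ge0// divr_ge0// mulr_ge0 ?sqr_ge0// ltW.
Qed.

Let sub_bounds N k a : (k < N - a)%N -> (0 < N - k - a <= N)%N.
Proof. lia. Qed.
Let addS_le N k a : (k + a.+1 <= N)%N -> (k < N - a)%N /\ (k + a <= N)%N.
Proof. lia. Qed.
Let sub_lt N j : (j < N)%N -> (N - j.+1 < N)%N.
Proof. lia. Qed.
Let level_le N k a : (n0 < N)%N -> (a <= n0)%N -> (k <= N - n0)%N -> (k + a <= N)%N.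
Proof. lia. Qed.
Let level_lt N k a : (a <= n0)%N -> (k < N - n0)%N -> (0 < N - k - a)%N.
Proof. lia. Qed.

(** The last term is an error: for [L] of order [N ^- 2] it is of order [N ^- (1/2)]. It collects
    the spread of [F] over [a], the last [n0] levels and the mismatch of the two branches. *)
Lemma thomson_lower_bound : exists C : R, forall N (F : 'I_2 -> nat -> nat -> R) (L : R),
  (n0 < N)%N -> (forall p k, F p 0%N k = F ord0 0%N k) -> F ord0 0%N 0%N = 0 -> F ord0 0%N N = 1 ->
  \sum_p \sum_(a < n0.+1) \sum_(k < N - a) level_energy p N F a k <= L ->
  1 <= Num.sqrt (L * \sum_(k < N) par (gam ord0 * resist ord0 N k) (gam ord_max * resist ord_max N k))
       + C * Num.sqrt (N%:R * L).
Proof.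
have [A /andP[A0 A1] HA] : exists2 A : R, 0 < A <= 1 & forall p,
    [/\ A <= al0 p, A <= al1 p, A <= (al0 p)^-1, A <= (al1 p)^-1 & A <= m p /\ A <= gam p].
  have [|A A01 HA] := @pos_lower_bound 'I_2 (fun p => Num.min (al0 p) (Num.min (al1 p)
    (Num.min (al0 p)^-1 (Num.min (al1 p)^-1 (Num.min (m p) (gam p)))))).
    by move=> p; rewrite !lt_min level_mass_gt0 m_gt0 al0_gt0 al1_gt0 !invr_gt0 al0_gt0 al1_gt0.
  by exists A => // p; have := HA p; rewrite !le_min => /and5P[? ? ? ? /andP[? ?]]; split.
have A0' := ltW A0.
pose b0 := Num.sqrt (A ^+ n0.+1)^-1.
pose Cs := 3 * A^-1 / (A * A).
exists (b0 * n0%:R * (6 + 2 * (2 + Cs))) => N F L n0N F0 F00 F0N HL.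
(* Each single edge has resistance at most [N / A ^+ n0.+1], so [B] bounds the increment of [F]
   along any edge. *)
pose S := Num.sqrt (N%:R * L); pose B := S * b0.
have N0 : 0 < N%:R :> R by rewrite ltr0n (leq_ltn_trans _ n0N).
have sum_ge0 : 0 <= \sum_p \sum_(a < n0.+1) \sum_(k < N - a) level_energy p N F a k.
  by apply: sumr_ge0 => p _; apply: sumr_ge0 => a _; apply: sumr_ge0.
have L0 : 0 <= L by apply: le_trans HL.
have S0 : 0 <= S by exact: sqrtr_ge0.
have b00 : 0 <= b0 by exact: sqrtr_ge0.
have B0 : 0 <= B by rewrite mulr_ge0.
have term p a k : (a <= n0)%N -> (k < N - a)%N -> level_energy p N F a k <= L.
  move=> an kN; apply: le_trans HL; rewrite (bigD1 p)//=.
  have an' : (a < n0.+1)%N by rewrite ltnS.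
  rewrite (bigD1 (Ordinal an'))//= (bigD1 (Ordinal kN))//= -!addrA lerDl !addr_ge0 ?sumr_ge0//.
  - by move=> i _; apply: sumr_ge0.
  - by move=> i _; apply: sumr_ge0 => j _; apply: sumr_ge0.
have ma p a : (a <= n0)%N -> A ^+ n0 <= m p ^+ a.
  move=> an; have [_ _ _ _ [Am _]] := HA p.
  apply: (@le_trans _ _ (m p ^+ n0)); first by rewrite lerXn2r ?nnegrE// ltW.
  by rewrite ler_wiXn2l// ltW.
have ptw (x al M mm : R) : A <= al -> A ^+ n0 <= mm -> 0 < M <= N%:R -> mm * (al * x ^+ 2 / M) <= L -> `|x| <= B.
  move=> Aal Amm /andP[M0 MN] H.
  have : x ^+ 2 <= (N%:R * L) * (A ^+ n0.+1)^-1.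
    rewrite ler_pdivlMr ?exprn_gt0//.
    apply: (@le_trans _ _ (M * L)); last by rewrite ler_wpM2r.
    apply: (@le_trans _ _ (M * (mm * (al * x ^+ 2 / M)))); last by rewrite ler_pM2l.
    have -> : M * (mm * (al * x ^+ 2 / M)) = x ^+ 2 * (al * mm) by field; rewrite gt_eqF.
    by rewrite (exprS A) ler_wpM2l ?sqr_ge0// ler_pM ?exprn_ge0.
  move=> /ler_wsqrtr; rewrite sqrtr_sqr sqrtrM ?mulr_ge0 ?(ltW N0)//.
have F1 p a k : (a <= n0)%N -> (k < N - a)%N -> `|F p a k - F p a.+1 k| <= B.
  move=> an kN; have [Aal0 Aal1 _ _ _] := HA p.
  apply: (ptw _ (al1 p) k.+1%:R (m p ^+ a)) => //; first exact: ma.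
    by rewrite ltr0n ler_nat (leq_trans kN)// leq_subr.
  apply: le_trans (term p a k an kN); rewrite ler_wpM2l ?exprn_ge0 ?(ltW (m_gt0 _))// lerDr.
  by rewrite divr_ge0// mulr_ge0 ?sqr_ge0// ltW.
have F2 p a k : (a <= n0)%N -> (k < N - a)%N -> `|F p a.+1 k - F p a k.+1| <= B.
  move=> an kN; have [Aal0 Aal1 _ _ _] := HA p.
  apply: (ptw _ (al0 p) (N - k - a)%:R (m p ^+ a)) => //; first exact: ma.
    by rewrite ltr0n ler_nat sub_bounds.
  apply: le_trans (term p a k an kN); rewrite ler_wpM2l ?exprn_ge0 ?(ltW (m_gt0 _))// lerDl.
  by rewrite divr_ge0// mulr_ge0 ?sqr_ge0// ltW.
have close p a k : (a <= n0)%N -> (k + a <= N)%N -> `|F p a k - F ord0 0%N k| <= a%:R * B.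
  elim: a => [|a IH] an ka; first by rewrite F0 subrr normr0 mul0r.
  have [h1 h2] := addS_le ka; have := F1 p a k (ltnW an) h1; have := IH (ltnW an) h2.
  by rewrite -natr1 mulrDl mul1r !ler_norml; lra.
have step k : (k < N)%N -> `|F ord0 0%N k.+1 - F ord0 0%N k| <= 2 * B.
  rewrite -{1}(subn0 N) => kN; have := F1 ord0 0%N k isT kN; have := F2 ord0 0%N k isT kN.
  by rewrite !ler_norml; lra.
have endp j : (j <= N)%N -> `|1 - F ord0 0%N (N - j)%N| <= j%:R * (2 * B).
  elim: j => [|j IH] jN; first by rewrite subn0 F0N subrr normr0 mul0r.
  have := step (N - j.+1)%N (sub_lt jN); rewrite -subSn// subSS; have := IH (ltnW jN).
  by rewrite -natr1 mulrDl mul1r !ler_norml; lra.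
(* Below level [N - n0] all values [a <= n0] are available. *)
pose K := (N - n0)%N.
pose G p k := gam p * \sum_(a < n0.+1) m p ^+ a * F p a k.
have gam1 p : gam p * \sum_(a < n0.+1) m p ^+ a = 1.
  by rewrite /gam mulVf// gt_eqF// -invr_gt0; exact: level_mass_gt0.
have Gclose p k : (k <= K)%N -> `|G p k - F ord0 0%N k| <= n0%:R * B.
  move=> kK; rewrite -[X in _ - X]mul1r -(gam1 p) -mulrA -mulrBr mulr_suml -sumrB.
  rewrite normrM gtr0_norm ?level_mass_gt0//.
  apply: (@le_trans _ _ (gam p * \sum_(a < n0.+1) m p ^+ a * (n0%:R * B))); last first.
    by rewrite -mulr_suml mulrA gam1 mul1r.
  rewrite ler_pM2l ?level_mass_gt0//; apply: le_trans (ler_norm_sum _ _ _) _.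
  apply: ler_sum => a _; rewrite -mulrBr normrM ger0_norm ?exprn_ge0 ?(ltW (m_gt0 _))//.
  rewrite ler_wpM2l ?exprn_ge0 ?(ltW (m_gt0 _))//.
  have an : (a <= n0)%N by rewrite -ltnS.
  apply: le_trans (close p a k an (level_le n0N an kK)) _.
  by rewrite ler_wpM2r// ler_nat.
pose gR p k := gam p * resist p N k.
have gR0 p k : (k <= N)%N -> 0 < gR p k by move=> kN; rewrite mulr_gt0 ?level_mass_gt0 ?resist_gt0.
(* Branch [ord0] gets the weight [1 - sh k] and branch [ord_max] the weight [sh k]: the shares of a
   current in two parallel resistors, for which Cauchy-Schwarz is sharp. *)
pose sh k := gR ord0 k / (gR ord0 k + gR ord_max k).
pose D p k := G p k.+1 - G p k.
have KN : (K <= N)%N by exact: leq_subr.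
(* Cauchy-Schwarz over [a] with weights [m p ^+ a], then the series law through the intermediate
   configuration [(a.+1, k)]. *)
have jensen p k : (k < K)%N -> D p k ^+ 2 / gR p k <= \sum_(a < n0.+1) level_energy p N F a k.
  move=> kK.
  have kN : (k < N)%N by apply: leq_trans KN.
  apply: (@le_trans _ _ (\sum_(a < n0.+1) m p ^+ a * (F p a k.+1 - F p a k) ^+ 2 / resist p N k)).
    have -> : D p k = gam p * \sum_(a < n0.+1) m p ^+ a * (F p a k.+1 - F p a k).
      by rewrite /D /G -mulrBr -sumrB; congr (_ * _); apply: eq_bigr => a _; rewrite mulrBr.
    rewrite /gR -mulr_suml.
    have := @titu_sum R 'I_n0.+1 xpredT (fun a => m p ^+ a * (F p a k.+1 - F p a k)) (fun a => m p ^+ a)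
      (fun a _ => exprn_gt0 a (m_gt0 p)).
    rewrite [X in _ <= X * _](eq_bigr (fun a : 'I_n0.+1 => m p ^+ a * (F p a k.+1 - F p a k) ^+ 2)); last first.
      by move=> a _; rewrite exprMn; field; rewrite expf_neq0 ?gt_eqF.
    set X := \sum_(a < n0.+1) m p ^+ a * (F p a k.+1 - F p a k).
    set Y := \sum_(a < n0.+1) _ => XY.
    have -> : (gam p * X) ^+ 2 / (gam p * resist p N k) = gam p * X ^+ 2 / resist p N k.
      by field; rewrite !gt_eqF ?level_mass_gt0 ?resist_gt0// ltnW.
    rewrite ler_pM2r ?invr_gt0 ?resist_gt0 1?ltnW//.
    rewrite -[Y]mul1r -(gam1 p) -mulrA ler_pM2l ?level_mass_gt0//.
    by rewrite [leRHS]mulrC.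
  apply: ler_sum => a _; rewrite /level_energy -mulrA ler_wpM2l ?exprn_ge0 ?(ltW (m_gt0 _))//.
  have an : (a <= n0)%N by rewrite -ltnS.
  have Nka : (0 < N - k - a)%N by exact: level_lt kK.
  have u0 : 0 < (N - k - a)%:R / al0 p by rewrite divr_gt0// ltr0n.
  have v0 : 0 < k.+1%:R / al1 p by rewrite divr_gt0.
  have := series_law (F p a.+1 k - F p a k.+1) (F p a k - F p a.+1 k) u0 v0.
  have -> : F p a.+1 k - F p a k.+1 + (F p a k - F p a.+1 k) = - (F p a k.+1 - F p a k) by ring.
  rewrite sqrrN => H.
  apply: (@le_trans _ _ ((F p a k.+1 - F p a k) ^+ 2 / ((N - k - a)%:R / al0 p + k.+1%:R / al1 p))).
    rewrite ler_wpM2l ?sqr_ge0// lef_pV2 ?posrE ?addr_gt0// ?divr_gt0// ?subr_gt0 ?ltr_nat//.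
    rewrite /resist lerD2r ler_pM2r ?invr_gt0// -natrB 1?ltnW// ler_nat leq_subr//.
  apply: le_trans H _.
  have cross (z al w : R) : z / (w / al) = al * z / w by rewrite invf_div mulrA [z * al]mulrC.
  by rewrite !cross.
have energy : \sum_(k < K) (D ord0 k ^+ 2 / gR ord0 k + D ord_max k ^+ 2 / gR ord_max k) <= L.
  apply: le_trans HL.
  apply: (@le_trans _ _ (\sum_p \sum_(a < n0.+1) \sum_(k < K) level_energy p N F a k)); last first.
    apply: ler_sum => p _; apply: ler_sum => a _; apply: sum_ord_le => //.
    by rewrite leq_sub2l// -ltnS.
  under [leRHS]eq_bigr do rewrite exchange_big/=.
  rewrite exchange_big/=; apply: ler_sum => k _.
  rewrite big_ord_recl big_ord_recl big_ord0 addr0.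
  have -> : lift ord0 ord0 = ord_max :> 'I_2 by apply/val_inj.
  by rewrite lerD ?jensen.
pose M k := par (gR ord0 k) (gR ord_max k).
have M0 k : (k <= N)%N -> 0 < M k by move=> kN; rewrite par_gt0 ?gR0.
pose X k := (1 - sh k) * D ord0 k + sh k * D ord_max k.
have XM k : (k < K)%N -> X k ^+ 2 / M k <= D ord0 k ^+ 2 / gR ord0 k + D ord_max k ^+ 2 / gR ord_max k.
  move=> kK; have kN : (k <= N)%N by rewrite ltnW// (leq_trans kK).
  rewrite ler_pdivrMr ?M0//; apply: le_trans (parallel_law _ _ (gR0 _ _ kN) (gR0 _ _ kN)).
  have -> : gR ord_max k / (gR ord0 k + gR ord_max k) = 1 - sh k; last exact: lexx.
  by rewrite /sh; field; rewrite gt_eqF// addr_gt0 ?gR0.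
have mainle : `|\sum_(k < K) X k| <= Num.sqrt (L * \sum_(k < N) M k).
  rewrite -sqrtr_sqr ler_wsqrtr//.
  apply: (@le_trans _ _ ((\sum_(k < K) X k ^+ 2 / M k) * \sum_(k < K) M k)).
    by apply: titu_sum => k _; rewrite M0// ltnW// (leq_trans (ltn_ord k)).
  apply: ler_pM.
  - by apply: sumr_ge0 => k _; rewrite divr_ge0 ?sqr_ge0// ltW// M0// ltnW// (leq_trans (ltn_ord k)).
  - by apply: sumr_ge0 => k _; rewrite ltW// M0// ltnW// (leq_trans (ltn_ord k)).
  - by apply: le_trans energy; apply: ler_sum => k _; exact: XM.
  - by apply: sum_ord_le => // k kN; rewrite ltW// M0// ltnW.
(* The difference of the branches is of order [B], but the sum of its increments over [N] levels is
   not controlled directly. The weight [sh] moves by only [Cs / N] per level, and summation by parts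
   keeps the total of order [B]. *)
pose E k := G ord_max k - G ord0 k.
have Eb k : (k <= K)%N -> `|E k| <= 2 * (n0%:R * B).
  by move=> kK; rewrite /E; have := Gclose ord_max k kK; have := Gclose ord0 k kK; rewrite !ler_norml; lra.
have sh01 k : (k <= N)%N -> 0 <= sh k <= 1.
  move=> kN; have g0 := gR0 ord0 k kN; have g1 := gR0 ord_max k kN.
  by apply/andP; split; [rewrite divr_ge0// ltW// addr_gt0|rewrite ler_pdivrMr ?addr_gt0// mul1r lerDl ltW].
have gRl p k : (k < N)%N -> `|gR p k.+1 - gR p k| <= A^-1.
  move=> kN; have [Aal0 Aal1 _ _ _] := HA p.
  rewrite /gR -mulrBr normrM gtr0_norm ?level_mass_gt0//.
  have g1 : gam p <= 1.
    rewrite /gam invf_le1 ?big_ord_recl ?expr0; last first.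
      by rewrite ltr_pwDl// sumr_ge0// => a _; rewrite exprn_ge0// ltW.
    by rewrite lerDl sumr_ge0// => a _; rewrite exprn_ge0// ltW.
  apply: (@le_trans _ _ (1 * A^-1)); last by rewrite mul1r.
  apply: ler_pM => //; first exact/ltW/level_mass_gt0.
  have -> : resist p N k.+1 - resist p N k = (al1 p)^-1 - (al0 p)^-1.
    by rewrite /resist -[k.+2%:R]natr1 -[k.+1%:R]natr1; ring.
  have i0 : 0 < (al0 p)^-1 <= A^-1 by rewrite invr_gt0 al0_gt0 lef_pV2 ?posrE.
  have i1 : 0 < (al1 p)^-1 <= A^-1 by rewrite invr_gt0 al1_gt0 lef_pV2 ?posrE.
  by rewrite ler_norml; move: i0 i1 => /andP[? ?] /andP[? ?]; lra.
have gRlow p k : (k <= N)%N -> A * A * N%:R <= gR p k.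
  move=> kN; have [_ _ Aal0 Aal1 [_ Ag]] := HA p.
  rewrite -mulrA ler_pM ?mulr_ge0//.
  have kN' : k%:R <= N%:R :> R by rewrite ler_nat.
  have k0 : 0 <= k%:R :> R by [].
  have h1 : (N%:R - k%:R) * A <= (N%:R - k%:R) / al0 p by rewrite ler_wpM2l// subr_ge0.
  have h2 : k.+1%:R * A <= k.+1%:R / al1 p by rewrite ler_wpM2l.
  by rewrite /resist; move: h1 h2; rewrite -[k.+1%:R]natr1; lra.
have shl k : (k < K)%N -> `|sh k.+1 - sh k| <= Cs / N%:R.
  move=> kK; have kN : (k < N)%N by apply: leq_trans KN.
  have e0 : 0 < A * A * N%:R by rewrite !mulr_gt0.
  apply: le_trans (ratio_lip (e := A * A * N%:R) (c := A^-1) _ _ _ _ _ _ _) _ => //.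
  - by rewrite ltW// gR0// ltnW.
  - by rewrite gR0// ltnW.
  - by apply: le_trans (gRlow ord0 _ kN) _; rewrite lerDl ltW// gR0.
  - by rewrite addr_gt0// gR0// ltnW.
  - exact: gRl.
  - exact: gRl.
  - by rewrite /Cs invfM mulrA.
have parts : `|\sum_(k < K) sh k * (E k.+1 - E k)| <= 2 * (n0%:R * B) * (2 + Cs).
  apply: le_trans (@abel_sum_le R sh E K _ (Cs / N%:R) Eb _ shl) _.
    by move=> k kK; have /andP[s0 s1] := sh01 k (leq_trans kK KN); rewrite ger0_norm.
  rewrite ler_wpM2l ?mulr_ge0// lerD2l mulrCA ler_piMr//; last by rewrite ler_pdivrMr// mul1r ler_nat.
  by rewrite !mulr_ge0 ?invr_ge0 ?mulr_ge0.
have tele : \sum_(k < K) X k = (G ord0 K - G ord0 0%N) + \sum_(k < K) sh k * (E k.+1 - E k).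
  rewrite -(telescope_sumr (G ord0)) ?leq0n// big_mkord -big_split/=; apply: eq_bigr => k _.
  by rewrite /X /D /E; ring.
have e1 := Gclose ord0 K (leqnn _); have e2 := Gclose ord0 0%N (leq0n _).
have e3 := endp n0 (ltnW n0N); rewrite -/K in e3.
rewrite -/S -[\sum_(k < N) _]/(\sum_(k < N) M k).
have -> : b0 * n0%:R * (6 + 2 * (2 + Cs)) * S = n0%:R * B * 6 + 2 * (n0%:R * B) * (2 + Cs) by rewrite /B; ring.
move: mainle parts e1 e2 e3; rewrite tele F00 subr0 (mulrCA n0%:R 2 B).
move: (Num.sqrt (L * _)) (2 * (n0%:R * B) * (2 + Cs)) (n0%:R * B) (G ord0 K) (G ord0 0%N) (F ord0 0%N K) (\sum_(k < K) _).
by move=> q1 q2 q3 q4 q5 q6 q7; rewrite !ler_norml => /andP[? ?] /andP[? ?] /andP[? ?] /andP[? ?] /andP[? ?]; lra.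
Qed.

End LowerBound.

(** Replacing [M - a.+1] by [M] costs a factor quadratic in [a], summable against the geometric
    weights, and divided by the cut-off length [s]. *)
Lemma shifted_inv_le (R : realType) (M s a : nat) : (0 < s <= M)%N -> (a.+1 < M)%N ->
  (M - a.+1)%:R^-1 <= (1 + (a.+1 * a.+2)%:R / s%:R) / M%:R :> R.
Proof.
move=> /andP[s0 sM] aM.
have M0 : 0 < M%:R :> R by rewrite ltr0n; lia.
have s0' : 0 < s%:R :> R by rewrite ltr0n.
have l0 : 0 < (M - a.+1)%:R :> R by rewrite ltr0n; lia.
apply: (@le_trans _ _ ((1 + (a.+1 * a.+2)%:R / M%:R) / M%:R)); last first.
  rewrite ler_wpM2r ?invr_ge0// lerD2l ler_wpM2l// lef_pV2 ?posrE// ler_nat//.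
rewrite -[leLHS]mul1r ler_pdivrMr//.
have -> : (1 + (a.+1 * a.+2)%:R / M%:R) / M%:R * (M - a.+1)%:R =
  ((M + a.+1 * a.+2) * (M - a.+1))%:R / M%:R ^+ 2 :> R.
  by rewrite !natrM natrD natrM; field; rewrite gt_eqF.
rewrite ler_pdivlMr ?exprn_gt0// mul1r -natrX ler_nat.
by rewrite -{1}(subnK (ltnW aM)); nia.
Qed.

Lemma sqrrD_le (R : realType) (del x y : R) : 0 < del ->
  (x + y) ^+ 2 <= (1 + del) * x ^+ 2 + (1 + del^-1) * y ^+ 2.
Proof.
move=> d0; rewrite -subr_ge0.
have -> : (1 + del) * x ^+ 2 + (1 + del^-1) * y ^+ 2 - (x + y) ^+ 2 = (del * x - y) ^+ 2 / del.
  by field; rewrite gt_eqF.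
by rewrite divr_ge0 ?sqr_ge0// ltW.
Qed.

Lemma prod5_le (R : realType) (x1 x2 x3 x4 x5 y1 y2 y3 y4 y5 : R) :
  0 <= x1 <= y1 -> 0 <= x2 <= y2 -> 0 <= x3 <= y3 -> 0 <= x4 <= y4 -> 0 <= x5 <= y5 ->
  0 <= x1 * x2 * x3 * x4 * x5 <= y1 * y2 * y3 * y4 * y5.
Proof.
move=> /andP[a1 b1] /andP[a2 b2] /andP[a3 b3] /andP[a4 b4] /andP[a5 b5].
by rewrite !mulr_ge0//= !ler_pM ?mulr_ge0.
Qed.

Lemma add3_le n k a b : (k + a + b <= n)%N ->
  [/\ (k <= n)%N, (a <= n)%N, (b <= n)%N & (a + b <= n.+1)%N /\ (n - (k + a + b) <= n)%N].
Proof. by move=> h; split; [lia|lia|lia|split; lia]. Qed.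

Lemma add3_full n s k a b : (2 <= s)%N -> (k + s <= n.+1)%N -> (n - (k + a + b) = 0)%N -> (s.-1 <= a + b)%N.
Proof. lia. Qed.

Lemma add3_support n s k a : (2 <= s)%N -> (k + s <= n.+1)%N ->
  (0 < s <= n.+1 - k)%N /\ (n - (k + a + 0) = n.+1 - k - a.+1)%N.
Proof. lia. Qed.

(** * Energy of the test function on the edges between [x_1], [x_2] and one site [y_p] *)

Section EdgePairBound.
Variables (R : realType) (n s : nat) (u w g Qb : nat -> R).
Variables (U al0 al1 ma mb mu C1 c del : R).
Local Notation N := n.+1.
Hypothesis U01 : 0 < U <= 1.
Hypothesis u_bound : forall k, (k <= n)%N -> 0 <= u k <= U.
Hypothesis w_bound : forall k, (0 < k <= n)%N -> 0 <= w k <= U / k%:R.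
Hypothesis w0 : w 0 = 1.
Hypothesis s_ge2 : (2 <= s)%N.
Hypothesis al0_gt0 : 0 < al0.
Hypothesis al1_gt0 : 0 < al1.
Hypothesis ma_bound : 0 <= ma <= mu.
Hypothesis mb_bound : 0 <= mb <= mu.
Hypothesis mu_lt1 : mu < 1.
Hypothesis del_gt0 : 0 < del.
Hypothesis g_low : forall k, (k < s)%N -> g k = 0.
Hypothesis g_high : forall k, (N < k + s)%N -> g k = 0.
Hypothesis g_bound : forall k, 0 <= g k <= C1.

Definition line_resist (k : nat) : R := (N%:R - k%:R) / al0 + k%:R / al1.
(** A voltage divider: of the increment [g k], the step from [x_2] to [y_p], of resistance
    [k / al1], takes its proportional share. This is the balance of currents at [y_p]. *)
Definition side_slope (k : nat) : R := g k * (k%:R / al1) / line_resist k.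

Local Notation Q := side_slope.
Hypothesis Q_lip : forall k, (k <= n)%N -> `|Q k - Q k.+1| <= c / N%:R.
Hypothesis Qb_lip : forall k, (k <= n)%N -> `|Qb k - Qb k.+1| <= c / N%:R.
Hypothesis Qb_supp : forall k, g k = 0 -> Qb k = 0.

Let C2 := C1 + c.
Let v (a : nat) : R := (a.+1 * a.+2)%:R.
Let B := 2 / (1 - mu) ^+ 3.
(** The increment of the unnormalized test function from [(k.+1, a, b)] to [(k, a.+1, b)]; the terms
    in [a] and [b] come from the dependence of the slopes on [k]. *)
Definition slope_gap (k a b : nat) : R :=
  Q k - g k + a%:R * (Q k - Q k.+1) + b%:R * (Qb k - Qb k.+1).

(** [E1] collects the variation of the slopes, of order [1 / N] per level, and the four small
    factors present when both [y_p] are charged. [E3] is for an empty [x1], where only two small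
    factors remain but the geometric weight is exponentially small. *)
Let E1 := U ^+ 3 * (1 + del^-1) * al0 * c ^+ 2 / N%:R ^+ 2 + (al0 + al1) * C2 ^+ 2 * U ^+ 4.
Let E3 := (al0 + al1) * C2 ^+ 2 * U ^+ 2 * mu ^+ s.-1.

Let mu0 : 0 <= mu. Proof. by case/andP: ma_bound => /le_trans; apply. Qed.
Let c0 : 0 <= c.
Proof. by have := le_trans (normr_ge0 _) (Q_lip (leq0n n)); rewrite pmulr_lge0 ?invr_gt0. Qed.
Let C10 : 0 <= C1. Proof. by have /andP[] := g_bound 0 => /le_trans; apply. Qed.
Let C20 : 0 <= C2. Proof. exact: addr_ge0. Qed.
Let U0 : 0 <= U. Proof. by have /andP[/ltW] := U01. Qed.
Let U1 : U <= 1. Proof. by have /andP[] := U01. Qed.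
Let v1 a : 1 <= v a. Proof. by rewrite /v ler1n muln_gt0. Qed.
Let v0 a : 0 <= v a. Proof. exact: le_trans (v1 a). Qed.

Let resist_gt0' k : (k <= n)%N -> 0 < line_resist k.
Proof.
move=> kn; rewrite /line_resist ltr_pwDl ?divr_ge0 ?(ltW al1_gt0)//.
by rewrite divr_gt0// subr_gt0 ltr_nat ltnS.
Qed.

Let w_le1 k : (k <= n)%N -> 0 <= w k <= 1.
Proof.
case: k => [|k] kn; first by rewrite w0 ler01 lexx.
have /andP[w1 w2] := w_bound (k := k.+1) kn; rewrite w1/=; apply: le_trans w2 _.
by rewrite ler_pdivrMr// mul1r (le_trans U1)// ler1n.
Qed.

Let w_leU k : (0 < k <= n)%N -> 0 <= w k <= U.
Proof.
case: k => // k kn; have /andP[w1 w2] := w_bound kn; rewrite w1/=; apply: le_trans w2 _.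
by rewrite ler_pdivrMr// ler_peMr// ler1n.
Qed.

Let Q_bound k : (k <= n)%N -> 0 <= Q k <= g k.
Proof.
move=> kn; have r0 := resist_gt0' kn; have /andP[g0 _] := g_bound k.
rewrite /Q; apply/andP; split.
  by apply: divr_ge0; [rewrite mulr_ge0// divr_ge0// ltW|exact: ltW].
rewrite ler_pdivrMr// ler_wpM2l// lerDr divr_ge0 ?(ltW al0_gt0)// subr_ge0 ler_nat ltnW//.
Qed.

Let gap_bound k a b : (k + a + b <= n)%N -> slope_gap k a b ^+ 2 <= C2 ^+ 2.
Proof.
move=> kab; have [kn _ _ [abN _]] := add3_le kab.
have abn : a%:R + b%:R <= N%:R :> R by rewrite -natrD ler_nat.
rewrite -[leLHS]real_normK ?num_real// lerXn2r ?nnegrE//.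
have /andP[q0 q1] := Q_bound kn; have /andP[g0 g1] := g_bound k.
have h1 : `|Q k - g k| <= C1 by rewrite ler_norml; apply/andP; split; lra.
have h2 : `|a%:R * (Q k - Q k.+1)| <= a%:R * (c / N%:R).
  by rewrite normrM ger0_norm// ler_wpM2l// Q_lip.
have h3 : `|b%:R * (Qb k - Qb k.+1)| <= b%:R * (c / N%:R).
  by rewrite normrM ger0_norm// ler_wpM2l// Qb_lip.
have h4 : (a%:R + b%:R) * (c / N%:R) <= c.
  by rewrite mulrCA ler_piMr// ler_pdivrMr// mul1r.
apply: le_trans (ler_normD _ _) _; rewrite /C2.
apply: (@le_trans _ _ (C1 + a%:R * (c / N%:R) + b%:R * (c / N%:R))).
  by apply: lerD => //; apply: le_trans (ler_normD _ _) _; exact: lerD.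
by rewrite -addrA lerD2l -mulrDl.
Qed.

Definition pair_term (k a b : nat) : R :=
  al0 * (u k * u a * w b * w (n - (k + a + b)) * (ma ^+ a * mb ^+ b) * slope_gap k a b ^+ 2) +
  al1 * (w k * u a * w b * u (n - (k + a + b)) * (ma ^+ a * mb ^+ b) * Q k ^+ 2).

Let main_term k a : R := U ^+ 3 * (1 + del) * (g k ^+ 2 / line_resist k) * ((1 + v a / s%:R) * ma ^+ a).

Let main_ge0 k a : (k <= n)%N -> 0 <= main_term k a.
Proof.
move=> kn; have [ma0 _] := andP ma_bound; rewrite /main_term.
apply: mulr_ge0; last by rewrite mulr_ge0 ?exprn_ge0// addr_ge0// divr_ge0.
apply: mulr_ge0; last by rewrite divr_ge0 ?sqr_ge0// ltW// resist_gt0'.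
by rewrite mulr_ge0 ?exprn_ge0// addr_ge0// ltW.
Qed.

Let E1_ge0 : 0 <= E1.
Proof.
have i0 : 0 <= del^-1 by rewrite invr_ge0 ltW.
have a0 := ltW al0_gt0; have a1 := ltW al1_gt0.
apply: addr_ge0.
  by apply: mulr_ge0; [rewrite !mulr_ge0 ?exprn_ge0 ?addr_ge0 ?sqr_ge0|rewrite invr_ge0 exprn_ge0].
by rewrite !mulr_ge0 ?exprn_ge0 ?addr_ge0 ?sqr_ge0.
Qed.

Let E3_ge0 : 0 <= E3.
Proof.
have a0 := ltW al0_gt0; have a1 := ltW al1_gt0.
by rewrite /E3 !mulr_ge0 ?exprn_ge0 ?addr_ge0 ?sqr_ge0.
Qed.

Let vv_ge0 a b : 0 <= (v a * ma ^+ a) * (v b * mb ^+ b).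
Proof. by have [? _] := andP ma_bound; have [? _] := andP mb_bound; rewrite !mulr_ge0 ?exprn_ge0. Qed.

Let pair_term_crude k a b (P : R) : (k + a + b <= n)%N ->
  0 <= u k * u a * w b * w (n - (k + a + b)) * (ma ^+ a * mb ^+ b) <= P ->
  0 <= w k * u a * w b * u (n - (k + a + b)) * (ma ^+ a * mb ^+ b) <= P ->
  pair_term k a b <= (al0 + al1) * C2 ^+ 2 * P.
Proof.
move=> kab /andP[p0 p1] /andP[q0 q1].
have [kn _ _ _] := add3_le kab.
rewrite mulrDl mulrDl /pair_term; apply: lerD; rewrite -?(mulrA al0) -?(mulrA al1) ler_pM2l//.
  by rewrite [leRHS]mulrC ler_pM ?sqr_ge0 ?gap_bound.
rewrite [leRHS]mulrC ler_pM ?sqr_ge0//.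
have /andP[q2 q3] := Q_bound kn; have /andP[g0 g1] := g_bound k.
by rewrite lerXn2r ?nnegrE// (le_trans q3)// (le_trans g1)// lerDl.
Qed.

Lemma pair_term_le k a b : (k + a + b <= n)%N ->
  pair_term k a b <= (b == 0)%N%:R * main_term k a + E1 * ((v a * ma ^+ a) * (v b * mb ^+ b)) + E3.
Proof.
move=> kab.
have [kn an bn [_ ln]] := add3_le kab.
have [ma0 ma1] := andP ma_bound; have [mb0 mb1] := andP mb_bound.
have ev0 := mulr_ge0 E1_ge0 (vv_ge0 a b).
have m0 : 0 <= (b == 0)%N%:R * main_term k a by rewrite mulr_ge0 ?main_ge0.
(* The threshold concerns [k.+1] because [slope_gap] also reads the slopes at [k.+1]; since
   [2 <= s], what remains still has [0 < k]. *)
have [ks|ks] := ltnP k.+1 s.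
  rewrite (_ : pair_term k a b = 0) ?addr_ge0//.
  have k0 : g k = 0 by apply: g_low; exact: ltnW.
  have k1 : g k.+1 = 0 by exact: g_low.
  rewrite /pair_term /slope_gap (Qb_supp k0) (Qb_supp k1) /side_slope k0 k1; ring.
have [kN|kN] := ltnP N (k + s).
  rewrite (_ : pair_term k a b = 0) ?addr_ge0//.
  have k0 : g k = 0 by exact: g_high.
  have k1 : g k.+1 = 0 by apply: g_high; rewrite addSn; exact: leqW.
  rewrite /pair_term /slope_gap (Qb_supp k0) (Qb_supp k1) /side_slope k0 k1; ring.
have kpos : (0 < k)%N := leq_trans s_ge2 ks.
have /andP[uk0 uk1] := u_bound kn; have /andP[ua0 ua1] := u_bound an.
have /andP[wk0 wk1] : 0 <= w k <= U by apply: w_leU; rewrite kpos.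
have /andP[wb0 wb1] := w_le1 bn; have /andP[wl0 wl1] := w_le1 ln; have /andP[ul0 ul1] := u_bound ln.
have Pm0 : 0 <= ma ^+ a * mb ^+ b by rewrite mulr_ge0 ?exprn_ge0.
(* With [x1] empty, [w] equals 1 there instead of being small; the cut-off then forces at least
   [s.-1] particles onto the two sites [y_p]. *)
have [l0|lpos] := posnP (n - (k + a + b)).
  have Pm1 : ma ^+ a * mb ^+ b <= mu ^+ s.-1.
    apply: (@le_trans _ _ (mu ^+ a * mu ^+ b)); first by rewrite ler_pM ?exprn_ge0 ?lerXn2r.
    by rewrite -exprD ler_wiXn2l// ?(ltW mu_lt1)// (add3_full s_ge2 kN l0).
  apply: (@le_trans _ _ E3); last by rewrite lerDr addr_ge0.
  rewrite (_ : E3 = (al0 + al1) * C2 ^+ 2 * (U ^+ 2 * mu ^+ s.-1)); last by rewrite /E3 mulrA.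
  have -> : U ^+ 2 * mu ^+ s.-1 = U * U * 1 * 1 * mu ^+ s.-1 by ring.
  apply: pair_term_crude => //; apply: prod5_le; apply/andP => //.
  by split=> //; exact: le_trans U1.
have /andP[wl2 wl3] : 0 <= w (n - (k + a + b)) <= U by apply: w_leU; rewrite lpos.
have E1b : (al0 + al1) * C2 ^+ 2 * (U ^+ 4 * (ma ^+ a * mb ^+ b)) <=
    E1 * ((v a * ma ^+ a) * (v b * mb ^+ b)).
  rewrite mulrA; apply: ler_pM => //.
  - by rewrite !mulr_ge0 ?exprn_ge0 ?addr_ge0 ?(ltW al0_gt0) ?(ltW al1_gt0) ?sqr_ge0.
  - rewrite /E1 lerDr; apply: mulr_ge0; last by rewrite invr_ge0 exprn_ge0.
    by rewrite !mulr_ge0 ?exprn_ge0 ?addr_ge0 ?invr_ge0 ?(ltW al0_gt0) ?(ltW del_gt0).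
  - by apply: ler_pM; rewrite ?exprn_ge0// ler_peMl// exprn_ge0.
have [b0|bpos] := posnP b; last first.
  have /andP[wb2 wb3] : 0 <= w b <= U by apply: w_leU; rewrite bpos.
  apply: (@le_trans _ _ (E1 * ((v a * ma ^+ a) * (v b * mb ^+ b)))); last first.
    rewrite -addrA addrCA lerDl addr_ge0// mulr_ge0//; exact: main_ge0.
  apply: le_trans E1b.
  have -> : U ^+ 4 * (ma ^+ a * mb ^+ b) = U * U * U * U * (ma ^+ a * mb ^+ b) by ring.
  by apply: pair_term_crude => //; apply: prod5_le; apply/andP.
subst b; rewrite [true%:R]/(1) mul1r {E1b m0}.
set l := (n - (k + a + 0))%N in lpos ln wl2 wl3 ul0 ul1 wl0 wl1 *.
have lpos' : 0 < l%:R :> R by rewrite ltr0n.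
have [sNk lE] := add3_support a s_ge2 kN; rewrite -/l in lE.
have Nk : (N - k)%:R = N%:R - k%:R :> R by rewrite natrB// ltnW.
have Nk0 : 0 < N%:R - k%:R :> R by rewrite subr_gt0 ltr_nat ltnS.
have kR0 : 0 < k%:R :> R by rewrite ltr0n.
have /andP[wl4 wl5] : 0 <= w l <= U / l%:R by apply: w_bound; rewrite lpos.
have /andP[wk4 wk5] : 0 <= w k <= U / k%:R by apply: w_bound; rewrite kpos.
have linv : l%:R^-1 <= (1 + v a / s%:R) / (N%:R - k%:R).
  rewrite lE -Nk; apply: shifted_inv_le => //.
  by move: lpos; rewrite lE subn_gt0.
have linv1 : l%:R^-1 <= 1 :> R by rewrite invf_le1// ler1n.
have mpa : 0 <= ma ^+ a by rewrite exprn_ge0.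
have y2 : (a%:R * (Q k - Q k.+1)) ^+ 2 <= v a * (c ^+ 2 / N%:R ^+ 2).
  rewrite exprMn; apply: ler_pM; rewrite ?sqr_ge0//.
    by rewrite /v -natrX ler_nat -mulnn leq_mul// ltnW// ltnW.
  rewrite -exprVn -exprMn -[leLHS]real_normK ?num_real// lerXn2r ?nnegrE ?divr_ge0//; exact: Q_lip.
have gapE : slope_gap k a 0 = (Q k - g k) + a%:R * (Q k - Q k.+1) by rewrite /slope_gap mul0r addr0.
have gap2 : slope_gap k a 0 ^+ 2 <= (1 + del) * (Q k - g k) ^+ 2 + (1 + del^-1) * (v a * (c ^+ 2 / N%:R ^+ 2)).
  rewrite gapE; apply: le_trans (sqrrD_le _ _ del_gt0) _; rewrite lerD2l ler_wpM2l// addr_ge0// invr_ge0 ltW//.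
have first : al0 * (u k * u a * w 0 * w l * ma ^+ a * slope_gap k a 0 ^+ 2) <=
   U ^+ 3 * ma ^+ a * (al0 * ((1 + del) * (Q k - g k) ^+ 2 * ((1 + v a / s%:R) / (N%:R - k%:R)) +
      (1 + del^-1) * (v a * (c ^+ 2 / N%:R ^+ 2)))).
  rewrite w0 mulr1.
  apply: (@le_trans _ _ (al0 * (U * U * (U / l%:R) * ma ^+ a * slope_gap k a 0 ^+ 2))).
    rewrite ler_pM2l// ler_wpM2r ?sqr_ge0// ler_wpM2r//.
    by apply: ler_pM => //; rewrite ?mulr_ge0// ler_pM.
  have -> : al0 * (U * U * (U / l%:R) * ma ^+ a * slope_gap k a 0 ^+ 2) =
    U ^+ 3 * ma ^+ a * (al0 * (slope_gap k a 0 ^+ 2 * l%:R^-1)) by ring.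
  rewrite ler_wpM2l ?mulr_ge0 ?exprn_ge0// ler_pM2l//.
  apply: (@le_trans _ _ (((1 + del) * (Q k - g k) ^+ 2 + (1 + del^-1) * (v a * (c ^+ 2 / N%:R ^+ 2))) * l%:R^-1)).
    by rewrite ler_wpM2r// invr_ge0 ltW.
  rewrite mulrDl; apply: lerD; first by rewrite ler_wpM2l// mulr_ge0 ?sqr_ge0// addr_ge0// ltW.
  rewrite ler_piMr// mulr_ge0//; first by rewrite addr_ge0// invr_ge0 ltW.
  by rewrite mulr_ge0// divr_ge0 ?sqr_ge0.
have second : al1 * (w k * u a * w 0 * u l * ma ^+ a * Q k ^+ 2) <=
   U ^+ 3 * ma ^+ a * (al1 * ((1 + del) * Q k ^+ 2 * ((1 + v a / s%:R) / k%:R))).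
  rewrite w0 mulr1.
  apply: (@le_trans _ _ (al1 * ((U / k%:R) * U * U * ma ^+ a * Q k ^+ 2))).
    rewrite ler_pM2l// ler_wpM2r ?sqr_ge0// ler_wpM2r//.
    by apply: ler_pM => //; rewrite ?mulr_ge0// ler_pM.
  have -> : al1 * (U / k%:R * U * U * ma ^+ a * Q k ^+ 2) =
    U ^+ 3 * ma ^+ a * (al1 * (Q k ^+ 2 * k%:R^-1)) by ring.
  rewrite ler_wpM2l ?mulr_ge0 ?exprn_ge0// ler_pM2l//.
  have -> : (1 + del) * Q k ^+ 2 * ((1 + v a / s%:R) / k%:R) =
    (Q k ^+ 2 * k%:R^-1) * ((1 + del) * (1 + v a / s%:R)) by ring.
  rewrite ler_peMr//; first by rewrite mulr_ge0 ?sqr_ge0// invr_ge0.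
  by rewrite mulr_ege1// lerDl ?divr_ge0// ltW.
(* With the balanced slope the two edges form a series circuit, whose energy is the squared
   increment over the total resistance. *)
have comb : al0 * ((1 + del) * (Q k - g k) ^+ 2 * ((1 + v a / s%:R) / (N%:R - k%:R))) +
    al1 * ((1 + del) * Q k ^+ 2 * ((1 + v a / s%:R) / k%:R)) =
    (1 + del) * (g k ^+ 2 / line_resist k) * (1 + v a / s%:R).
  have r0 : (N%:R - k%:R) * al1 + k%:R * al0 != 0 :> R by rewrite gt_eqF// addr_gt0// mulr_gt0.
  have s0 : s%:R != 0 :> R by rewrite pnatr_eq0 -lt0n ltnW.
  rewrite /side_slope /line_resist; move: (g k) (v a) => G V.
  move: r0 Nk0 kR0 s0; move: (N%:R : R) (k%:R : R) (s%:R : R) => NN kk ss r0 Nk0 kR0 s0.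
  by field; rewrite s0 r0 ![al1 == 0]gt_eqF// ![al0 == 0]gt_eqF// ![kk == 0]gt_eqF// gt_eqF.
have E1c : U ^+ 3 * ma ^+ a * (al0 * ((1 + del^-1) * (v a * (c ^+ 2 / N%:R ^+ 2)))) <=
    E1 * (v a * ma ^+ a * (v 0 * mb ^+ 0)).
  have -> : U ^+ 3 * ma ^+ a * (al0 * ((1 + del^-1) * (v a * (c ^+ 2 / N%:R ^+ 2)))) =
    (U ^+ 3 * (1 + del^-1) * al0 * c ^+ 2 / N%:R ^+ 2) * (v a * ma ^+ a) by ring.
  have a0 := ltW al0_gt0; have a1 := ltW al1_gt0; have i0 : 0 <= del^-1 by rewrite invr_ge0 ltW.
  apply: ler_pM.
  - by apply: mulr_ge0; [rewrite !mulr_ge0 ?exprn_ge0 ?addr_ge0 ?sqr_ge0|rewrite invr_ge0 exprn_ge0].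
  - by rewrite mulr_ge0.
  - by rewrite /E1 lerDl !mulr_ge0 ?exprn_ge0 ?addr_ge0 ?sqr_ge0.
  - by rewrite expr0 mulr1 ler_peMr ?v1// mulr_ge0.
apply: (@le_trans _ _ (main_term k a + E1 * (v a * ma ^+ a * (v 0 * mb ^+ 0)))); last by rewrite lerDl.
rewrite /pair_term -/l expr0 mulr1; apply: le_trans (lerD first second) _.
have -> : main_term k a = U ^+ 3 * ma ^+ a * ((1 + del) * (g k ^+ 2 / line_resist k) * (1 + v a / s%:R)).
  by rewrite /main_term; ring.
rewrite -comb [al0 * (_ + _)]mulrDr !(mulrDr (U ^+ 3 * ma ^+ a)) addrAC lerD2l.
by rewrite expr0 in E1c.
Qed.

Lemma pair_sum_le : \sum_(k < N) \sum_(a < N) \sum_(b < N) (if (k + a + b <= n)%N then pair_term k a b else 0) <=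
  U ^+ 3 * (1 + del) * ((1 - ma)^-1 + B / s%:R) * (\sum_(k < N) g k ^+ 2 / line_resist k) +
  (N%:R * (E1 * (B * B)) + N%:R ^+ 3 * E3).
Proof.
have [ma0 ma1] := andP ma_bound; have [mb0 mb1] := andP mb_bound.
apply: (@le_trans _ _ (\sum_(k < N) \sum_(a < N) \sum_(b < N)
   ((b == 0 :> nat)%:R * main_term k a + E1 * ((v a * ma ^+ a) * (v b * mb ^+ b)) + E3))).
  apply: ler_sum => k _; apply: ler_sum => a _; apply: ler_sum => b _.
  case: ifPn => [|_]; first exact: pair_term_le.
  rewrite !addr_ge0 ?E3_ge0//; first by rewrite mulr_ge0// main_ge0// -ltnS.
  by rewrite mulr_ge0 ?E1_ge0 ?vv_ge0.
have vsum (m : R) : 0 <= m <= mu -> \sum_(a < N) v a * m ^+ a <= B.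
  move=> /andP[m0 m1]; have m11 : m < 1 by apply: le_lt_trans mu_lt1.
  apply: (le_trans (geom2_sum_le _ _)); first by rewrite m0.
  by rewrite ler_wpM2l// lef_pV2 ?posrE ?exprn_gt0 ?subr_gt0// lerXn2r ?nnegrE ?subr_ge0 ?lerD2l ?lerN2// ltW.
have vsum0 (m : R) : 0 <= m -> 0 <= \sum_(a < N) v a * m ^+ a.
  by move=> m0; apply: sumr_ge0 => a _; rewrite mulr_ge0 ?exprn_ge0.
have -> : \sum_(k < N) \sum_(a < N) \sum_(b < N)
   ((b == 0 :> nat)%:R * main_term k a + E1 * ((v a * ma ^+ a) * (v b * mb ^+ b)) + E3) =
   \sum_(k < N) \sum_(a < N) main_term k a +
   (N%:R * (E1 * ((\sum_(a < N) v a * ma ^+ a) * \sum_(b < N) v b * mb ^+ b)) + N%:R ^+ 3 * E3).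
  transitivity (\sum_(k < N) (\sum_(a < N) main_term k a +
     (E1 * ((\sum_(a < N) v a * ma ^+ a) * \sum_(b < N) v b * mb ^+ b) + N%:R ^+ 2 * E3))).
    apply: eq_bigr => k _.
    transitivity (\sum_(a < N) (main_term k a + (E1 * ((v a * ma ^+ a) * \sum_(b < N) v b * mb ^+ b) + N%:R * E3))).
      apply: eq_bigr => a _; rewrite !big_split/= -mulr_suml big_ord_recl/= big1 ?addr0 ?mul1r//.
      by rewrite sumr_const card_ord mulr_natl -addrA -!mulr_sumr.
    rewrite !big_split/= sumr_const card_ord; congr (_ + (_ + _)); first by rewrite mulr_suml mulr_sumr.
    by rewrite -mulr_natl; ring.
  by rewrite big_split/= sumr_const card_ord -[(_ + _) *+ N]mulr_natl mulrDr [in X in _ + (_ + X)]mulrA -exprS.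
apply: lerD.
  rewrite mulr_sumr; apply: ler_sum => k _; rewrite /main_term -mulr_sumr.
  have kn : (k <= n)%N by rewrite -ltnS.
  have r0 := resist_gt0' kn.
  rewrite [leRHS]mulrAC ler_wpM2l//.
    apply: mulr_ge0; last by rewrite divr_ge0 ?sqr_ge0// ltW.
    by rewrite mulr_ge0 ?exprn_ge0// addr_ge0// ltW.
  rewrite (eq_bigr (fun a : 'I_N => ma ^+ a + s%:R^-1 * (v a * ma ^+ a))); last by move=> a _; ring.
  rewrite big_split/= -mulr_sumr; apply: lerD.
    by apply: sum_exp_le; rewrite ma0 (le_lt_trans ma1).
  by rewrite mulrC ler_wpM2r ?invr_ge0// vsum.
rewrite lerD2r ler_wpM2l// ler_wpM2l ?E1_ge0// ler_pM ?vsum0 ?vsum//.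
Qed.

End EdgePairBound.

Section EdgePairLower.
Variables (R : realType) (T : finType) (x0 x1 ya yb : T).
Hypothesis sites_uniq : uniq [:: x0; x1; ya; yb].
Hypothesis sites_cover : forall z, z \in [:: x0; x1; ya; yb].
Variables (ms : T -> R) (r : T -> T -> R) (d : R).
Hypothesis ms_x0 : ms x0 = 1.
Hypothesis ms_x1 : ms x1 = 1.
Hypothesis ms_gt0 : forall z, 0 < ms z.
Hypothesis r_ge0 : forall a b, 0 <= r a b.
Hypothesis d01 : 0 < d <= 1.

Let add0_lt n k a : ((k + a + 0 <= n) = (k < n.+1 - a))%N.
Proof. lia. Qed.
Let sub_succ n k a : (k < n.+1 - a)%N -> ((n - (k + a + 0)).+1 = n.+1 - k - a)%N.
Proof. lia. Qed.

(** Only the terms with [b = 0] and [a <= n0] are kept; three factors of each conductance are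
    bounded below by [d], up to the inverse occupation number of one end. *)
Lemma edge_pair_ge n n0 (f : config T n.+1 -> R) (F : nat -> nat -> R) : (n0 < n.+1)%N ->
  (forall a k, F a k = f (cfg x0 ya yb n.+1 k a 0)) ->
  d ^+ 3 * (\sum_(a < n0.+1) \sum_(k < n.+1 - a) ms ya ^+ a *
    (r x0 ya * (F a.+1 k - F a k.+1) ^+ 2 / (n.+1 - k - a)%:R +
     r x1 ya * (F a k - F a.+1 k) ^+ 2 / k.+1%:R)) <=
  edge_energy ms r d f x0 ya + edge_energy ms r d f x1 ya.
Proof.
move=> n0n FE.
have d0 : 0 < d by case/andP: d01.
rewrite (edge_energy_x0_ya sites_uniq sites_cover r d ms_x0 ms_x1).
rewrite (edge_energy_x1_ya sites_uniq sites_cover r d ms_x0 ms_x1).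
pose t k a b : R := r x0 ya * (cond_x0_ya ya yb ms d n k a b *
     (f (cfg x0 ya yb n.+1 k a.+1 b) - f (cfg x0 ya yb n.+1 k.+1 a b)) ^+ 2) +
   r x1 ya * (cond_x1_ya ya yb ms d n k a b *
     (f (cfg x0 ya yb n.+1 k a.+1 b) - f (cfg x0 ya yb n.+1 k a b)) ^+ 2).
have u0 j := ltW (ip_u_gt0 j d0); have w0 j := ltW (ip_w_gt0 j d0).
have c0 k a b : 0 <= cond_x0_ya ya yb ms d n k a b.
  by apply: mulr_ge0; [exact: (mulr_ge0 (mulr_ge0 (mulr_ge0 (u0 _) (u0 _)) (w0 _)) (w0 _))|rewrite mulr_ge0// exprn_ge0// ltW].
have c1 k a b : 0 <= cond_x1_ya ya yb ms d n k a b.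
  by apply: mulr_ge0; [exact: (mulr_ge0 (mulr_ge0 (mulr_ge0 (w0 _) (u0 _)) (w0 _)) (u0 _))|rewrite mulr_ge0// exprn_ge0// ltW].
have t0 k a b : 0 <= t k a b.
  exact: (addr_ge0 (mulr_ge0 (r_ge0 _ _) (mulr_ge0 (c0 _ _ _) (sqr_ge0 _)))
    (mulr_ge0 (r_ge0 _ _) (mulr_ge0 (c1 _ _ _) (sqr_ge0 _)))).
rewrite [leRHS](_ : _ = \sum_(a < n.+1) \sum_(k < n.+1) \sum_(b < n.+1) (if (k + a + b <= n)%N then t k a b else 0)).
  2: { rewrite [RHS]exchange_big/= !mulr_sumr -big_split/=; apply: eq_bigr => k _.
       rewrite !mulr_sumr -big_split/=; apply: eq_bigr => a _.
       rewrite !mulr_sumr -big_split/=; apply: eq_bigr => b _.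
       by case: ifP => // _; rewrite !mulr0 addr0. }
pose S (a : nat) : R := \sum_(k < n.+1) \sum_(b < n.+1) (if (k + a + b <= n)%N then t k a b else 0).
have S0 a : 0 <= S a by apply: sumr_ge0 => k _; apply: sumr_ge0 => b _; case: ifP.
apply: (@le_trans _ _ (\sum_(a < n0.+1) S a)); last by apply: (@sum_ord_le _ S).
rewrite mulr_sumr; apply: ler_sum => a _.
have -> : \sum_(k < n.+1 - a) ms ya ^+ a * (r x0 ya * (F a.+1 k - F a k.+1) ^+ 2 / (n.+1 - k - a)%:R +
     r x1 ya * (F a k - F a.+1 k) ^+ 2 / k.+1%:R) =
   \sum_(k < n.+1) (if (k < n.+1 - a)%N then ms ya ^+ a * (r x0 ya * (F a.+1 k - F a k.+1) ^+ 2 / (n.+1 - k - a)%:R +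
     r x1 ya * (F a k - F a.+1 k) ^+ 2 / k.+1%:R) else 0).
  by rewrite -big_mkcond/= -(big_ord_widen _ (fun k : nat => ms ya ^+ a * (r x0 ya * (F a.+1 k - F a k.+1) ^+ 2 / (n.+1 - k - a)%:R +
     r x1 ya * (F a k - F a.+1 k) ^+ 2 / k.+1%:R)))// leq_subr.
rewrite mulr_sumr; apply: ler_sum => k _.
rewrite big_ord_recl/= add0_lt.
apply: (@le_trans _ _ (if (k < n.+1 - a)%N then t k a 0%N else 0)); last first.
  by rewrite lerDl sumr_ge0// => b _; case: ifP.
case: ifPn => kn; last by rewrite mulr0.
have wl := ip_w_ge (n - (k + a + 0)) d01; rewrite sub_succ// in wl.
have wk := ip_w_ge k d01.
have uk := ip_u_ge k (ltW d0); have ua := ip_u_ge a (ltW d0); have ul := ip_u_ge (n - (k + a + 0)) (ltW d0).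
have ma : 0 <= ms ya ^+ a by rewrite exprn_ge0// ltW.
have d0' := ltW d0.
rewrite /t /cond_x0_ya /cond_x1_ya ip_w0 expr0 !mulr1 -!FE.
rewrite !mulrDr; apply: lerD.
  have -> : d ^+ 3 * (ms ya ^+ a * (r x0 ya * (F a.+1 k - F a k.+1) ^+ 2 / (n.+1 - k - a)%:R)) =
    r x0 ya * (d * d * (d / (n.+1 - k - a)%:R) * ms ya ^+ a * (F a.+1 k - F a k.+1) ^+ 2) by ring.
  rewrite ler_wpM2l// ler_wpM2r ?sqr_ge0// ler_wpM2r// ler_pM ?mulr_ge0 ?divr_ge0// ler_pM//.
have -> : d ^+ 3 * (ms ya ^+ a * (r x1 ya * (F a k - F a.+1 k) ^+ 2 / k.+1%:R)) =
    r x1 ya * ((d / k.+1%:R) * d * d * ms ya ^+ a * (F a.+1 k - F a k) ^+ 2) by ring.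
rewrite ler_wpM2l// ler_wpM2r ?sqr_ge0// ler_wpM2r// ler_pM ?mulr_ge0 ?divr_ge0// ler_pM ?divr_ge0//.
Qed.

End EdgePairLower.

(** * The limiting resistance profile and its integral *)

Section Profile.
Variables (R : realType) (al0 al1 m : 'I_2 -> R).
Hypothesis al0_gt0 : forall p, 0 < al0 p.
Hypothesis al1_gt0 : forall p, 0 < al1 p.
Hypothesis m_gt0 : forall p, 0 < m p.
Hypothesis m_lt1 : forall p, m p < 1.

(** The limit of [level_mass * resist / N] at level [k = t N], as [N] and then [n0] tend to
    infinity. *)
Definition branch p (t : R) : R := (1 - m p) * ((1 - t) / al0 p + t / al1 p).
Definition profile t : R := par (branch ord0 t) (branch ord_max t).
Definition profile_mass : R := Rintegral (@lebesgue_measure R) `[0, 1] profile.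

Lemma branch_gt0 p t : 0 <= t <= 1 -> 0 < branch p t.
Proof.
move=> /andP[t0 t1]; apply: mulr_gt0; first by rewrite subr_gt0.
have i0 : 0 < (al0 p)^-1 by rewrite invr_gt0.
have i1 : 0 < (al1 p)^-1 by rewrite invr_gt0.
have [e|e] := eqVneq t 0; first by rewrite e subr0 mul0r addr0 mul1r.
by rewrite ltr_wpDl ?mulr_ge0 ?subr_ge0 ?(ltW i0)// mulr_gt0// lt_def e.
Qed.

Lemma profile_gt0 t : 0 <= t <= 1 -> 0 < profile t.
Proof. by move=> t01; rewrite par_gt0 ?branch_gt0. Qed.

Lemma profile_lipschitz : exists2 L, 0 <= L &
  forall s t, 0 <= s <= 1 -> 0 <= t <= 1 -> `|profile s - profile t| <= L * `|s - t|.
Proof.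
pose l p := `|(1 - m p) * ((al1 p)^-1 - (al0 p)^-1)|.
exists (l ord0 + l ord_max) => [|s t s01 t01]; first by apply: addr_ge0; exact: normr_ge0.
apply: le_trans (par_lip _ _ _ _) _; rewrite ?branch_gt0//.
have B p : `|branch p s - branch p t| = l p * `|s - t|.
  by rewrite /l -normrM /branch; congr `|_|; ring.
by rewrite !B mulrDl.
Qed.

Lemma profile_bounds : exists A B, [/\ 0 < A, 0 <= B & forall t, 0 <= t <= 1 -> A <= profile t <= B].
Proof.
have lb p : exists2 A, 0 < A & forall t, 0 <= t <= 1 -> A <= branch p t.
  have i0 : 0 < (al0 p)^-1 by rewrite invr_gt0.
  have i1 : 0 < (al1 p)^-1 by rewrite invr_gt0.
  exists ((1 - m p) * Num.min (al0 p)^-1 (al1 p)^-1).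
    by rewrite mulr_gt0 ?subr_gt0// lt_min i0.
  move=> t /andP[t0 t1]; rewrite ler_wpM2l ?subr_ge0 ?(ltW (m_lt1 _))//.
  set mn := Num.min _ _.
  have h0 : mn <= (al0 p)^-1 by rewrite ge_min lexx.
  have h1 : mn <= (al1 p)^-1 by rewrite ge_min lexx orbT.
  have -> : mn = (1 - t) * mn + t * mn by ring.
  by rewrite lerD// ler_wpM2l// subr_ge0.
have [A0 A00 H0] := lb ord0; have [A1 A10 H1] := lb ord_max.
have [L L0 HL] := profile_lipschitz.
exists (par A0 A1), (profile 0 + L); split.
- exact: par_gt0.
- by rewrite addr_ge0// ltW// profile_gt0// lexx ler01.
move=> t t01; apply/andP; split; first by rewrite par_le ?A00 ?A10 ?H0 ?H1.
have z : 0 <= (0 : R) <= 1 by rewrite lexx ler01.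
have := HL t 0 t01 z; rewrite subr0 => H.
have : profile t - profile 0 <= L.
  apply: le_trans (ler_norm _) _; apply: le_trans H _.
  by move: t01 => /andP[t0 t1]; rewrite ger0_norm// ler_piMr.
lra.
Qed.

Lemma profile_mass_gt0 : 0 < profile_mass.
Proof.
have [A [B [A0 B0 AB]]] := profile_bounds; have [L L0 HL] := profile_lipschitz.
have [n _ Hn] := near_le_nat (2 * (L + 1) / A).
have {}Hn := Hn n (leqnn _).
have := riemann_sum_lipschitz (ltn0Sn n) HL; rewrite -/profile_mass => H.
have N0 : 0 < n.+1%:R :> R by [].
have HA : A <= \sum_(k < n.+1) profile (k%:R / n.+1%:R) / n.+1%:R.
  apply: (@le_trans _ _ (\sum_(k < n.+1) A / n.+1%:R)).
    by rewrite sumr_const card_ord -[_ *+ n.+1]mulr_natl mulrCA divff ?mulr1 ?gt_eqF.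
  apply: ler_sum => k _; rewrite ler_pM2r ?invr_gt0//.
  have /AB/andP[] // : 0 <= (k%:R / n.+1%:R : R) <= 1.
  by rewrite divr_ge0//= ler_pdivrMr// mul1r ler_nat ltnW.
have : L / n.+1%:R < A.
  rewrite ltr_pdivrMr//; move: Hn; rewrite ler_pdivrMr// => Hn.
  by rewrite mulrC; lra.
by move: HA H; rewrite ler_norml; move: (\sum_(k < _) _) (L / _) => S z h0 /andP[h1 h2] h3; lra.
Qed.

Lemma level_mass_le (del : R) : 0 < del ->
  \forall n0 \near \oo, forall p, level_mass m n0 p <= (1 + del) * (1 - m p).
Proof.
move=> d0.
have H p : \forall n0 \near \oo, level_mass m n0 p <= (1 + del) * (1 - m p).
  have c0 : 0 < 1 - m p by rewrite subr_gt0.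
  have cv : (fun n => m p ^+ n.+1) @ \oo --> (0 : R).
    rewrite (cvg_shiftS (fun n => m p ^+ n)); apply: cvg_expr.
    by rewrite ger0_norm// ltW.
  have e0 : 0 < del / (1 + del) by rewrite divr_gt0// addr_gt0.
  move/cvgrPdist_le: cv => /(_ _ e0); apply: filterS => n; rewrite sub0r normrN ger0_norm ?exprn_ge0 ?(ltW (m_gt0 _))// => h.
  have sE : \sum_(a < n.+1) m p ^+ a = (1 - m p ^+ n.+1) / (1 - m p).
    have := subrX1 (m p) n.+1; rewrite -(opprB 1 (m p)) -(opprB 1 (m p ^+ n.+1)) mulNr => /oppr_inj ->.
    by rewrite mulrC mulKf// gt_eqF.
  have pos : 0 < 1 - m p ^+ n.+1 by rewrite subr_gt0 exprn_ilt1// ltW.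
  rewrite /level_mass sE invf_div ler_pdivrMr// mulrAC ler_peMl ?(ltW c0)//.
  move: h; rewrite ler_pdivlMr ?addr_gt0//; lra.
apply: filterS2 (H ord0) (H ord_max) => n h0 h1 p.
have [->//|p1] := eqVneq p ord0.
by have -> : p = ord_max by case: p p1 => -[|[|//]] i //= _; exact/val_inj.
Qed.

(** [n0] is fixed first, to bring [level_mass] near [1 - m p]; for large [N] the sum is then a
    Riemann sum, the shift [k.+1] in [resist] contributing only order [N] to a total of order
    [N ^+ 2]. *)
Lemma thomson_mass_le (eta : R) : 0 < eta -> exists n0, \forall N \near \oo,
  \sum_(k < N) par (level_mass m n0 ord0 * resist al0 al1 ord0 N k)
                   (level_mass m n0 ord_max * resist al0 al1 ord_max N k) <= N%:R ^+ 2 * (profile_mass + eta).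
Proof.
move=> eta0; have [L L0 HL] := profile_lipschitz.
have M0 := profile_mass_gt0.
pose del := Num.min 1 (eta / (2 * (profile_mass + 1))).
have del0 : 0 < del by rewrite lt_min ltr01 divr_gt0// mulr_gt0// addr_gt0.
have del1 : del <= 1 by rewrite ge_min lexx.
have del2 : del * (profile_mass + 1) <= eta / 2.
  rewrite -ler_pdivlMr ?addr_gt0//; apply: (@le_trans _ _ (eta / (2 * (profile_mass + 1)))).
    by rewrite ge_min lexx orbT.
  by rewrite invfM mulrA.
have [n0 _ Hn0] := level_mass_le del0; exists n0.
have {}Hn0 := Hn0 n0 (leqnn _).
pose s p := (1 - m p) / al1 p.
have s0 p : 0 <= s p by rewrite divr_ge0 ?subr_ge0 ?(ltW (m_lt1 _)) ?(ltW (al1_gt0 _)).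
pose C := L + (s ord0 + s ord_max).
have C0 : 0 <= C by rewrite !addr_ge0.
near=> N.
have N0 : (0 < N)%N by near: N; exact: nbhs_infty_gt.
have Nr : 0 < N%:R :> R by rewrite ltr0n.
have CN : C / N%:R <= Num.min 1 (eta / 4).
  have e0 : 0 < Num.min 1 (eta / 4) by rewrite lt_min ltr01 divr_gt0.
  rewrite ler_pdivrMr// -ler_pdivrMl//.
  near: N; exists (Num.truncn (C / Num.min 1 (eta / 4))).+1 => // k /= hk.
  rewrite mulrC; apply: ltW; apply: (lt_le_trans (truncnS_gt _)); rewrite ler_nat//.
move: CN; rewrite le_min => /andP[CN1 CN2].
have step (k : 'I_N) : par (level_mass m n0 ord0 * resist al0 al1 ord0 N k)
     (level_mass m n0 ord_max * resist al0 al1 ord_max N k) <=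
   (1 + del) * (N%:R ^+ 2 * (profile (k%:R / N%:R) / N%:R) + (s ord0 + s ord_max)).
  have t01 : 0 <= (k%:R / N%:R : R) <= 1.
    by rewrite divr_ge0//= ler_pdivrMr// mul1r ler_nat ltnW.
  have kN : (k <= N)%N by rewrite ltnW.
  have rE p : (1 - m p) * resist al0 al1 p N k = N%:R * branch p (k%:R / N%:R) + s p.
    rewrite /resist /branch /s -natr1; field.
    by rewrite !gt_eqF.
  apply: (@le_trans _ _ (par ((1 + del) * (N%:R * branch ord0 (k%:R / N%:R) + s ord0))
      ((1 + del) * (N%:R * branch ord_max (k%:R / N%:R) + s ord_max)))).
    by apply: par_le; rewrite mulr_gt0 ?level_mass_gt0 ?resist_gt0//= -rE mulrA ler_pM2r ?resist_gt0.
  have b0 p : 0 < N%:R * branch p (k%:R / N%:R) by rewrite mulr_gt0 ?branch_gt0.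
  have b1 p : 0 < N%:R * branch p (k%:R / N%:R) + s p by rewrite ltr_pwDl.
  rewrite (par_scale _ (b1 _) (b1 _)) ?addr_gt0// ler_pM2l ?addr_gt0//.
  apply: le_trans (par_add_le _ _ _ _) _ => //.
  rewrite par_scale ?branch_gt0// -addrA lerD2r /profile.
  by rewrite expr2 -mulrA [X in _ <= _ * X]mulrC divfK ?gt_eqF.
apply: (le_trans (ler_sum _ (fun k _ => step k))).
rewrite -mulr_sumr big_split/= -mulr_sumr sumr_const card_ord -(mulr_natl (s ord0 + s ord_max) N).
have := riemann_sum_lipschitz N0 HL; rewrite -/profile_mass ler_norml => /andP[_ H].
set S := \sum_(k < N) _ in H *.
apply: (@le_trans _ _ ((1 + del) * (N%:R ^+ 2 * (profile_mass + C / N%:R)))).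
  rewrite ler_pM2l ?addr_gt0//.
  have -> : N%:R ^+ 2 * (profile_mass + C / N%:R) =
    N%:R ^+ 2 * (profile_mass + L / N%:R) + N%:R * (s ord0 + s ord_max).
    by rewrite /C; field; rewrite gt_eqF.
  by rewrite lerD2r ler_wpM2l ?exprn_ge0//; lra.
rewrite mulrCA ler_wpM2l ?exprn_ge0//.
have dC : del * (C / N%:R) <= eta / 4 by apply: le_trans CN2; rewrite ler_piMl// divr_ge0.
by move: del2 CN2 dC; move: (C / N%:R) => e; rewrite !(mulrDl, mulrDr) !mul1r mulr1; lra.
Unshelve. all: by end_near.
Qed.

(** By contradiction: a smaller energy would make the first term of [thomson_lower_bound] at most
    [Num.sqrt q < 1] while the error term tends to 0. *)
Lemma thomson_asymptotic (eps : R) : 0 < eps -> exists n0, \forall N \near \oo,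
  forall (F : 'I_2 -> nat -> nat -> R) (L : R),
  (forall p k, F p 0%N k = F ord0 0%N k) -> F ord0 0%N 0%N = 0 -> F ord0 0%N N = 1 ->
  \sum_p \sum_(a < n0.+1) \sum_(k < N - a) level_energy al0 al1 m p N F a k <= L ->
  profile_mass^-1 - eps <= N%:R ^+ 2 * L.
Proof.
move=> eps0; have M0 := profile_mass_gt0.
have [eps1|eps1] := leP profile_mass^-1 eps.
  exists 0%N; near=> N => F L _ _ _ HL; apply: (@le_trans _ _ 0); first by rewrite subr_le0.
  rewrite mulr_ge0 ?exprn_ge0//; apply: le_trans HL; do 3![apply: sumr_ge0 => ? _].
  rewrite /level_energy mulr_ge0 ?exprn_ge0 ?(ltW (m_gt0 _))// addr_ge0// divr_ge0// mulr_ge0 ?sqr_ge0// ltW//.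
pose rho := profile_mass^-1 - eps.
have rho0 : 0 < rho by rewrite subr_gt0.
(* Chosen so that [rho * (profile_mass + eta)] is exactly [1 - eps * profile_mass / 2]. *)
pose eta := eps * profile_mass / (2 * rho).
have eta0 : 0 < eta by rewrite divr_gt0 ?mulr_gt0.
have [n0 Hn0] := thomson_mass_le eta0.
have [C HC] := @thomson_lower_bound R al0 al1 m n0 al0_gt0 al1_gt0 m_gt0 m_lt1.
exists n0.
pose q := 1 - eps * profile_mass / 2.
have qE : rho * (profile_mass + eta) = q.
  have r1 : 0 < 1 + - eps * profile_mass by rewrite mulNr subr_gt0 -ltr_pdivlMr// div1r.
  by rewrite /q /eta /rho; field; rewrite !gt_eqF.
have q0 : 0 < q by rewrite -qE mulr_gt0// addr_gt0.
have q1 : Num.sqrt q < 1.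
  by rewrite -[ltRHS]sqrtr1 ltr_sqrt// /q ltrBlDr ltrDl divr_gt0// mulr_gt0.
near=> N => F L F0 F00 F0N HL; rewrite leNgt; apply/negP => Lrho.
have n0N : (n0 < N)%N by near: N; exact: nbhs_infty_gt.
have Nr : 0 < N%:R :> R by rewrite ltr0n (leq_ltn_trans _ n0N).
have L0 : 0 <= L.
  apply: le_trans HL; do 3![apply: sumr_ge0 => ? _].
  rewrite /level_energy mulr_ge0 ?exprn_ge0 ?(ltW (m_gt0 _))// addr_ge0// divr_ge0// mulr_ge0 ?sqr_ge0// ltW//.
have := HC N F L n0N F0 F00 F0N HL; apply/negP; rewrite -ltNge.
have h1 : Num.sqrt (L * \sum_(k < N) par (level_mass m n0 ord0 * resist al0 al1 ord0 N k)
                   (level_mass m n0 ord_max * resist al0 al1 ord_max N k)) <= Num.sqrt q.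
  rewrite ler_wsqrtr// -qE; apply: (@le_trans _ _ (L * (N%:R ^+ 2 * (profile_mass + eta)))).
    by rewrite ler_wpM2l//; near: N.
  by rewrite mulrA ler_wpM2r ?(ltW (addr_gt0 _ _))// mulrC ltW.
have h2 : C * Num.sqrt (N%:R * L) <= (1 - Num.sqrt q) / 2.
  apply: (@le_trans _ _ ((`|C| + 1) * Num.sqrt (rho / N%:R))).
    apply: (@le_trans _ _ ((`|C| + 1) * Num.sqrt (N%:R * L))).
      rewrite ler_wpM2r// ?sqrtr_ge0//; have := ler_norm C; lra.
    rewrite ler_wpM2l ?addr_ge0// ler_wsqrtr// ler_pdivlMr// mulrC mulrA -expr2 ltW//.
  rewrite -ler_pdivlMl ?ltr_wpDl//.
  have e0 : 0 < (`|C| + 1)^-1 * ((1 - Num.sqrt q) / 2).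
    by rewrite mulr_gt0 ?invr_gt0 ?ltr_wpDl// divr_gt0// subr_gt0.
  rewrite -[leRHS]gtr0_norm// -sqrtr_sqr ler_wsqrtr// ler_pdivrMr// -ler_pdivrMl ?exprn_gt0//.
  set z := _ * rho.
  near: N; exists (Num.truncn z).+1 => // k /= hk.
  by apply: ltW; apply: (lt_le_trans (truncnS_gt _)); rewrite ler_nat.
lra.
Unshelve. all: by end_near.
Qed.

End Profile.

(** * Upper bound on the capacity *)

Section CrossBound.
Variables (R : realType) (n s : nat) (u w g Qa Qb : nat -> R) (U ma mb mu C1 : R).
Local Notation N := n.+1.
Hypothesis U01 : 0 < U <= 1.
Hypothesis u_bound : forall k, (k <= n)%N -> 0 <= u k <= U.
Hypothesis w_bound : forall k, (0 < k <= n)%N -> 0 <= w k <= U / k%:R.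
Hypothesis w0 : w 0 = 1.
Hypothesis s_ge2 : (2 <= s)%N.
Hypothesis ma_bound : 0 <= ma <= mu.
Hypothesis mb_bound : 0 <= mb <= mu.
Hypothesis mu_lt1 : mu < 1.
Hypothesis g_low : forall k, (k < s)%N -> g k = 0.
Hypothesis g_high : forall k, (N < k + s)%N -> g k = 0.
Hypothesis Qa_bound : forall k, (k <= n)%N -> `|Qa k| <= C1.
Hypothesis Qb_bound : forall k, (k <= n)%N -> `|Qb k| <= C1.
Hypothesis Qa_supp : forall k, g k = 0 -> Qa k = 0.
Hypothesis Qb_supp : forall k, g k = 0 -> Qb k = 0.

(** An edge between the two [y_p] has a conductance with four small factors, or an exponentially
    small one when the fourth site is empty. *)
Lemma cross_sum_le : \sum_(k < N) \sum_(a < N) \sum_(b < N) (if (k + a + b <= n)%N then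
    w k * u a * u b * w (n - (k + a + b)) * (ma ^+ a * mb ^+ b) * (Qb k - Qa k) ^+ 2 else 0) <=
  (2 * C1) ^+ 2 * (N%:R * (U ^+ 4 * (1 - mu)^-1 ^+ 2) + N%:R ^+ 3 * (U ^+ 2 * mu ^+ s.-1)).
Proof.
have [ma0 ma1] := andP ma_bound; have [mb0 mb1] := andP mb_bound; have [U0' U1] := andP U01.
have U0 := ltW U0'; have mu0 : 0 <= mu by exact: le_trans ma1.
have C10 : 0 <= C1 by exact: le_trans (Qa_bound (leq0n n)).
have wU k : (0 < k <= n)%N -> 0 <= w k <= U.
  case: k => // k kn; have /andP[w1 w2] := w_bound kn; rewrite w1/=; apply: le_trans w2 _.
  by rewrite ler_pdivrMr// ler_peMr// ler1n.
have pos k a b : 0 <= U ^+ 4 * (ma ^+ a * mb ^+ b) + U ^+ 2 * mu ^+ s.-1 :> R.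
  by rewrite addr_ge0 ?mulr_ge0 ?exprn_ge0//= => _; exact: k.
have term k a b : (k + a + b <= n)%N ->
    w k * u a * u b * w (n - (k + a + b)) * (ma ^+ a * mb ^+ b) * (Qb k - Qa k) ^+ 2 <=
    (2 * C1) ^+ 2 * (U ^+ 4 * (ma ^+ a * mb ^+ b) + U ^+ 2 * mu ^+ s.-1).
  move=> kab; have [kn an bn [_ ln]] := add3_le kab.
  have p1 : 0 <= U ^+ 4 * (ma ^+ a * mb ^+ b) by rewrite !mulr_ge0 ?exprn_ge0.
  have p2 : 0 <= U ^+ 2 * mu ^+ s.-1 by rewrite mulr_ge0 ?exprn_ge0.
  have [ks|ks] := ltnP k s.
    by rewrite (Qa_supp (g_low ks)) (Qb_supp (g_low ks)) subrr expr0n mulr0 mulr_ge0 ?sqr_ge0// addr_ge0.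
  have [kN|kN] := ltnP N (k + s).
    by rewrite (Qa_supp (g_high kN)) (Qb_supp (g_high kN)) subrr expr0n mulr0 mulr_ge0 ?sqr_ge0// addr_ge0.
  have kpos : (0 < k)%N := leq_trans (ltnW s_ge2) ks.
  have Pm0 : 0 <= ma ^+ a * mb ^+ b by rewrite mulr_ge0 ?exprn_ge0.
  have Q2 : (Qb k - Qa k) ^+ 2 <= (2 * C1) ^+ 2.
    rewrite -[leLHS]real_normK ?num_real// lerXn2r ?nnegrE ?mulr_ge0//.
    apply: le_trans (ler_normB _ _) _; have := Qa_bound kn; have := Qb_bound kn; lra.
  have wk : 0 <= w k <= U by apply: wU; rewrite kpos.
  have uU j : (j <= n)%N -> 0 <= u j <= U by exact: u_bound.
  have u1 : 0 <= u b <= 1 by have /andP[-> h] := uU b bn; rewrite (le_trans h).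
  rewrite [leRHS]mulrC.
  have [l0|lpos] := posnP (n - (k + a + b)).
    have Pm1 : ma ^+ a * mb ^+ b <= mu ^+ s.-1.
      apply: (@le_trans _ _ (mu ^+ a * mu ^+ b)); first by rewrite ler_pM ?exprn_ge0 ?lerXn2r.
      by rewrite -exprD ler_wiXn2l// ?(ltW mu_lt1)// (add3_full s_ge2 kN l0).
    have /andP[h1 h2] : 0 <= w k * u a * u b * w (n - (k + a + b)) * (ma ^+ a * mb ^+ b) <=
        U * U * 1 * 1 * mu ^+ s.-1.
      by apply: prod5_le; rewrite ?l0 ?w0 ?lexx ?ler01 ?Pm0 ?uU.
    apply: ler_pM; rewrite ?sqr_ge0//; apply: (le_trans h2); rewrite !mulr1 -expr2 lerDr//.
  have /andP[h1 h2] : 0 <= w k * u a * u b * w (n - (k + a + b)) * (ma ^+ a * mb ^+ b) <=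
        U * U * U * U * (ma ^+ a * mb ^+ b).
    by apply: prod5_le; rewrite ?uU ?Pm0 ?lexx// wU// lpos.
  apply: ler_pM; rewrite ?sqr_ge0//; apply: (le_trans h2).
  by rewrite (_ : U * U * U * U = U ^+ 4) ?lerDl//; ring.
apply: (@le_trans _ _ (\sum_(k < N) \sum_(a < N) \sum_(b < N)
   (2 * C1) ^+ 2 * (U ^+ 4 * (ma ^+ a * mb ^+ b) + U ^+ 2 * mu ^+ s.-1))).
  apply: ler_sum => k _; apply: ler_sum => a _; apply: ler_sum => b _.
  case: ifPn => [|_]; first exact: term.
  by rewrite mulr_ge0 ?sqr_ge0// addr_ge0// ?mulr_ge0 ?exprn_ge0.
have geo (m : R) : 0 <= m <= mu -> 0 <= \sum_(a < N) m ^+ a <= (1 - mu)^-1.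
  move=> /andP[m0 m1]; have m11 : m < 1 by apply: le_lt_trans mu_lt1.
  rewrite sumr_ge0 => [|a _]; last by rewrite exprn_ge0.
  apply: (le_trans (sum_exp_le _ _)); first by rewrite m0.
  by rewrite lef_pV2 ?posrE ?subr_gt0// lerD2l lerN2.
have [ga0 ga1] := andP (geo _ ma_bound); have [gb0 gb1] := andP (geo _ mb_bound).
have -> : \sum_(k < N) \sum_(a < N) \sum_(b < N)
   (2 * C1) ^+ 2 * (U ^+ 4 * (ma ^+ a * mb ^+ b) + U ^+ 2 * mu ^+ s.-1) =
   (2 * C1) ^+ 2 * (N%:R * (U ^+ 4 * ((\sum_(a < N) ma ^+ a) * \sum_(b < N) mb ^+ b)) +
     N%:R ^+ 3 * (U ^+ 2 * mu ^+ s.-1)).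
  transitivity (\sum_(k < N) (2 * C1) ^+ 2 * (U ^+ 4 * ((\sum_(a < N) ma ^+ a) * \sum_(b < N) mb ^+ b) +
     N%:R ^+ 2 * (U ^+ 2 * mu ^+ s.-1))).
    apply: eq_bigr => k _; under eq_bigr do rewrite -mulr_sumr.
    rewrite -mulr_sumr; congr (_ * _).
    transitivity (\sum_(a < N) (U ^+ 4 * (ma ^+ a * \sum_(b < N) mb ^+ b) + N%:R * (U ^+ 2 * mu ^+ s.-1))).
      by apply: eq_bigr => a _; rewrite big_split/= sumr_const card_ord -[in X in _ + X = _]mulr_natl -!mulr_sumr.
    rewrite big_split/= sumr_const card_ord; congr (_ + _); first by rewrite -mulr_sumr -mulr_suml.
    by rewrite -[LHS]mulr_natl mulrA -expr2.
  rewrite sumr_const card_ord -[LHS]mulr_natl mulrCA mulrDr; congr (_ * (_ + _)).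
  by rewrite [LHS]mulrA; congr (_ * _); rewrite -exprS.
rewrite ler_wpM2l ?sqr_ge0// lerD2r ler_wpM2l// ler_wpM2l ?exprn_ge0// expr2 ler_pM//.
Qed.

End CrossBound.

Section Cutoff.
Variables (R : realType) (n s : nat).
Local Notation N := n.+1.
Hypothesis s_gt0 : (0 < s)%N.

(** A trapezoid: zero within [s] of either end, then a ramp of length [s]. The truncated subtraction
    produces the zeros. *)
Definition cutoff (k : nat) : R := Num.min 1 ((minn k (N - k) - s.-1)%:R / s%:R).

Let s0 : 0 < s%:R :> R. Proof. by rewrite ltr0n. Qed.

Lemma cutoff_low k : (k < s)%N -> cutoff k = 0.
Proof.
move=> ks; rewrite /cutoff (_ : (minn k (N - k) - s.-1 = 0)%N); last by lia.
by rewrite mul0r min_r.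
Qed.

Lemma cutoff_high k : (N < k + s)%N -> cutoff k = 0.
Proof.
move=> ks; rewrite /cutoff (_ : (minn k (N - k) - s.-1 = 0)%N); last by lia.
by rewrite mul0r min_r.
Qed.

Lemma cutoff_ge0_le1 k : 0 <= cutoff k <= 1.
Proof. by rewrite /cutoff le_min ler01 divr_ge0//= ge_min lexx. Qed.

Lemma cutoff_lip k : `|cutoff k - cutoff k.+1| <= s%:R^-1.
Proof.
have mn (a u v : R) : `|Num.min a u - Num.min a v| <= `|u - v|.
  have := ler_norm (u - v); have := ler_norm (v - u); rewrite (distrC v u) => h1 h2.
  by rewrite ler_norml; have [?|?] := leP a u; have [?|?] := leP a v; lra.
apply: le_trans (mn _ _ _) _; rewrite -mulrBl normrM [`|s%:R^-1|]gtr0_norm ?invr_gt0//.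
rewrite -[leRHS]mul1r ler_pM2r ?invr_gt0//.
set i := (_ - _)%N; set j := (_ - _)%N.
have ij : (i <= j.+1)%N by rewrite /i /j; lia.
have ji : (j <= i.+1)%N by rewrite /i /j; lia.
have ij' : i%:R <= j%:R + 1 :> R by rewrite natr1 ler_nat.
have ji' : j%:R <= i%:R + 1 :> R by rewrite natr1 ler_nat.
by rewrite ler_norml; apply/andP; split; lra.
Qed.

Lemma cutoff_sum_ge : \sum_(k < N) (1 - cutoff k) <= 4 * s%:R.
Proof.
have cnt (M j : nat) : \sum_(k < j) (k < M)%N%:R <= M%:R :> R.
  suff H : \sum_(k < j) (k < M)%N%:R = (minn j M)%:R :> R by rewrite H ler_nat geq_minr.
  elim: j => [|j IH]; first by rewrite big_ord0 min0n.
  by rewrite big_ord_recr/= IH -natrD; congr (_%:R); have [?|?] := ltnP j M; lia.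
have b (k : 'I_N) : 1 - cutoff k <= (k < s.*2)%N%:R + (rev_ord k < s.*2)%N%:R.
  have /andP[c0 c1] := cutoff_ge0_le1 k.
  have [ks|ks] := ltnP k s.*2; first by rewrite -[true%:R]/(1 : R); have : 0 <= (rev_ord k < s.*2)%N%:R :> R by []; lra.
  have [rs|rs] := ltnP (rev_ord k) s.*2; first by rewrite -[true%:R]/(1 : R) -[false%:R]/(0 : R); lra.
  rewrite /cutoff min_l ?subrr ?addr0//.
  rewrite ler_pdivlMr// mul1r ler_nat; move: ks rs => /=; lia.
apply: (le_trans (ler_sum _ (fun k _ => b k))); rewrite big_split/=.
have -> : \sum_(k < N) (rev_ord k < s.*2)%N%:R = \sum_(k < N) (k < s.*2)%N%:R :> R.
  by rewrite (reindex_inj rev_ord_inj); apply: eq_bigr => k _; rewrite rev_ordK.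
have := cnt s.*2 N; rewrite -muln2 natrM; lra.
Qed.
End Cutoff.

Lemma par_split (R : realType) (N u0 u1 v0 v1 g : R) : 0 < N -> 0 < u0 -> 0 < u1 -> 0 < v0 -> 0 < v1 ->
  u0^-1 * (g ^+ 2 / (N * (v0 / u0))) + u1^-1 * (g ^+ 2 / (N * (v1 / u1))) =
  g / N * (g / par v0 v1).
Proof. by move=> *; rewrite /par invrK; field; rewrite !gt_eqF. Qed.

Lemma line_resist_split (R : realType) (N k a b u : R) : 0 < N -> 0 < a -> 0 < b -> 0 < u ->
  (N - k) / a + k / b = N * (u * ((1 - k / N) / a + k / N / b) / u).
Proof. by move=> *; field; rewrite !gt_eqF. Qed.

Lemma sum4_le (R : realType) (a b c d : R) : 0 <= a -> 0 <= b -> 0 <= c -> 0 <= d ->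
  a <= a + b + c + d /\ b + c + d <= a + b + c + d.
Proof. by move=> *; split; lra. Qed.

Lemma coef_le2 (R : realType) (v a b e : R) : 0 <= v -> 0 <= a -> 0 <= b -> 0 <= e ->
  v * b + 1 * e <= (v + 1) * (a + b + e).
Proof.
move=> v0 a0 b0 e0; have va := mulr_ge0 v0 a0; have ve := mulr_ge0 v0 e0.
by rewrite mulrDl !mulrDr !mul1r; lra.
Qed.

Lemma coef_le (R : realType) (b u v : R) : 0 <= b -> 0 <= u -> 0 <= v ->
  [/\ b * u <= b * u + (b + 1) * v, b * v <= b * u + (b + 1) * v & 1 * v <= b * u + (b + 1) * v].
Proof.
move=> b0 u0 v0; have bu := mulr_ge0 b0 u0; have bv := mulr_ge0 b0 v0.
by rewrite mulrDl mul1r; split; lra.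
Qed.

Section LinearTest.
Variables (R : realType) (T : finType) (x0 x1 ya yb : T).
Hypothesis sites_uniq : uniq [:: x0; x1; ya; yb].
Hypothesis sites_cover : forall z, z \in [:: x0; x1; ya; yb].
Variables (ms : T -> R) (r : T -> T -> R) (d Z : R).
Hypothesis ms_x0 : ms x0 = 1.
Hypothesis ms_x1 : ms x1 = 1.
Variables (n : nat) (f : config T n.+1 -> R) (g Qb : nat -> R).
Let Qa := side_slope n g (r x0 ya) (r x1 ya).
Hypothesis fE : forall k a b, (k + a + b <= n.+1)%N ->
  f (cfg x0 ya yb n.+1 k a b) = (\sum_(j < k) g j + (a%:R * Qa k + b%:R * Qb k)) / Z.

Let up k a b : (k + a + b <= n)%N -> [/\ (k + a.+1 + b <= n.+1)%N, (k.+1 + a + b <= n.+1)%N,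
  (k + a + b <= n.+1)%N & (k + a + b.+1 <= n.+1)%N].
Proof. by move=> h; split; lia. Qed.

Lemma edge_pair_linear : edge_energy ms r d f x0 ya + edge_energy ms r d f x1 ya =
  (\sum_(k < n.+1) \sum_(a < n.+1) \sum_(b < n.+1) (if (k + a + b <= n)%N then
    pair_term n (ip_u d) (ip_w d) g Qb (r x0 ya) (r x1 ya) (ms ya) (ms yb) k a b else 0)) / Z ^+ 2.
Proof.
rewrite (edge_energy_x0_ya sites_uniq sites_cover r d ms_x0 ms_x1).
rewrite (edge_energy_x1_ya sites_uniq sites_cover r d ms_x0 ms_x1).
rewrite !mulr_sumr -big_split/= mulr_suml; apply: eq_bigr => k _.
rewrite !mulr_sumr -big_split/= mulr_suml; apply: eq_bigr => a _.
rewrite !mulr_sumr -big_split/= mulr_suml; apply: eq_bigr => b _.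
case: ifPn => [kab|_]; last by rewrite !mulr0 addr0 mul0r.
have [h1 h2 h3 _] := up kab.
rewrite !fE// -!mulrBl !exprMn /pair_term /cond_x0_ya /cond_x1_ya /slope_gap -/Qa big_ord_recr/= exprVn.
rewrite (_ : _ - _ = Qa k - g k + a%:R * (Qa k - Qa k.+1) + b%:R * (Qb k - Qb k.+1)); last first.
  by rewrite -natr1; ring.
rewrite [in X in _ + X = _](_ : _ - _ = Qa k); last by rewrite -natr1; ring.
by ring.
Qed.

Lemma edge_cross_linear : edge_energy ms r d f ya yb =
  (ms ya * r ya yb) * (\sum_(k < n.+1) \sum_(a < n.+1) \sum_(b < n.+1) (if (k + a + b <= n)%N then
    ip_w d k * ip_u d a * ip_u d b * ip_w d (n - (k + a + b)) * (ms ya ^+ a * ms yb ^+ b) *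
    (Qb k - Qa k) ^+ 2 else 0)) / Z ^+ 2.
Proof.
rewrite (edge_energy_ya_yb sites_uniq sites_cover r d ms_x0 ms_x1) -[RHS]mulrA; congr (_ * _).
rewrite mulr_suml; apply: eq_bigr => k _.
rewrite mulr_suml; apply: eq_bigr => a _.
rewrite mulr_suml; apply: eq_bigr => b _.
case: ifPn => [kab|_]; last by rewrite mul0r.
have [h1 h2 _ h3] := up kab.
rewrite !fE// -!mulrBl exprMn /cond_ya_yb exprVn.
rewrite (_ : _ - _ = Qb k - Qa k); last by rewrite -!natr1; ring.
by rewrite [LHS]mulrA.
Qed.

End LinearTest.

Section Capacity.
Variables (R : realType) (T : finType) (x y : 'I_2 -> T) (ms : T -> R) (r : T -> T -> R).
Hypothesis sites_uniq : uniq [:: x ord0; x ord_max; y ord0; y ord_max].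
Hypothesis sites_cover : forall z : T, z \in [:: x ord0; x ord_max; y ord0; y ord_max].
Hypothesis ms_x : forall i, ms (x i) = 1.
Hypothesis ms_gt0 : forall z, 0 < ms z.
Hypothesis ms_y : forall p, ms (y p) < 1.
Hypothesis r_ge0 : forall a b, 0 <= r a b.
Hypothesis r_diag : forall a, r a a = 0.
Hypothesis r_rev : forall a b, ms a * r a b = ms b * r b a.
Hypothesis r_xy : forall i p, 0 < r (x i) (y p).
Hypothesis r_x01 : r (x ord0) (x ord_max) = 0.
Hypothesis r_x10 : r (x ord_max) (x ord0) = 0.

Let al0 p := r (x ord0) (y p).
Let al1 p := r (x ord_max) (y p).
Let mm p := ms (y p).
Let al0_gt0 p : 0 < al0 p. Proof. exact: r_xy. Qed.
Let al1_gt0 p : 0 < al1 p. Proof. exact: r_xy. Qed.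
Let mm_gt0 p : 0 < mm p. Proof. exact: ms_gt0. Qed.
Let mm_lt1 p : mm p < 1. Proof. exact: ms_y. Qed.
Let rho := (profile_mass al0 al1 mm)^-1.

Let sum_I2 (F : 'I_2 -> R) : \sum_p F p = F ord0 + F ord_max.
Proof. by rewrite !big_ord_recl big_ord0 addr0; congr (_ + F _); exact/val_inj. Qed.

Let sites_uniq' : uniq [:: x ord0; x ord_max; y ord_max; y ord0].
Proof.
move: sites_uniq; rewrite /= !inE !negb_or !andbT => /and3P[/and3P[-> -> ->] /andP[-> ->] h].
by rewrite eq_sym h.
Qed.

Let sites_cover' z : z \in [:: x ord0; x ord_max; y ord_max; y ord0].
Proof. by have := sites_cover z; rewrite !inE => /or4P[]->; rewrite ?orbT. Qed.

Lemma capacity_lower (eps : R) : 0 < eps -> \forall n \near \oo,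
  forall (d : R) (f : config T n.+1 -> R), 0 < d <= 1 ->
  f (xi n.+1 (x ord0)) = 1 -> f (xi n.+1 (x ord_max)) = 0 ->
  2 * d ^+ 3 / n.+1%:R ^+ 2 * (rho - eps) <=
    dirichlet (incl_rate r d (N:=n.+1)) (ip_weight ms d (N:=n.+1)) f.
Proof.
move=> eps0.
have [n0 [M _ HM]] := thomson_asymptotic al0_gt0 al1_gt0 mm_gt0 mm_lt1 eps0.
exists (maxn M n0) => // n /=; rewrite geq_max => /andP[Mn n0n] d f d01 f0 f1.
have d0 : 0 < d by case/andP: d01.
have d3 : 0 < d ^+ 3 by rewrite exprn_gt0.
set D := dirichlet _ _ f.
(* For [p = ord_max] the two sites [y_p] exchange roles, so one lemma covers both branches; at
   [a = 0] the two descriptions coincide. *)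
pose F (p : 'I_2) a k := if p == ord0 then f (cfg (x ord0) (y ord0) (y ord_max) n.+1 k a 0)
  else f (cfg (x ord0) (y ord_max) (y ord0) n.+1 k a 0).
have Fcomm p k : F p 0%N k = F ord0 0%N k.
  rewrite /F; case: ifP => // _; rewrite eqxx; congr (f (config_of _ _ _)); apply/funext => z.
  by case: eqP => // _; do 2![case: eqP => // _].
have [c1 c0] := cfg_xi sites_uniq sites_cover n.+1.
have F00 : F ord0 0%N 0%N = 0 by rewrite /F eqxx c0.
have F0N : F ord0 0%N n.+1 = 1 by rewrite /F eqxx c1.
have n0N : (n0 < n.+1)%N by rewrite ltnS.
have low : \sum_p \sum_(a < n0.+1) \sum_(k < n.+1 - a) level_energy al0 al1 mm p n.+1 F a k <= D / 2 / d ^+ 3.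
  rewrite sum_I2 ler_pdivlMr// mulrC mulrDr.
  have h0 := edge_pair_ge (F := F ord0) sites_uniq sites_cover (ms_x _) (ms_x _) ms_gt0 r_ge0 d01 n0N
    (fun a k => erefl _ : F ord0 a k = f (cfg (x ord0) (y ord0) (y ord_max) n.+1 k a 0)).
  have h1 := edge_pair_ge (F := F ord_max) sites_uniq' sites_cover' (ms_x _) (ms_x _) ms_gt0 r_ge0 d01 n0N
    (fun a k => erefl _ : F ord_max a k = f (cfg (x ord0) (y ord_max) (y ord0) n.+1 k a 0)).
  apply: le_trans (lerD h0 h1) _.
  rewrite /D (dirichlet_four_sites sites_uniq sites_cover d r_diag r_rev r_x01 r_x10 f).
  rewrite mulrAC divff// mul1r lerDl; exact: edge_energy_ge0.
have := HM n.+1 (leqW Mn) F _ Fcomm F00 F0N low; rewrite -/rho => H.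
have -> : D = 2 * d ^+ 3 / n.+1%:R ^+ 2 * (n.+1%:R ^+ 2 * (D / 2 / d ^+ 3)).
  by field; rewrite gt_eqF//= addrC natr1 pnatr_eq0.
rewrite ler_wpM2l// divr_ge0 ?mulr_ge0 ?exprn_ge0// ltW//.
Qed.

(** [K] depends on the rates and on [C1], [c1] only, so that [n], [s], [d] and [del] can be tuned
    afterwards. The three error terms come from the variation of the slopes, from configurations
    charging both [y_p], and from an empty [x_2]. *)
Lemma test_function_energy (C1 c1 : R) : 0 <= C1 -> 0 <= c1 ->
  exists2 K, 0 <= K & forall n s (d U del : R) (g : nat -> R), 0 < d -> 0 < U <= 1 ->
  (forall k, (k <= n)%N -> ip_u d k <= U) -> (forall k, (0 < k <= n)%N -> ip_w d k <= U / k%:R) ->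
  (2 <= s)%N -> 0 < del ->
  (forall k, (k < s)%N -> g k = 0) -> (forall k, (n.+1 < k + s)%N -> g k = 0) ->
  (forall k, 0 <= g k <= C1) ->
  (forall k, (k <= n)%N -> g k <= profile al0 al1 mm (k%:R / n.+1%:R)) ->
  (forall k, (k <= n)%N -> `|g k - g k.+1| <= c1 / n.+1%:R) ->
  0 < \sum_(k < n.+1) g k ->
  exists f : config T n.+1 -> R, [/\ f (xi n.+1 (x ord0)) = 1, f (xi n.+1 (x ord_max)) = 0 &
    dirichlet (incl_rate r d (N:=n.+1)) (ip_weight ms d (N:=n.+1)) f <=
    2 / (\sum_(k < n.+1) g k) ^+ 2 *
     (U ^+ 3 * (1 + del) * (1 + K / s%:R) * ((\sum_(k < n.+1) g k) / n.+1%:R) +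
      K * (U ^+ 3 * (1 + del^-1) / n.+1%:R + n.+1%:R * U ^+ 4 +
           n.+1%:R ^+ 3 * (U ^+ 2 * (Num.max (mm ord0) (mm ord_max)) ^+ s.-1)))].
Proof.
move=> C10 c10.
have [A /andP[A0 A1] HA] : exists2 A : R, 0 < A <= 1 & forall p,
    [/\ A <= (al0 p)^-1, A <= (al1 p)^-1, (al0 p)^-1 <= A^-1 & (al1 p)^-1 <= A^-1].
  have [|A A01 HA] := @pos_lower_bound R 'I_2 (fun p => Num.min (al0 p) (Num.min (al1 p)
    (Num.min (al0 p)^-1 (al1 p)^-1))).
    by move=> p; rewrite !lt_min al0_gt0 al1_gt0 !invr_gt0 al0_gt0 al1_gt0.
  exists A => // p; have := HA p; rewrite !le_min => /and4P[a0 a1 a2 a3]; case/andP: A01 => A0 _.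
  by split=> //; rewrite lef_pV2 ?posrE.
pose mu := Num.max (mm ord0) (mm ord_max).
have mu1 : mu < 1 by rewrite gt_max !mm_lt1.
have mub p : 0 <= mm p <= mu.
  rewrite (ltW (mm_gt0 p))/= /mu le_max.
  have [->|p1] := eqVneq p ord0; first by rewrite lexx.
  by rewrite (_ : p = ord_max) ?lexx ?orbT//; case: p p1 => -[|[|//]] i //= _; exact/val_inj.
have mu0 : 0 <= mu by case/andP: (mub ord0) => /le_trans; apply.
pose B := 2 / (1 - mu) ^+ 3.
have B0 : 0 <= B by rewrite divr_ge0// exprn_ge0// subr_ge0 ltW.
(* Lipschitz constant of a product: [c1] for [g], the second part for the share [q], a ratio of
   affine functions of [k] bounded below by [ratio_lip]'s margin [A * N]. *)
pose c := c1 + C1 * (3 * A^-1 / A).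
have c0 : 0 <= c by rewrite addr_ge0// mulr_ge0// divr_ge0 ?mulr_ge0 ?invr_ge0 ?(ltW A0).
pose kap := ms (y ord0) * r (y ord0) (y ord_max).
have kap0 : 0 <= kap by rewrite mulr_ge0// ltW.
pose kp p := B * B * (al0 p * c ^+ 2) + (B * B + 1) * ((al0 p + al1 p) * (C1 + c) ^+ 2).
pose K0 := 2 * (B * C1 / A).
pose kc := kap * ((2 * C1) ^+ 2 * ((1 - mu)^-1 ^+ 2 + 1)).
have kp0 p : 0 <= kp p.
  have a0 := ltW (al0_gt0 p); have a1 := ltW (al1_gt0 p).
  have BB : 0 <= B * B by rewrite mulr_ge0.
  by apply: addr_ge0; apply: mulr_ge0; rewrite ?addr_ge0// mulr_ge0 ?sqr_ge0 ?addr_ge0.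
have K00 : 0 <= K0 by apply: mulr_ge0 => //; apply: mulr_ge0; [exact: mulr_ge0|rewrite invr_ge0 ltW].
have kc0 : 0 <= kc by apply: mulr_ge0 => //; rewrite mulr_ge0 ?sqr_ge0// addr_ge0 ?sqr_ge0.
exists (K0 + kp ord0 + kp ord_max + kc).
  exact: (addr_ge0 (addr_ge0 (addr_ge0 K00 (kp0 _)) (kp0 _)) kc0).
move=> n s d U del g d0 /andP[U0' U1] hu hw s2 del0 glow ghigh gb gphi glip Z0.
set Z := \sum_(k < n.+1) g k in Z0 *.
have U0 := ltW U0'.
have N0 : 0 < n.+1%:R :> R by [].
pose Q p := side_slope n g (al0 p) (al1 p).
pose LR p := line_resist n (al0 p) (al1 p).
have LRlow p k : (k <= n.+1)%N -> A * n.+1%:R <= LR p k.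
  move=> kn; have [a0 a1 _ _] := HA p.
  have h : 0 <= n.+1%:R - k%:R :> R by rewrite subr_ge0 ler_nat.
  rewrite /LR /line_resist; have -> : A * n.+1%:R = (n.+1%:R - k%:R) * A + k%:R * A by ring.
  by rewrite lerD// ler_wpM2l.
have LR0 p k : (k <= n.+1)%N -> 0 < LR p k.
  by move=> kn; apply: lt_le_trans (LRlow p k kn); rewrite mulr_gt0.
pose q p k := (k%:R / al1 p) / LR p k.
have QE p k : Q p k = g k * q p k by rewrite /Q /side_slope /q [RHS]mulrA.
have q01 p k : (k <= n.+1)%N -> 0 <= q p k <= 1.
  move=> kn; have h := LR0 p k kn; rewrite /q; apply/andP; split.
    by rewrite divr_ge0 ?(ltW h)// divr_ge0// ltW.
  rewrite ler_pdivrMr// mul1r /LR /line_resist lerDr divr_ge0 ?(ltW (al0_gt0 _))// subr_ge0 ler_nat//.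
have qlip p k : (k <= n)%N -> `|q p k - q p k.+1| <= (3 * A^-1 / A) / n.+1%:R.
  move=> kn; have [_ _ b0 b1] := HA p; rewrite distrC.
  have i0 : 0 < (al0 p)^-1 by rewrite invr_gt0.
  have i1 : 0 < (al1 p)^-1 by rewrite invr_gt0.
  have e0 : 0 < A * n.+1%:R by rewrite mulr_gt0.
  rewrite /q /LR /line_resist ![_ + _ / al1 p]addrC.
  apply: le_trans (ratio_lip (c := A^-1) (e := A * n.+1%:R) _ _ _ _ _ _ _) _ => //.
  - by rewrite mulr_ge0// ltW.
  - by rewrite mulr_gt0// subr_gt0 ltr_nat ltnS.
  - by have := LRlow p k.+1 kn; rewrite /LR /line_resist [_ + _ / al1 p]addrC.
  - by have := LR0 p k (leqW kn); rewrite /LR /line_resist [_ + _ / al1 p]addrC.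
  - by rewrite -mulrBl -natr1 addrAC subrr add0r mul1r gtr0_norm.
  - rewrite -mulrBl (_ : _ - _ - _ = -1); last by rewrite -natr1; ring.
    by rewrite mulN1r normrN gtr0_norm.
  - by rewrite invfM !mulrA.
have Qb p k : (k <= n)%N -> `|Q p k| <= C1.
  move=> kn; have /andP[q0 q1] := q01 p k (leqW kn); have /andP[g0 g1] := gb k.
  by rewrite QE normrM (ger0_norm g0) (ger0_norm q0); apply: le_trans g1; rewrite ler_piMr.
have Qlip p k : (k <= n)%N -> `|Q p k - Q p k.+1| <= c / n.+1%:R.
  move=> kn; rewrite !QE.
  have /andP[q0 q1] := q01 p k (leqW kn); have /andP[g0 g1] := gb k.+1.
  have -> : g k * q p k - g k.+1 * q p k.+1 = (g k - g k.+1) * q p k + g k.+1 * (q p k - q p k.+1) by ring.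
  apply: le_trans (ler_normD _ _) _; rewrite (normrM (g k - _)) (normrM (g k.+1)) /c mulrDl; apply: lerD.
    rewrite (ger0_norm q0) -[leRHS]mulr1; apply: ler_pM => //; exact: glip.
  rewrite (ger0_norm g0) -mulrA; apply: ler_pM => //; exact: qlip.
have Qsupp p k : g k = 0 -> Q p k = 0 by move=> gk; rewrite QE gk mul0r.
have ub k : (k <= n)%N -> 0 <= ip_u d k <= U by move=> kn; rewrite (ltW (ip_u_gt0 _ d0)) hu.
have wb k : (0 < k <= n)%N -> 0 <= ip_w d k <= U / k%:R by move=> kn; rewrite (ltW (ip_w_gt0 _ d0)) hw.
have U01 : 0 < U <= 1 by rewrite U0'.
pose f (eta : config T n.+1) := (\sum_(j < val eta (x ord0)) g j +
  ((val eta (y ord0))%:R * Q ord0 (val eta (x ord0)) + (val eta (y ord_max))%:R * Q ord_max (val eta (x ord0)))) / Z.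
have fE0 k a b : (k + a + b <= n.+1)%N -> f (cfg (x ord0) (y ord0) (y ord_max) n.+1 k a b) =
    (\sum_(j < k) g j + (a%:R * Q ord0 k + b%:R * Q ord_max k)) / Z.
  by move=> kab; have [e0 _ ea eb] := cfgE sites_uniq sites_cover kab; rewrite /f e0 ea eb.
have fE1 k a b : (k + a + b <= n.+1)%N -> f (cfg (x ord0) (y ord_max) (y ord0) n.+1 k a b) =
    (\sum_(j < k) g j + (a%:R * Q ord_max k + b%:R * Q ord0 k)) / Z.
  move=> kab; have [e0 _ ea eb] := cfgE sites_uniq' sites_cover' kab; rewrite /f e0 ea eb.
  by rewrite [a%:R * _ + _]addrC.
have [xi1 xi0] := cfg_xi sites_uniq sites_cover n.+1.
exists f; split.
- by rewrite -xi1 fE0 ?addn0// !mul0r !addr0 divff// gt_eqF.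
- by rewrite -xi0 fE0// big_ord0 !mul0r !addr0 mul0r.
rewrite (dirichlet_four_sites sites_uniq sites_cover d r_diag r_rev r_x01 r_x10 f).
rewrite (edge_pair_linear sites_uniq sites_cover d (ms_x _) (ms_x _) fE0).
rewrite (edge_pair_linear sites_uniq' sites_cover' d (ms_x _) (ms_x _) fE1).
rewrite (edge_cross_linear sites_uniq sites_cover d (ms_x _) (ms_x _) fE0).
rewrite -/kap; set E0 := \sum_(k < n.+1) _; set E1 := \sum_(k < n.+1) _; set EX := \sum_(k < n.+1) _.
rewrite -!mulrDl [leLHS]mulrA [leRHS]mulrAC; apply: ler_wpM2r.
  by rewrite invr_ge0 sqr_ge0.
rewrite ler_pM2l//.
have H0 := pair_sum_le U01 ub wb (ip_w0 d) s2 (al0_gt0 ord0) (al1_gt0 ord0) (mub ord0) (mub ord_max) mu1 del0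
  glow ghigh gb (Qlip ord0) (Qlip ord_max) (Qsupp ord_max).
have H1 := pair_sum_le U01 ub wb (ip_w0 d) s2 (al0_gt0 ord_max) (al1_gt0 ord_max) (mub ord_max) (mub ord0) mu1 del0
  glow ghigh gb (Qlip ord_max) (Qlip ord0) (Qsupp ord0).
have HX := cross_sum_le U01 ub wb (ip_w0 d) s2 (mub ord0) (mub ord_max) mu1
  glow ghigh (Qb ord0) (Qb ord_max) (Qsupp ord0) (Qsupp ord_max).
rewrite -/E0 -/B in H0; rewrite -/E1 -/B in H1; rewrite -/EX in HX.
set S0 := \sum_(k < n.+1) _ in H0; set S1 := \sum_(k < n.+1) _ in H1.
have t01 (k : 'I_n.+1) : 0 <= (k%:R / n.+1%:R : R) <= 1.
  by rewrite divr_ge0//= ler_pdivrMr// mul1r ler_nat ltnW.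
have Nn0 : n.+1%:R != 0 :> R by rewrite gt_eqF.
(* At each level the two branches together cost [g ^+ 2 / (N * profile)], and [g <= profile] turns
   this into [g / N]. *)
have SZ : (1 - mm ord0)^-1 * S0 + (1 - mm ord_max)^-1 * S1 <= Z / n.+1%:R.
  rewrite /S0 /S1 !mulr_sumr -big_split/= /Z mulr_suml; apply: ler_sum => k _.
  have kn : (k <= n)%N by rewrite -ltnS.
  have brE p : line_resist n (al0 p) (al1 p) k = n.+1%:R * (branch al0 al1 mm p (k%:R / n.+1%:R) / (1 - mm p)).
    by apply: line_resist_split => //; rewrite subr_gt0.
  have b0 p : 0 < branch al0 al1 mm p (k%:R / n.+1%:R) by exact: branch_gt0.
  have /andP[g0 _] := gb k.
  have ple := gphi k kn.
  have -> : (1 - mm ord0)^-1 * (g k ^+ 2 / line_resist n (al0 ord0) (al1 ord0) k) +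
     (1 - mm ord_max)^-1 * (g k ^+ 2 / line_resist n (al0 ord_max) (al1 ord_max) k) =
     g k / n.+1%:R * (g k / profile al0 al1 mm (k%:R / n.+1%:R)).
    by rewrite !brE; apply: par_split => //; rewrite subr_gt0.
  rewrite ler_piMr ?divr_ge0// ler_pdivrMr ?mul1r//; exact: profile_gt0.
have SB p : \sum_(k < n.+1) g k ^+ 2 / line_resist n (al0 p) (al1 p) k <= C1 / A * (Z / n.+1%:R).
  rewrite /Z mulr_suml mulr_sumr; apply: ler_sum => k _.
  have /andP[g0 g1] := gb k.
  have -> : C1 / A * (g k / n.+1%:R) = g k * C1 * (A * n.+1%:R)^-1.
    by rewrite invfM; ring.
  apply: ler_pM; rewrite ?sqr_ge0 ?invr_ge0//.
  - by rewrite ltW// LR0// ltnW.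
  - by rewrite expr2 ler_wpM2l.
  - by rewrite lef_pV2 ?posrE ?mulr_gt0 ?LR0// 1?ltnW//; apply: LRlow; rewrite ltnW.
have S0b := SB ord0; have S1b := SB ord_max; rewrite -/S0 in S0b; rewrite -/S1 in S1b.
have Xp : 0 <= U ^+ 3 * (1 + del) by rewrite mulr_ge0 ?exprn_ge0// addr_ge0// ltW.
have ZN : 0 <= Z / n.+1%:R by rewrite divr_ge0// ltW.
have i0 : 0 <= del^-1 by rewrite invr_ge0 ltW.
pose e1 := U ^+ 3 * (1 + del^-1) / n.+1%:R.
pose e2 := n.+1%:R * U ^+ 4.
pose e3 := n.+1%:R ^+ 3 * (U ^+ 2 * mu ^+ s.-1).
have e10 : 0 <= e1 by rewrite divr_ge0// mulr_ge0 ?exprn_ge0// addr_ge0.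
have e20 : 0 <= e2 by rewrite mulr_ge0 ?exprn_ge0.
have e30 : 0 <= e3 by rewrite !mulr_ge0 ?exprn_ge0.
have err p : n.+1%:R * ((U ^+ 3 * (1 + del^-1) * al0 p * c ^+ 2 / n.+1%:R ^+ 2 +
    (al0 p + al1 p) * (C1 + c) ^+ 2 * U ^+ 4) * (B * B)) +
    n.+1%:R ^+ 3 * ((al0 p + al1 p) * (C1 + c) ^+ 2 * U ^+ 2 * mu ^+ s.-1) <= kp p * (e1 + e2 + e3).
  have -> : n.+1%:R * ((U ^+ 3 * (1 + del^-1) * al0 p * c ^+ 2 / n.+1%:R ^+ 2 +
    (al0 p + al1 p) * (C1 + c) ^+ 2 * U ^+ 4) * (B * B)) +
    n.+1%:R ^+ 3 * ((al0 p + al1 p) * (C1 + c) ^+ 2 * U ^+ 2 * mu ^+ s.-1) =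
    (B * B * (al0 p * c ^+ 2)) * e1 + (B * B * ((al0 p + al1 p) * (C1 + c) ^+ 2)) * e2 +
    (1 * ((al0 p + al1 p) * (C1 + c) ^+ 2)) * e3.
    rewrite /e1 /e2 /e3; move: Nn0; move: (n.+1%:R : R) (1 + del^-1) (mu ^+ s.-1) => NN dd mm' NN0.
    by field.
  have a0 := ltW (al0_gt0 p); have a1 := ltW (al1_gt0 p).
  have BB : 0 <= B * B by rewrite mulr_ge0.
  have w1 : 0 <= al0 p * c ^+ 2 by rewrite mulr_ge0 ?sqr_ge0.
  have w2 : 0 <= (al0 p + al1 p) * (C1 + c) ^+ 2 by rewrite mulr_ge0 ?sqr_ge0 ?addr_ge0.
  rewrite !mulrDr /kp; apply: lerD; [apply: lerD|]; apply: ler_wpM2r => //.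
  - by case: (coef_le BB w1 w2).
  - by case: (coef_le BB w1 w2).
  - by case: (coef_le BB w1 w2).
have errX : kap * EX <= kc * (e1 + e2 + e3).
  apply: (@le_trans _ _ (kap * ((2 * C1) ^+ 2 * ((1 - mu)^-1 ^+ 2 * e2 + 1 * e3)))).
    rewrite ler_wpM2l//; apply: (le_trans HX); rewrite ler_wpM2l ?sqr_ge0// mul1r lerD2r.
    by rewrite [leLHS]mulrA [leLHS]mulrC.
  have -> : kc * (e1 + e2 + e3) = kap * ((2 * C1) ^+ 2 * (((1 - mu)^-1 ^+ 2 + 1) * (e1 + e2 + e3))).
    by rewrite /kc -!(mulrA kap) -(mulrA ((2 * C1) ^+ 2)).
  rewrite ler_wpM2l// ler_wpM2l ?sqr_ge0//.
  have v0 : 0 <= (1 - mu)^-1 ^+ 2 by rewrite sqr_ge0.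
  exact: coef_le2.
have sge : 0 <= s%:R^-1 :> R by rewrite invr_ge0.
apply: (@le_trans _ _ (U ^+ 3 * (1 + del) * ((Z / n.+1%:R) + B / s%:R * (2 * (C1 / A * (Z / n.+1%:R)))) +
    (kp ord0 + kp ord_max + kc) * (e1 + e2 + e3))).
  have main : U ^+ 3 * (1 + del) * ((1 - mm ord0)^-1 + B / s%:R) * S0 +
    U ^+ 3 * (1 + del) * ((1 - mm ord_max)^-1 + B / s%:R) * S1 <=
    U ^+ 3 * (1 + del) * ((Z / n.+1%:R) + B / s%:R * (2 * (C1 / A * (Z / n.+1%:R)))).
    have -> : U ^+ 3 * (1 + del) * ((1 - mm ord0)^-1 + B / s%:R) * S0 +
       U ^+ 3 * (1 + del) * ((1 - mm ord_max)^-1 + B / s%:R) * S1 =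
       U ^+ 3 * (1 + del) * (((1 - mm ord0)^-1 * S0 + (1 - mm ord_max)^-1 * S1) + B / s%:R * (S0 + S1)) by ring.
    rewrite ler_wpM2l// lerD// ler_wpM2l//; first exact: mulr_ge0.
    by rewrite [2 * _]mulr_natl mulr2n lerD.
  apply: le_trans (lerD (lerD H0 H1) errX) _.
  rewrite (mulrDl (kp ord0 + kp ord_max) kc) (mulrDl (kp ord0) (kp ord_max)) addrACA -[leLHS]addrA.
  apply: lerD => //; rewrite lerD2r; apply: lerD; exact: err.
rewrite -/e1 -/e2 -/e3; apply: lerD.
  have -> : Z / n.+1%:R + B / s%:R * (2 * (C1 / A * (Z / n.+1%:R))) = (1 + K0 / s%:R) * (Z / n.+1%:R).
    by rewrite /K0; ring.
  rewrite [leLHS]mulrA ler_wpM2r// ler_wpM2l// lerD2l ler_wpM2r//.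
  by case: (sum4_le K00 (kp0 ord0) (kp0 ord_max) kc0).
rewrite ler_wpM2r ?addr_ge0//.
by case: (sum4_le K00 (kp0 ord0) (kp0 ord_max) kc0).
Qed.

End Capacity.

Section DecayRates.
Variables (R : realType) (d : nat -> R).
Hypothesis Hd_pos : forall N, (0 < N)%N -> 0 < d N.
Hypothesis Hd_lim : d @ \oo --> 0.
Hypothesis Hd_log : (fun N => d N * ln N%:R) @ \oo --> 0.
Hypothesis Hd_subexp : forall eps : R, 0 < eps -> (fun N => d N * expR (eps * N%:R)) @ \oo --> +oo.
Hypothesis Hd_N2log2 : (fun N => d N * N%:R ^+ 2 * (ln N%:R) ^+ 2) @ \oo --> 0.

Lemma d_harm_cvg : (fun N => d N * harm R N) @ \oo --> 0.
Proof.
apply: (@squeeze_cvgr _ _ _ _ (fun=> 0) (fun N => d N + d N * ln N%:R)).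
- near=> N; have N0 : (0 < N)%N by near: N; exact: nbhs_infty_gt.
  have d0 := ltW (Hd_pos N0); rewrite mulr_ge0 ?sumr_ge0//=.
  by rewrite -{2}[d N]mulr1 -mulrDr ler_wpM2l// harm_le.
- exact: cvg_cst.
- by rewrite -[0]addr0; exact: cvgD.
Unshelve. all: by end_near.
Qed.

Lemma kappa_cvg : (fun N => expR (d N * harm R N)) @ \oo --> (1 : R).
Proof.
rewrite -expR0; apply: continuous_cvg; [exact: continuous_expR|exact: d_harm_cvg].
Qed.

Lemma dN_cvg : (fun N => d N * N%:R) @ \oo --> 0.
Proof.
apply: (@squeeze_cvgr _ _ _ _ (fun=> 0) (fun N => d N * N%:R ^+ 2 * (ln N%:R) ^+ 2)) => //; last exact: cvg_cst.
near=> N; have N0 : (0 < N)%N by near: N; exact: nbhs_infty_gt.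
have N3 : expR 1 <= N%:R :> R.
  near: N; exists (Num.truncn (expR 1 : R)).+1 => // k /= hk.
  by apply: ltW; apply: (lt_le_trans (truncnS_gt _)); rewrite ler_nat.
have d0 := ltW (Hd_pos N0); rewrite mulr_ge0//=.
have Nr : 0 < N%:R :> R by rewrite ltr0n.
have l1 : 1 <= ln N%:R :> R by rewrite -[leLHS](expRK 1) ler_ln ?posrE ?expR_gt0.
rewrite -mulrA ler_wpM2l// expr2 -mulrA ler_peMr ?(ltW Nr)// mulr_ege1 ?exprn_ege1// ler1n//.
Unshelve. all: by end_near.
Qed.

Lemma inv_nat_cvg : (fun N => N%:R^-1) @ \oo --> (0 : R).
Proof. by rewrite -(cvg_shiftS (fun N => N%:R^-1 : R)); exact: cvg_harmonic. Qed.

(** Half of the exponential decay absorbs [1 / d N], by subexponentiality; the other half absorbs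
    the polynomial, since [expR (b N)] exceeds [(b N) ^+ 4 / 24]. *)
Lemma poly_exp_cvg (mu a : R) : 0 < mu < 1 -> 0 < a ->
  (fun N => N%:R ^+ 3 * mu ^+ (Num.truncn (a * N%:R)).-1 / d N) @ \oo --> 0.
Proof.
move=> /andP[mu0 mu1] a0.
pose lam := - ln mu.
have lam0 : 0 < lam by rewrite oppr_gt0 ln_lt0// mu0.
have muE k : mu ^+ k = expR (- (lam * k%:R)).
  by rewrite /lam mulNr opprK expRM_natr lnK ?posrE.
pose b := lam * a / 2.
have b0 : 0 < b by rewrite divr_gt0// mulr_gt0.
pose C := expR (2 * lam) * (24 / b ^+ 4).
have C0 : 0 <= C by rewrite mulr_ge0 ?expR_ge0// divr_ge0// exprn_ge0// ltW.
apply: (@squeeze_cvgr _ _ _ _ (fun=> 0) (fun N => C / N%:R)).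
- near=> N; have N0 : (0 < N)%N by near: N; exact: nbhs_infty_gt.
  have d0 := Hd_pos N0.
  have Nr : 0 < N%:R :> R by rewrite ltr0n.
  rewrite divr_ge0 ?mulr_ge0 ?exprn_ge0 ?(ltW mu0) ?(ltW d0)//=.
  have dle : 1 <= d N * expR (b * N%:R).
    by near: N; move/cvgryPge: (Hd_subexp b0); apply.
  have mle : mu ^+ (Num.truncn (a * N%:R)).-1 <= expR (2 * lam) * expR (- (2 * b * N%:R)).
    rewrite muE -expRD ler_expR.
    have /truncn_itv/andP[_ h] : 0 <= a * N%:R by rewrite mulr_ge0// ltW.
    have h2 : a * N%:R - 2 <= (Num.truncn (a * N%:R)).-1%:R.
      move: h; case: (Num.truncn _) => [|k] /=; rewrite -?natr1; last by lra.
      by rewrite add0r; lra.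
    have -> : 2 * lam + - (2 * b * N%:R) = - (lam * (a * N%:R - 2)) by rewrite /b; field.
    by rewrite lerN2 ler_pM2l.
  have e4 : (b * N%:R) ^+ 4 / 24 <= expR (b * N%:R).
    have x0 : 0 <= b * N%:R by rewrite mulr_ge0// ltW.
    have := @expR_ge1Dxn R (b * N%:R) 3 x0; rewrite (_ : 4`!%:R = 24)//; lra.
  have inv : (d N)^-1 <= expR (b * N%:R) by rewrite -[leLHS]mul1r ler_pdivrMr// mulrC.
  have bN0 : 0 < (b * N%:R) ^+ 4 / 24 by rewrite divr_gt0// exprn_gt0// mulr_gt0.
  have em : expR (- (b * N%:R)) <= ((b * N%:R) ^+ 4 / 24)^-1.
    by rewrite expRN lef_pV2 ?posrE// expR_gt0.
  apply: (@le_trans _ _ (N%:R ^+ 3 * (expR (2 * lam) * expR (- (2 * b * N%:R))) * expR (b * N%:R))).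
    apply: ler_pM; rewrite ?mulr_ge0 ?exprn_ge0 ?invr_ge0 ?(ltW mu0) ?(ltW d0)//.
    by rewrite ler_wpM2l// exprn_ge0.
  have -> : N%:R ^+ 3 * (expR (2 * lam) * expR (- (2 * b * N%:R))) * expR (b * N%:R) =
    N%:R ^+ 3 * expR (2 * lam) * expR (- (b * N%:R)).
    rewrite (_ : - (b * N%:R) = - (2 * b * N%:R) + b * N%:R); last by ring.
    by rewrite expRD; ring.
  have -> : C / N%:R = N%:R ^+ 3 * expR (2 * lam) * ((b * N%:R) ^+ 4 / 24)^-1.
    by rewrite /C; field; rewrite !gt_eqF.
  by rewrite ler_wpM2l// mulr_ge0 ?exprn_ge0 ?expR_ge0.
- exact: cvg_cst.
- by rewrite -(mulr0 C); apply: cvgM; [exact: cvg_cst|exact: inv_nat_cvg].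
Unshelve. all: by end_near.
Qed.

End DecayRates.

Lemma near_succ (P : nat -> Prop) : (\forall N \near \oo, P N) -> \forall n \near \oo, P n.+1.
Proof. by move=> [M _ HM]; exists M => // n /= Mn; apply: HM; exact: leqW. Qed.

Lemma near_pos_le (R : realType) (c : R) : \forall N \near \oo, c <= N%:R.
Proof.
exists (Num.truncn c).+1 => // k /= hk.
by apply: ltW; apply: (lt_le_trans (truncnS_gt _)); rewrite ler_nat.
Qed.

Lemma mass_arith (R : realType) (S S' a b m e : R) : - a <= S - m -> S <= S' + b ->
  b <= e / 2 -> a <= e / 2 -> m - e <= S'.
Proof. lra. Qed.

Lemma truncn_half_ge (R : realType) (v : R) : 4 <= v ->
  (2 <= Num.truncn v)%N /\ v / 2 <= (Num.truncn v)%:R.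
Proof.
move=> v4; have /truncn_itv/andP[_] : 0 <= v by lra.
rewrite -natr1 => vs; split; last by lra.
by rewrite -(ler_nat R) -(lerD2r 1) ltW// (lt_trans _ vs)//; lra.
Qed.

(** With [U = kap * d], factoring out [2 * d ^+ 3 / N ^+ 2] leaves relative errors [1 / N], [d * N]
    and [N ^+ 3 * mu3 / d], all of which vanish. *)
Lemma test_bound_arith (R : realType) (N Z kap d del K s z P mu3 : R) : 0 < N -> 0 < Z -> 0 < d -> 0 < del ->
  0 <= K -> 0 < s -> 0 < kap ->
  N / Z <= z -> kap ^+ 3 * (1 + K / s) <= 1 + del -> del <= 1 -> del * (3 * z + z ^+ 2) <= P ->
  K * (kap ^+ 3 * (1 + del^-1) / N + kap ^+ 4 * (d * N) + kap ^+ 2 * (N ^+ 3 * mu3 / d)) <= del ->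
  2 / Z ^+ 2 * ((kap * d) ^+ 3 * (1 + del) * (1 + K / s) * (Z / N) +
      K * ((kap * d) ^+ 3 * (1 + del^-1) / N + N * (kap * d) ^+ 4 + N ^+ 3 * ((kap * d) ^+ 2 * mu3))) <=
  2 * d ^+ 3 / N ^+ 2 * (z + P).
Proof.
move=> N0 Z0 d0 del0 K0 s0 kap0 hz hk del1 hP hE.
have z0 : 0 < N / Z by rewrite divr_gt0.
have -> : 2 / Z ^+ 2 * ((kap * d) ^+ 3 * (1 + del) * (1 + K / s) * (Z / N) +
      K * ((kap * d) ^+ 3 * (1 + del^-1) / N + N * (kap * d) ^+ 4 + N ^+ 3 * ((kap * d) ^+ 2 * mu3))) =
  2 * d ^+ 3 / N ^+ 2 * ((1 + del) * (kap ^+ 3 * (1 + K / s)) * (N / Z) + (N / Z) ^+ 2 *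
     (K * (kap ^+ 3 * (1 + del^-1) / N + kap ^+ 4 * (d * N) + kap ^+ 2 * (N ^+ 3 * mu3 / d)))).
  by field; rewrite !gt_eqF.
rewrite ler_wpM2l//.
  by rewrite divr_ge0 ?mulr_ge0 ?exprn_ge0// ltW.
have zz0 : 0 <= z by apply: le_trans hz; exact: ltW.
have del0' := ltW del0.
have h1 : (1 + del) * (kap ^+ 3 * (1 + K / s)) * (N / Z) <= (1 + del) * (1 + del) * z.
  apply: ler_pM => //; [|exact: ltW|by rewrite ler_wpM2l// addr_ge0].
  by rewrite mulr_ge0 ?addr_ge0// mulr_ge0 ?exprn_ge0 ?addr_ge0 ?divr_ge0// ltW.
have h2 : (N / Z) ^+ 2 * (K * (kap ^+ 3 * (1 + del^-1) / N + kap ^+ 4 * (d * N) + kap ^+ 2 * (N ^+ 3 * mu3 / d))) <=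
   z ^+ 2 * del.
  apply: (@le_trans _ _ ((N / Z) ^+ 2 * del)); first by rewrite ler_wpM2l// sqr_ge0.
  by rewrite ler_wpM2r// lerXn2r ?nnegrE// ltW.
apply: (le_trans (lerD h1 h2)).
have h3 : del * del * z <= del * z by rewrite -mulrA ler_piMl// mulr_ge0.
move: hP; rewrite !mulrDr !mulrDl !mul1r; lra.
Qed.

Section CapacityUpper.
Variables (R : realType) (T : finType) (x y : 'I_2 -> T) (ms : T -> R) (r : T -> T -> R).
Hypothesis sites_uniq : uniq [:: x ord0; x ord_max; y ord0; y ord_max].
Hypothesis sites_cover : forall z : T, z \in [:: x ord0; x ord_max; y ord0; y ord_max].
Hypothesis ms_x : forall i, ms (x i) = 1.
Hypothesis ms_gt0 : forall z, 0 < ms z.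
Hypothesis ms_y : forall p, ms (y p) < 1.
Hypothesis r_ge0 : forall a b, 0 <= r a b.
Hypothesis r_diag : forall a, r a a = 0.
Hypothesis r_rev : forall a b, ms a * r a b = ms b * r b a.
Hypothesis r_xy : forall i p, 0 < r (x i) (y p).
Hypothesis r_x01 : r (x ord0) (x ord_max) = 0.
Hypothesis r_x10 : r (x ord_max) (x ord0) = 0.

Let al0 p := r (x ord0) (y p).
Let al1 p := r (x ord_max) (y p).
Let mm p := ms (y p).
Let M := profile_mass al0 al1 mm.
Let rho := M^-1.

Variables (d : nat -> R).
Hypothesis Hd_pos : forall N, (0 < N)%N -> 0 < d N.
Hypothesis Hd_lim : d @ \oo --> 0.
Hypothesis Hd_log : (fun N => d N * ln N%:R) @ \oo --> 0.
Hypothesis Hd_subexp : forall eps : R, 0 < eps -> (fun N => d N * expR (eps * N%:R)) @ \oo --> +oo.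
Hypothesis Hd_N2log2 : (fun N => d N * N%:R ^+ 2 * (ln N%:R) ^+ 2) @ \oo --> 0.

(** The increments are the profile times a cut-off. Their sum [Z] is then close to [N] times the
    resistance integral, and an energy of order [Z / N] divided by [Z ^+ 2] gives the inverse of
    this integral. *)
Lemma capacity_upper (eps : R) : 0 < eps -> \forall n \near \oo, exists f : config T n.+1 -> R,
  [/\ f (xi n.+1 (x ord0)) = 1, f (xi n.+1 (x ord_max)) = 0 &
    dirichlet (incl_rate r (d n.+1) (N:=n.+1)) (ip_weight ms (d n.+1) (N:=n.+1)) f <=
    2 * d n.+1 ^+ 3 / n.+1%:R ^+ 2 * (rho + eps)].
Proof.
move=> eps0.
have al0_gt0 p : 0 < al0 p by exact: r_xy.
have al1_gt0 p : 0 < al1 p by exact: r_xy.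
have mm_lt1 p : mm p < 1 by exact: ms_y.
have mm_gt0 p : 0 < mm p by exact: ms_gt0.
have M0 : 0 < M by exact: profile_mass_gt0.
have [A [C1 [A0 C10 AC]]] := profile_bounds al0_gt0 al1_gt0 mm_lt1.
have [L L0 HL] := profile_lipschitz al0_gt0 al1_gt0 mm_lt1.
(* Small enough that [1 / (M - eta)] exceeds [1 / M] by at most [eps / 2]. *)
pose eta := Num.min (M / 2) (eps * M ^+ 2 / 4).
have eta0 : 0 < eta by rewrite lt_min !divr_gt0// mulr_gt0// exprn_gt0.
have etaM : eta <= M / 2 by rewrite ge_min lexx.
have etaE : eta <= eps * M ^+ 2 / 4 by rewrite ge_min lexx orbT.
have Me0 : 0 < M - eta by lra.
pose z := (M - eta)^-1.
have z0 : 0 < z by rewrite invr_gt0.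
have zle : z <= rho + eps / 2.
  rewrite /z /rho -[leLHS]mul1r ler_pdivrMr//.
  have -> : (M^-1 + eps / 2) * (M - eta) = 1 + (eps / 2 * (M - eta) - eta / M).
    by field; rewrite gt_eqF.
  rewrite lerDl subr_ge0 ler_pdivrMr//; apply: (le_trans etaE).
  have -> : eps / 2 * (M - eta) * M = eps * M ^+ 2 / 4 + eps * M / 2 * (M / 2 - eta) by field.
  by rewrite lerDl mulr_ge0 ?subr_ge0// divr_ge0// mulr_ge0// ltW.
pose del := Num.min 1 (eps / 2 / (3 * z + z ^+ 2)).
have w0 : 0 < 3 * z + z ^+ 2 by rewrite addr_gt0 ?mulr_gt0 ?exprn_gt0.
have del0 : 0 < del by rewrite lt_min ltr01 divr_gt0// divr_gt0.
have del1 : del <= 1 by rewrite ge_min lexx.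
have delP : del * (3 * z + z ^+ 2) <= eps / 2 by rewrite -ler_pdivlMr// ge_min lexx orbT.
(* The cut-off length is the proportion [e0] of [N]: long enough for an exponentially small weight,
   short enough to lose at most [eta / 2] of the mass. *)
pose e0 := eta / (8 * (C1 + 1)).
have C11 : 0 < C1 + 1 by rewrite ltr_wpDl.
have e00 : 0 < e0 by rewrite divr_gt0// mulr_gt0.
have e0C : 4 * C1 * e0 <= eta / 2.
  rewrite /e0 mulrA ler_pdivrMr ?mulr_gt0//.
  have -> : eta / 2 * (8 * (C1 + 1)) = 4 * C1 * eta + 4 * eta by field.
  by rewrite lerDl mulr_ge0// ltW.
pose c1 := 2 * C1 / e0 + L.
have c10 : 0 <= c1 by apply: addr_ge0 => //; apply: divr_ge0; [rewrite mulr_ge0|exact: ltW].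
have [K K0 HK] := test_function_energy sites_uniq sites_cover ms_x ms_gt0 ms_y r_ge0 r_diag r_rev r_xy r_x01 r_x10 C10 c10.
pose mu := Num.max (mm ord0) (mm ord_max).
have mu01 : 0 < mu < 1 by rewrite lt_max mm_gt0 gt_max !mm_lt1.
pose kap N := expR (d N * harm R N).
have kc : kap @ \oo --> (1 : R) by exact: kappa_cvg.
have kpow j : (fun N => kap N ^+ j) @ \oo --> (1 : R).
  elim: j => [|j IH]; first by under eq_fun do rewrite expr0; exact: cvg_cst.
  rewrite (_ : (fun N => kap N ^+ j.+1) = kap \* (fun N => kap N ^+ j)); last first.
    by apply/funext => N; rewrite exprS.
  by rewrite (_ : nbhs (1 : R) = nbhs (1 * 1 : R)); [exact: cvgM|rewrite mulr1].
have ic := @inv_nat_cvg R.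
have F1 : \forall N \near \oo, kap N ^+ 3 * (1 + K * (2 / e0 * N%:R^-1)) <= 1 + del.
  have cv : (fun N => kap N ^+ 3 * (1 + K * (2 / e0 * N%:R^-1))) @ \oo --> 1 * (1 + K * (2 / e0 * 0)).
    apply: cvgM; first exact: kpow.
    apply: cvgD; first exact: cvg_cst.
    by apply: cvgMr; apply: cvgMr.
  rewrite !mulr0 addr0 mulr1 in cv.
  have : \forall N \near \oo, `|1 - kap N ^+ 3 * (1 + K * (2 / e0 * N%:R^-1))| <= del.
    by move/cvgrPdist_le: cv; apply.
  by apply: filterS => N; rewrite ler_norml => /andP[h _]; lra.
have F2 : \forall N \near \oo, K * (kap N ^+ 3 * (1 + del^-1) / N%:R + kap N ^+ 4 * (d N * N%:R) +
   kap N ^+ 2 * (N%:R ^+ 3 * mu ^+ (Num.truncn (e0 * N%:R)).-1 / d N)) <= del.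
  have cv : (fun N => K * (kap N ^+ 3 * (1 + del^-1) / N%:R + kap N ^+ 4 * (d N * N%:R) +
     kap N ^+ 2 * (N%:R ^+ 3 * mu ^+ (Num.truncn (e0 * N%:R)).-1 / d N))) @ \oo -->
     K * (1 * (1 + del^-1) * 0 + 1 * 0 + 1 * 0).
    apply: cvgMr; apply: cvgD; [apply: cvgD|].
    - by apply: cvgM => //; apply: cvgMl; exact: kpow.
    - by apply: cvgM; [exact: kpow|exact: dN_cvg].
    - by apply: cvgM; [exact: kpow|exact: poly_exp_cvg].
  rewrite !mulr0 !addr0 mulr0 in cv.
  have := cv; move/cvgrPdist_le => /(_ _ del0); apply: filterS => N.
  by rewrite sub0r normrN => /(le_trans (ler_norm _)).
have F3 : \forall N \near \oo, kap N * d N <= 1.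
  have cv : (fun N => kap N * d N) @ \oo --> (1 * 0 : R) by apply: cvgM.
  rewrite mulr0 in cv; have := cv; move/cvgrPdist_le => /(_ _ ltr01); apply: filterS => N.
  by rewrite sub0r normrN => /(le_trans (ler_norm _)).
have F4 := near_pos_le (4 / e0).
have F5 := near_pos_le (2 * L / eta).
near=> n.
have G1 : kap n.+1 ^+ 3 * (1 + K * (2 / e0 * n.+1%:R^-1)) <= 1 + del by near: n; exact: near_succ F1.
have G2 : K * (kap n.+1 ^+ 3 * (1 + del^-1) / n.+1%:R + kap n.+1 ^+ 4 * (d n.+1 * n.+1%:R) +
   kap n.+1 ^+ 2 * (n.+1%:R ^+ 3 * mu ^+ (Num.truncn (e0 * n.+1%:R)).-1 / d n.+1)) <= del.
  by near: n; exact: near_succ F2.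
have G3 : kap n.+1 * d n.+1 <= 1 by near: n; exact: near_succ F3.
have G4 : 4 / e0 <= n.+1%:R by near: n; exact: near_succ F4.
have G5 : 2 * L / eta <= n.+1%:R by near: n; exact: near_succ F5.
have N0 : 0 < n.+1%:R :> R by [].
have dn0 : 0 < d n.+1 by exact: Hd_pos.
pose s := Num.truncn (e0 * n.+1%:R).
have eN4 : 4 <= e0 * n.+1%:R by rewrite mulrC -ler_pdivrMr.
have [s_ge2 s_half] := truncn_half_ge eN4; rewrite -/s in s_ge2 s_half.
have s1 : s%:R <= e0 * n.+1%:R by rewrite truncn_le// mulr_ge0// ltW.
have sr0 : 0 < s%:R :> R by rewrite ltr0n ltnW.
have sinv : s%:R^-1 <= 2 / e0 * n.+1%:R^-1.
  have -> : 2 / e0 * n.+1%:R^-1 = (e0 * n.+1%:R / 2)^-1 by rewrite [RHS]invf_div (invfM e0) [RHS]mulrA.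
  have eN0 : 0 < e0 * n.+1%:R / 2 by rewrite divr_gt0// (mulr_gt0 e00 N0).
  by rewrite lef_pV2 ?posrE.
have sgt0 : (0 < s)%N := ltnW s_ge2.
pose g k := cutoff R n s k * profile al0 al1 mm (k%:R / n.+1%:R).
have t01 k : (k <= n.+1)%N -> 0 <= (k%:R / n.+1%:R : R) <= 1.
  by move=> kn; rewrite divr_ge0//= ler_pdivrMr// mul1r ler_nat.
have gb k : 0 <= g k <= C1.
  have /andP[c0 c1'] := cutoff_ge0_le1 R n s k.
  have [kn|kn] := leqP k n.+1; last by rewrite /g cutoff_high ?mul0r ?lexx// ltn_addr.
  have /andP[p0 p1] := AC _ (t01 k kn).
  have p0' : 0 <= profile al0 al1 mm (k%:R / n.+1%:R) by apply: le_trans p0; exact: ltW.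
  by rewrite /g mulr_ge0//= (le_trans _ p1)// ler_piMl.
have gphi k : (k <= n)%N -> g k <= profile al0 al1 mm (k%:R / n.+1%:R).
  move=> kn; have /andP[c0 c1'] := cutoff_ge0_le1 R n s k.
  by rewrite /g ler_piMl// ltW// profile_gt0// t01// leqW.
have glip k : (k <= n)%N -> `|g k - g k.+1| <= c1 / n.+1%:R.
  move=> kn; have /andP[c0 c1'] := cutoff_ge0_le1 R n s k.+1.
  have /andP[p0 p1] := AC _ (t01 k (leqW kn)).
  have -> : g k - g k.+1 = (cutoff R n s k - cutoff R n s k.+1) * profile al0 al1 mm (k%:R / n.+1%:R) +
     cutoff R n s k.+1 * (profile al0 al1 mm (k%:R / n.+1%:R) - profile al0 al1 mm (k.+1%:R / n.+1%:R)).
    by rewrite /g; ring.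
  apply: le_trans (ler_normD _ _) _; rewrite (normrM (_ - cutoff _ _ _ _)) (normrM (cutoff _ _ _ _)) /c1 mulrDl.
  apply: lerD.
    apply: (@le_trans _ _ (s%:R^-1 * C1)).
      apply: ler_pM => //; first exact: cutoff_lip.
      by rewrite ger0_norm// (le_trans _ p0)// ltW.
    apply: (@le_trans _ _ (2 / e0 * n.+1%:R^-1 * C1)); first by rewrite ler_wpM2r.
    by rewrite (mulrAC 2 C1) (mulrAC (2 / e0) C1).
  rewrite (ger0_norm c0).
  apply: (@le_trans _ _ (1 * (L / n.+1%:R))); last by rewrite mul1r.
  apply: ler_pM => //; apply: le_trans (HL _ _ (t01 k (leqW kn)) (t01 k.+1 kn)) _.
  rewrite ler_wpM2l// -mulrBl normrM [`|n.+1%:R^-1|]gtr0_norm ?invr_gt0//.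
  by rewrite -natr1 opprD addrA subrr sub0r normrN normr1 mul1r.
have riem := riemann_sum_lipschitz (ltn0Sn n) HL; rewrite -/M in riem.
have Zlow : M - eta <= (\sum_(k < n.+1) g k) / n.+1%:R.
  have h1 : \sum_(k < n.+1) profile al0 al1 mm (k%:R / n.+1%:R) / n.+1%:R <=
     (\sum_(k < n.+1) g k) / n.+1%:R + C1 * (4 * s%:R) / n.+1%:R.
    rewrite -mulr_suml -mulrDl ler_pM2r ?invr_gt0// -lerBlDl -sumrB.
    apply: (@le_trans _ _ (C1 * \sum_(k < n.+1) (1 - cutoff R n s k))); last by rewrite ler_wpM2l// cutoff_sum_ge.
    rewrite mulr_sumr; apply: ler_sum => k _.
    have kn : (k <= n.+1)%N by rewrite ltnW.
    have /andP[p0 p1] := AC _ (t01 k kn); have /andP[c0 c1'] := cutoff_ge0_le1 R n s k.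
    rewrite /g -{1}[profile _ _ _ _]mul1r -mulrBl mulrC ler_wpM2r// subr_ge0//.
  have h2 : C1 * (4 * s%:R) / n.+1%:R <= eta / 2.
    apply: le_trans e0C; rewrite ler_pdivrMr//.
    have -> : 4 * C1 * e0 * n.+1%:R = C1 * (4 * (e0 * n.+1%:R)) by ring.
    by rewrite ler_wpM2l// ler_wpM2l.
  have h3 : L / n.+1%:R <= eta / 2.
    have -> : L / n.+1%:R = 2 * L / n.+1%:R / 2 by field; rewrite addrC natr1 pnatr_eq0.
    by rewrite ler_pM2r// ler_pdivrMr// (mulrC eta) -ler_pdivrMr.
  by move: riem; rewrite ler_norml => /andP[h4 _]; exact: (mass_arith h4 h1 h2 h3).
have Z0 : 0 < \sum_(k < n.+1) g k.
  by have : 0 < (\sum_(k < n.+1) g k) / n.+1%:R; [apply: lt_le_trans Zlow|rewrite pmulr_lgt0 ?invr_gt0].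
have U0 : 0 < kap n.+1 * d n.+1 <= 1 by rewrite mulr_gt0 ?expR_gt0.
have hu k : (k <= n)%N -> ip_u (d n.+1) k <= kap n.+1 * d n.+1.
  by move=> kn; apply: ip_u_le; [exact: ltW|exact: leqW].
have hw k : (0 < k <= n)%N -> ip_w (d n.+1) k <= kap n.+1 * d n.+1 / k%:R.
  by case: k => // k kn; apply: ip_w_le; [exact: ltW|exact: leqW].
have glow k : (k < s)%N -> g k = 0 by move=> ks; rewrite /g cutoff_low ?mul0r.
have ghigh k : (n.+1 < k + s)%N -> g k = 0 by move=> ks; rewrite /g cutoff_high ?mul0r.
have [f [f1 f0 fD]] := HK n s (d n.+1) _ del g dn0 U0 hu hw s_ge2 del0 glow ghigh gb gphi glip Z0.
exists f; split=> //; apply: (le_trans fD).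
apply: (@le_trans _ _ (2 * d n.+1 ^+ 3 / n.+1%:R ^+ 2 * (z + eps / 2))).
  apply: test_bound_arith => //.
  - exact: expR_gt0.
  - by rewrite -invf_div /z lef_pV2 ?posrE ?divr_gt0.
  - apply: le_trans G1; rewrite ler_wpM2l ?exprn_ge0 ?expR_ge0// lerD2l ler_wpM2l//.
rewrite ler_wpM2l//; last first.
  by have -> : rho + eps = rho + eps / 2 + eps / 2; [field|rewrite lerD2r].
by rewrite divr_ge0 ?mulr_ge0 ?exprn_ge0// ltW.
Unshelve. all: by end_near.
Qed.

End CapacityUpper.

(** * Convergence of the trace process *)

Section UniformGridPath.
Variables (R : realType) (d : measure_display) (Om : measurableType d) (P : probability Om R).
Variables (q : 'I_2 -> 'I_2 -> R) (W : Om -> R -> 'I_2) (k0 : 'I_2).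
Hypothesis HW : is_ctmc P W q k0.
Variables (F : (R -> 'I_2) -> R) (M : R).
Hypothesis FM : forall w, `|F w| <= M.
Hypothesis Fc : sk_continuous F.

(** A counterexample for each [N] would form a sequence violating [grid_path_cvg]. Uniformity is
    needed because the mesh [k] is chosen after [N] and the step is the resulting [flip_time]. *)
Lemma grid_path_close (e : R) : 0 < e -> exists2 del : R, 0 < del & exists K : nat,
  forall k tau, (K <= k)%N -> 0 <= tau -> `|tau * k.+1%:R - 1| <= del ->
  `|Rintegral P [set: Om] (fun w => F (W w)) -
    Rintegral P [set: Om] (fun w => F (grid_path W k tau w))| <= e.
Proof.
move=> e0; apply: contrapT => bad.
have ex (N : nat) : exists kt : nat * R, [/\ (N <= kt.1)%N, 0 <= kt.2,
    `|kt.2 * kt.1.+1%:R - 1| <= N.+1%:R^-1 &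
    ~ (`|Rintegral P [set: Om] (fun w => F (W w)) -
      Rintegral P [set: Om] (fun w => F (grid_path W kt.1 kt.2 w))| <= e)].
  apply: contrapT => no; apply: bad; exists N.+1%:R^-1; first by rewrite invr_gt0.
  exists N => k tau Nk tau0 ht; apply: contrapT => h; apply: no.
  by exists (k, tau).
pose n N := (projT1 (cid (ex N))).1; pose tau N := (projT1 (cid (ex N))).2.
have H N := projT2 (cid (ex N)).
have noo (c : R) : \forall N \near \oo, c <= (n N).+1%:R.
  have := near_le_nat c; apply: filterS => N /le_trans; apply.
  by rewrite ler_nat ltnS; case: (H N).
have tau0 N : 0 <= tau N by case: (H N).
have taun : (fun N => tau N * (n N).+1%:R) @ \oo --> (1 : R).
  apply/cvgrPdist_le => c c0; have := harmonic_scale_le 1 c0; apply: filterS => N.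
  by rewrite mul1r; apply: le_trans; rewrite distrC; case: (H N).
have := @grid_path_cvg _ _ _ _ _ _ _ HW _ _ FM Fc n tau tau0 noo taun.
move/cvgrPdist_le => /(_ _ e0) [N _ HN].
by case: (H N) => _ _ _; apply; exact: HN (leqnn N).
Qed.
End UniformGridPath.

Lemma score_arith a b c : (0 < b)%N -> (2 * a + b + c < 2 * (a - 0 + 1) + (b - 1 + 0) + (c - 0 + 0))%N.
Proof. lia. Qed.

Section Score.
Variables (R : realType) (T : finType) (r : T -> T -> R) (d : R).
Hypothesis r_ge0 : forall a b, 0 <= r a b.
Hypothesis d_gt0 : 0 < d.

Lemma incl_rate_ge0 N (eta zeta : config T N) : 0 <= incl_rate r d eta zeta.
Proof.
rewrite /incl_rate; case: ifP => // _; apply: sumr_ge0 => s _; apply: sumr_ge0 => t _.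
by case: ifP => // _; rewrite mulr_ge0// mulr_ge0// addr_ge0// ltW.
Qed.

Lemma incl_rate_gt0 n (eta : config T n.+1) s t : s != t -> (0 < val eta s)%N -> 0 < r s t ->
  0 < incl_rate r d eta (add_particle (remove_particle eta s) t).
Proof.
move=> st s0 rst; set zeta := add_particle _ _.
have zE z : val zeta z = (val eta z - (z == s) + (z == t))%N :> nat.
  by rewrite add_particleE remove_particleE.
rewrite /incl_rate ifF; last first.
  apply/negP => /config_eqP/(_ t); rewrite zE eqxx (eq_sym t) (negbTE st) subn0 addn1 => /eqP.
  by rewrite gtn_eqF.
have ge0 a b : 0 <= (if [forall z, val zeta z == moven (fun w => val eta w : nat) a b z :> nat]
     then (val eta a : nat)%:R * (d + (val eta b : nat)%:R) * r a b else 0).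
  by case: ifP => // _; rewrite mulr_ge0// mulr_ge0// addr_ge0// ltW.
rewrite (bigD1 s)//= (bigD1 t)//= ifT; last first.
  apply/forallP => z; apply/eqP; rewrite /moven [X in if X then _ else _]gtn_eqF//; exact: zE.
rewrite -addrA ltr_pwDl ?addr_ge0 ?sumr_ge0//.
  by rewrite mulr_gt0// mulr_gt0 ?ltr0n// ltr_wpDr.
by move=> a _; apply: sumr_ge0.
Qed.
End Score.

Section Model.
Variables (R : realType) (T : finType) (x y : 'I_2 -> T) (r : T -> T -> R) (m : T -> R).
Hypothesis sites_uniq : uniq [:: x ord0; x ord_max; y ord0; y ord_max].
Hypothesis sites_cover : forall z : T, z \in [:: x ord0; x ord_max; y ord0; y ord_max].
Hypothesis Hr_ge0 : forall a b, 0 <= r a b.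
Hypothesis Hm_ge0 : forall a, 0 <= m a.
Hypothesis Hm_sum : \sum_a m a = 1.
Hypothesis Hrev : forall a b, m a * r a b = m b * r b a.
Hypothesis Hxy : forall i p : 'I_2, 0 < r (x i) (y p) < r (y p) (x i).
Hypothesis Hm12 : m (x ord0) = m (x ord_max).

Let I2P (k : 'I_2) : k = ord0 \/ k = ord_max.
Proof. by case: k => -[|[|//]] i; [left|right]; exact/val_inj. Qed.

Let mx i : m (x i) = m (x ord0).
Proof. by have [->|->] := I2P i. Qed.

Let mx_gt0 : 0 < m (x ord0).
Proof.
rewrite lt_def Hm_ge0 andbT; apply/eqP => m0.
have my p : m (y p) = 0.
  have /andP[a b] := Hxy ord0 p; have := Hrev (x ord0) (y p); rewrite m0 mul0r => /esym/eqP.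
  by rewrite mulf_eq0 (gt_eqF (lt_trans a b)) orbF => /eqP.
have := Hm_sum; rewrite (big_four_sites sites_uniq sites_cover)/= m0 -Hm12 m0 !my !addr0.
by move/eqP; rewrite eq_sym oner_eq0.
Qed.

(** Reversibility turns [r (y p) (x i) > r (x i) (y p)] into a comparison of masses: the maximum of
    [m] is attained at the [x i] only. *)
Let my_bound p : 0 < m (y p) < m (x ord0).
Proof.
have /andP[a b] := Hxy ord0 p; have E := Hrev (x ord0) (y p).
have b0 := lt_trans a b.
apply/andP; split.
  by rewrite -(pmulr_lgt0 _ b0) -E mulr_gt0.
by rewrite -(ltr_pM2r b0) -E ltr_pM2l.
Qed.

Lemma Mstar_x : Mstar m = m (x ord0).
Proof.
apply/eqP; rewrite eq_le /Mstar (bigD1 (x ord0))//= le_max lexx andbT ge_max lexx/=.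
elim/big_ind: _ => // [a b a1 b1|z _]; first by rewrite ge_max a1.
have := sites_cover z; rewrite !inE => /or4P[]/eqP->; rewrite ?mx//.
  by have /andP[_ /ltW] := my_bound ord0.
by have /andP[_ /ltW] := my_bound ord_max.
Qed.

Lemma mstar_x i : mstar m (x i) = 1.
Proof. by rewrite /mstar Mstar_x mx divff// gt_eqF. Qed.

Lemma mstar_gt0 z : 0 < mstar m z.
Proof.
rewrite /mstar Mstar_x divr_gt0//.
have := sites_cover z; rewrite !inE => /or4P[]/eqP->; rewrite ?mx//.
  by have /andP[] := my_bound ord0.
by have /andP[] := my_bound ord_max.
Qed.

Lemma mstar_y p : mstar m (y p) < 1.
Proof. by rewrite /mstar Mstar_x ltr_pdivrMr// mul1r; case/andP: (my_bound p). Qed.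

Lemma mstar_rev a b : mstar m a * r a b = mstar m b * r b a.
Proof. by rewrite /mstar ![_ / _]mulrC -!mulrA Hrev. Qed.

(** The weights 2 at [x_1], 1 at the [y_p] and 0 at [x_2] make each of the moves [x_2] to [y_p] and
    [y_p] to [x_1] raise the score. *)
Lemma score_step (d : R) n (eta : config T n.+1) : 0 < d -> eta != xi n.+1 (x ord0) ->
  let s (e : config T n.+1) := (2 * val e (x ord0) + val e (y ord0) + val e (y ord_max))%N in
  exists zeta, (s eta < s zeta)%N /\ 0 < incl_rate r d eta zeta.
Proof.
move=> d0 ne s.
have [n1 n2 n3 [n4 n5 n6]] : [/\ x ord0 != x ord_max, x ord0 != y ord0, x ord0 != y ord_max &
    [/\ x ord_max != y ord0, x ord_max != y ord_max & y ord0 != y ord_max]].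
  by move: sites_uniq; rewrite /= !inE !negb_or andbT => /and3P[/and3P[-> -> ->] /andP[-> ->] ->].
have [n1' n2' n3' [n4' n5' n6']] : [/\ x ord_max != x ord0, y ord0 != x ord0, y ord_max != x ord0 &
    [/\ y ord0 != x ord_max, y ord_max != x ord_max & y ord_max != y ord0]].
  by split; [| | |split]; rewrite eq_sym.
have r1 i p : 0 < r (x i) (y p) by case/andP: (Hxy i p).
have r2 p i : 0 < r (y p) (x i) by have /andP[a b] := Hxy i p; exact: lt_trans b.
have sE a b (h : (0 < val eta a)%N) z : val (add_particle (remove_particle eta a) b) z =
    (val eta z - (z == a) + (z == b))%N :> nat by rewrite add_particleE remove_particleE.
have neqs := (eqxx, negbTE n1, negbTE n2, negbTE n3, negbTE n4, negbTE n5, negbTE n6,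
  negbTE n1', negbTE n2', negbTE n3', negbTE n4', negbTE n5', negbTE n6').
have [ya|ya] := posnP (val eta (y ord0)); last first.
  exists (add_particle (remove_particle eta (y ord0)) (x ord0)); split; last exact: incl_rate_gt0.
  by rewrite /s !sE// !neqs; exact: score_arith.
have [yb|yb] := posnP (val eta (y ord_max)); last first.
  exists (add_particle (remove_particle eta (y ord_max)) (x ord0)); split; last exact: incl_rate_gt0.
  by rewrite /s !sE// !neqs addnAC [ltnRHS]addnAC; exact: score_arith.
have [xb|xb] := posnP (val eta (x ord_max)).
  case/negP: ne; apply/eqP; have sum := config_four_sum sites_uniq sites_cover eta.
  apply: (config_four_eq sites_uniq sites_cover); rewrite /= /xi_fun ffunE ?neqs.
  - by move: sum; rewrite ya yb xb !addn0.
  - by rewrite ya.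
  - by rewrite yb.
exists (add_particle (remove_particle eta (x ord_max)) (y ord0)); split; last exact: incl_rate_gt0.
by rewrite /s !sE// !neqs !subn0 !addn0 addn1 addnS addSn.
Qed.

End Model.

(** [flip_time] is [p / rho] to first order, through [2 p <= - ln (1 - 2 p) <= 2 p / (1 - 2 p)]. *)
Lemma flip_time_close (R : realType) (rho del : R) : 0 < rho -> 0 < del ->
  exists2 e : R, 0 < e <= 1 / 4 & forall p k1, 0 <= p <= e -> 0 < k1 -> `|p * k1 - rho| <= e ->
    0 <= flip_time rho p /\ `|flip_time rho p * k1 - 1| <= del.
Proof.
move=> rho0 del0.
pose dl := Num.min del 1; pose e := Num.min (1 / 4) (dl / (rho^-1 + 4)).
have dl0 : 0 < dl by rewrite lt_min del0 ltr01.
have dl1 : dl <= 1 by rewrite ge_min lexx orbT.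
have dld : dl <= del by rewrite ge_min lexx.
have i0 : 0 < rho^-1 by rewrite invr_gt0.
have i4 : 0 < rho^-1 + 4 by rewrite addr_gt0.
have e0 : 0 < e by rewrite lt_min !divr_gt0.
have e4 : e <= 1 / 4 by rewrite ge_min lexx.
have eP : e * (rho^-1 + 4) <= dl by rewrite -ler_pdivlMr// ge_min lexx orbT.
exists e; first by rewrite e0.
move=> p k1 /andP[p0 pe] k10 hp.
have p2 : 2 * p <= 1 / 2 by lra.
have q0 : 0 < 1 - 2 * p by lra.
have lo : 2 * p <= - ln (1 - 2 * p).
  have := @le_ln1Dx R (- (2 * p)); rewrite lerNr; apply; lra.
have hi : - ln (1 - 2 * p) <= 2 * p / (1 - 2 * p).
  rewrite -lnV ?posrE//.
  have E : (1 - 2 * p)^-1 = 1 + 2 * p / (1 - 2 * p) by field; rewrite gt_eqF.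
  rewrite [X in ln X]E.
  by apply: le_ln1Dx; apply: (@lt_le_trans _ _ 0); rewrite ?ltrN10// divr_ge0 ?mulr_ge0// ltW.
have fl : p * k1 / rho <= flip_time rho p * k1.
  have -> : p * k1 / rho = 2 * p / (2 * rho) * k1 by field; rewrite gt_eqF.
  by rewrite /flip_time ler_pM2r// ler_pM2r// invr_gt0 mulr_gt0.
have fh : flip_time rho p * k1 <= p * k1 / rho / (1 - 2 * p).
  have -> : p * k1 / rho / (1 - 2 * p) = 2 * p / (1 - 2 * p) / (2 * rho) * k1.
    by field; rewrite !gt_eqF.
  by rewrite /flip_time ler_pM2r// ler_pM2r// invr_gt0 mulr_gt0.
split; first by rewrite /flip_time divr_ge0 ?mulr_ge0 ?(ltW rho0)// (le_trans _ lo)// mulr_ge0.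
have er : e / rho <= dl - 4 * e by move: eP; rewrite mulrDr; lra.
move: hp; rewrite ler_norml => /andP[h1 h2].
have P1 : 1 - e / rho <= p * k1 / rho.
  rewrite ler_pdivlMr// mulrBl divfK ?gt_eqF//; lra.
have P2 : p * k1 / rho <= 1 + e / rho.
  rewrite ler_pdivrMr// mulrDl divfK ?gt_eqF//; lra.
have P3 : p * k1 / rho / (1 - 2 * p) <= 1 + dl.
  rewrite ler_pdivrMr//; apply: (le_trans P2).
  have : (1 + dl) * (1 - 2 * e) <= (1 + dl) * (1 - 2 * p) by rewrite ler_wpM2l//; lra.
  apply: le_trans.
  have : dl * e <= e by rewrite ler_piMl// ltW.
  rewrite mulrDl mul1r mulrBr mulr1 (mulrCA dl); lra.
by rewrite ler_norml; apply/andP; split; lra.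
Qed.

(** Multiplying the flip probability by the number of steps per unit of rescaled time leaves [rho]
    times [d / (N * mu)], a ratio close to 1. *)
Lemma rate_window (R : realType) (N d mu p k1 D e' rho eps : R) :
  0 < N -> 0 < d -> 0 < mu -> 0 < k1 -> 0 <= e' <= eps -> e' * (N / d ^+ 2 / (2 * mu)) <= eps ->
  1 - eps <= d / (N * mu) <= 1 -> 0 < eps < rho -> eps < 1 ->
  D <= 2 * d ^+ 3 / N ^+ 2 * (rho + eps) ->
  (1 - e') * (N / d ^+ 2 / k1) * (2 * d ^+ 3 / N ^+ 2 * (rho - eps)) <= 2 * (mu * p)
    <= N / d ^+ 2 / k1 * (D + e') ->
  [/\ 0 <= p * k1, rho - eps * (1 + 2 * rho) <= p * k1 & p * k1 <= rho + 2 * eps].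
Proof.
move=> N0 d0 mu0 k10 /andP[e'0 e'e] he /andP[l1 l2] /andP[eps0 epsr] eps1 hD /andP[hl hu].
set lam := d / (N * mu) in l1 l2.
have lam0 : 0 < lam by rewrite divr_gt0// mulr_gt0.
have lo : (1 - e') * lam * (rho - eps) <= p * k1.
  have -> : (1 - e') * lam * (rho - eps) =
    ((1 - e') * (N / d ^+ 2 / k1) * (2 * d ^+ 3 / N ^+ 2 * (rho - eps))) * (k1 / (2 * mu)).
    by rewrite /lam; field; rewrite !gt_eqF.
  have -> : p * k1 = 2 * (mu * p) * (k1 / (2 * mu)) by field; rewrite gt_eqF.
  by rewrite ler_wpM2r// divr_ge0 ?mulr_ge0// ltW.
have hi : p * k1 <= lam * (rho + eps) + e' * (N / d ^+ 2 / (2 * mu)).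
  have -> : p * k1 = 2 * (mu * p) * (k1 / (2 * mu)) by field; rewrite gt_eqF.
  have -> : lam * (rho + eps) + e' * (N / d ^+ 2 / (2 * mu)) =
    N / d ^+ 2 / k1 * (2 * d ^+ 3 / N ^+ 2 * (rho + eps) + e') * (k1 / (2 * mu)).
    by rewrite /lam; field; rewrite !gt_eqF.
  apply: ler_wpM2r; first by rewrite divr_ge0 ?mulr_ge0// ltW.
  apply: (le_trans hu); apply: ler_wpM2l; last by rewrite lerD2r.
  by rewrite !divr_ge0 ?exprn_ge0// ltW.
have re0 : 0 < rho - eps by rewrite subr_gt0.
have lo2 : (1 - eps) * (1 - eps) * (rho - eps) <= (1 - e') * lam * (rho - eps).
  rewrite ler_pM2r//; apply: ler_pM => //; lra.
have lam1 : lam * (rho + eps) <= rho + eps by rewrite ler_piMl//; lra.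
have ee : 0 <= eps * eps * (rho - eps) by rewrite !mulr_ge0// ltW.
split; [|move: lo lo2 ee|lra].
  by apply: le_trans lo; apply: mulr_ge0; [apply: mulr_ge0|]; lra.
have -> : (1 - eps) * (1 - eps) * (rho - eps) = rho - eps * (1 + 2 * rho) + 2 * (eps * eps) + eps * eps * (rho - eps).
  by ring.
have : 0 <= eps * eps by rewrite mulr_ge0// ltW.
lra.
Qed.

Theorem theorem2p8
  (R : realType) (T : finType) (x y : 'I_2 -> T)
  (r : T -> T -> R) (m : T -> R) (d : nat -> R)
  (* S = {x_1, x_2, y_1, y_2}, four distinct sites *)
  (HS_uniq : uniq [:: x ord0; x ord_max; y ord0; y ord_max])
  (HS_cover : forall z : T, z \in [:: x ord0; x ord_max; y ord0; y ord_max])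
  (* rates of an irreducible random walk *)
  (Hr_ge0 : forall a b, 0 <= r a b)
  (Hr_diag : forall a, r a a = 0)
  (Hirr : irreducible r)
  (* reversible w.r.t. the probability measure m *)
  (Hm_ge0 : forall a, 0 <= m a)
  (Hm_sum : \sum_a m a = 1)
  (Hrev : forall a b, m a * r a b = m b * r b a)
  (Hxy : forall i p : 'I_2, 0 < r (x i) (y p) < r (y p) (x i))
  (Hx12 : r (x ord0) (x ord_max) = 0) (Hx21 : r (x ord_max) (x ord0) = 0)
  (Hm12 : m (x ord0) = m (x ord_max))
  (* the sequence d_N *)
  (Hd_pos : forall N, (0 < N)%N -> 0 < d N)
  (Hd_lim : d @ \oo --> 0)
  (Hd_log : (fun N => d N * ln N%:R) @ \oo --> 0)
  (Hd_subexp : forall eps : R, 0 < eps ->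
      (fun N => d N * expR (eps * N%:R)) @ \oo --> +oo)
  (Hd_N2log2 : (fun N => d N * N%:R ^+ 2 * (ln N%:R) ^+ 2) @ \oo --> 0)
  (i0 : 'I_2)
  (* the inclusion processes, started at xi_N^{x_{i0}} *)
  (dO : measure_display) (Om : nat -> measurableType dO)
  (P : forall N, probability (Om N) R)
  (X : forall N, Om N -> R -> config T N)
  (HX : forall N, (0 < N)%N ->
      is_ctmc (P N) (X N) (incl_rate r (d N) (N:=N)) (xi N (x i0)))
  (* the limiting two-state chain, jumping at rate 1/frakR, started at i0 *)
  (dW : measure_display) (OmW : measurableType dW)
  (PW : probability OmW R) (W : OmW -> R -> 'I_2) :
  let theta := fun N : nat => N%:R / d N ^+ 2 in
  let frakR := Rintegral (@lebesgue_measure R) `[0, 1]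
     (fun t => (\sum_(p < 2)
        1 / ((1 - mstar m (y p)) * ((1 - t) / r (x ord0) (y p) + t / r (x ord_max) (y p))))^-1) in
  is_ctmc PW W (fun i j : 'I_2 => if i != j then frakR^-1 else 0) i0 ->
  forall F : (R -> 'I_2) -> R,
    (exists M : R, forall w, `|F w| <= M) ->
    sk_continuous F ->
    (fun N => Rintegral (P N) setT
        (fun w => F (fun t => Yspl x (X N) w (theta N * t))))
      @ \oo --> Rintegral PW setT (fun w => F (W w)).
Proof.
move=> theta frakR HW F [Mb FM] Fc.
pose ms := mstar m.
pose al0 p := r (x ord0) (y p); pose al1 p := r (x ord_max) (y p); pose mm p := ms (y p).
have r_xy i p : 0 < r (x i) (y p) by case/andP: (Hxy i p).
have ms_x i : ms (x i) = 1 by exact: (mstar_x HS_uniq HS_cover Hm_ge0 Hm_sum Hrev Hxy Hm12).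
have ms_gt0 z : 0 < ms z by exact: (mstar_gt0 HS_uniq HS_cover Hm_ge0 Hm_sum Hrev Hxy Hm12).
have ms_y p : ms (y p) < 1 by exact: (mstar_y HS_uniq HS_cover Hm_ge0 Hm_sum Hrev Hxy Hm12).
have ms_rev a b : ms a * r a b = ms b * r b a by exact: mstar_rev.
have frakE : frakR = profile_mass al0 al1 mm.
  rewrite /frakR /profile_mass; apply: eq_Rintegral => t _.
  rewrite /profile /par /branch !big_ord_recl big_ord0 addr0.
  by congr (_ + _)^-1; congr (1 / (_ * (_ / _ + _ / _))); congr (r _ (y _)) || congr (_ - ms (y _)); exact/val_inj.
have rho0 : 0 < frakR^-1 by rewrite invr_gt0 frakE; apply: profile_mass_gt0 => p; [exact: r_xy|exact: r_xy|exact: ms_y].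
set rho := frakR^-1 in HW rho0 *.
have rhoE : (profile_mass al0 al1 mm)^-1 = rho by rewrite /rho frakE.
rewrite -(cvg_shiftS (fun N => Rintegral (P N) setT _)) /=.
apply/cvgrPdist_le => e e0.
have e20 : 0 < e / 2 by rewrite divr_gt0.
have [del del0 [K HK]] := grid_path_close HW FM Fc e20.
have [e1 /andP[e10 e14] He1] := flip_time_close rho0 del0.
have e12 : e1 < 1 / 2 by lra.
(* The last two bounds make the window of [rate_window] fit inside the tolerance [e1] of
   [flip_time_close]. *)
pose eps := Num.min (Num.min (1 / 2) (rho / 2)) (Num.min (e1 / 2) (e1 / (1 + 2 * rho))).
have r1 : 0 < 1 + 2 * rho by rewrite addr_gt0// mulr_gt0.
have eps0 : 0 < eps by rewrite !lt_min !divr_gt0.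
have eps1 : eps < 1 by apply: (@le_lt_trans _ _ (1 / 2)); rewrite ?ge_min ?lexx//; lra.
have epsr : eps < rho by apply: (@le_lt_trans _ _ (rho / 2)); rewrite ?ge_min ?lexx ?orbT//; lra.
have epse : 2 * eps <= e1.
  have : eps <= e1 / 2 by rewrite !ge_min lexx !orbT.
  lra.
have epse' : eps * (1 + 2 * rho) <= e1.
  by rewrite -ler_pdivlMr// !ge_min lexx !orbT.
have low := capacity_lower HS_uniq HS_cover ms_x ms_gt0 ms_y Hr_ge0 Hr_diag ms_rev r_xy Hx12 Hx21 eps0.
have upp := capacity_upper HS_uniq HS_cover ms_x ms_gt0 ms_y Hr_ge0 Hr_diag ms_rev r_xy Hx12 Hx21
  Hd_pos Hd_lim Hd_log Hd_subexp Hd_N2log2 eps0.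
have d1 : \forall N \near \oo, d N <= 1.
  move/cvgrPdist_le: Hd_lim => /(_ _ ltr01); apply: filterS => N.
  by rewrite sub0r normrN => /(le_trans (ler_norm _)).
have kp : \forall N \near \oo, expR (d N * harm R N) <= 1 + eps.
  have := kappa_cvg Hd_pos Hd_lim Hd_log; move/cvgrPdist_le => /(_ _ eps0); apply: filterS => N.
  by rewrite ler_norml => /andP[h _]; lra.
near=> n.
have N0 : 0 < n.+1%:R :> R by [].
have dn0 : 0 < d n.+1 by exact: Hd_pos.
have dn1 : d n.+1 <= 1 by near: n; exact: near_succ d1.
have kn : expR (d n.+1 * harm R n.+1) <= 1 + eps by near: n; exact: near_succ kp.
have d01 : 0 < d n.+1 <= 1 by rewrite dn0.
have lown : forall (dd : R) (f : config T n.+1 -> R), 0 < dd <= 1 ->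
  f (xi n.+1 (x ord0)) = 1 -> f (xi n.+1 (x ord_max)) = 0 ->
  2 * dd ^+ 3 / n.+1%:R ^+ 2 * ((profile_mass al0 al1 mm)^-1 - eps) <=
    dirichlet (incl_rate r dd (N:=n.+1)) (ip_weight ms dd (N:=n.+1)) f by near: n; exact: low.
have [f [f1 f0 fD]] : exists f : config T n.+1 -> R,
  [/\ f (xi n.+1 (x ord0)) = 1, f (xi n.+1 (x ord_max)) = 0 &
    dirichlet (incl_rate r (d n.+1) (N:=n.+1)) (ip_weight ms (d n.+1) (N:=n.+1)) f <=
    2 * d n.+1 ^+ 3 / n.+1%:R ^+ 2 * ((profile_mass al0 al1 mm)^-1 + eps)] by near: n; exact: upp.
rewrite rhoE in lown fD.
pose gg k : config T n.+1 := xi n.+1 (x k).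
have x01 : x ord0 != x ord_max by move: HS_uniq; rewrite /= !inE !negb_or => /andP[/and3P[]].
have g01 : gg ord0 != gg ord_max.
  apply/negP => /config_eqP/(_ (x ord0)); rewrite /= !ffunE eqxx (negbTE x01) /=; discriminate.
have q_ge0 i j : 0 <= incl_rate r (d n.+1) (N:=n.+1) i j by exact: incl_rate_ge0.
pose s (eta : config T n.+1) := (2 * val eta (x ord0) + val eta (y ord0) + val eta (y ord_max))%N.
have [g [c c0 [g0 gd]]] : exists g : config T n.+1 -> R, exists2 c : R, 0 < c &
    (forall i, 0 <= g i) /\
    (forall i, ~~ [pred i0 | (i0 == gg ord0) || (i0 == gg ord_max)] i ->
       \sum_j Qgen (incl_rate r (d n.+1) (N:=n.+1)) i j * g j <= - c).
  apply: (drift_of_score (s := s) q_ge0) => eta; rewrite /= negb_or => /andP[ne _].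
  exact: (score_step HS_uniq HS_cover Hr_ge0 Hxy dn0 ne).
pose mu := ip_weight ms (d n.+1) (N:=n.+1).
have mu_gt0 i : 0 < mu i by exact: ip_weight_gt0.
have q_rev i j : mu i * incl_rate r (d n.+1) i j = mu j * incl_rate r (d n.+1) j i.
  exact: incl_rate_rev.
have [mu0E mu1E] := ip_weight_xi HS_uniq HS_cover (d n.+1) (ms_x ord0) (ms_x ord_max) n.+1.
have mu01 : mu (gg ord0) = mu (gg ord_max) by rewrite /mu /gg mu0E mu1E.
pose lab (eta : config T n.+1) : 'I_2 := if eta == xi n.+1 (x ord0) then ord0 else ord_max.
have labK k : lab (gg k) = k.
  rewrite /lab; case: k => -[|[|//]] i; rewrite /gg.
    by rewrite (_ : Ordinal i = ord0) ?eqxx//; exact/val_inj.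
  rewrite (_ : Ordinal i = ord_max); last exact/val_inj.
  by rewrite ifF//; apply/negbTE; rewrite eq_sym.
have th0 : 0 < theta n.+1 by rewrite /theta divr_gt0// exprn_gt0.
have mug1 : mu (gg ord_max) = ip_w (d n.+1) n.+1 by rewrite /mu /gg mu1E.
have mug0 := mu_gt0 (gg ord_max).
(* Chosen after [N]: the additive error of the small-time Dirichlet form gets multiplied by
   [theta / (2 * mu)], which is large. *)
pose e' := Num.min eps (eps / (theta n.+1 / (2 * mu (gg ord_max)))).
have tm0 : 0 < theta n.+1 / (2 * mu (gg ord_max)) by rewrite divr_gt0// mulr_gt0.
have e'0 : 0 < e' by rewrite lt_min eps0 divr_gt0.
have e'e : e' <= eps by rewrite ge_min lexx.
have e'1 : 0 < e' < 1 by rewrite e'0 (le_lt_trans e'e).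
have e't : e' * (theta n.+1 / (2 * mu (gg ord_max))) <= eps by rewrite -ler_pdivlMr// ge_min lexx orbT.
have tb := trace_jump_bounds g01 q_ge0 g0 c0 gd mu_gt0 q_rev th0 e'1 (fun phi p0 p1 => lown (d n.+1) phi d01 p0 p1) f1 f0.
have ta := trace_approx g01 (HX n.+1 isT) q_ge0 g0 c0 gd mu_gt0 q_rev mu01 labK th0 rho0 FM Fc HW e20.
have kbig := near_le_nat ((rho + e1) / e1).
have kK : \forall k \near \oo, (K <= k)%N by exact: nbhs_infty_ge.
(* A single mesh satisfying all the requirements suffices for the given [N]. *)
have [k [[Hb Ha] [Kk kk]]] := filter_ex (filterI (filterI tb ta) (filterI kK kbig)).
set p := trace_jump _ _ _ k in Hb Ha.
have k10 : 0 < k.+1%:R :> R by [].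
(* [N * ip_w d N] equals [ip_u d N.-1], which lies between [d] and [(1 + eps) * d]. *)
have lam : 1 - eps <= d n.+1 / (n.+1%:R * mu (gg ord_max)) <= 1.
  rewrite mug1 mulrC [n.+1%:R * _]mulrC ip_wS.
  have u0 := ip_u_gt0 n dn0.
  have u1 := ip_u_ge n (ltW dn0).
  have u2 : ip_u (d n.+1) n <= (1 + eps) * d n.+1.
    apply: (le_trans (@ip_u_le R (d n.+1) n n.+1 (ltW dn0) (leqnSn n))); rewrite ler_pM2r//.
  rewrite mulrC ler_pdivrMr// mul1r u1 andbT ler_pdivlMr//.
  apply: (@le_trans _ _ ((1 - eps) * ((1 + eps) * d n.+1))); first by rewrite ler_wpM2l// subr_ge0 ltW.
  rewrite mulrA ler_piMl ?(ltW dn0)//.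
  have -> : (1 - eps) * (1 + eps) = 1 - eps * eps by ring.
  by rewrite gerBl mulr_ge0// ltW.
have [P0 P1 P2] : [/\ 0 <= p * k.+1%:R, rho - eps * (1 + 2 * rho) <= p * k.+1%:R & p * k.+1%:R <= rho + 2 * eps].
  apply: (rate_window N0 dn0 mug0 k10 _ e't lam _ eps1 fD Hb); first by rewrite (ltW e'0).
  by rewrite eps0.
have p0 : 0 <= p by rewrite -(pmulr_lge0 _ k10).
have pe : p <= e1.
  have : p * k.+1%:R <= e1 * k.+1%:R.
    apply: (@le_trans _ _ (rho + e1)); first by apply: (le_trans P2); rewrite lerD2l.
    by rewrite mulrC -ler_pdivrMr.
  by rewrite ler_pM2r.
have Pc : `|p * k.+1%:R - rho| <= e1 by rewrite ler_distl; apply/andP; split; [apply: le_trans P1; rewrite lerD2l lerN2|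
    apply: (le_trans P2); rewrite lerD2l].
have [tau0 tau1] := He1 p k.+1%:R (introT andP (conj p0 pe)) k10 Pc.
have := HK k _ Kk tau0 tau1.
have := Ha; rewrite p0 => /(_ (le_lt_trans pe e12)).
set A := Rintegral _ _ _; set B := Rintegral PW _ _; set C := Rintegral PW _ _.
move=> h1 h2; rewrite (le_trans (ler_distD B _ _))// (splitr e) lerD//.
by rewrite distrC.
Unshelve. all: by end_near.
Qed.
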